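(* Let $k=\mathbb{F}_q$ with $q=2^n>2$. Let $(E_1,E_2,E_3)$ be a triple of ordinary elliptic curves over $k$ with $j$-invariants $j_1,j_2,j_3$, and set $\operatorname{sgn}(E_1,E_2,E_3):=\operatorname{sgn}(E_1)+\operatorname{sgn}(E_2)+\operatorname{sgn}(E_3)\in\{0,r_0\}$. Consider the elements of $k^*$ $$T_a:=\frac{(j_1+j_2+j_3)^2}{j_1j_2j_3},\qquad T_b:=\frac{j_1j_2j_3^2}{(j_1j_2+j_1j_3+j_2j_3)^2}.$$ Then $(E_1,E_2,E_3)$ admits an Artin-Schreier cover by a non-hyperelliptic genus $3$ curve if and only if $$T_a\in\operatorname{sgn}(E_1,E_2,E_3)+\operatorname{AS}(k)\quad\text{or}\quad T_b\in\operatorname{sgn}(E_1,E_2,E_3)+\operatorname{AS}(k).$$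
   Context: $\operatorname{AS}(k)=\{x+x^2\mid x\in k\}$, the kernel of the absolute trace $\operatorname{tr}\colon k\to\mathbb{F}_2$. Fix $r_0\in k$ with $\operatorname{tr}(r_0)=1$ ($r_0=1$ if $q$ is not a square). An elliptic curve $E/k$ is ordinary iff $j_E\neq0$, and then there is a unique $\operatorname{sgn}(E)\in\{0,r_0\}$ such that $E$ is $k$-isomorphic to $y^2+xy=x^3+\operatorname{sgn}(E)x^2+j_E^{-1}$; the sum of signatures lies in $\{0,r_0\}$ modulo $\operatorname{AS}(k)$. An Artin-Schreier cover of $(E_1,E_2,E_3)$ is a commutative diagram consisting of a genus $3$ curve $C$ over $k$, maps $C\to E_i$ and $E_i\to\mathbb{P}^1$ ($i=1,2,3$) with all composites $C\to E_i\to\mathbb{P}^1$ equal, all maps being separable degree two morphisms defined over $k$.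
   Formalization: An Artin-Schreier cover is required to have three pairwise distinct coverings C→E_i (otherwise the claim fails, e.g. for repeated C→E→P^1 over F_4), and the condition on T_b counts as false when j1j2+j1j3+j2j3=0, where T_b is undefined. *)

(* Defs.v *)
From HB Require Import structures.
From mathcomp Require Import all_boot all_algebra all_field.

Set Implicit Arguments.
Unset Strict Implicit.
Unset Printing Implicit Defensive.

Import GRing.Theory.
Local Open Scope ring_scope.

(* Field extensions are ring morphisms between fields.                        *)

Definition extension_degree (F K : fieldType) (phi : {rmorphism F -> K})
    (n : nat) : Prop :=
  exists b : 'I_n -> K, forall z : K,
    exists! c : 'rV[F]_n, z = \sum_(i < n) phi (c 0 i) * b i.

(* [separable_poly 0] is false. *)
Definition separable_extension (F K : fieldType) (phi : {rmorphism F -> K}) :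
    Prop :=
  forall z : K, exists2 p : {poly F}, separable_poly p & root (map_poly phi p) z.

Definition is_subfield (K : fieldType) (S : K -> Prop) : Prop :=
  [/\ S 1, forall x y, S x -> S y -> S (x - y),
      forall x y, S x -> S y -> S (x * y) & forall x, S x -> S x^-1].

Definition ratfun_const (k : fieldType) : {rmorphism k -> {fraction {poly k}}} :=
  (@FracField.tofrac {poly k} \o polyC : {rmorphism k -> {fraction {poly k}}}).

(* Smooth projective geometrically irreducible curves over a perfect field k,
   with their non-constant k-morphisms, are given by their function fields:
   the extensions of k that are finite over some k(t) and in which k is
   algebraically closed, with the k-embeddings (in the opposite direction). *)
Record curve (k : fieldType) := Curve {
  ffield :> fieldType;
  const : {rmorphism k -> ffield};
  curve_finite : exists phi : {rmorphism {fraction {poly k}} -> ffield},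
    (forall c, phi (ratfun_const k c) = const c) /\
    (exists n, extension_degree phi n);
  curve_const_closed : forall z : ffield,
    algebraicOver const z -> exists c, z = const c
}.
Arguments const {k} c.

Record curve_hom (k : fieldType) (C D : curve k) := CurveHom {
  pullback :> {rmorphism ffield D -> ffield C};
  pullback_const : forall c, pullback (const D c) = const C c
}.

Definition hom_degree (k : fieldType) (C D : curve k) (f : curve_hom C D) n :=
  extension_degree (pullback f) n.

Definition hom_separable (k : fieldType) (C D : curve k) (f : curve_hom C D) :=
  separable_extension (pullback f).

Section ProjectiveLine.

Variable k : fieldType.

Local Notation Kt := {fraction {poly k}}.
Local Notation "p %:F" := (@FracField.tofrac {poly k} p).

Lemma ratfun_constE c : ratfun_const k c = c%:P%:F.
Proof. by []. Qed.

Lemma ratfun_finite : exists phi : {rmorphism Kt -> Kt},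
  (forall c, phi (ratfun_const k c) = ratfun_const k c) /\
  (exists n, extension_degree phi n).
Proof.
exists (idfun : {rmorphism Kt -> Kt}); split=> //.
exists 1%N, (fun=> 1) => z; exists (const_mx z); split=> [|c].
  by rewrite big_ord1 mxE mulr1.
rewrite big_ord1 mulr1 /= => ->.
by apply/rowP=> i; rewrite mxE ord1 [i]ord1.
Qed.

Lemma ratfun_fracP (z : Kt) : exists a b : {poly k},
  b != 0 /\ z * b%:F = a%:F.
Proof.
elim/quotW: z => x; exists (frac x).1, (frac x).2; split; first exact: denom_ratioP.
rewrite !piE /FracField.mulf !numden_Ratio ?oner_eq0 //.
apply/eqmodP; rewrite /= FracField.equivfE.
rewrite !numden_Ratio ?mulf_neq0 ?oner_eq0 ?denom_ratioP //.
by rewrite !mulr1 mulrC.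
Qed.

Lemma ratfun_const_closed (z : Kt) :
  algebraicOver (ratfun_const k) z -> exists c, z = ratfun_const k c.
Proof.
move=> /integral_algebraic [p mon_p].
have [a0 [b0 [nz_b0 zb0]]] := ratfun_fracP z.
have g0 : gcdp a0 b0 != 0 by rewrite gcdp_eq0 negb_and nz_b0 orbT.
pose a : {poly k} := a0 %/ gcdp a0 b0; pose b : {poly k} := b0 %/ gcdp a0 b0.
have Ea : a0 = a * gcdp a0 b0 by rewrite divpK ?dvdp_gcdl.
have Eb : b0 = b * gcdp a0 b0 by rewrite divpK ?dvdp_gcdr.
have cab : coprimep b a.
  by rewrite coprimep_sym coprimep_div_gcd // nz_b0 orbT.
have nz_b : b != 0 by apply: contraNneq nz_b0 => b_0; rewrite Eb b_0 mul0r.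
have zb : z * b%:F = a%:F.
  apply: (@mulIf _ (gcdp a0 b0)%:F); first by rewrite tofrac_eq0.
  by rewrite -mulrA -!tofracM -Ea -Eb.
have [n sp] : exists n, size p = n.+1.
  by exists (size p).-1; rewrite prednK // size_poly_gt0 monic_neq0.
have p_n : p`_n = 1 by move/monicP: mon_p; rewrite lead_coefE sp.
have pE i : (map_poly (ratfun_const k) p)`_i = (p`_i)%:P%:F by exact: coef_map.
move=> /rootP; rewrite horner_coef size_map_poly sp big_ord_recr pE p_n.
rewrite polyC1 tofrac1 mul1r; under eq_bigr => i _ do rewrite pE.
rewrite /= => pz.
have dvd_b : b %| a ^+ n.
  case: n => [|n] in sp p_n pz *; first by rewrite big_ord0 add0r expr0 in pz;
    move/eqP: pz; rewrite oner_eq0.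
  apply/dvdpP.
  exists (- \sum_(i < n.+1) (p`_i)%:P * a ^+ i * b ^+ (n - i)).
  apply/eqP; rewrite -tofrac_eq tofracXn -zb exprMn.
  move/eqP: pz; rewrite addrC addr_eq0 => /eqP ->.
  rewrite tofracM tofracN mulNr mulNr eqr_opp rmorph_sum !mulr_suml.
  apply/eqP/eq_bigr=> i _.
  have lein : (i <= n)%N by rewrite -ltnS.
  have -> : b%:F ^+ n.+1 = b%:F ^+ i * b%:F ^+ (n - i) * b%:F.
    by rewrite -exprD subnKC // exprSr.
  by rewrite /= !tofracM !tofracXn -zb exprMn !mulrA.
have : size b == 1%N.
  have /coprimepP/(_ b (dvdpp b) dvd_b) := coprimep_expr n cab.
  by rewrite -size_poly_eq1.
case/size_poly1P=> d nz_d Ed.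
pose q := d^-1 *: a.
have Ez : z = q%:F.
  apply: (@mulIf _ b%:F); first by rewrite tofrac_eq0.
  by rewrite zb -tofracM Ed /q -mul_polyC mulrAC -polyCM mulVf // mul1r.
suff /size1_polyC Eq : (size q <= 1)%N by exists q`_0; rewrite Ez {1}Eq.
have pq0 : p \Po q = 0.
  apply/eqP; rewrite -tofrac_eq0 comp_polyE sp rmorph_sum big_ord_recr /=.
  rewrite p_n scale1r -[X in _ == X]pz tofracXn -Ez; apply/eqP.
  congr (_ + _); apply: eq_bigr=> i _.
  by rewrite -mul_polyC tofracM tofracXn -Ez.
rewrite leqNgt; apply/negP=> q_gt1.
have := size_comp_poly p q; rewrite pq0 size_poly0 sp /= => /eqP.
rewrite eq_sym muln_eq0 => /orP[/eqP n0|/eqP q0]; last by case: (size q) q0 q_gt1 => [|[|]].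
move: pz; rewrite n0 big_ord0 add0r expr0 => /eqP.
by rewrite oner_eq0.
Qed.

Definition projective_line : curve k :=
  @Curve k Kt (ratfun_const k) ratfun_finite ratfun_const_closed.

End ProjectiveLine.

Section Genus.

Variables (k : fieldType) (C : curve k).

Definition is_derivation (D : C -> C) : Prop :=
  [/\ forall c, D (const C c) = 0, forall x y, D (x + y) = D x + D y
    & forall x y, D (x * y) = x * D y + y * D x].

(* [:: (f_1, g_1); ..; (f_m, g_m)] stands for the Kaehler differential
   f_1 dg_1 + .. + f_m dg_m.  When k is perfect the module of differentials of
   C is one-dimensional over the function field, so that two differentials are
   equal if and only if they agree on all k-derivations. *)
Definition diff_form := seq (C * C).

Definition form_at (w : diff_form) (D : C -> C) : C :=
  \sum_(p <- w) p.1 * D p.2.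

Definition form_eq (w w' : diff_form) : Prop :=
  forall D, is_derivation D -> form_at w D = form_at w' D.

(* The closed points of C are the valuation rings of its function field that
   contain k and are different from the whole field. *)
Definition is_local_ring (O : C -> Prop) : Prop :=
  [/\ forall c, O (const C c),
      forall x y, O x -> O y -> O (x - y) /\ O (x * y),
      forall z, O z \/ O z^-1
    & exists z, ~ O z].

Definition regular_form (w : diff_form) : Prop :=
  forall O, is_local_ring O ->
    exists2 w' : diff_form,
      (forall p, p \in w' -> O p.1 /\ O p.2) & form_eq w w'.

(* dim_k H^0(C, Omega^1) = g *)
Definition has_genus (g : nat) : Prop :=
  exists2 b : 'I_g -> diff_form, forall i, regular_form (b i) &
    forall w, regular_form w ->
      exists! c : 'rV[k]_g, forall D, is_derivation D ->
        form_at w D = \sum_(i < g) const C (c 0 i) * form_at (b i) D.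

(* Over a finite field the quotient of C by a (geometric) hyperelliptic
   involution is a conic with a rational point, hence the projective line. *)
Definition hyperelliptic : Prop :=
  (exists2 g, (2 <= g)%N & has_genus g) /\
  exists f : curve_hom C (projective_line k), hom_degree f 2.

End Genus.

(* y^2 + a1 x y + a3 y = x^3 + a2 x^2 + a4 x + a6 *)
Record weierstrass (k : fieldType) := Weierstrass {
  wa1 : k; wa2 : k; wa3 : k; wa4 : k; wa6 : k }.

Section Weierstrass.

Variable k : fieldType.
Implicit Types W : weierstrass k.

Definition on_weierstrass W (L : fieldType) (iota : {rmorphism k -> L})
    (x y : L) : Prop :=
  y ^+ 2 + iota (wa1 W) * x * y + iota (wa3 W) * y =
  x ^+ 3 + iota (wa2 W) * x ^+ 2 + iota (wa4 W) * x + iota (wa6 W).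

Definition wb2 W := wa1 W ^+ 2 + 4%:R * wa2 W.
Definition wb4 W := 2%:R * wa4 W + wa1 W * wa3 W.
Definition wb6 W := wa3 W ^+ 2 + 4%:R * wa6 W.
Definition wb8 W := wa1 W ^+ 2 * wa6 W + 4%:R * wa2 W * wa6 W
  - wa1 W * wa3 W * wa4 W + wa2 W * wa3 W ^+ 2 - wa4 W ^+ 2.
Definition wc4 W := wb2 W ^+ 2 - 24%:R * wb4 W.
Definition wdisc W := - (wb2 W ^+ 2 * wb8 W) - 8%:R * wb4 W ^+ 3
  - 27%:R * wb6 W ^+ 2 + 9%:R * wb2 W * wb4 W * wb6 W.

Record elliptic_curve := EllipticCurve {
  wequation :> weierstrass k;
  wdisc_neq0 : wdisc wequation != 0
}.

Definition jinv (E : elliptic_curve) : k := wc4 E ^+ 3 / wdisc E.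

(* In characteristic 2: E has a point (x, y) = -(x, y) of order 2 over some
   finite extension of k, i.e., E[2] has a non-trivial geometric point. *)
Definition ordinary (E : elliptic_curve) : Prop :=
  exists (L : fieldExtType k) (x y : L),
    on_weierstrass E (in_alg L) x y /\
    y = - y - in_alg L (wa1 E) * x - in_alg L (wa3 E).

(* X is the smooth projective model of E: its function field is k(x, y), where
   x and y satisfy the equation of E. *)
Definition is_model (E : elliptic_curve) (X : curve k) : Prop :=
  exists x y : X, on_weierstrass E (const X) x y /\
    forall S : X -> Prop, is_subfield S -> (forall c, S (const X c)) ->
      S x -> S y -> forall z, S z.

End Weierstrass.

(* The equation W' is obtained from W by a substitution over k
   x = u^2 x' + r, y = u^3 y' + s u^2 x' + t. *)
Definition w_isomorphic (k : finFieldType) (W W' : weierstrass k) : bool :=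
  [exists u : k, exists r : k, exists s : k, exists t : k,
    [&& u != 0,
        u * wa1 W' == wa1 W + 2%:R * s,
        u ^+ 2 * wa2 W' == wa2 W - s * wa1 W + 3%:R * r - s ^+ 2,
        u ^+ 3 * wa3 W' == wa3 W + r * wa1 W + 2%:R * t,
        u ^+ 4 * wa4 W' == wa4 W - s * wa3 W + 2%:R * r * wa2 W
          - (t + r * s) * wa1 W + 3%:R * r ^+ 2 - 2%:R * s * t
      & u ^+ 6 * wa6 W' == wa6 W + r * wa4 W + r ^+ 2 * wa2 W + r ^+ 3
          - t * wa3 W - t ^+ 2 - r * t * wa1 W]].

Section Signature.

Variables (k : finFieldType) (r0 : k).

(* The element e of {0, r0} such that E is isomorphic to
   y^2 + x y = x^3 + e x^2 + j^-1; for an ordinary curve in characteristic 2 it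
   exists and is unique when r0 has trace 1. *)
Definition sgn (E : elliptic_curve k) : k :=
  odflt 0 [pick e in [:: 0; r0] |
    w_isomorphic E (Weierstrass 1 e 0 0 (jinv E)^-1)].

End Signature.

(* The absolute trace to F_2, when k has 2 ^ n elements. *)
Definition abs_trace (k : fieldType) (n : nat) (x : k) : k :=
  \sum_(i < n) x ^+ (2 ^ i).

Definition AS (k : fieldType) (z : k) : Prop := exists x : k, z = x + x ^+ 2.

(* The maps C -> E_i are the three intermediate coverings of C -> P^1, so they
   are required to be pairwise distinct as coverings, i.e., to correspond to
   distinct subfields of the function field of C (the curves E_i themselves may
   be isomorphic).  Without this condition the diagram could be degenerate,
   e.g., consist of three copies of the same C -> E -> P^1. *)
Record artin_schreier_cover (k : fieldType) (E : 3.-tuple (elliptic_curve k)) :=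
  ArtinSchreierCover {
    as_curve :> curve k;
    as_genus : has_genus as_curve 3;
    as_model : 'I_3 -> curve k;
    as_modelP : forall i, is_model (tnth E i) (as_model i);
    as_top : forall i, curve_hom as_curve (as_model i);
    as_bot : forall i, curve_hom (as_model i) (projective_line k);
    as_top2 : forall i, hom_degree (as_top i) 2 /\ hom_separable (as_top i);
    as_bot2 : forall i, hom_degree (as_bot i) 2 /\ hom_separable (as_bot i);
    as_comm : forall i j t, as_top i (as_bot i t) = as_top j (as_bot j t);
    as_distinct : forall i j, i != j ->
      ~ (forall z, (exists a, z = as_top i a) <-> (exists a, z = as_top j a))
  }.

(* Main.v *)
(* Let d_i be the square root of 1 / j_i and s the sum of the signatures.  In
   terms of the d_i, the two conditions say that d_1 = ab, d_2 = bc, d_3 = ac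
   with a + b + c + s in AS(k), resp. that D = d_1 + d_2 + d_3 is nonzero and
   d_1 d_2 / D^2 + s is in AS(k).

   Necessity.  A quotient C / E_i -> P^1 has an equation y^2 + y = h_i / G_i with
   h_i, G_i in k[t] of degree at most 2 and G_i = dt / (dx / x), where dx / x is
   the invariant differential of E_i; its invariants are d_i = Res(h_i, G_i) and
   the signature.  Composing the three covers gives an identity
   h_1 / G_1 + h_2 / G_2 + h_3 / G_3 = a^2 + a with a constant, which forces the
   G_i to be either lm, l(l + m), m(l + m) with linear forms l, m (first
   condition), or all equal (second condition).  In the latter case D = 0 would
   make C hyperelliptic.

   Sufficiency.  The equations are chosen with denominators t, t + 1, t(t + 1),
   resp. with the denominator t^2 + t + d_1 d_2 / D^2.  The regular differentials
   are determined by local computations at all valuation rings of the function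
   field: they form a space of dimension 3 whose ratios generate the function
   field, whereas on a hyperelliptic curve such ratios lie in a rational subfield. *)
Require Import Defs.
From HB Require Import structures.
From mathcomp Require Import all_boot all_algebra all_field.
From mathcomp Require Import polyXY.
From mathcomp Require Import boolp classical_sets.
From Stdlib Require Ring_theory Ring_polynom Field_theory BinList.

Set Implicit Arguments.
Unset Strict Implicit.
Unset Printing Implicit Defensive.

Import GRing.Theory.
Local Open Scope ring_scope.

(** * Characteristic two *)

(** Regularity is tested by derivations. A regular form takes integral values on any derivation
    preserving a valuation ring [O]; conversely, if [c * D] preserves [O] and has a unit value at
    some [g] in [O], the form is regular at [O] once [c] times its value at [D] is integral. The
    local data are thus scaling factors [c], and in an Artin-Schreier tower these are products of
    uniformizers, one for each ramified step. Elements of the tower are controlled by their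
    coordinates over k(t), isolated by conjugation and bounded through norms; an element of k(t)
    integral on both charts is constant. The genus and the constant field both come out of this
    computation. Reading d and the signature off an arbitrary quadratic map t from an elliptic curve
    rests on the relation of bidegree (2, 2) between x and t: the invariant derivation reproduces it
    up to a scalar, which makes its outer coefficients squares up to a constant. In the other
    direction a denominator without rational roots is the obstacle, overcome by an element of norm
    1. The square roots d_i are harmless because z + z^2 is in AS(k): T_a is a fourth power and T_b
    a square of the expressions in the d_i. *)

Section CharTwo.

Variable F : comNzRingType.
Hypothesis F2 : 2%:R = 0 :> F.

Lemma addxx (x : F) : x + x = 0.
Proof. by rewrite -mulr2n -mulr_natl F2 mul0r. Qed.

Lemma oppxx (x : F) : - x = x.
Proof. by apply/eqP; rewrite eq_sym -addr_eq0 addxx. Qed.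

Lemma addxK (x y : F) : x + y + y = x.
Proof. by rewrite -addrA addxx addr0. Qed.

Lemma addxx_eq0 (x y : F) : x + y = 0 -> x = y.
Proof. by move/eqP; rewrite addr_eq0 oppxx => /eqP. Qed.

Lemma sqrD2 (x y : F) : (x + y) ^+ 2 = x ^+ 2 + y ^+ 2.
Proof. by rewrite sqrrD -mulr_natl F2 mul0r addr0. Qed.

End CharTwo.

(* Stdlib's reflexive ring and field normalization, run with coefficients in
   the two-element field, decides identities modulo 2. *)
Section Reflection.

Definition bool_coef (F : comNzRingType) (b : bool) : F := if b then 1 else 0.

Lemma char2_ring_theory (F : comNzRingType) :
  Ring_theory.ring_theory (0 : F) 1 +%R *%R (fun x y => x - y) -%R eq.
Proof.
split=> //; [exact: add0r|exact: addrC|exact: addrA|exact: mul1r|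
  exact: mulrC|exact: mulrA|exact: mulrDl|exact: subrr].
Qed.

Lemma char2_morph (F : comNzRingType) (F2 : 2%:R = 0 :> F) :
  Ring_theory.ring_morph (0 : F) 1 +%R *%R (fun x y => x - y) -%R eq
    false true xorb andb xorb (fun x : bool => x) Bool.eqb (bool_coef F).
Proof.
split=> //; try by case.
- by case; case; rewrite /bool_coef /= ?addr0 ?add0r ?addxx.
- by case; case; rewrite /bool_coef /= ?subr0 ?add0r ?oppxx ?subrr.
- by case; case; rewrite /bool_coef /= ?mulr0 ?mul0r ?mul1r.
- by case; rewrite /bool_coef /= ?oppxx ?oppr0.
- by case; case.
Qed.

Lemma char2_pow (F : comNzRingType) :
  Ring_theory.power_theory (1 : F) *%R eq BinNat.N.to_nat (fun x n => x ^+ n).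
Proof.
split=> x n; case: n => //= p.
elim: p => [p IH|p IH|//] /=.
- by rewrite -IH -exprD -exprS Pnat.Pos2Nat.inj_xI addnn -mul2n multE.
- by rewrite -IH -exprD Pnat.Pos2Nat.inj_xO addnn -mul2n multE.
Qed.

Lemma char2_field_theory (F : fieldType) :
  Field_theory.field_theory (0 : F) 1 +%R *%R (fun x y => x - y) -%R
    (fun x y => x / y) (@GRing.inv F) eq.
Proof.
split=> //; first exact: char2_ring_theory.
  by apply/eqP; rewrite oner_eq0.
by move=> p /eqP p0; rewrite mulVf.
Qed.

Lemma char2_ext (F : comNzRingType) :
  Ring_theory.ring_eq_ext (+%R : F -> F -> F) *%R -%R eq.
Proof. by split=> [x _ <- y _ <-|x _ <- y _ <-|x _ <-]. Qed.

(** Quotient and remainder in the two-element field, the form in which the normalizer rewrites with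
    hypotheses; division by zero leaves the dividend as remainder. *)
Definition char2_div (a b : bool) :=
  if b then (a, false) else (false, a).

Lemma char2_div_theory (F : comNzRingType) (F2 : 2%:R = 0 :> F) :
  Ring_theory.div_theory eq xorb andb (bool_coef F) char2_div.
Proof.
by split=> -[] [] /=; rewrite /bool_coef ?mulr0 ?mul1r ?add0r ?addr0.
Qed.

Definition ring2_correct (F : comNzRingType) (F2 : 2%:R = 0 :> F) :=
  @Ring_polynom.ring_correct F 0 1 +%R *%R (fun x y => x - y) -%R eq
    (RelationClasses.eq_equivalence) (char2_ext F)
    (Ring_theory.Rth_ARth RelationClasses.eq_equivalence (char2_ext F)
       (char2_ring_theory F))
    bool _ _ _ _ _ _ _ _ (char2_morph F2) _ _ _ (char2_pow F)
    _ (char2_div_theory F2) 100%N.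

Section FieldCorrect.

Variables (F : fieldType) (F2 : 2%:R = 0 :> F).

Let evalP := Ring_polynom.PEeval (0 : F) 1 +%R *%R (fun x y => x - y) -%R
  (bool_coef F) BinNat.N.to_nat (fun x n => x ^+ n).

Fixpoint nonzero_conditions (l : seq F) (c : seq (Ring_polynom.PExpr bool)) :=
  if c is a :: c' then evalP l a != 0 /\ nonzero_conditions l c' else True.

Definition field2_conditions fe1 fe2 :=
  (Field_theory.condition
     (Field_theory.Fnorm false true xorb andb xorb id Bool.eqb fe1) ++
   Field_theory.condition
     (Field_theory.Fnorm false true xorb andb xorb id Bool.eqb fe2)).

Lemma nonzero_conditionsP l c : nonzero_conditions l c ->
  Field_theory.PCond 0 1 +%R *%R (fun x y => x - y) -%R eq
    (bool_coef F) BinNat.N.to_nat (fun x n => x ^+ n) l c.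
Proof.
elim: c => [|a [|b c] IH] //= [/eqP a0]; first by move=> _.
by move=> bc; split=> //; apply: IH.
Qed.

Definition field2_check lpe fe1 fe2 :=
  let lmp := Ring_polynom.mk_monpol_list false true xorb andb xorb id
    Bool.eqb char2_div lpe in
  let n1 := Field_theory.Fnorm false true xorb andb xorb id Bool.eqb fe1 in
  let n2 := Field_theory.Fnorm false true xorb andb xorb id Bool.eqb fe2 in
  let nrm := Ring_polynom.norm_subst false true xorb andb xorb id Bool.eqb
    char2_div 100%N lmp in
  Ring_polynom.Peq Bool.eqb
    (nrm (Ring_polynom.PEmul (Field_theory.num n1) (Field_theory.denum n2)))
    (nrm (Ring_polynom.PEmul (Field_theory.num n2) (Field_theory.denum n1))).

Lemma field2_correct (l : seq F) lpe fe1 fe2 c :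
    Ring_polynom.interp_PElist (0 : F) 1 +%R *%R (fun x y => x - y) -%R eq
      (bool_coef F) BinNat.N.to_nat (fun x n => x ^+ n) l lpe ->
    field2_check lpe fe1 fe2 = true -> field2_conditions fe1 fe2 = c ->
    nonzero_conditions l c ->
  Field_theory.FEeval (0 : F) 1 +%R *%R (fun x y => x - y) -%R
      (fun x y => x / y) (@GRing.inv F)
      (bool_coef F) BinNat.N.to_nat (fun x n => x ^+ n) l fe1 =
  Field_theory.FEeval (0 : F) 1 +%R *%R (fun x y => x - y) -%R
      (fun x y => x / y) (@GRing.inv F)
      (bool_coef F) BinNat.N.to_nat (fun x n => x ^+ n) l fe2.
Proof.
move=> hl hc hcond nz; rewrite -hcond in nz.
exact: (Field_theory.Field_correct RelationClasses.eq_equivalence (char2_ext F)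
  (fun p q (e : p = q) => congr1 _ e)
  (Field_theory.F2AF RelationClasses.eq_equivalence (char2_ext F)
     (char2_field_theory F))
  (char2_morph F2) (char2_pow F) (char2_div_theory F2) 100%N l lpe fe1 fe2 hl
  (erefl _) (erefl _) (erefl _) hc (nonzero_conditionsP nz)).
Qed.

End FieldCorrect.

End Reflection.

Ltac r2_is_num n :=
  lazymatch n with
  | O => constr:(true) | S ?m => r2_is_num m | _ => constr:(false) end.

(* Atoms are compared up to the choice of canonical instances in all but their
   last argument. *)
Ltac r2_same x y :=
  match x with
  | y => constr:(true)
  | ?f ?a => lazymatch y with
    | ?g a => let _ := match goal with _ => unify f g end in constr:(true)
    end
  | _ => constr:(false)
  end.

Ltac r2_mem x l :=
  lazymatch l with
  | nil => constr:(false)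
  | ?y :: ?t => let b := r2_same x y in
      lazymatch b with true => b | false => r2_mem x t end
  end.

Ltac r2_add x l :=
  let b := r2_mem x l in
  lazymatch b with true => l | false => constr:(x :: l) end.

Ltac r2_pos x l :=
  lazymatch l with
  | ?y :: ?t => let b := r2_same x y in
      lazymatch b with
      | true => constr:(BinNums.xH)
      | false => let p := r2_pos x t in
        let q := eval vm_compute in (BinPos.Pos.succ p) in constr:(q)
      end
  end.

Ltac r2_vars t l :=
  lazymatch t with
  | Algebra.add ?a ?b => let l := r2_vars a l in r2_vars b l
  | GRing.mul ?a ?b => let l := r2_vars a l in r2_vars b l
  | Algebra.opp ?a => r2_vars a l
  | GRing.inv ?a => r2_vars a l
  | GRing.exp ?a ?n => let b := r2_is_num n in
      lazymatch b with true => r2_vars a l | false => r2_add t l end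
  | Algebra.natmul ?a ?n => let b := r2_is_num n in
      lazymatch b with true => r2_vars a l | false => r2_add t l end
  | @Algebra.zero _ => l
  | @GRing.one _ => l
  | _ => r2_add t l
  end.

Ltac r2_reify t l :=
  lazymatch t with
  | Algebra.add ?a (Algebra.opp ?b) => let a := r2_reify a l in
      let b := r2_reify b l in constr:(@Field_theory.FEsub bool a b)
  | Algebra.add ?a ?b => let a := r2_reify a l in
      let b := r2_reify b l in constr:(@Field_theory.FEadd bool a b)
  | GRing.mul ?a (GRing.inv ?b) => let a := r2_reify a l in
      let b := r2_reify b l in constr:(@Field_theory.FEdiv bool a b)
  | GRing.mul ?a ?b => let a := r2_reify a l in
      let b := r2_reify b l in constr:(@Field_theory.FEmul bool a b)
  | Algebra.opp ?a => let a := r2_reify a l in constr:(@Field_theory.FEopp bool a)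
  | GRing.inv ?a => let a := r2_reify a l in constr:(@Field_theory.FEinv bool a)
  | @Algebra.zero _ => constr:(@Field_theory.FEO bool)
  | @GRing.one _ => constr:(@Field_theory.FEI bool)
  | GRing.exp ?a ?n => let b := r2_is_num n in
      lazymatch b with
      | true => let a := r2_reify a l in
        let m := eval vm_compute in (BinNat.N.of_nat n) in
        constr:(@Field_theory.FEpow bool a m)
      | false => let p := r2_pos t l in constr:(@Field_theory.FEX bool p)
      end
  | Algebra.natmul ?a ?n => let b := r2_is_num n in
      lazymatch b with
      | true => let a := r2_reify a l in r2_natmul a n
      | false => let p := r2_pos t l in constr:(@Field_theory.FEX bool p)
      end
  | _ => let p := r2_pos t l in constr:(@Field_theory.FEX bool p)
  end
with r2_natmul a n :=
  lazymatch n with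
  | O => constr:(@Field_theory.FEO bool)
  | S O => a
  | S ?m => let b := r2_natmul a m in constr:(@Field_theory.FEadd bool a b)
  end.

Ltac r2_toP e :=
  lazymatch e with
  | Field_theory.FEadd ?a ?b => let a := r2_toP a in let b := r2_toP b in
      constr:(@Ring_polynom.PEadd bool a b)
  | Field_theory.FEsub ?a ?b => let a := r2_toP a in let b := r2_toP b in
      constr:(@Ring_polynom.PEsub bool a b)
  | Field_theory.FEmul ?a ?b => let a := r2_toP a in let b := r2_toP b in
      constr:(@Ring_polynom.PEmul bool a b)
  | Field_theory.FEopp ?a => let a := r2_toP a in
      constr:(@Ring_polynom.PEopp bool a)
  | Field_theory.FEpow ?a ?n => let a := r2_toP a in
      constr:(@Ring_polynom.PEpow bool a n)
  | Field_theory.FEX _ ?p => constr:(@Ring_polynom.PEX bool p)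
  | Field_theory.FEO => constr:(@Ring_polynom.PEO bool)
  | Field_theory.FEI => constr:(@Ring_polynom.PEI bool)
  | Field_theory.FEc ?c => constr:(@Ring_polynom.PEc bool c)
  | _ => fail 100 "ring2: inverse in a polynomial position"
  end.

Ltac r2_nth p l :=
  lazymatch p with
  | BinNums.xH => lazymatch l with ?x :: _ => x end
  | _ => let q := eval vm_compute in (BinPos.Pos.pred p) in
    lazymatch l with _ :: ?t => r2_nth q t end
  end.

Ltac r2_unreify T e l :=
  lazymatch e with
  | Ring_polynom.PEadd ?a ?b => let a := r2_unreify T a l in
      let b := r2_unreify T b l in constr:((a + b : T)%R)
  | Ring_polynom.PEsub ?a ?b => let a := r2_unreify T a l in
      let b := r2_unreify T b l in constr:((a - b : T)%R)
  | Ring_polynom.PEmul ?a ?b => let a := r2_unreify T a l in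
      let b := r2_unreify T b l in constr:((a * b : T)%R)
  | Ring_polynom.PEopp ?a => let a := r2_unreify T a l in constr:((- a : T)%R)
  | Ring_polynom.PEpow ?a ?n => let a := r2_unreify T a l in
      let m := eval vm_compute in (BinNat.N.to_nat n) in
      constr:((a ^+ m : T)%R)
  | Ring_polynom.PEX _ ?p => r2_nth p l
  | Ring_polynom.PEO => constr:((0 : T)%R)
  | Ring_polynom.PEI => constr:((1 : T)%R)
  | Ring_polynom.PEc true => constr:((1 : T)%R)
  | Ring_polynom.PEc false => constr:((0 : T)%R)
  end.

Ltac r2_conditions T c l :=
  lazymatch c with
  | ?a :: ?c' => let a' := r2_unreify T a l in
      let r := r2_conditions T c' l in constr:((a' != 0 :> T)%R /\ r)
  | _ => constr:(True)
  end.

Ltac r2_hvars hs l :=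
  lazymatch hs with
  | tt => l
  | (?hs', ?h) => let l := r2_hvars hs' l in
      lazymatch type of h with
      | ?a = ?b => let l := r2_vars a l in r2_vars b l end
  end.

Ltac r2_hyps hs l acc pf :=
  lazymatch hs with
  | tt => constr:((acc, pf))
  | (?hs', ?h) =>
      lazymatch type of h with
      | ?a = ?b => let a := r2_reify a l in let b := r2_reify b l in
        let a := r2_toP a in let b := r2_toP b in
        lazymatch acc with
        | nil => r2_hyps hs' l constr:([:: (a, b)]) h
        | _ => r2_hyps hs' l constr:((a, b) :: acc) constr:(conj h pf)
        end
      end
  end.

(** The equations in [hs] act as rewrite rules: the left-hand side is read as a monomial, whose
    multiples are replaced during normalization. Relations such as [y ^+ 2 = y + f] are therefore
    put into this shape before a call. *)
Ltac r2_ring F2 hs :=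
  lazymatch goal with
  | |- @eq ?T ?a ?b =>
    let l := r2_vars a constr:(@nil T) in
    let l := r2_vars b l in
    let l := r2_hvars hs l in
    let a := r2_reify a l in let b := r2_reify b l in
    let a := r2_toP a in let b := r2_toP b in
    let lp := r2_hyps hs l constr:(@nil (Ring_polynom.PExpr bool *
                Ring_polynom.PExpr bool)) I in
    lazymatch lp with
    | (?lpe, ?pf) =>
      exact (@ring2_correct _ F2 l lpe a b pf
        ltac:(vm_compute; reflexivity))
    end
  end.

Ltac nonzero_rec :=
  first [assumption | exact: oner_neq0 |
    lazymatch goal with
    | |- is_true (~~ (@eq_op _ (GRing.exp _ _) _)) =>
        apply: expf_neq0; nonzero_rec
    | |- is_true (~~ (@eq_op _ (GRing.mul _ _) _)) =>
        apply: mulf_neq0; nonzero_rec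
    | |- is_true (~~ (@eq_op _ (GRing.inv _) _)) =>
        rewrite invr_eq0; nonzero_rec
    end].

Ltac nonzero := try solve [nonzero_rec].

Ltac r2_field F2 hs :=
  lazymatch goal with
  | |- @eq ?T ?a ?b =>
    let l := r2_vars a constr:(@nil T) in
    let l := r2_vars b l in
    let l := r2_hvars hs l in
    let a := r2_reify a l in let b := r2_reify b l in
    let lp := r2_hyps hs l constr:(@nil (Ring_polynom.PExpr bool *
                Ring_polynom.PExpr bool)) I in
    lazymatch lp with
    | (?lpe, ?pf) =>
      let c := eval vm_compute in (field2_conditions a b) in
      let r := r2_conditions T c l in
      refine (@field2_correct _ F2 l lpe a b c pf
        ltac:(vm_compute; reflexivity) ltac:(vm_compute; reflexivity) _);
      change r; repeat (split; first nonzero); try exact I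
    end
  end.

Tactic Notation "ring2" constr(F2) := r2_ring F2 tt.
Tactic Notation "ring2" constr(F2) constr(h) := r2_ring F2 (tt, h).
Tactic Notation "ring2" constr(F2) constr(h) constr(h2) :=
  r2_ring F2 (tt, h, h2).
Tactic Notation "ring2" constr(F2) constr(h) constr(h2) constr(h3) :=
  r2_ring F2 (tt, h, h2, h3).
Tactic Notation "ring2" constr(F2) constr(h) constr(h2) constr(h3) constr(h4) :=
  r2_ring F2 (tt, h, h2, h3, h4).
Tactic Notation "field2" constr(F2) := r2_field F2 tt.
Tactic Notation "field2" constr(F2) constr(h) := r2_field F2 (tt, h).
Tactic Notation "field2" constr(F2) constr(h) constr(h2) :=
  r2_field F2 (tt, h, h2).
Tactic Notation "field2" constr(F2) constr(h) constr(h2) constr(h3) :=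
  r2_field F2 (tt, h, h2, h3).
Tactic Notation "field2" constr(F2) constr(h) constr(h2) constr(h3) constr(h4) :=
  r2_field F2 (tt, h, h2, h3, h4).

(** * Valuation rings *)

(** The same conditions as in [is_local_ring], but for a field not yet known to be the function
    field of a curve: the constant field of a tower is determined by means of these rings. *)
Definition valuation_ring (k F : fieldType) (kap : k -> F) (O : F -> Prop) :=
  [/\ forall c, O (kap c),
      forall x y, O x -> O y -> O (x - y) /\ O (x * y),
      forall z, O z \/ O z^-1
    & exists z, ~ O z].

(** The maximal ideal of [O], as the set of non-units. Zero has its own clause because [0^-1 = 0]
    belongs to [O]. *)
Definition maxid (F : fieldType) (O : F -> Prop) (z : F) :=
  z = 0 \/ ~ O z^-1.

Section ValuationRing.

Variables (k F : fieldType) (kap : {rmorphism k -> F}) (O : F -> Prop).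
Hypothesis vO : valuation_ring kap O.

Lemma vr_const c : O (kap c). Proof. by case: vO. Qed.
Lemma vrB x y : O x -> O y -> O (x - y).
Proof. by case: vO => _ h _ _ x1 y1; case: (h _ _ x1 y1). Qed.
Lemma vrM x y : O x -> O y -> O (x * y).
Proof. by case: vO => _ h _ _ x1 y1; case: (h _ _ x1 y1). Qed.
Lemma vr0 : O 0. Proof. by rewrite -(rmorph0 kap); apply: vr_const. Qed.
Lemma vr1 : O 1. Proof. by rewrite -(rmorph1 kap); apply: vr_const. Qed.
Lemma vrN x : O x -> O (- x).
Proof. by rewrite -sub0r; apply: vrB vr0. Qed.
Lemma vrD x y : O x -> O y -> O (x + y).
Proof. by move=> x1 y1; rewrite -(opprK y); apply/vrB/vrN. Qed.
Lemma vrX x n : O x -> O (x ^+ n).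
Proof.
by move=> x1; elim: n => [|n IH]; [exact: vr1|rewrite exprS; apply: vrM].
Qed.
Lemma vr_or z : O z \/ O z^-1. Proof. by case: vO. Qed.

Lemma maxidW z : maxid O z -> O z.
Proof. by case=> [->|]; [exact: vr0|case: (vr_or z)]. Qed.

Lemma maxid0 : maxid O 0. Proof. by left. Qed.

Lemma vr_unit z : O z -> ~ maxid O z -> O z^-1.
Proof. by move=> _ h; apply: contrapT => h1; apply: h; right. Qed.

Lemma maxid_nz z : ~ maxid O z -> z != 0.
Proof. by move=> h; apply/eqP => z0; apply: h; left. Qed.

Lemma maxidV z : ~ O z -> maxid O z^-1.
Proof. by move=> h; right; rewrite invrK. Qed.

Lemma maxid1 : ~ maxid O 1.
Proof. by case=> [/eqP|]; rewrite ?oner_eq0 // invr1; case; apply: vr1. Qed.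

Lemma maxidMl a z : O a -> maxid O z -> maxid O (a * z).
Proof.
move=> a1 mz; have [->|z0] := eqVneq z 0; first by rewrite mulr0; left.
have [->|a0] := eqVneq a 0; first by rewrite mul0r; left.
case: mz => [/eqP|nz]; first by rewrite (negPf z0).
right => h; apply: nz.
have -> : z^-1 = a * (a * z)^-1 by rewrite invfM mulrA divff // mul1r.
exact: vrM.
Qed.

Lemma maxidMr a z : O a -> maxid O z -> maxid O (z * a).
Proof. by rewrite mulrC; apply: maxidMl. Qed.

Lemma maxidD x y : maxid O x -> maxid O y -> maxid O (x + y).
Proof.
have aux a b : b != 0 -> O (a / b) -> maxid O b -> maxid O (a + b).
  move=> b0 ab mb; have -> : a + b = (a / b + 1) * b.
    by rewrite mulrDl divfK // mul1r.
  by apply: maxidMl mb; apply: vrD vr1.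
have [->|x0] := eqVneq x 0; first by rewrite add0r.
have [->|y0] := eqVneq y 0; first by rewrite addr0.
move=> mx my; case: (vr_or (x / y)) => h; first exact: aux.
by rewrite addrC; apply: aux => //; rewrite invf_div in h.
Qed.

Lemma maxidN x : maxid O x -> maxid O (- x).
Proof. by case=> [->|h]; [rewrite oppr0; left|right]; rewrite // invrN => /vrN; rewrite opprK. Qed.

Lemma maxid_prime a b : O a -> O b -> maxid O (a * b) -> maxid O a \/ maxid O b.
Proof.
move=> a1 b1 mab; have [mb|nb] := pselect (maxid O b); first by right.
left; have := maxidMr (vr_unit b1 nb) mab.
by rewrite mulfK // maxid_nz.
Qed.

Lemma maxid_sqr a : maxid O (a ^+ 2) -> maxid O a.
Proof.
case=> [/eqP|h]; first by rewrite sqrf_eq0 => /eqP ->; left.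
by right=> h1; apply: h; rewrite -exprVn; apply: vrX.
Qed.

(** Integral closedness in degree two: if [z] is not in [O] then [z^-1] is, and dividing the
    equation by [z] gives [z = c / z - b]. *)
Lemma vr_quadratic z b c : O b -> O c -> z ^+ 2 + b * z = c -> O z.
Proof.
move=> b1 c1 E; apply: contrapT => nz; have := maxidV nz.
have z0 : z != 0 by apply/eqP => z0; apply: nz; rewrite z0; apply: vr0.
case: (vr_or z) => // iz _; apply: nz.
have -> : z = c * z^-1 - b.
  by rewrite -E mulrDl expr2 -!mulrA divff // !mulr1 addrK.
by apply: vrB => //; apply: vrM.
Qed.

Lemma vr_sqr z : O (z ^+ 2) -> O z.
Proof. by move=> h; apply: (vr_quadratic vr0 h); rewrite mul0r addr0. Qed.

End ValuationRing.

(** * Existence of valuation rings *)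

Section Existence.

Variables (k F : fieldType) (kap : {rmorphism k -> F}).

Definition is_subring (A : F -> Prop) :=
  [/\ A 1, forall x y, A x -> A y -> A (x - y)
    & forall x y, A x -> A y -> A (x * y)].

Section Subring.
Variable A : F -> Prop.
Hypothesis sA : is_subring A.
Lemma subring1 : A 1. Proof. by case: sA. Qed.
Lemma subringB x y : A x -> A y -> A (x - y). Proof. by case: sA => _ h _; apply: h. Qed.
Lemma subringM x y : A x -> A y -> A (x * y). Proof. by case: sA => _ _; apply. Qed.
Lemma subring0 : A 0. Proof. by rewrite -(subrr 1); apply: subringB subring1 subring1. Qed.
Lemma subringN x : A x -> A (- x). Proof. by rewrite -sub0r; apply: subringB subring0. Qed.
Lemma subringD x y : A x -> A y -> A (x + y).
Proof. by move=> x1 y1; rewrite -(opprK y); apply/subringB/subringN. Qed.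
Lemma subringX x n : A x -> A (x ^+ n).
Proof. by move=> x1; elim: n => [|n IH]; [exact: subring1|rewrite exprS; apply: subringM]. Qed.
Lemma subring_sum (I : Type) (r : seq I) (P : pred I) (f : I -> F) :
  (forall i, P i -> A (f i)) -> A (\sum_(i <- r | P i) f i).
Proof. by move=> h; apply: big_ind => //; [exact: subring0|exact: subringD]. Qed.

Definition adjoin y z := exists2 q : {poly F}, forall i, A q`_i & z = q.[y].

Lemma adjoin_subring y : is_subring (adjoin y).
Proof.
split=> [|x z [q Aq ->] [r Ar ->]|x z [q Aq ->] [r Ar ->]].
- exists 1; last by rewrite hornerC.
  by move=> i; rewrite coef1; case: eqP => _; [exact: subring1|exact: subring0].
- exists (q - r); last by rewrite hornerD hornerN.
  by move=> i; rewrite coefB; apply: subringB.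
- exists (q * r); last by rewrite hornerM.
  by move=> i; rewrite coefM; apply: subring_sum => j _; apply: subringM.
Qed.

Lemma adjoin_sub y z : A z -> adjoin y z.
Proof.
move=> Az; exists z%:P; last by rewrite hornerC.
by move=> i; rewrite coefC; case: eqP => _ //; apply: subring0.
Qed.

Lemma adjoin_gen y : adjoin y y.
Proof.
exists 'X; last by rewrite hornerX.
by move=> i; rewrite coefX; case: eqP => _; [exact: subring1|exact: subring0].
Qed.

End Subring.

Section Maximal.

Variables (A : F -> Prop) (p : F).
Hypothesis sA : is_subring A.
Hypotheses (Ap : A p) (nAp : ~ A p^-1).
Hypothesis maxA : forall B, is_subring B -> (forall z, A z -> B z) ->
  ~ B p^-1 -> forall z, B z -> A z.

Let p_nz : p != 0.
Proof. by apply/eqP => p0; apply: nAp; rewrite p0 invr0; apply: (subring0 sA). Qed.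

Let I z := A (z / p).

Let one_notin_I : ~ I 1. Proof. by rewrite /I mul1r. Qed.
Let IM a z : A a -> I z -> I (a * z).
Proof. by move=> Aa Iz; rewrite /I -mulrA; apply: (subringM sA). Qed.
Let I_A z : I z -> A z.
Proof. by move=> Iz; rewrite -(divfK p_nz z); apply: (subringM sA). Qed.
Let I_sum (J : Type) (r : seq J) (P : pred J) (f : J -> F) :
  (forall i, P i -> I (f i)) -> I (\sum_(i <- r | P i) f i).
Proof. by move=> h; rewrite /I mulr_suml; apply: (subring_sum sA). Qed.
Let ID x y : I x -> I y -> I (x + y).
Proof. by rewrite /I mulrDl; apply: (subringD sA). Qed.

(** All powers of [u = 1 - z] are congruent to 1 modulo [p * A], so the localization of [A] at these
    powers does not contain [p^-1]; by maximality it equals [A]. *)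
Let unit_1I z : I z -> A (1 - z)^-1.
Proof.
move=> Iz; set u := 1 - z.
have Au : A u by apply: (subringB sA) (I_A Iz) => //; apply: (subring1 sA).
have uX n : I (1 - u ^+ n).
  elim: n => [|n IH]; first by rewrite subrr /I mul0r; apply: (subring0 sA).
  have -> : 1 - u ^+ n.+1 = u * (1 - u ^+ n) + z.
    by rewrite mulrBr mulr1 exprS /u; rewrite addrAC subrK.
  by apply: ID => //; apply: IM.
have u0 : u != 0.
  by apply/eqP => u0; have := uX 1%N; rewrite u0 expr1 subr0.
pose B x := exists n, A (x * u ^+ n).
apply: (maxA (B := B)).
- split=> [|x y [n xn] [m ym]|x y [n xn] [m ym]].
  + by exists 0%N; rewrite mulr1; apply: (subring1 sA).
  + exists (n + m)%N; have -> : (x - y) * u ^+ (n + m) =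
        x * u ^+ n * u ^+ m - y * u ^+ m * u ^+ n.
      by rewrite mulrBl {1}exprD addnC exprD !mulrA.
    by apply: (subringB sA) => //; apply: (subringM sA) => //; apply: (subringX sA).
  + by exists (n + m)%N; rewrite exprD mulrACA; apply: (subringM sA).
- by move=> x Ax; exists 0%N; rewrite mulr1.
- move=> [n pn]; apply: one_notin_I; rewrite -(subrK (u ^+ n) 1).
  by apply: ID => //; rewrite /I mulrC.
- by exists 1%N; rewrite expr1 mulVf //; apply: (subring1 sA).
Qed.

(* If [f] is at least as long as [g], then dividing [g.[y^-1] = 1] by the unit
   [1 - g_0] expresses [y ^+ n] through lower powers, which shortens [f]. *)
Let shorten y (f g : {poly F}) : y != 0 ->
    (forall i, I f`_i) -> (forall i, I g`_i) -> f.[y] = 1 -> g.[y^-1] = 1 ->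
    (size g <= size f)%N ->
  exists2 h : {poly F}, (forall i, I h`_i) /\ h.[y] = 1 & (size h < size f)%N.
Proof.
move=> y0 If Ig fy gy sgf; pose n := (size f).-1.
have sf : size f = n.+1.
  rewrite prednK // size_poly_gt0; apply/eqP => f0.
  by move: fy; rewrite f0 horner0 => /esym/eqP; rewrite oner_eq0.
pose u := 1 - g`_0; have Au : A u^-1 by apply: unit_1I.
have u0 : u != 0.
  apply/eqP => /eqP; rewrite subr_eq0 => /eqP g0.
  by apply: one_notin_I; rewrite g0.
pose h := f - f`_n *: 'X^n
  + \sum_(i < n.+1 | (0 < i)%N) (f`_n * g`_i / u) *: 'X^(n - i).
have gE : \sum_(i < n.+1 | (0 < i)%N) (g`_i / u) * y ^- i = 1.
  have : g.[y^-1] = \sum_(i < n.+1) g`_i * y^-1 ^+ i.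
    by apply: horner_coef_wide; rewrite -sf.
  rewrite gy big_ord_recl expr0 mulr1 => /eqP; rewrite addrC -subr_eq => /eqP gE.
  rewrite big_mkcond big_ord_recl /= add0r.
  rewrite -[RHS](divff u0) [X in _ = X / _]gE mulr_suml; apply: eq_bigr => i _.
  by rewrite exprVn mulrAC.
exists h; first split.
- move=> i; rewrite coefD; apply: ID.
    rewrite coefB coefZ coefXn; have [->|ne] := eqVneq i n.
      by rewrite mulr1 subrr /I mul0r; apply: (subring0 sA).
    by rewrite mulr0 subr0.
  rewrite coef_sum; apply: I_sum => j _; rewrite coefZ coefXn.
  rewrite -!mulrA mulrC; apply: IM => //.
  rewrite mulrA; apply: (subringM sA); last by case: eqP => _; [exact: (subring1 sA)|exact: (subring0 sA)].
  by apply: (subringM sA) => //; apply: I_A.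
- rewrite hornerD hornerD hornerN hornerZ hornerXn fy horner_sum.
  suff -> : \sum_(i < n.+1 | (0 < i)%N) ((f`_n * g`_i / u) *: 'X^(n - i)).[y]
      = f`_n * y ^+ n by rewrite subrK.
  rewrite -[RHS]mulr1 -gE mulr_sumr; apply: eq_bigr => i i0.
  rewrite hornerZ hornerXn.
  have -> : y ^+ (n - i) = y ^+ n * y ^- i.
    have E : (n - i + i = n)%N by rewrite subnK // -ltnS.
    by rewrite -[X in _ = y ^+ X / _]E exprD mulfK // expf_neq0.
  by rewrite -!mulrA; congr (_ * _); rewrite [RHS]mulrCA; congr (_ * _);
     rewrite [RHS]mulrCA.
- rewrite sf ltnS; apply/leq_sizeP => j nj; rewrite coefD coefB coefZ coefXn.
  rewrite coef_sum big1 ?addr0 => [|i i0].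
    have [->|ne] := eqVneq j n; first by rewrite mulr1 subrr.
    rewrite mulr0 subr0; apply: nth_default; rewrite sf ltn_neqAle nj eq_sym.
    by rewrite ne.
  rewrite coefZ coefXn; case: eqP => [jE|_]; last by rewrite mulr0.
  have := leq_ltn_trans (leq0n i) (ltn_ord i).
  by move: nj; rewrite jE -{1}(subn0 n) leqNgt ltn_sub2l //; case: (n) i {jE} i0 => [|m] [[|i] //].
Qed.

(** If neither [y] nor [y^-1] is in [A], both rings obtained by adjoining one of them contain
    [p^-1]. This gives two relations expressing 1 as a polynomial in [y], resp. [y^-1], with
    coefficients in [p * A], and the longer one can be shortened for ever. *)
Lemma maximal_valuation y : A y \/ A y^-1.
Proof.
have [y0|y0] := eqVneq y 0; first by left; rewrite y0; apply: (subring0 sA).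
apply: contrapT => /not_orP[ny niy].
have rel z : ~ A z -> exists2 f : {poly F}, (forall i, I f`_i) & f.[z] = 1.
  move=> nz; have [|nB] := pselect (adjoin A z p^-1).
    case=> q Aq qE; exists (p *: q) => [i|].
      by rewrite coefZ /I mulrC mulKf.
    by rewrite hornerZ -qE divff.
  case: nz; apply: (maxA (adjoin_subring sA z) _ nB); last exact: adjoin_gen.
  by move=> w; apply: adjoin_sub.
have no n : forall z (f g : {poly F}), z != 0 -> (forall i, I f`_i) ->
    (forall i, I g`_i) -> f.[z] = 1 -> g.[z^-1] = 1 ->
    (size f + size g <= n)%N -> False.
  elim: n => [|n IH] z f g z0 If Ig fz gz sn.
    have : f = 0 by apply/eqP; rewrite -size_poly_leq0 (leq_trans (leq_addr (size g) _)).
    by move=> f0; move/eqP: fz; rewrite f0 horner0 eq_sym oner_eq0.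
  have [gf|/ltnW fg] := leqP (size g) (size f).
    have [h [Ih hz] sh] := shorten z0 If Ig fz gz gf.
    apply: (IH z h g) => //.
    by rewrite -ltnS (leq_trans _ sn) // ltn_add2r.
  have [] := @shorten z^-1 g f _ Ig If gz _ fg; rewrite ?invr_eq0 ?invrK //.
  move=> h [Ih hz] sh; apply: (IH z f h) => //.
  by rewrite -ltnS (leq_trans _ sn) // ltn_add2l.
have [f If fy] := rel _ ny; have [g Ig gy] := rel _ niy.
exact: (no _ y f g).
Qed.

End Maximal.

(** Chevalley's extension theorem: by Zorn's lemma there is a maximal ring containing [A] but not
    [p^-1], and such a ring is a valuation ring. *)
Theorem exists_valuation_ring (A : F -> Prop) (p : F) :
    is_subring A -> (forall c, A (kap c)) -> A p -> ~ A p^-1 ->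
  exists2 O, valuation_ring kap O & (forall z, A z -> O z) /\ ~ O p^-1.
Proof.
move=> sA Ak Ap nAp.
(* Joining [A] to the set makes the union of the empty chain admissible. *)
pose P (X : set F) := let Y z := X z \/ A z in is_subring Y /\ ~ Y p^-1.
have PF (Fam : set (set F)) : (forall X, Fam X -> P X) -> total_on Fam subset ->
    P (\bigcup_(X in Fam) X)%classic.
  move=> FP tF; set Y := (\bigcup_(X in Fam) X)%classic.
  have two x y : Y x \/ A x -> Y y \/ A y ->
      (A x /\ A y) \/ exists2 X, Fam X & (X x \/ A x) /\ (X y \/ A y).
    case=> [[X FX Xx]|Ax]; case=> [[X' FX' X'y]|Ay]; last by left.
    - have [XX'|X'X] := tF _ _ FX FX'.
        by right; exists X' => //; split; left => //; apply: XX'.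
      by right; exists X => //; split; left => //; apply: X'X.
    - by right; exists X => //; split; [left|right].
    - by right; exists X' => //; split; [right|left].
  have lift X z : Fam X -> X z \/ A z -> Y z \/ A z.
    by move=> FX [Xz|Az]; [left; exists X|right].
  split; first split.
  - by right; apply: subring1.
  - move=> x y Yx Yy; have [[Ax Ay]|[X FX [Xx Xy]]] := two _ _ Yx Yy.
      by right; apply: subringB.
    by apply: (lift X) => //; have [sX _] := FP _ FX; apply: (subringB sX).
  - move=> x y Yx Yy; have [[Ax Ay]|[X FX [Xx Xy]]] := two _ _ Yx Yy.
      by right; apply: subringM.
    by apply: (lift X) => //; have [sX _] := FP _ FX; apply: (subringM sX).
  - case=> // -[X FX Xp]; have [_ ] := FP _ FX; apply; by left.
have [X [[sX nXp] maxX]] := Zorn_bigcup PF.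
pose O z := X z \/ A z.
have maxO (B : set F) : is_subring B -> (forall z, O z -> B z) -> ~ B p^-1 ->
    forall z, B z -> O z.
  move=> sB OB nB; apply: contrapT => /existsNP[z /not_implyP[Bz nOz]].
  have EB : (fun z => B z \/ A z) = B.
    by apply/funext => x; apply/propext; split=> [[//|Ax]|]; [apply: OB; right|left].
  apply: (maxX B); last by split; [rewrite EB|case].
  split=> [x Xx|BX]; first by apply: OB; left.
  by apply: nOz; left; apply: BX.
exists O.
  split.
  - by move=> c; right.
  - by move=> x y Ox Oy; split; [apply: (subringB sX)|apply: (subringM sX)].
  - by move=> z; apply: (maximal_valuation (A := O) (p := p)) => //; right.
  - by exists p^-1.
by split=> // z Az; right.
Qed.

End Existence.

(** * Subfields and rational functions *)

Section Subfield.

Variables (F : fieldType) (S : F -> Prop).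
Hypothesis sS : is_subfield S.

Lemma sf1 : S 1. Proof. by case: sS. Qed.
Lemma sfB x y : S x -> S y -> S (x - y). Proof. by case: sS => _ h _ _; apply: h. Qed.
Lemma sfM x y : S x -> S y -> S (x * y). Proof. by case: sS => _ _ h _; apply: h. Qed.
Lemma sfV x : S x -> S x^-1. Proof. by case: sS => _ _ _; apply. Qed.
Lemma sf0 : S 0. Proof. by rewrite -(subrr 1); apply: sfB sf1 sf1. Qed.
Lemma sfN x : S x -> S (- x). Proof. by rewrite -sub0r; apply: sfB sf0. Qed.
Lemma sfD x y : S x -> S y -> S (x + y).
Proof. by move=> x1 y1; rewrite -(opprK y); apply/sfB/sfN. Qed.
Lemma sfX x n : S x -> S (x ^+ n).
Proof. by move=> x1; elim: n => [|n IH]; [exact: sf1|rewrite exprS; apply: sfM]. Qed.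
Lemma sf_div x y : S x -> S y -> S (x / y).
Proof. by move=> x1 y1; apply/sfM/sfV. Qed.

End Subfield.

Ltac sfsolve := repeat first [assumption | apply: sfD | apply: sfM
  | apply: sfX | apply: sfV | apply: sfN | apply: sf1 | apply: sf0].

Section Rational.

Variables (k F : fieldType) (kap : {rmorphism k -> F}).
Implicit Types (t z : F) (p q u v : {poly k}).

Definition pev t p := (map_poly kap p).[t].

Lemma pevD t p q : pev t (p + q) = pev t p + pev t q.
Proof. by rewrite /pev rmorphD hornerD. Qed.
Lemma pevB t p q : pev t (p - q) = pev t p - pev t q.
Proof. by rewrite /pev rmorphB hornerD hornerN. Qed.
Lemma pevN t p : pev t (- p) = - pev t p.
Proof. by rewrite /pev rmorphN hornerN. Qed.
Lemma pevM t p q : pev t (p * q) = pev t p * pev t q.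
Proof. by rewrite /pev rmorphM hornerM. Qed.
Lemma pevX t p n : pev t (p ^+ n) = pev t p ^+ n.
Proof. by rewrite /pev rmorphXn horner_exp. Qed.
Lemma pevC t c : pev t c%:P = kap c.
Proof. by rewrite /pev map_polyC hornerC. Qed.
Lemma pev0 t : pev t 0 = 0.
Proof. by rewrite /pev rmorph0 horner0. Qed.
Lemma pev1 t : pev t 1 = 1.
Proof. by rewrite /pev rmorph1 hornerC. Qed.
Lemma pev_X t : pev t 'X = t.
Proof. by rewrite /pev map_polyX hornerX. Qed.
Lemma pevZ t c p : pev t (c *: p) = kap c * pev t p.
Proof. by rewrite -mul_polyC pevM pevC. Qed.
Definition pevE := (pevD, pevB, pevN, pevM, pevX, pevC, pev0, pev1, pev_X, pevZ).

Lemma pev_sum t p : pev t p = \sum_(i < size p) kap p`_i * t ^+ i.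
Proof.
rewrite /pev horner_coef size_map_poly; apply: eq_bigr => i _.
by rewrite coef_map.
Qed.

Lemma pev_in (S : F -> Prop) t p : is_subring S -> (forall c, S (kap c)) -> S t ->
  S (pev t p).
Proof.
move=> sS Sk St; rewrite pev_sum; apply: (subring_sum sS) => i _.
by apply: (subringM sS) => //; apply: (subringX sS).
Qed.

Lemma subfield_subring (S : F -> Prop) : is_subfield S -> is_subring S.
Proof. by case. Qed.

Definition ratl t z := exists u v, pev t v != 0 /\ z = pev t u / pev t v.

Definition transcendental t := forall p, p != 0 -> pev t p != 0.

Lemma rat_pev t p : ratl t (pev t p).
Proof. by exists p, 1; rewrite pev1 oner_eq0 divr1. Qed.

Lemma rat_const t c : ratl t (kap c).
Proof. by rewrite -(pevC t); apply: rat_pev. Qed.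

Lemma rat_gen t : ratl t t.
Proof. by rewrite -{2}(pev_X t); apply: rat_pev. Qed.

Lemma rat_subfield t : is_subfield (ratl t).
Proof.
split.
- by rewrite -(pev1 t); apply: rat_pev.
- move=> _ _ [u [v [v0 ->]]] [u' [v' [v0' ->]]].
  exists (u * v' - u' * v), (v * v'); rewrite !pevE mulf_neq0 //; split=> //.
  by rewrite -mulNr addf_div // mulNr.
- move=> _ _ [u [v [v0 ->]]] [u' [v' [v0' ->]]].
  by exists (u * u'), (v * v'); rewrite !pevE mulf_neq0 // mulf_div.
- move=> _ [u [v [v0 ->]]].
  have [u0|u0] := eqVneq (pev t u) 0.
    by exists 0, 1; rewrite !pevE u0 !mul0r invr0 oner_eq0.
  by exists v, u; rewrite invf_div.
Qed.

Lemma rat_min (S : F -> Prop) t : is_subfield S -> (forall c, S (kap c)) -> S t ->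
  forall z, ratl t z -> S z.
Proof.
move=> sS Sk St _ [u [v [_ ->]]].
by apply: (sf_div sS); apply: pev_in => //; apply: subfield_subring.
Qed.

Lemma rat_inv t z : ratl t z -> ratl t^-1 z.
Proof.
apply: rat_min; [exact: rat_subfield|exact: rat_const|].
by rewrite -{2}(invrK t); apply: (sfV (rat_subfield _)); apply: rat_gen.
Qed.

Lemma transcendental_nz t : transcendental t -> t != 0.
Proof.
by move=> /(_ 'X); rewrite polyX_eq0 pev_X; apply.
Qed.

Lemma transcendental_const t c : transcendental t -> t != kap c.
Proof.
move=> /(_ ('X - c%:P)); rewrite polyXsubC_eq0 pevB pev_X pevC subr_eq0.
exact.
Qed.

Lemma pev_inj t p q : transcendental t -> pev t p = pev t q -> p = q.
Proof.
move=> tr E; apply/eqP; rewrite -subr_eq0; apply: contraT => /tr.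
by rewrite pevB E subrr eqxx.
Qed.

Lemma rat_coprime t z : ratl t z ->
  exists u v, [/\ coprimep u v, pev t v != 0 & z = pev t u / pev t v].
Proof.
case=> u [v [v0 ->]]; pose g := gcdp u v.
have vn : v != 0 by apply: contraNneq v0 => ->; rewrite pev0.
have Eu : u = (u %/ g) * g by rewrite divpK ?dvdp_gcdl.
have Ev : v = (v %/ g) * g by rewrite divpK ?dvdp_gcdr.
have := v0; rewrite {1}Ev pevM mulf_eq0 negb_or => /andP[v1 g1].
exists (u %/ g), (v %/ g); split=> //.
  by rewrite coprimep_div_gcd // vn orbT.
by rewrite {1}Eu {1}Ev !pevM -mulf_div divff // mulr1.
Qed.

Lemma pev_rev t n p : t != 0 -> (size p <= n.+1)%N ->
  pev t^-1 p * t ^+ n = pev t (\sum_(i < n.+1) p`_i *: 'X^(n - i)).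
Proof.
move=> t0 sp; rewrite /pev rmorph_sum horner_sum /=.
rewrite (horner_coef_wide (n := n.+1)) ?size_map_poly // mulr_suml.
apply: eq_bigr => i _; rewrite coef_map map_polyZ /= map_polyXn hornerZ hornerXn.
rewrite -mulrA; congr (_ * _).
have E : (n - i + i = n)%N by rewrite subnK // -ltnS.
by rewrite -[X in t ^+ X]E exprD exprVn mulrCA mulVf ?mulr1 // expf_neq0.
Qed.

Lemma transcendentalV t : transcendental t -> transcendental t^-1.
Proof.
move=> tr p p0; have t0 := transcendental_nz tr.
have [n sp] : exists n, size p = n.+1.
  by exists (size p).-1; rewrite prednK // size_poly_gt0.
suff : pev t^-1 p * t ^+ n != 0 by rewrite mulf_eq0 negb_or => /andP[].
rewrite pev_rev ?sp //; apply: tr; apply/eqP => /polyP /(_ 0%N).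
rewrite coef0 coef_sum big_ord_recr /= big1 => [|i _]; last first.
  rewrite coefZ coefXn; case: eqP => [/esym/eqP|_]; last by rewrite mulr0.
  by rewrite subn_eq0 leqNgt ltn_ord.
rewrite subnn add0r coefZ coefXn mulr1 => /eqP.
have -> : p`_n = lead_coef p by rewrite lead_coefE sp.
by rewrite lead_coef_eq0 (negPf p0).
Qed.

(** Multiplied by a power of [t], the right-hand side becomes a polynomial in [t] of bounded degree,
    which leaves only the constant term of [p]. Finiteness at infinity is always used in this
    form. *)
Lemma poly_in_both t p q : transcendental t -> pev t p = pev t^-1 q ->
  exists c, p = c%:P.
Proof.
move=> tr E; have t0 := transcendental_nz tr.
pose n := size q.
have := pev_rev t0 (leqnSn n); rewrite -E.
have -> : pev t p * t ^+ n = pev t (p * 'X^n) by rewrite !pevE.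
move/(pev_inj tr) => E'; exists p`_0; apply: size1_polyC.
have : (size (p * 'X^n)%R <= n.+1)%N.
  rewrite E'; apply: (leq_trans (size_sum _ _ _)).
  apply/bigmax_leqP => i _; apply: (leq_trans (size_scale_leq _ _)).
  by rewrite size_polyXn ltnS leq_subr.
have [->|p0] := eqVneq p 0; first by rewrite size_poly0.
by rewrite size_mulXn // -addn1 leq_add2l.
Qed.

Section Valuations.

Variable O : F -> Prop.
Hypothesis vO : valuation_ring kap O.

Lemma vr_subring : is_subring O.
Proof. by split; [exact: (vr1 vO)|exact: (vrB vO)|exact: (vrM vO)]. Qed.

Lemma vr_pev t p : O t -> O (pev t p).
Proof. apply: pev_in; [exact: vr_subring|exact: vr_const vO]. Qed.

Lemma maxid_coprime t u v : O t -> coprimep u v -> maxid O (pev t u) ->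
  maxid O (pev t v) -> False.
Proof.
move=> Ot /Bezout_eq1_coprimepP[[a b] /= E] mu mv.
apply: (maxid1 vO); rewrite -(pev1 t) -E pevD !pevM.
by apply: (maxidD vO); apply: (maxidMl vO) => //; apply: vr_pev.
Qed.

Lemma rat_valuation t z : O t -> ratl t z -> O z ->
  exists u v, [/\ ~ maxid O (pev t v), pev t v != 0 & z = pev t u / pev t v].
Proof.
move=> Ot /rat_coprime[u [v [cuv v0 zE]]] Oz; exists u, v; split=> //.
move=> mv; apply: (maxid_coprime Ot cuv) => //.
by rewrite -(divfK v0 (pev t u)) -zE; apply: (maxidMl vO).
Qed.

(** The condition on factorizations says that [p] is squarefree. If [z = u / v], the gcd of [u] and
    [p] lies in the maximal ideal by Bezout, so the cofactor of [p] is a unit and [u / p] is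
    integral. *)
Lemma rat_uniformizer t p : transcendental t -> O t ->
    (forall g q, p = g * q -> coprimep g q) ->
    maxid O (pev t p) -> p != 0 ->
  forall z, ratl t z -> maxid O z -> O (z / pev t p).
Proof.
move=> tr Ot sqf mp p0 z rz mz.
have [u [v [nv v0 zE]]] := rat_valuation Ot rz (maxidW vO mz).
have mu : maxid O (pev t u).
  have -> : pev t u = z * pev t v by rewrite zE divfK.
  by apply: (maxidMr vO) => //; apply: vr_pev.
pose g := gcdp u p.
have Eu : u = (u %/ g) * g by rewrite divpK ?dvdp_gcdl.
have Ep : p = g * (p %/ g) by rewrite mulrC divpK ?dvdp_gcdr.
have cgq := sqf _ _ Ep.
have mg : maxid O (pev t g).
  have [[a b] /= /eqpf_eq[c c0 E]] := Bezoutp u p.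
  have -> : pev t g = kap c^-1 * pev t (a * u + b * p).
    by rewrite E pevZ mulrA -rmorphM mulVf // rmorph1 mul1r.
  apply: (maxidMl vO); first exact: (vr_const vO).
  by rewrite pevD !pevM; apply: (maxidD vO); apply: (maxidMl vO) => //; apply: vr_pev.
have nq : ~ maxid O (pev t (p %/ g)) by move=> mq; apply: (maxid_coprime Ot cgq).
have q0 := maxid_nz nq.
have Oq := vr_unit (vr_pev (p %/ g) Ot) nq.
have g1 : pev t g != 0.
  by have := tr _ p0; rewrite {1}Ep pevM mulf_eq0 negb_or => /andP[].
have -> : z / pev t p = pev t (u %/ g) * (pev t (p %/ g))^-1 * (pev t v)^-1.
  rewrite zE {1}Eu {1}Ep !pevM invfM -!mulrA; congr (_ * _).
  by rewrite mulrCA mulVKf // mulrC.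
apply: (vrM vO); last by apply: (vr_unit (vr_pev v Ot)).
by apply: (vrM vO) => //; apply: vr_pev.
Qed.

End Valuations.

(** If the reduced denominator [v] is not constant, some valuation ring contains k[t] but not
    [1 / v]; the coprime numerator is a unit there, and [z] has a pole. *)
Lemma rat_integral t z : transcendental t -> ratl t z ->
  (forall O, valuation_ring kap O -> O t -> O z) -> exists p, z = pev t p.
Proof.
move=> tr /rat_coprime[u [v [cuv v0 zE]]] h.
have [sv|sv] := leqP (size v) 1.
  have Ev := size1_polyC sv; exists ((v`_0)^-1 *: u).
  rewrite zE pevZ fmorphV mulrC; congr (_ * _); rewrite {1}Ev pevC //.
pose A z := exists p, z = pev t p.
have sA : is_subring A.
  split=> [|_ _ [p ->] [q ->]|_ _ [p ->] [q ->]]; first by exists 1; rewrite pev1.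
    by exists (p - q); rewrite pevB.
  by exists (p * q); rewrite pevM.
have nA : ~ A (pev t v)^-1.
  case=> w E; have : v * w = 1.
    by apply: (pev_inj tr); rewrite pevM pev1 -E divff.
  move/(congr1 (fun p : {poly k} => size p)); rewrite size_poly1 => /eqP.
  rewrite size_mul_eq1 => /andP[/eqP E1 _].
  by rewrite E1 in sv.
have Ak c : A (kap c) by exists c%:P; rewrite pevC.
have [O vO [AO nO]] := exists_valuation_ring sA Ak (ex_intro _ v erefl) nA.
have Ot : O t by apply: AO; exists 'X; rewrite pev_X.
have mv : maxid O (pev t v) by right.
case: (maxid_coprime vO Ot cuv _ mv).
rewrite -(divfK v0 (pev t u)) -zE; apply: (maxidMl vO) => //.
exact: h.
Qed.

Lemma rat_integral_both t z : transcendental t -> ratl t z ->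
    (forall O, valuation_ring kap O -> O t -> O z) ->
    (forall O, valuation_ring kap O -> O t^-1 -> O z) -> exists c, z = kap c.
Proof.
move=> tr rz h1 h2; have [p zp] := rat_integral tr rz h1.
have [q zq] := rat_integral (transcendentalV tr) (rat_inv rz) h2.
have [c pc] := poly_in_both tr (etrans (esym zp) zq).
by exists c; rewrite zp pc pevC.
Qed.

End Rational.

(** * Artin-Schreier extensions *)

(** An Artin-Schreier extension L = K(y), expressed by subsets of one ambient field so that all
    steps of a tower and their conjugates live in the same type. *)
Definition quad (F : fieldType) (K L : F -> Prop) (y : F) :=
  [/\ is_subfield K, K (y ^+ 2 + y), ~ K y
    & forall z, L z <-> exists a b, [/\ K a, K b & z = a + b * y]].

Section Quad.

Variables (F : fieldType).
Hypothesis F2 : 2%:R = 0 :> F.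
Variables (K L : F -> Prop) (y : F).
Hypothesis q : quad K L y.

Let sK : is_subfield K. Proof. by case: q. Qed.
Let Kf : K (y ^+ 2 + y). Proof. by case: q. Qed.
Let f := y ^+ 2 + y.
Let yf : y ^+ 2 = y + f. Proof. by rewrite /f; ring2 F2. Qed.

Lemma quad_uniq a b a' b' : K a -> K b -> K a' -> K b' ->
  a + b * y = a' + b' * y -> a = a' /\ b = b'.
Proof.
move=> Ka Kb Ka' Kb' E; have [_ _ ny _] := q.
have [bb|nb] := eqVneq b b'; first by split=> //; move: E; rewrite bb => /addIr.
have b0 : b - b' != 0 by rewrite subr_eq0.
case: ny; have -> : y = (a' - a) / (b - b').
  apply: (mulIf b0); rewrite divfK //.
  have -> : y * (b - b') = (a + b * y) - a - b' * y by ring2 F2.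
  by rewrite E; ring2 F2.
by apply: (sf_div sK); apply: (sfB sK).
Qed.

Lemma quad_sub z : K z -> L z.
Proof.
case: q => _ _ _ h Kz; apply/h; exists z, 0; split=> //; first exact: sf0 sK.
by rewrite mul0r addr0.
Qed.

Lemma quad_gen : L y.
Proof.
case: q => _ _ _ h; apply/h; exists 0, 1; split; [exact: sf0 sK|exact: sf1 sK|].
by rewrite mul1r add0r.
Qed.

Lemma quad_nz a b : K a -> K b -> a + b * y != 0 ->
  a ^+ 2 + a * b + b ^+ 2 * f != 0.
Proof.
move=> Ka Kb; apply: contraNneq => N0.
have E : (a + b * y) * (a + b * (y + 1)) = 0 by rewrite -N0 /f; ring2 F2.
move/eqP: E; rewrite mulf_eq0 => /orP[/eqP//|/eqP E].
have [_ b0] : a + b = 0 /\ b = 0.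
  apply: quad_uniq => //; try exact: sf0 sK; first exact: sfD.
  by rewrite mul0r addr0 -E; ring2 F2.
by move: E; rewrite b0 !mul0r => ->.
Qed.

Lemma quad_inv a b : K a -> K b -> a + b * y != 0 ->
  (a + b * y)^-1 = (a + b) / (a ^+ 2 + a * b + b ^+ 2 * f)
    + (b / (a ^+ 2 + a * b + b ^+ 2 * f)) * y.
Proof.
move=> Ka Kb nz; have n0 := quad_nz Ka Kb nz.
by field2 F2 yf.
Qed.

Lemma quad_subfield : is_subfield L.
Proof.
have [_ _ _ h] := q; split.
- by apply: quad_sub; apply: sf1.
- move=> _ _ /h[a [b [Ka Kb ->]]] /h[a' [b' [Ka' Kb' ->]]]; apply/h.
  exists (a - a'), (b - b'); split; try exact: sfB.
  by rewrite mulrBl opprD addrACA.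
- move=> _ _ /h[a [b [Ka Kb ->]]] /h[a' [b' [Ka' Kb' ->]]]; apply/h.
  exists (a * a' + b * b' * f), (a * b' + a' * b + b * b').
  by split; [sfsolve|sfsolve|ring2 F2 yf].
- move=> _ /h[a [b [Ka Kb ->]]].
  have [->|nz] := eqVneq (a + b * y) 0.
    by rewrite invr0; apply: quad_sub; apply: sf0.
  rewrite quad_inv //; apply/h.
  by eexists; eexists; split; last reflexivity; rewrite -/f; sfsolve.
Qed.

Lemma quad_other b a : K a -> K b -> b != 0 ->
  forall z, L z <-> exists a' b', [/\ K a', K b' & z = a' + b' * (a + b * y)].
Proof.
move=> Ka Kb b0 z; have [_ _ _ h] := q.
rewrite h; split=> -[a' [b' [Ka' Kb' ->]]].
  exists (a' + b' / b * a), (b' / b); split; try by sfsolve.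
  by field2 F2.
exists (a' + b' * a), (b' * b); split; try by sfsolve.
by ring2 F2.
Qed.

Lemma quad_shift a : K a -> quad K L (y + a).
Proof.
move=> Ka; have [_ _ ny h] := q; split=> //.
- have -> : (y + a) ^+ 2 + (y + a) = f + (a ^+ 2 + a) by rewrite /f; ring2 F2.
  by sfsolve.
- by move=> Kya; apply: ny; rewrite -(addrK a y); apply: sfB.
- move=> z; rewrite (quad_other Ka (sf1 sK) (oner_neq0 _)) mul1r.
  by split=> -[a' [b' [Ka' Kb' ->]]]; exists a', b'; rewrite (addrC a).
Qed.

End Quad.

(** Writing [z = a + b * y], the coefficient of [y] in [z ^+ 2 + z] is [b ^+ 2 + b]. It has to
    vanish, and [b = 0] is excluded, so [b = 1]. *)
Lemma quad_AS (F : fieldType) (F2 : 2%:R = 0 :> F) (K L : F -> Prop) (y z : F) :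
  quad K L y -> L z -> ~ K z -> K (z ^+ 2 + z) -> K (y + z).
Proof.
move=> q Lz nz Kz; have [sK Kf _ h] := q.
have /h[a [b [Ka Kb zE]]] := Lz.
have yf : y ^+ 2 = y + (y ^+ 2 + y) by ring2 F2.
set f := y ^+ 2 + y in Kf yf.
have [_ /eqP] : a ^+ 2 + b ^+ 2 * f + a = z ^+ 2 + z /\ b ^+ 2 + b = 0.
  apply: (quad_uniq F2 q) => //; try by sfsolve.
  by rewrite zE; ring2 F2 yf.
have -> : b ^+ 2 + b = b * (b + 1) by ring2 F2.
rewrite mulf_eq0 => /orP[/eqP b0|/eqP /(addxx_eq0 F2) b1].
  by case: nz; rewrite zE b0 mul0r addr0.
by rewrite zE b1 mul1r addrCA addxx // addr0.
Qed.

Section Conjugation.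

Variables (F : fieldType).
Hypothesis F2 : 2%:R = 0 :> F.
Variables (K L : F -> Prop) (y : F).
Hypothesis q : quad K L y.
Hypothesis Lall : forall z, L z.

Let coordP z : exists ab : F * F, [/\ K ab.1, K ab.2 & z = ab.1 + ab.2 * y].
Proof.
by case: q => _ _ _ h; have /h[a [b ?]] := Lall z; exists (a, b).
Qed.
Let co z := projT1 (cid (coordP z)).
Let coP z : [/\ K (co z).1, K (co z).2 & z = (co z).1 + (co z).2 * y].
Proof. by rewrite /co; case: cid. Qed.
Let cj z := z + (co z).2.
Let cjE a b : K a -> K b -> cj (a + b * y) = a + b * y + b.
Proof.
move=> Ka Kb; rewrite /cj; have [Ka' Kb' E] := coP (a + b * y).
by have [_ <-] := quad_uniq F2 q Ka Kb Ka' Kb' E.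
Qed.

Let cj_zmod : zmod_morphism cj.
Proof.
move=> x z; have [Ka Kb ->] := coP x; have [Ka' Kb' ->] := coP z.
set a := (co x).1 in Ka *; set b := (co x).2 in Kb *.
set a' := (co z).1 in Ka' *; set b' := (co z).2 in Kb' *.
have [sK Kf _ _] := q.
have -> : a + b * y - (a' + b' * y) = (a - a') + (b - b') * y by ring2 F2.
by rewrite !cjE //; first (by ring2 F2); apply: sfB.
Qed.

Let cj_monoid : monoid_morphism cj.
Proof.
have [sK Kf _ _] := q.
have yf : y ^+ 2 = y + (y ^+ 2 + y) by ring2 F2.
set f := y ^+ 2 + y in Kf yf.
split=> [|x z].
  have E : 1 = 1 + 0 * y by ring2 F2.
  by rewrite {1}E cjE; [ring2 F2|sfsolve|sfsolve].
have [Ka Kb ->] := coP x; have [Ka' Kb' ->] := coP z.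
set a := (co x).1 in Ka *; set b := (co x).2 in Kb *.
set a' := (co z).1 in Ka' *; set b' := (co z).2 in Kb' *.
have -> : (a + b * y) * (a' + b' * y) =
    (a * a' + b * b' * f) + (a * b' + a' * b + b * b') * y by ring2 F2 yf.
by rewrite !cjE //; [ring2 F2 yf|sfsolve|sfsolve].
Qed.

HB.instance Definition _ := GRing.isZmodMorphism.Build F F cj cj_zmod.
HB.instance Definition _ := GRing.isMonoidMorphism.Build F F cj cj_monoid.

Lemma quad_conj : exists tau : {rmorphism F -> F},
  forall a b, K a -> K b -> tau (a + b * y) = a + b * y + b.
Proof. by exists cj => a b; apply: cjE. Qed.

End Conjugation.

Section ConjValuation.

Variables (k F : fieldType) (kap : {rmorphism k -> F}).

Lemma conj_valuation (tau : {rmorphism F -> F}) (O : F -> Prop) :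
  (forall c, tau (kap c) = kap c) -> (forall z, exists w, tau w = z) ->
  valuation_ring kap O -> valuation_ring kap (fun z => O (tau z)).
Proof.
move=> tk st vO; split.
- by move=> c; rewrite tk; apply: vr_const vO _.
- by move=> x y Ox Oy; rewrite rmorphB rmorphM; split; [apply: (vrB vO)|apply: (vrM vO)].
- by move=> z; rewrite fmorphV; apply: vr_or vO _.
- by case: vO => _ _ _ [z nz]; have [w wz] := st z; exists w; rewrite wz.
Qed.

End ConjValuation.

(** * Derivations *)

(** A total function required to be a derivation on the subset [K] only; derivations are thus
    extended along a tower inside one field. *)
Definition derivation_on (k F : fieldType) (kap : k -> F) (K : F -> Prop)
    (D : F -> F) :=
  [/\ forall c, D (kap c) = 0, forall x y, K x -> K y -> D (x + y) = D x + D y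
    & forall x y, K x -> K y -> D (x * y) = x * D y + y * D x].

Definition derivation (k F : fieldType) (kap : k -> F) (D : F -> F) :=
  [/\ forall c, D (kap c) = 0, forall x y, D (x + y) = D x + D y
    & forall x y, D (x * y) = x * D y + y * D x].

Section Derivation.

Variables (k F : fieldType) (kap : {rmorphism k -> F}).
Hypothesis F2 : 2%:R = 0 :> F.

Section Rules.

Variable D : F -> F.
Hypothesis dD : derivation kap D.

Lemma der_const c : D (kap c) = 0. Proof. by case: dD. Qed.
Lemma derD x y : D (x + y) = D x + D y. Proof. by case: dD. Qed.
Lemma derM x y : D (x * y) = x * D y + y * D x. Proof. by case: dD. Qed.
Lemma der0 : D 0 = 0. Proof. by rewrite -{1}(rmorph0 kap) der_const. Qed.
Lemma der1 : D 1 = 0. Proof. by rewrite -(rmorph1 kap) der_const. Qed.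
Lemma der_sqr x : D (x ^+ 2) = 0.
Proof. by rewrite expr2 derM addxx. Qed.
Lemma derV x : D x^-1 = D x / x ^+ 2.
Proof.
have [->|x0] := eqVneq x 0; first by rewrite invr0 der0 mul0r.
have : D (x * x^-1) = 0 by rewrite divff // der1.
rewrite derM => E; have {}E := addxx_eq0 F2 E.
by apply: (mulfI x0); rewrite E; field2 F2.
Qed.
Lemma der_div x z : z != 0 -> D (x / z) = (D x * z + x * D z) / z ^+ 2.
Proof. by move=> z0; rewrite derM derV; field2 F2. Qed.
Lemma der_AS x : D (x ^+ 2 + x) = D x.
Proof. by rewrite derD der_sqr add0r. Qed.

Lemma der_pev t (p : {poly k}) : D (pev kap t p) = pev kap t p^`() * D t.
Proof.
elim/poly_ind: p => [|p c IH]; first by rewrite pev0 deriv0 pev0 der0 mul0r.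
rewrite derivMXaddC !pevE derD derM IH der_const addr0; ring2 F2.
Qed.

Lemma der_scale c : derivation kap (fun z => c * D z).
Proof.
split=> [a|x y|x y]; first by rewrite der_const mulr0.
  by rewrite derD mulrDr.
by rewrite derM; ring2 F2.
Qed.

Lemma der_sub D' : derivation kap D' -> derivation kap (fun z => D z + D' z).
Proof.
case=> h1 h2 h3; split=> [a|x y|x y]; first by rewrite der_const h1 addr0.
  by rewrite derD h2 addrACA.
by rewrite derM h3; ring2 F2.
Qed.

Lemma der_rat0 t z : ratl kap t z -> D t = 0 -> D z = 0.
Proof.
move=> [u [v [v0 ->]]] t0.
by rewrite der_div // !der_pev t0 !mulr0 mul0r addr0 mul0r.
Qed.

Lemma der_quad0 K L y z : quad K L y -> (forall a, K a -> D a = 0) -> L z ->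
  D z = 0.
Proof.
case=> _ Kf _ h D0 /h[a [b [Ka Kb ->]]].
by rewrite derD derM (D0 a) // (D0 b) // mulr0 add0r addr0 -der_AS (D0 _ Kf) mulr0.
Qed.

End Rules.

Definition stable (O L : F -> Prop) (D : F -> F) :=
  forall z, L z -> O z -> O (D z).

Lemma deriv_one : (1 : {poly k})^`() = 0.
Proof. by rewrite -polyC1 derivC. Qed.

(** This is d/dt, defined by the quotient rule. Independence of the chosen fraction follows by
    differentiating the equality of cross products as polynomials, [t] being transcendental. *)
Lemma der_ratE t (tr : transcendental kap t) :
  exists D, derivation_on kap (ratl kap t) D /\ D t = 1.
Proof.
have h z : exists w, forall u v, pev kap t v != 0 -> z = pev kap t u / pev kap t v ->
    w = (pev kap t u^`() * pev kap t v + pev kap t u * pev kap t v^`())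
          / pev kap t v ^+ 2.
  have [[u [v [v0 zE]]]|nz] := pselect (ratl kap t z); last first.
    by exists 0 => u v v0 zE; case: nz; exists u, v.
  exists ((pev kap t u^`() * pev kap t v + pev kap t u * pev kap t v^`())
          / pev kap t v ^+ 2) => u' v' v0'; rewrite zE => E.
  have E' : pev kap t (u * v') = pev kap t (u' * v).
    by rewrite !pevE; move/eqP: E; rewrite eqr_div // => /eqP ->.
  have := congr1 (fun p : {poly k} => pev kap t p^`()) (pev_inj tr E').
  rewrite !derivM !pevE => E1; rewrite !pevE in E'.
  have -> : pev kap t u' = pev kap t u * pev kap t v' / pev kap t v.
    by rewrite E' mulfK.
  have -> : pev kap t u'^`() = (pev kap t u^`() * pev kap t v' +
      pev kap t u * pev kap t v'^`() +
      pev kap t u * pev kap t v' / pev kap t v * pev kap t v^`())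
      / pev kap t v by rewrite E1 E' mulfK // (addxK F2) mulfK.
  by field2 F2.
have [D DE] := choice h.
exists D; split; last first.
  rewrite (DE t 'X 1) ?pevE ?oner_eq0 ?divr1 //.
  by rewrite derivX deriv_one !pevE; field2 F2.
have DE' u v : pev kap t v != 0 -> D (pev kap t u / pev kap t v) =
    (pev kap t u^`() * pev kap t v + pev kap t u * pev kap t v^`())
          / pev kap t v ^+ 2 by move=> v0; apply: DE.
split.
- move=> c; rewrite (DE _ c%:P 1) ?pevE ?oner_eq0 ?divr1 //.
  by rewrite derivC deriv_one !pevE !mul0r !mulr0 addr0 mul0r.
- move=> _ _ [u [v [v0 ->]]] [u' [v' [v0' ->]]].
  have -> : pev kap t u / pev kap t v + pev kap t u' / pev kap t v' =
     pev kap t (u * v' + u' * v) / pev kap t (v * v').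
    by rewrite !pevE; field2 F2.
  rewrite !DE' ?pevM ?mulf_neq0 // !derivD !derivM !pevE.
  by field2 F2.
- move=> _ _ [u [v [v0 ->]]] [u' [v' [v0' ->]]].
  have -> : pev kap t u / pev kap t v * (pev kap t u' / pev kap t v') =
     pev kap t (u * u') / pev kap t (v * v').
    by rewrite !pevE; field2 F2.
  rewrite !DE' ?pevM ?mulf_neq0 // !derivM !pevE.
  by field2 F2.
Qed.

(** Squares have derivative zero, so [y] must have the derivative of [y ^+ 2 + y]; this prescription
    does define a derivation. *)
Lemma der_extend K L y D : quad K L y -> (forall c, K (kap c)) ->
    derivation_on kap K D ->
  exists D', [/\ derivation_on kap L D' , forall a, K a -> D' a = D a
    & D' y = D (y ^+ 2 + y)].
Proof.
move=> qd Kk [h1 h2 h3]; have [sK Kf ny hL] := qd.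
have yf : y ^+ 2 = y + (y ^+ 2 + y) by ring2 F2.
set f := y ^+ 2 + y in Kf yf *; clearbody f.
have h z : exists w, forall a b, K a -> K b -> z = a + b * y ->
    w = D a + D b * y + b * D f.
  have [/hL[a [b [Ka Kb zE]]]|nz] := pselect (L z); last first.
    by exists 0 => a b Ka Kb zE; case: nz; apply/hL; exists a, b.
  exists (D a + D b * y + b * D f) => a' b' Ka' Kb'; rewrite zE => E.
  by have [-> ->] := quad_uniq F2 qd Ka Kb Ka' Kb' E.
have [D' DE] := choice h.
have D'E a b : K a -> K b -> D' (a + b * y) = D a + D b * y + b * D f.
  by move=> Ka Kb; apply: DE.
have D0 : D 0 = 0 by rewrite -{1}(rmorph0 kap) h1.
have D1 : D 1 = 0 by rewrite -(rmorph1 kap) h1.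
have D'K a : K a -> D' a = D a.
  move=> Ka; rewrite (DE a a 0) ?mul0r ?addr0 ?D0 ?mul0r ?addr0 //; exact: sf0.
exists D'; split=> //; last first.
  rewrite (DE y 0 1) ?D0 ?D1 ?mul0r ?mul1r ?add0r //; by sfsolve.
split.
- by move=> c; rewrite D'K ?h1.
- move=> _ _ /hL[a [b [Ka Kb ->]]] /hL[a' [b' [Ka' Kb' ->]]].
  have -> : a + b * y + (a' + b' * y) = (a + a') + (b + b') * y by ring2 F2.
  rewrite !D'E ?h2 //; try by sfsolve.
  by ring2 F2.
- move=> _ _ /hL[a [b [Ka Kb ->]]] /hL[a' [b' [Ka' Kb' ->]]].
  have -> : (a + b * y) * (a' + b' * y) =
      (a * a' + b * b' * f) + (a * b' + a' * b + b * b') * y by ring2 F2 yf.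
  rewrite !D'E ?(h2, h3) //; try by sfsolve.
  by ring2 F2 yf.
Qed.

Lemma derivation_all L D : (forall z, L z) -> derivation_on kap L D ->
  derivation kap D.
Proof. by move=> Lall [h1 h2 h3]; split=> // x y; [apply: h2|apply: h3]. Qed.

(** * Derivations preserving a valuation ring *)

Section Stable.

Variable O : F -> Prop.
Hypothesis vO : valuation_ring kap O.

Lemma stable_rat t D : transcendental kap t -> derivation kap D -> O t ->
  O (D t) -> stable O (ratl kap t) D.
Proof.
move=> tr dD Ot ODt z rz Oz.
have [u [v [nv v0 ->]]] := rat_valuation vO Ot rz Oz.
have Ov := vr_unit (vr_pev vO v Ot) nv.
rewrite der_div // !(der_pev dD) -exprVn.
by repeat first [apply: (vrM vO)|apply: (vrD vO)|apply: (vrX vO)|apply: (vr_pev vO)].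
Qed.

(** A uniformizer of the valuation ring induced by [O] on the subfield [K]; in the ambient field the
    place may ramify further. *)
Definition uniformizer (K : F -> Prop) (p : F) :=
  [/\ K p, p != 0, maxid O p & forall z, K z -> maxid O z -> O (z / p)].

(** A pole of [r] doubles in [r ^+ 2 + r], while [f] has a simple pole. With [r^-1 = z * p] this
    reads [1 + r^-1 = (p * f) * z ^+ 2 * p], where the left side is a unit and the right side is
    not. *)
Lemma uniformizer_noAS K p f : is_subfield K -> uniformizer K p ->
  O (p * f) -> ~ maxid O (p * f) -> forall r, K r -> r ^+ 2 + r <> f.
Proof.
move=> sK [Kp p0 mp up] Opf nmpf r Kr E.
have nr : ~ O r.
  move=> Or; apply: nmpf; apply: (maxidMr vO) => //.
  by rewrite -E; apply: (vrD vO) => //; apply: (vrX vO).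
have r0 : r != 0 by apply/eqP => r0; apply: nr; rewrite r0; apply: (vr0 vO).
have mr := maxidV nr.
have Oz := up _ (sfV sK Kr) mr; set z := r^-1 / p in Oz.
have z0 : z != 0 by rewrite mulf_neq0 ?invr_eq0.
have : 1 + r^-1 = (p * f) * z ^+ 2 * p by rewrite -E /z; field2 F2.
move=> E1; have m1 : maxid O (1 + r^-1).
  by rewrite E1; apply: (maxidMl vO) => //; apply: (vrM vO) => //; apply: (vrX vO).
apply: (maxid1 vO); rewrite -(addrK r^-1 1).
by apply: (maxidD vO) => //; apply: (maxidN vO).
Qed.

Section Step.

Variables (K L : F -> Prop) (y u : F).
Hypothesis qd : quad K L y.
Let f := y ^+ 2 + y.
Let th := u * y.
Let v := u ^+ 2 * f.
Hypotheses (Ku : K u) (u0 : u != 0) (Ou : O u) (Ov : O v).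
(** Local maximality of the order generated by [th]: unless [u] is a unit, the norm of a translate
    [e + th] is never divisible by the square of the uniformizer of [K]. *)
Hypothesis minu : O u^-1 \/ exists p, [/\ uniformizer K p, O (u / p)
  & forall e, K e -> O e -> ~ O ((e ^+ 2 + e * u + v) / p ^+ 2)].

Let thv : th ^+ 2 + u * th = v.
Proof. by rewrite /th /v /f; ring2 F2. Qed.

Lemma step_theta : O th.
Proof. exact: (vr_quadratic vO Ou Ov thv). Qed.

(** Several places of [L] may lie above one place of [K], so the coordinates of an integral
    [z = a + b * th] need not be integral. If [b] has a pole, then [e + th] with [e = a / b] is a
    non-unit. If its conjugate [e + u + th] is a unit, multiplication by it yields the fraction; if
    not, [u] is a non-unit as well and the norm of [e + th] is divisible by [p ^+ 2]. *)
Lemma step_fraction z : L z -> O z -> exists a b c d,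
  [/\ [/\ K a, K b, K c & K d], [/\ O a, O b, O c & O d],
      ~ maxid O (c + d * th) & z = (a + b * th) / (c + d * th)].
Proof.
have [sK Kf ny hL] := qd; have Oth := step_theta.
move=> /hL[a [b' [Ka Kb' zE]]] Oz.
pose b := b' / u; have Kb : K b by sfsolve.
have {}zE : z = a + b * th by rewrite zE /b /th; field2 F2.
have K0 := sf0 sK; have K1 := sf1 sK; have O0 := vr0 vO; have O1 := vr1 vO.
have m1 := maxid1 vO.
have [Ob|nOb] := pselect (O b).
  have Oa : O a.
    by rewrite -(addrK (b * th) a) -zE; apply: (vrB vO) => //; apply: (vrM vO).
  by exists a, b, 1, 0; split; rewrite ?mul0r ?addr0 ?divr1.
have b0 : b != 0 by apply/eqP => b0; apply: nOb; rewrite b0.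
have mb := maxidV nOb.
pose e := a / b; have Ke : K e by sfsolve.
have zbE : z / b = e + th by rewrite zE /e; field2 F2.
have meth : maxid O (e + th) by rewrite -zbE; apply: (maxidMl vO).
have Oe : O e.
  by rewrite -(addrK th e); apply: (vrB vO) => //; apply: (maxidW vO).
pose N := e ^+ 2 + e * u + v.
have KN : K N by rewrite /N /v /f; sfsolve.
have [mc|nmc] := pselect (maxid O (e + u + th)); last first.
  exists (b * N), 0, (e + u), 1; rewrite mul1r mul0r addr0.
  have NE : b * N = z * (e + u + th) by rewrite /N -thv zE /e; field2 F2.
  split=> //; first by split=> //; sfsolve.
    split=> //; last exact: (vrD vO).
    by rewrite NE; apply: (vrM vO) => //; apply: (vrD vO) => //; apply: (vrD vO).
  by rewrite NE mulfK // (maxid_nz nmc).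
have mu : maxid O u.
  have -> : u = (e + u + th) - (e + th) by ring2 F2.
  by apply: (maxidD vO) => //; apply: (maxidN vO).
case: minu => [Oiu|[p [[Kp p0 mp up] Oup nN]]].
  by case: m1; rewrite -(divff u0); apply: (maxidMr vO).
case: (nN e) => //; rewrite -/N.
have Oethp : O ((e + th) / p).
  rewrite -zbE -mulrA; apply: (vrM vO) => //; apply: up => //; by sfsolve.
have -> : N / p ^+ 2 = ((e + th) / p) ^+ 2 + (u / p) * ((e + th) / p).
  by rewrite /N -thv; field2 F2.
by apply: (vrD vO); [apply: (vrX vO)|apply: (vrM vO)].
Qed.

Lemma stable_step D : derivation kap D -> stable O K D -> O (D th) ->
  stable O L D.
Proof.
move=> dD sD ODth z Lz Oz; have Oth := step_theta.
have [a [b [c [d [[Ka Kb Kc Kd] [Oa Ob Oc Od] nm ->]]]]] := step_fraction Lz Oz.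
have := sD _ Ka Oa; have := sD _ Kb Ob; have := sD _ Kc Oc; have := sD _ Kd Od.
move: nm Oth ODth; move: (th) => s nm Os ODs Odd Odc Odb Oda.
have Oden : O (c + d * s) by apply: (vrD vO) => //; apply: (vrM vO).
have Oi := vr_unit Oden nm.
rewrite der_div ?(maxid_nz nm) // !(derD dD) !(derM dD) -exprVn.
by repeat first [assumption|apply: (vrM vO)|apply: (vrD vO)|apply: (vrX vO)].
Qed.

End Step.

Lemma stable_etale K L y D : quad K L y -> O (y ^+ 2 + y) -> derivation kap D ->
  stable O K D -> stable O L D.
Proof.
move=> qd Of dD sD; have [sK Kf _ _] := qd.
have O1 := vr1 vO.
apply: (stable_step (u := 1) qd) => //; rewrite ?expr1n ?mul1r ?oner_eq0 //.
- exact: sf1.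
- by left; rewrite invr1.
- by rewrite -der_AS //; apply: sD.
Qed.

Section Ramified.

Variables (K L : F -> Prop) (y p : F).
Hypothesis qd : quad K L y.
Let f := y ^+ 2 + y.
Hypothesis up : uniformizer K p.
Hypotheses (Opf : O (p * f)) (nmpf : ~ maxid O (p * f)).

Let p0 : p != 0. Proof. by case: up. Qed.
Let mp : maxid O p. Proof. by case: up. Qed.
Let Op : O p. Proof. exact: (maxidW vO mp). Qed.
Let vE : p ^+ 2 * f = p * (p * f). Proof. by ring2 F2. Qed.
Let Ov : O (p ^+ 2 * f). Proof. by rewrite vE; apply: (vrM vO). Qed.
Let mv : maxid O (p ^+ 2 * f). Proof. by rewrite vE; apply: (maxidMr vO). Qed.

Let thv : (p * y) ^+ 2 + p * (p * y) = p ^+ 2 * f.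
Proof. by rewrite /f; ring2 F2. Qed.

(** An Eisenstein argument: if [p ^+ 2] divided [e ^+ 2 + e * p + p ^+ 2 * f], then [p] would divide
    [e], and [f] itself would be integral, against its simple pole. *)
Let minp : O p^-1 \/ exists p', [/\ uniformizer K p', O (p / p')
  & forall e, K e -> O e -> ~ O ((e ^+ 2 + e * p + p ^+ 2 * f) / p' ^+ 2)].
Proof.
right; exists p; split=> // [|e Ke Oe ON]; first by rewrite divff //; apply: (vr1 vO).
have [Kp _ _ hp] := up.
have mN : maxid O (e ^+ 2 + e * p + p ^+ 2 * f).
  rewrite -(divfK (expf_neq0 2 p0) (e ^+ 2 + e * p + p ^+ 2 * f)).
  by apply: (maxidMl vO) => //; rewrite expr2; apply: (maxidMl vO).
have me : maxid O e.
  apply: (maxid_sqr vO).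
  have -> : e ^+ 2 = (e ^+ 2 + e * p + p ^+ 2 * f) - (e * p + p ^+ 2 * f).
    by ring2 F2.
  apply: (maxidD vO) => //; apply: (maxidN vO); apply: (maxidD vO) => //.
  exact: (maxidMl vO).
have Oep := hp _ Ke me.
apply: nmpf; have -> : p * f = p * ((e ^+ 2 + e * p + p ^+ 2 * f) / p ^+ 2
   - (e / p) ^+ 2 - e / p) by field2 F2.
by apply: (maxidMr vO) => //; repeat first [assumption|apply: (vrB vO)|apply: (vrX vO)].
Qed.

Let Oth : O (p * y). Proof. exact: (vr_quadratic vO Op Ov thv). Qed.

Lemma ramified_maxid : maxid O (p * y).
Proof.
apply: (maxid_sqr vO); have -> : (p * y) ^+ 2 = p ^+ 2 * f - p * (p * y).
  by rewrite -thv addrK.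
apply: (maxidD vO) => //; apply: (maxidN vO); exact: (maxidMr vO).
Qed.

(** At a simple pole the different is generated by [p], which is the square of the new uniformizer
    [p * y] up to a unit. Scaling by [p] restores stability, and the value at [p * y] shows that the
    factor is exact. *)
Lemma stable_ramified D : derivation kap D -> stable O K D ->
  stable O L (fun z => p * D z) /\
  (~ maxid O (D p) -> ~ maxid O (p * D (p * y))).
Proof.
move=> dD sD; have [Kp _ _ _] := up; have [sK Kf _ _] := qd.
have ODp := sD _ Kp Op; have ODpf : O (D (p * f)) by apply: sD => //; sfsolve.
have E : p * D (p * y) = D p * (p * y) + p * D (p * f) + (p * f) * D p.
  by rewrite !(derM dD) -(der_AS dD y) -/f; ring2 F2.
split.
  apply: (stable_step (u := p) qd) => //.
  - exact: der_scale.
  - by move=> z Kz Oz; apply: (vrM vO) => //; apply: sD.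
  - by rewrite E; repeat first [assumption|apply: (vrD vO)|apply: (vrM vO)].
move=> nDp mE; apply: nmpf.
suff m : maxid O (p * f * D p) by case: (maxid_prime vO Opf ODp m).
have -> : p * f * D p = p * D (p * y) - (D p * (p * y) + p * D (p * f)).
  by rewrite E; ring2 F2.
apply: (maxidD vO) => //; apply: (maxidN vO); apply: (maxidD vO).
  by apply: (maxidMl vO) => //; apply: ramified_maxid.
exact: (maxidMr vO).
Qed.

Lemma ramified_uniformizer : uniformizer L (p * y).
Proof.
have [Kp _ _ hp] := up; have [sK Kf ny hL] := qd.
have y0 : y != 0 by apply/eqP => y0; apply: ny; rewrite y0; apply: sf0.
have mth := ramified_maxid.
split=> //; [|by rewrite mulf_neq0|].
  apply: (sfM (quad_subfield F2 qd)); first exact: (quad_sub qd Kp).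
  exact: (quad_gen qd).
move=> z Lz mz.
have [] := @step_fraction K L y p qd Kp p0 Op Ov minp z Lz (maxidW vO mz).
move=> a [b [c [d [[Ka Kb Kc Kd] [Oa Ob Oc Od] nm zE]]]].
have Oden : O (c + d * (p * y)) by apply: (vrD vO) => //; apply: (vrM vO).
have den0 := maxid_nz nm.
have ma : maxid O a.
  have -> : a = z * (c + d * (p * y)) - b * (p * y) by rewrite zE divfK // addrK.
  apply: (maxidD vO); first exact: (maxidMr vO).
  by apply: (maxidN vO); apply: (maxidMl vO).
have nt : ~ maxid O (p * y + p * f).
  move=> m; apply: nmpf; have -> : p * f = (p * y + p * f) - p * y by ring2 F2.
  by apply: (maxidD vO) => //; apply: (maxidN vO).
have Oit : O (p * y + p * f)^-1 by apply: vr_unit nt; apply: (vrD vO).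
have t0 := maxid_nz nt.
(* The unit [p * y + p * f] equals [p * y ^+ 2], so [1 / (p * y)] is an integral multiple of
   [1 / p], and [a] absorbs the factor [1 / p]. *)
have -> : z / (p * y) = (a / p * ((p * y) / (p * y + p * f)) + b) / (c + d * (p * y)).
  have E : p * y + p * f = p * y ^+ 2 by rewrite /f; ring2 F2.
  by rewrite zE E; field2 F2.
apply: (vrM vO); last exact: vr_unit.
apply: (vrD vO) => //; apply: (vrM vO); first exact: hp.
exact: (vrM vO).
Qed.

End Ramified.

End Stable.

End Derivation.

(** * Polynomials *)

Section PolyFactors.

Variable k : fieldType.
Implicit Types p q u : {poly k}.

(** Descent for a property that behaves like membership in a prime ideal; it is applied to vanishing
    at a place and to being nonconstant. *)
Lemma irreducible_factor (P : {poly k} -> Prop) u :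
    (forall a b, P (a * b) -> P a \/ P b) ->
    (forall a, a != 0 -> P a -> (1 < size a)%N) -> u != 0 -> P u ->
  exists p, [/\ irreducible_poly p, p %| u & P p].
Proof.
move=> Pm Pc; elim: {u}_.+1 {-2}u (ltnSn (size u)) => // n IH u su u0 Pu.
have s1 := Pc _ u0 Pu.
have [irr|] := pselect (irreducible_poly u); first by exists u.
move=> /not_andP[/(_ s1)//|] /existsNP[q] /not_implyP[sq] /not_implyP[qu nqu].
have [w uE] := dvdpP _ _ qu.
have [w0 q0] : w != 0 /\ q != 0.
  by move: u0; rewrite uE mulf_eq0 negb_or => /andP[].
have sz : (size u = (size w + size q).-1)%N by rewrite uE size_mul.
have q_gt1 : (1 < size q)%N.
  by rewrite ltn_neqAle eq_sym sq size_poly_gt0.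
have w_gt1 : (1 < size w)%N.
  rewrite ltnNge; apply/negP => w1; apply: nqu.
  by rewrite -dvdp_size_eqp // sz; move: w1 w0; rewrite -size_poly_gt0; case: (size w) => [|[|]].
have sw : (size w < n)%N.
  apply: leq_trans (_ : (size w < size u)%N) _; last by [].
  by rewrite sz; case: (size q) q_gt1 => [|[|m]] // _; rewrite !addnS /= ltnS leq_addr.
have sq' : (size q < n)%N.
  apply: leq_trans (_ : (size q < size u)%N) _; last by [].
  by rewrite sz; case: (size w) w_gt1 => [|[|m]] // _; rewrite !addSn /= ltnS leq_addl.
have [] := Pm w q; first by rewrite -uE.
  move=> Pw; have [p [ip pw Pp]] := IH w sw w0 Pw.
  by exists p; split=> //; rewrite uE dvdp_mulr.
move=> Pq; have [p [ip pw Pp]] := IH q sq' q0 Pq.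
by exists p; split=> //; rewrite uE dvdp_mull.
Qed.

Lemma irreducible_squarefree p : irreducible_poly p ->
  forall g q, p = g * q -> coprimep g q.
Proof.
move=> ip g q E; have [s1 h] := ip.
have p0 : p != 0 by rewrite -size_poly_gt0 ltnW.
have [g0 q0] : g != 0 /\ q != 0.
  by move: p0; rewrite E mulf_eq0 negb_or => /andP[].
have unit_coprime (a b : {poly k}) : size a == 1%N -> coprimep a b.
  by rewrite size_poly_eq1 => /eqp_coprimepl ->; apply: coprime1p.
have [/unit_coprime //|sg] := boolP (size g == 1%N).
rewrite coprimep_sym; apply: unit_coprime.
have : g %= p by apply: h => //; rewrite E dvdp_mulr.
rewrite -dvdp_size_eqp ?E ?dvdp_mulr // size_mul //.
have : (0 < size g)%N by rewrite size_poly_gt0.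
case: (size g) => // m _; rewrite addSn /= -addn1 eqn_add2l eq_sym.
exact.
Qed.

Lemma irreducible_coprime p q : irreducible_poly p -> ~~ (p %| q) -> coprimep p q.
Proof.
by move=> ip npq; rewrite irreducible_poly_coprime.
Qed.

End PolyFactors.

(** * Regular differentials *)

Section RegularForms.

Variables (k : fieldType) (C : curve k).
Hypothesis k2 : 2%:R = 0 :> k.

Lemma char2_curve : 2%:R = 0 :> C.
Proof. by rewrite -(rmorph_nat (const C)) k2 rmorph0. Qed.
Let F2 := char2_curve.

Implicit Types (w : diff_form C) (D : C -> C).

Let valuation O := valuation_ring (const C) O.

(** Near [O] the form is a sum of terms f dg with f and g integral, and a derivation preserving [O]
    takes an integral value on each of them. *)
Lemma regular_stable w O D : regular_form w -> valuation O ->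
  derivation (const C) D -> (forall z, O z -> O (D z)) -> O (form_at w D).
Proof.
move=> rw vO dD sD; have [w' Ow' /(_ _ dD) ->] := rw O vO.
rewrite /form_at big_seq; apply: big_ind; first exact: (vr0 vO).
  exact: (vrD vO).
move=> p pw; have [O1 O2] := Ow' p pw.
by apply: (vrM vO) => //; apply: sD.
Qed.

Lemma form_at_scale w D D' c : (forall z, D z = c * D' z) ->
  form_at w D = c * form_at w D'.
Proof.
move=> h; rewrite /form_at mulr_sumr; apply: eq_bigr => p _.
by rewrite h mulrCA.
Qed.

(** All derivations are multiples of [D0], so the form is the quotient of its value at [D0] by
    [D0 g], times dg. The factor [c] cancels; it is kept so that numerator and denominator can be
    controlled separately. *)
Lemma regular_intro w D0 t :
    derivation (const C) D0 ->
    (forall D, derivation (const C) D -> forall z, D z = D t * D0 z) ->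
    (forall O, valuation O -> exists c g,
        [/\ O g, c * D0 g != 0 & O (c * form_at w D0 / (c * D0 g))]) ->
  regular_form w.
Proof.
move=> dD0 all h O vO; have [c [g [Og nz Oh]]] := h O vO.
exists [:: (c * form_at w D0 / (c * D0 g), g)].
  by move=> p; rewrite inE => /eqP ->.
move=> D dD; rewrite (form_at_scale w (all _ dD)) /form_at big_seq1 /= (all _ dD g).
by move: nz; rewrite mulf_eq0 negb_or => /andP[c0 g0]; field2 F2.
Qed.

Lemma regular0 : regular_form ([::] : diff_form C).
Proof. by move=> O vO; exists [::]. Qed.

(** The coefficient [H] of dr is a polynomial in [r], and [r ^+ 2 * H] is a polynomial in [1 / r]
    because dr has a double pole at infinity; together they force [H = 0]. *)
Lemma genus0_regular r w D : transcendental (const C) r ->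
    (forall z, ratl (const C) r z) -> regular_form w ->
  derivation (const C) D -> form_at w D = 0.
Proof.
move=> tr allr rw dD.
have [D0 [dD0 D0r]] := der_ratE F2 tr.
have {}dD0 : derivation (const C) D0 := derivation_all allr dD0.
have r0 := transcendental_nz tr.
have trV := transcendentalV tr.
set H := form_at w D0.
have [p Hp] : exists p, H = pev (const C) r p.
  apply: rat_integral => // O vO Or; apply: (regular_stable rw vO dD0) => z Oz.
  have O1 : O (D0 r) by rewrite D0r; apply: (vr1 vO).
  exact: (stable_rat F2 vO tr dD0 Or O1 (allr z) Oz).
have [q Hq] : exists q, r ^+ 2 * H = pev (const C) r^-1 q.
  apply: rat_integral => //; first by apply: rat_inv.
  move=> O vO Or; pose D1 z := r ^+ 2 * D0 z.
  have dD1 : derivation (const C) D1 by apply: der_scale.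
  have <- : form_at w D1 = r ^+ 2 * H by apply: form_at_scale.
  apply: (regular_stable rw vO dD1) => z Oz.
  have O1 : O (D1 r^-1).
    rewrite /D1 (derV F2 dD0) D0r mulrC divfK ?expf_neq0 //; exact: (vr1 vO).
  exact: (stable_rat F2 vO trV dD1 Or O1 (rat_inv (allr z)) Oz).
have E : pev (const C) r ('X^2 * p) = pev (const C) r^-1 q by rewrite !pevE -Hq Hp.
have [c Ec] := poly_in_both tr E.
have p0 : p = 0.
  apply/eqP; apply: contraT => p0.
  have : (size ('X^2 * p)%R <= 1)%N by rewrite Ec size_polyC leq_b1.
  by rewrite mulrC size_mulXn // -size_poly_eq0; case: (size p) p0.
have H0 : H = 0 by rewrite Hp p0 pev0.
have -> : form_at w D = D r * H.
  apply: form_at_scale => z.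
  pose D2 z := D z + D r * D0 z.
  have dD2 : derivation (const C) D2 by apply: der_sub => //; apply: der_scale.
  have : D2 z = 0.
    by apply: (der_rat0 F2 dD2 (allr z)); rewrite /D2 D0r mulr1 addxx.
  exact: addxx_eq0.
by rewrite H0 mulr0.
Qed.

Section Hyperelliptic.

Variables (K : C -> Prop) (t y : C) (D : C -> C) (w : diff_form C).
Hypothesis tr : transcendental (const C) t.
Hypothesis KE : forall z, K z <-> ratl (const C) t z.
Variable L : C -> Prop.
Hypothesis Lall : forall z, L z.
Hypothesis qd : quad K L y.
Hypotheses (dD : derivation (const C) D) (Dt : D t = 1).
Hypothesis rw : regular_form w.

Let ev := pev (const C) t.

Let sK : is_subfield K. Proof. by case: qd. Qed.
Let Kev p : K (ev p). Proof. by apply/KE; apply: rat_pev. Qed.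

(** The lengths of the polynomials [u] for which [u * y'] is integral over k[t], [y'] being some
    Artin-Schreier generator in the class of [y] modulo [K]. *)
Let admissible n := exists (u v : {poly k}) (y' : C), [/\ size u = n, u != 0, quad K L y',
  K (y' + y) & ev v = ev u ^+ 2 * (y' ^+ 2 + y')].

Let admissible_ex : exists n, `[< admissible n >].
Proof.
have [_ Kf _ _] := qd; have /KE[a [b [b0 E]]] := Kf.
exists (size b); apply/asboolP; exists b, (a * b), y; split=> //.
- by apply: contraNneq b0 => ->; rewrite pev0.
- by rewrite addxx //; apply: sf0.
- by rewrite E /ev pevM; field2 F2.
Qed.

(* With [u] of least degree, [k[t] + k[t] (u y)] is integrally closed: a local
   integral element outside it would allow to divide [u] by a prime. *)
Let minimal : exists (u v : {poly k}) (y' : C), [/\ u != 0, quad K L y', K (y' + y),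
    ev v = ev u ^+ 2 * (y' ^+ 2 + y')
  & forall p c, irreducible_poly p -> p %| u -> ~~ (p ^+ 2 %| c ^+ 2 + c * u + v)].
Proof.
case: (ex_minnP admissible_ex) => n /asboolP[u [v [y' [su u0 q' Kyy E]]]] minn.
exists u, v, y'; split=> // p c ip pu; apply/negP => pc.
have p0 : p != 0 by rewrite -size_poly_gt0 ltnW //; case: ip.
have [u' uE] := dvdpP _ _ pu; have [v' vE] := dvdpP _ _ pc.
have u'0 : u' != 0 by apply: contraNneq u0 => u'0; rewrite uE u'0 mul0r.
have : (n <= size u')%N.
  apply: minn; apply/asboolP; exists u', v', (y' + ev c / ev u).
  have Kc : K (ev c / ev u) by apply: (sf_div sK).
  split=> //; first exact: quad_shift.
    by rewrite addrAC; apply: (sfD sK).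
  have evu0 : ev u != 0 by apply: tr.
  have := congr1 ev vE; rewrite /ev !pevE -/ev E => Ev.
  have evp0 : ev p != 0 by apply: tr.
  have evu' : ev u' = ev u / ev p by rewrite uE /ev pevM mulfK.
  have -> : ev v' = ev v' * ev p ^+ 2 / ev p ^+ 2 by field2 F2.
  by rewrite -Ev evu'; field2 F2.
rewrite leqNgt -su uE size_mul // => /negP; apply; have [s1 _] := ip.
by case: (size p) s1 => [|[|m]] // _; rewrite !addnS /= ltnS leq_addr.
Qed.

Let Oev O p : valuation O -> O t -> O (ev p).
Proof. by move=> vO Ot; apply: (vr_pev vO). Qed.

Let maxid_dvd O p q : valuation O -> O t -> irreducible_poly p ->
  maxid O (ev p) -> maxid O (ev q) -> p %| q.
Proof.
move=> vO Ot ip mp mq; apply: contraT => npq.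
by case: (maxid_coprime vO Ot (irreducible_coprime ip npq)).
Qed.

(** The divisibility condition supplies the local maximality required for a quadratic step at each
    zero of [u], so [u * D] preserves every valuation ring containing [t]. *)
Let minimal_stable u v y' : u != 0 -> quad K L y' ->
    ev v = ev u ^+ 2 * (y' ^+ 2 + y') ->
    (forall p c, irreducible_poly p -> p %| u -> ~~ (p ^+ 2 %| c ^+ 2 + c * u + v)) ->
  forall O, valuation O -> O t -> O (ev u * form_at w D).
Proof.
move=> u0 q' vE nodiv O vO Ot.
pose D1 z := ev u * D z.
have dD1 : derivation (const C) D1 by apply: der_scale.
have <- : form_at w D1 = ev u * form_at w D by apply: form_at_scale.
apply: (regular_stable rw vO dD1) => z Oz.
have evu0 : ev u != 0 by apply: tr.
have Ou := Oev u vO Ot.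
have sD : stable O K D.
  have O1 : O (D t) by rewrite Dt; apply: (vr1 vO).
  by move=> x /KE rx Ox; apply: (stable_rat F2 vO tr dD Ot O1 rx Ox).
have sD1 : stable O K D1.
  by move=> x Kx Ox; apply: (vrM vO) => //; apply: sD.
have Ov : O (ev u ^+ 2 * (y' ^+ 2 + y')) by rewrite -vE; apply: Oev.
have minu : O (ev u)^-1 \/ exists p, [/\ uniformizer O K p, O (ev u / p)
  & forall e, K e -> O e ->
    ~ O ((e ^+ 2 + e * ev u + ev u ^+ 2 * (y' ^+ 2 + y')) / p ^+ 2)].
  have [mu|nmu] := pselect (maxid O (ev u)); last by left; apply: vr_unit.
  right; have [p [ip pu mp]] : exists p, [/\ irreducible_poly p, p %| u & maxid O (ev p)].
    apply: (irreducible_factor (P := fun p => maxid O (ev p))) => //.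
      by move=> a b; rewrite /ev pevM; apply: (maxid_prime vO); apply: Oev.
    move=> a a0 ma; rewrite ltnNge; apply/negP => /size1_polyC aE.
    have c0 : a`_0 != 0 by apply: contraNneq a0 => c0; rewrite aE c0.
    apply: (maxid1 vO); have -> : 1 = const C (a`_0)^-1 * ev a.
      by rewrite aE /ev pevC coefC /= -rmorphM mulVf // rmorph1.
    by apply: (maxidMl vO) => //; apply: (vr_const vO).
  have p0 : p != 0 by rewrite -size_poly_gt0 ltnW //; case: ip.
  have evp0 : ev p != 0 by apply: tr.
  exists (ev p); split.
  + split=> // x /KE; apply: (rat_uniformizer vO tr Ot _ mp p0).
    exact: irreducible_squarefree.
  + have [u' ->] := dvdpP _ _ pu; rewrite /ev pevM mulfK //; exact: Oev.
  + move=> e /KE re Oe Oq.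
    have [x1 [x2 [nm x20 eE]]] := rat_valuation vO Ot re Oe.
    have cp : coprimep (p ^+ 2) x2.
      apply: coprimep_expl; apply: irreducible_coprime => //.
      apply/negP => /dvdpP[x' x2E]; apply: nm; rewrite x2E /ev pevM.
      by apply: (maxidMl vO) => //; apply: Oev.
    (* The local element [e = x1 / x2] is replaced by the polynomial [a * x1], congruent to it
       modulo [p ^+ 2], where [a] inverts [x2]. *)
    have /Bezout_eq1_coprimepP[[b a] /= Eab] := cp.
    have := nodiv p (a * x1) ip pu.
    set c := a * x1; set N := c ^+ 2 + c * u + v.
    have O2 := vr_unit (Oev x2 vO Ot) nm.
    pose d := ev b * ev x1 / ev x2.
    have Od : O d by repeat first [assumption|apply: Oev|apply: (vrM vO)].
    have ce : ev c = e + d * ev p ^+ 2.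
      have := congr1 ev Eab; rewrite /ev !pevE -/ev => Eab'.
      rewrite eE /d -/ev.
      have -> : ev a = (1 - ev b * ev p ^+ 2) / ev x2 by rewrite -Eab' addrAC subrr add0r mulfK.
      by field2 F2.
    clearbody c.
    have ON : O (ev N / ev p ^+ 2).
      have -> : ev N / ev p ^+ 2 = (e ^+ 2 + e * ev u + ev u ^+ 2 * (y' ^+ 2 + y')) / ev p ^+ 2
           + d ^+ 2 * ev p ^+ 2 + d * ev u.
        by rewrite /N /ev !pevE -/ev ce vE; field2 F2.
      by repeat first [assumption|apply: Oev|apply: (vrX vO)|apply: (vrM vO)|apply: (vrD vO)].
    have [N1 N1E] : exists N1, N = N1 * p.
      apply/dvdpP; apply: (maxid_dvd vO Ot ip mp).
      rewrite -(divfK (expf_neq0 2 evp0) (ev N)) expr2.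
      by apply: (maxidMl vO) => //; apply: (maxidMl vO) => //; apply: Oev.
    have [N2 N2E] : exists N2, N1 = N2 * p.
      apply/dvdpP; apply: (maxid_dvd vO Ot ip mp).
      have -> : ev N1 = ev N / ev p ^+ 2 * ev p by rewrite N1E /ev pevM -/ev; field2 F2.
      by apply: (maxidMl vO).
    by rewrite N1E N2E -mulrA -expr2 dvdp_mulIr.
have OD1 : O (D1 (ev u * y')).
  have -> : D1 (ev u * y') = D (ev u) * (ev u * y') + D (ev v).
    rewrite /D1 vE (derM dD) (derM dD (_ ^+ 2)) (der_sqr F2 dD) (der_AS F2 dD); ring2 F2.
  apply: (vrD vO); last by apply: sD => //; apply: Oev.
  apply: (vrM vO); first by apply: sD.
  exact: (step_theta F2 vO Ou Ov).
exact: (stable_step F2 vO q' (Kev u) evu0 Ou Ov minu dD1 sD1 OD1 (Lall z) Oz).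
Qed.

(** [B] is the trace of the coefficient of [w]. Only [u] times this coefficient is known to be
    integral, so a priori [B = b1 / u1] with [u1] dividing [u]. At a prime factor [p] of [u1], trace
    and norm give an equation which, divided by [b1] modulo [p ^+ 2], contradicts the choice of
    [u]. *)
Lemma hyperelliptic_trace A B : K A -> K B -> form_at w D = A + B * y ->
  exists p, B = pev (const C) t p.
Proof.
move=> KA KB HE.
have [u [v [y' [u0 q' Kyy vE nodiv]]]] := minimal.
have Ost := minimal_stable u0 q' vE nodiv.
have evu0 : ev u != 0 by apply: tr.
pose A' := A + B * (y' + y).
have KA' : K A' by apply: (sfD sK) => //; apply: (sfM sK).
have {}HE : form_at w D = A' + B * y' by rewrite HE /A'; ring2 F2.
have [tau tauE] := quad_conj F2 q' Lall.
have tauK a : K a -> tau a = a.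
  move=> Ka; have := tauE a 0 Ka (sf0 sK).
  by rewrite mul0r !addr0.
have tauS z : exists z', tau z' = z.
  have [_ _ _ h] := q'; have /h[a [b [Ka Kb ->]]] := Lall z.
  exists (a + b * y' + b).
  by rewrite rmorphD tauE // (tauK b) // addxK.
have tauO O : valuation O -> valuation (fun z => O (tau z)).
  apply: conj_valuation => // c; apply: tauK; apply/KE; exact: rat_const.
have taut : tau t = t by apply: tauK; apply/KE; apply: rat_gen.
set X := ev u * form_at w D in Ost.
have XE : X = ev u * A' + ev u * B * y' by rewrite /X HE; ring2 F2.
have tX : tau X = X + ev u * B.
  by rewrite XE tauE //; apply: (sfM sK).
have Otau O : valuation O -> O t -> O (tau X).
  by move=> vO Ot; apply: (Ost (fun z => O (tau z))); [apply: tauO|rewrite taut].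
have [b bE] : exists b, ev u * B = ev b.
  apply: rat_integral => //; first by apply/KE; apply: (sfM sK).
  move=> O vO Ot; have -> : ev u * B = tau X - X by rewrite tX; ring2 F2.
  by apply: (vrB vO); [apply: Otau|apply: Ost].
have NE : X * tau X = (ev u * A') ^+ 2 + (ev u * A') * ev b + B ^+ 2 * ev v.
  by rewrite tX XE vE -bE; ring2 F2.
have [n nE] : exists n, X * tau X = ev n.
  apply: rat_integral => //.
    by apply/KE; rewrite NE; sfsolve; apply: Kev.
  by move=> O vO Ot; apply: (vrM vO); [apply: Ost|apply: Otau].
pose g := gcdp b u.
have Eb : b = (b %/ g) * g by rewrite divpK ?dvdp_gcdl.
have Eu : u = (u %/ g) * g by rewrite divpK ?dvdp_gcdr.
have cop : coprimep (b %/ g) (u %/ g) by rewrite coprimep_div_gcd // u0 orbT.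
move: Eb Eu cop; set b1 := b %/ g; set u1 := u %/ g => Eb Eu cop.
have [u10 g0] : u1 != 0 /\ g != 0.
  by move: u0; rewrite Eu mulf_eq0 negb_or => /andP[].
have evg0 : ev g != 0 by apply: tr.
have evu10 : ev u1 != 0 by apply: tr.
have BE : B = ev b1 / ev u1.
  apply: (mulfI evu0); rewrite bE {1}Eb {1}Eu /ev !pevM -/ev; field2 F2.
have [su1|su1] := leqP (size u1) 1.
  have u1E := size1_polyC su1; exists ((u1`_0)^-1 *: b1).
  by rewrite BE mulrC pevZ fmorphV {1}u1E /ev pevC.
have [p [ip pu1 _]] : exists p, [/\ irreducible_poly p, p %| u1 & (1 < size p)%N].
  apply: (irreducible_factor (P := fun p => (1 < size p)%N)) => //.
  move=> a b' h; have [sa|sa] := ltnP 1 (size a); first by left.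
  right; move: h; have [->|b'0] := eqVneq b' 0; first by rewrite mulr0 size_poly0.
  have [->|a0] := eqVneq a 0; first by rewrite mul0r size_poly0.
  rewrite size_mul //; move: sa a0; rewrite -size_poly_gt0.
  by case: (size a) => [|[|]].
have cE : (ev u1 * (ev u * A')) ^+ 2 + (ev b1 * ev u) * (ev u1 * (ev u * A'))
    = ev n * ev u1 ^+ 2 - ev b1 ^+ 2 * ev v.
  rewrite -nE NE -bE BE; field2 F2.
have [c cE'] : exists c, ev u1 * (ev u * A') = ev c.
  apply: rat_integral => //; first by apply/KE; sfsolve; apply: Kev.
  move=> O vO Ot; apply: (vr_quadratic vO _ _ cE).
    by apply: (vrM vO); apply: Oev.
  by repeat first [assumption|apply: Oev|apply: (vrM vO)|apply: (vrX vO)|apply: (vrB vO)].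
rewrite cE' in cE.
have {cE}cE : c ^+ 2 + b1 * u * c + b1 ^+ 2 * v = n * u1 ^+ 2.
  apply: (pev_inj tr); rewrite !pevE -/ev.
  have -> : ev n * ev u1 ^+ 2 = ev n * ev u1 ^+ 2 - ev b1 ^+ 2 * ev v + ev b1 ^+ 2 * ev v.
    by rewrite subrK.
  by rewrite -cE.
have npb : coprimep (p ^+ 2) b1.
  apply: coprimep_expl; apply: irreducible_coprime => //; apply/negP => pb.
  have h : p %| gcdp b1 u1 by rewrite dvdp_gcd pb pu1.
  have [s1 _] := ip; move/eqP: cop => cop.
  have := dvdp_leq _ h; rewrite -size_poly_gt0 cop => /(_ isT).
  by rewrite leqNgt s1.
have /Bezout_eq1_coprimepP[[a s] /= Eas] := npb.
have pu : p %| u by rewrite Eu dvdp_mulr.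
case/negP: (nodiv p (s * c) ip pu).
have P2 : 2%:R = 0 :> {poly k} by rewrite -polyC_natr k2.
have -> : (s * c) ^+ 2 + s * c * u + v
    = s ^+ 2 * (c ^+ 2 + b1 * u * c + b1 ^+ 2 * v) +
      p ^+ 2 * (a * s * c * u + a ^+ 2 * p ^+ 2 * v).
  have e : s * b1 = 1 + a * p ^+ 2 by rewrite -Eas; ring2 P2.
  transitivity ((s * c) ^+ 2 + (s * b1 + a * p ^+ 2) * (s * c * u) + (s * b1 + a * p ^+ 2) ^+ 2 * v).
    by rewrite e addxK // mul1r expr1n mul1r.
  by ring2 P2.
rewrite cE; apply: dvdp_add; last exact: dvdp_mulIl.
by apply/dvdp_mull/dvdp_mull/dvdp_exp2r.
Qed.

End Hyperelliptic.

Lemma quad_ext (F : fieldType) (K K' L : F -> Prop) y :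
  (forall z, K z <-> K' z) -> quad K L y -> quad K' L y.
Proof.
move=> KK'; have -> : K = K' by apply/funext => z; apply/propext.
by [].
Qed.

(** The trace of [w] is a form on the line whose coefficient is polynomial in [t] and, seen from
    infinity, polynomial in [1 / t]. As in genus zero it vanishes, so conjugation fixes the
    coefficient of [w]. *)
Lemma hyperelliptic_regular t y L D w : transcendental (const C) t ->
    (forall z, L z) -> quad (ratl (const C) t) L y ->
    derivation (const C) D -> D t = 1 -> regular_form w ->
  ratl (const C) t (form_at w D).
Proof.
move=> tr Lall qd dD Dt rw; have [sK Kf ny hL] := qd.
have t0 := transcendental_nz tr; have trV := transcendentalV tr.
have /hL[A [B [KA KB HE]]] := Lall (form_at w D).
have [p Bp] := hyperelliptic_trace tr (fun z => iff_refl _) Lall qd dD Dt rw KA KB HE.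
pose D1 z := t ^+ 2 * D z.
have dD1 : derivation (const C) D1 by apply: der_scale.
have D1t : D1 t^-1 = 1.
  by rewrite /D1 (derV F2 dD) Dt mulrC divfK // expf_neq0.
have KE z : ratl (const C) t z <-> ratl (const C) t^-1 z.
  by split=> [|h]; [apply: rat_inv|rewrite -(invrK t); apply: rat_inv].
have Kt := rat_gen (const C) t.
have [q Bq] : exists q, t ^+ 2 * B = pev (const C) t^-1 q.
  apply: (hyperelliptic_trace trV KE Lall qd dD1 D1t rw (A := t ^+ 2 * A)); try by sfsolve.
  have -> : form_at w D1 = t ^+ 2 * form_at w D by apply: form_at_scale.
  by rewrite HE; ring2 F2.
have E : pev (const C) t ('X^2 * p) = pev (const C) t^-1 q by rewrite !pevE -Bq Bp.
have [c Ec] := poly_in_both tr E.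
have p0 : p = 0.
  apply/eqP; apply: contraT => p0.
  have : (size ('X^2 * p)%R <= 1)%N by rewrite Ec size_polyC leq_b1.
  by rewrite mulrC size_mulXn // -size_poly_eq0; case: (size p) p0.
by rewrite HE Bp p0 pev0 mul0r addr0.
Qed.

End RegularForms.

(** * Morphisms of curves *)

Definition image_of (F K : fieldType) (phi : F -> K) (z : K) :=
  exists a, z = phi a.

Lemma image_subfield (F K : fieldType) (phi : {rmorphism F -> K}) :
  is_subfield (image_of phi).
Proof.
split; first by exists 1; rewrite rmorph1.
- by move=> _ _ [a ->] [b ->]; exists (a - b); rewrite rmorphB.
- by move=> _ _ [a ->] [b ->]; exists (a * b); rewrite rmorphM.
- by move=> _ [a ->]; exists a^-1; rewrite fmorphV.
Qed.

Section DegreeTwo.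

Variables (F K : fieldType) (phi : {rmorphism F -> K}).
Hypothesis K2 : 2%:R = 0 :> K.
Hypothesis deg2 : extension_degree phi 2.

Lemma degree2P : (exists z, ~ image_of phi z) /\
  forall z, ~ image_of phi z -> forall x, exists a b, x = phi a + phi b * z.
Proof.
have [b hb] := deg2; pose b0 := b 0; pose b1 := b 1.
have ex z : exists c0 c1, z = phi c0 * b0 + phi c1 * b1.
  have [c [-> _]] := hb z; exists (c 0 0), (c 0 1).
  by rewrite big_ord_recl big_ord1; congr (_ + phi (c 0 _) * b _); apply: val_inj.
have un c0 c1 d0 d1 : phi c0 * b0 + phi c1 * b1 = phi d0 * b0 + phi d1 * b1 ->
    c0 = d0 /\ c1 = d1.
  move=> E; have [c [_ hc]] := hb (phi c0 * b0 + phi c1 * b1).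
  pose v (x y : F) : 'rV[F]_2 := \row_i (if i == 0 then x else y).
  have vE x y : \sum_(i < 2) phi (v x y 0 i) * b i = phi x * b0 + phi y * b1.
    rewrite big_ord_recl big_ord1 !mxE /=; congr (_ + _ * b _); exact: val_inj.
  have e : v c0 c1 = v d0 d1 by rewrite -(hc (v c0 c1)) ?vE // -(hc (v d0 d1)) // vE.
  by split; [have := congr1 (fun v : 'rV_2 => v 0 0) e|have := congr1 (fun v : 'rV_2 => v 0 1) e];
     rewrite !mxE.
have [e0 [e1 E1]] := ex 1.
split.
  apply: contrapT => /forallNP h.
  have [l /= b0E] : image_of phi b0 by apply: contrapT; apply: h.
  have [m /= b1E] : image_of phi b1 by apply: contrapT; apply: h.
  have [c1 d1] : 1 = l * e0 /\ 0 = l * e1.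
    apply: un; rewrite rmorph1 rmorph0 mul1r mul0r addr0 !rmorphM -!mulrA -mulrDr -E1 mulr1 //.
  have [c2 d2] : 0 = m * e0 /\ 1 = m * e1.
    apply: un; rewrite rmorph1 rmorph0 mul1r mul0r add0r !rmorphM -!mulrA -mulrDr -E1 mulr1 //.
  have m0 : m != 0 by apply/eqP => m0; move/eqP: d2; rewrite m0 mul0r oner_eq0.
  move/esym/eqP: c2; rewrite mulf_eq0 (negPf m0) /= => /eqP e00.
  by move/eqP: c1; rewrite e00 mulr0 oner_eq0.
move=> z nz x; have [z0 [z1 zE]] := ex z; have [x0 [x1 xE]] := ex x.
(* As [e0] and [e1] are the coordinates of 1, this is the determinant of 1 and [z]; if it vanishes,
   [z] is a multiple of 1 by an element of the image. *)
have [d0|d0] := eqVneq (phi e0 * phi z1 + phi e1 * phi z0) 0.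
  case: nz; have E : phi e0 * z = phi z0 /\ phi e1 * z = phi z1.
    have d0' := addxx_eq0 K2 d0.
    split; rewrite -[RHS]mulr1 E1 zE !mulrDr; first by congr (_ + _); [|]; rewrite ?mulrA ?d0'; ring2 K2.
    by rewrite !mulrA -d0'; ring2 K2.
  have [e00|e00] := eqVneq e0 0; last first.
    exists (z0 / e0); rewrite rmorphM fmorphV -(proj1 E) mulrAC mulfV ?mul1r //.
    by rewrite fmorph_eq0.
  have [e10|e10] := eqVneq e1 0.
    by move/eqP: E1; rewrite e00 e10 rmorph0 !mul0r addr0 oner_eq0.
  exists (z1 / e1); rewrite rmorphM fmorphV -(proj2 E) mulrAC mulfV ?mul1r //.
  by rewrite fmorph_eq0.
pose d := e0 * z1 + e1 * z0.
exists ((x0 * z1 + x1 * z0) / d), ((e0 * x1 + e1 * x0) / d).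
rewrite -[X in _ = X + _]mulr1 E1 zE xE /d !(rmorphM, rmorphD, fmorphV).
by field2 K2.
Qed.

End DegreeTwo.

(** From [z ^+ 2 = a + b * z] one gets the generator [z / b]. If [b = 0], then ['X^2 + a] divides
    every polynomial over [F] with root [z], and its derivative is zero in characteristic two, so
    [z] is not separable. *)
Lemma degree2_quad (F K : fieldType) (phi : {rmorphism F -> K}) :
    2%:R = 0 :> K -> extension_degree phi 2 -> separable_extension phi ->
  exists y, forall L : K -> Prop, (forall z, L z) -> quad (image_of phi) L y.
Proof.
move=> K2 deg2 sep; have [[z nz] h] := degree2P K2 deg2.
have [a [b zz]] := h z nz (z ^+ 2).
have F2 : 2%:R = 0 :> F.
  by apply: (fmorph_inj phi); rewrite rmorph_nat rmorph0.
have b0 : b != 0.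
  apply/eqP => b0; rewrite b0 rmorph0 mul0r addr0 in zz.
  have [p sp pz] := sep z.
  have p0 := separable_poly_neq0 sp.
  pose m : {poly F} := 'X^2 + a%:P.
  have sm : size m = 3 by rewrite size_XnaddC.
  have m0 : m != 0 by rewrite -size_poly_eq0 sm.
  have mz : (map_poly phi m).[z] = 0.
    by rewrite rmorphD /= map_polyXn map_polyC hornerD hornerXn hornerC zz addxx.
  have r0 : p %% m = 0.
    have := ltn_modp p m; rewrite m0 sm ltnS => sr.
    have : (map_poly phi (p %% m)).[z] = 0.
      move: pz; rewrite {1}(divp_eq p m) rmorphD rmorphM /= /root hornerD hornerM mz.
      by rewrite mulr0 add0r => /eqP.
    rewrite (horner_coef_wide (n := 2)) ?size_map_poly // big_ord_recl big_ord1 /=.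
    rewrite expr0 mulr1 expr1 !coef_map => E.
    have r1 : (p %% m)`_1 = 0.
      apply/eqP; apply: contraT => r1; case: nz.
      exists ((p %% m)`_0 / (p %% m)`_1); rewrite rmorphM fmorphV.
      have r1' : phi (p %% m)`_1 != 0 by rewrite fmorph_eq0.
      by apply: (mulfI r1'); rewrite mulrCA mulfV // mulr1; apply/esym/(addxx_eq0 K2).
    have E1 : phi (p %% m)`_(bump 0 0) = 0.
      exact: (etrans (congr1 phi r1) (rmorph0 phi)).
    move: E; rewrite [X in _ + X * z](E1) mul0r addr0 => E.
    apply/polyP => i; rewrite coef0; case: i => [|[|i]] //.
      by apply: (fmorph_inj phi); rewrite E rmorph0.
    by rewrite nth_default // (leq_trans sr).
  have : m %| p by rewrite /dvdp r0.
  move/dvdp_separable => /(_ sp); rewrite separable_poly.unlock /m derivD derivXn derivC addr0.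
  rewrite -mulr_natl -polyC_natr F2 mul0r coprimep0 => /eqp_size.
  by rewrite -/m sm size_poly1.
have b0' : phi b != 0 by rewrite fmorph_eq0.
exists (z / phi b) => L Lall; split.
- exact: image_subfield.
- exists (a / b ^+ 2); rewrite rmorphM fmorphV rmorphXn.
  have -> : (z / phi b) ^+ 2 + z / phi b = (z ^+ 2 + z * phi b) / phi b ^+ 2 by field2 K2.
  by rewrite zz; field2 K2.
- move=> Iz; apply: nz; rewrite -(divfK b0' z).
  by apply: (sfM (image_subfield phi)) => //; exists b.
- move=> x; split=> // _; have [c [d ->]] := h z nz x.
  exists (phi c), (phi d * phi b); split; [by exists c|by exists (d * b); rewrite rmorphM|].
  by field2 K2.
Qed.

(** * Embeddings of the rational function field *)

Section FractionMap.

Variables (k F : fieldType) (kap : {rmorphism k -> F}).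
Local Notation Kt := {fraction {poly k}}.
Local Notation "p %:F" := (@FracField.tofrac {poly k} p).

Lemma frac_pev (phi : {rmorphism Kt -> F}) :
  (forall c, phi (ratfun_const k c) = kap c) ->
  forall p : {poly k}, phi p%:F = pev kap (phi 'X%:F) p.
Proof.
move=> hc; elim/poly_ind => [|p c IH]; first by rewrite tofrac0 rmorph0 pev0.
by rewrite tofracD tofracM rmorphD rmorphM IH !pevE -hc.
Qed.

Lemma frac_transcendental (phi : {rmorphism Kt -> F}) :
  (forall c, phi (ratfun_const k c) = kap c) -> transcendental kap (phi 'X%:F).
Proof.
by move=> hc p p0; rewrite -frac_pev // fmorph_eq0 tofrac_eq0.
Qed.

Lemma frac_image (phi : {rmorphism Kt -> F}) :
  (forall c, phi (ratfun_const k c) = kap c) ->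
  forall z, image_of phi z <-> ratl kap (phi 'X%:F) z.
Proof.
move=> hc z; split.
  case=> a ->; have [u [v [v0 E]]] := ratfun_fracP a.
  exists u, v; rewrite -!frac_pev // fmorph_eq0 tofrac_eq0; split=> //.
  by rewrite -E rmorphM mulfK // fmorph_eq0 tofrac_eq0.
case=> u [v [v0 ->]]; exists (u%:F / v%:F).
by rewrite rmorphM fmorphV (frac_pev hc u) (frac_pev hc v).
Qed.

Section Lift.

Variable r : F.
Hypothesis tr : transcendental kap r.

Let liftP (z : Kt) : exists w, forall a b : {poly k}, b != 0 ->
  z * b%:F = a%:F -> w = pev kap r a / pev kap r b.
Proof.
have [a [b [b0 E]]] := ratfun_fracP z.
exists (pev kap r a / pev kap r b) => a' b' b0' E'.
apply/eqP; rewrite eqr_div ?tr // -!pevM; apply/eqP; congr pev.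
apply/eqP; rewrite -tofrac_eq !tofracM -E -E'.
by rewrite mulrAC.
Qed.

Let lift z := projT1 (cid (liftP z)).
Let liftE z a b : b != 0 -> z * b%:F = a%:F -> lift z = pev kap r a / pev kap r b.
Proof. by move=> b0 E; rewrite /lift; case: cid => w /= h; apply: h. Qed.

Let lift_zmod : zmod_morphism lift.
Proof.
move=> x y; have [a [b [b0 E]]] := ratfun_fracP x; have [c [d [d0 E']]] := ratfun_fracP y.
rewrite (liftE b0 E) (liftE d0 E').
rewrite (liftE (a := a * d - c * b) (b := b * d)) ?mulf_neq0 //.
  by rewrite -[in RHS]mulNr addf_div ?tr // !pevE mulNr.
by rewrite tofracB !tofracM -E -E' mulrBl !mulrA; congr (_ - _); rewrite mulrAC.
Qed.

Let lift_monoid : monoid_morphism lift.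
Proof.
split; first by rewrite (liftE (a := 1) (b := 1)) ?pev1 ?divr1 ?oner_neq0 // tofrac1 mulr1.
move=> x y; have [a [b [b0 E]]] := ratfun_fracP x; have [c [d [d0 E']]] := ratfun_fracP y.
rewrite (liftE b0 E) (liftE d0 E').
rewrite (liftE (a := a * c) (b := b * d)) ?mulf_neq0 //; first by rewrite !pevM mulf_div.
by rewrite !tofracM -E -E' mulrACA.
Qed.

HB.instance Definition _ := GRing.isZmodMorphism.Build Kt F lift lift_zmod.
HB.instance Definition _ := GRing.isMonoidMorphism.Build Kt F lift lift_monoid.

Lemma frac_lift : exists phi : {rmorphism Kt -> F},
  (forall c, phi (ratfun_const k c) = kap c) /\ phi 'X%:F = r.
Proof.
exists (lift : {rmorphism Kt -> F}); split=> [c|] /=.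
  have E : ratfun_const k c * 1%:F = c%:P%:F by rewrite tofrac1 mulr1.
  by rewrite (liftE (oner_neq0 _) E) !pevE ?rmorph1 divr1.
have E : 'X%:F * 1%:F = 'X%:F by rewrite tofrac1 mulr1.
by rewrite (liftE (oner_neq0 _) E) !pevE ?rmorph1 divr1.
Qed.

End Lift.

End FractionMap.

Section MorphismRational.

Variables (k F M : fieldType) (kap : {rmorphism k -> F}) (mu : {rmorphism k -> M}).
Variable g : {rmorphism F -> M}.
Hypothesis gk : forall c, g (kap c) = mu c.

Lemma morph_pev t p : g (pev kap t p) = pev mu (g t) p.
Proof.
elim/poly_ind: p => [|p c IH]; first by rewrite !pev0 rmorph0.
by rewrite !pevE rmorphD rmorphM IH gk.
Qed.

Lemma morph_transcendental t : transcendental kap t -> transcendental mu (g t).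
Proof. by move=> tr p p0; rewrite -morph_pev fmorph_eq0 tr. Qed.

Lemma morph_rat t z : ratl kap t z <-> ratl mu (g t) (g z).
Proof.
split=> -[u [v [v0 E]]]; exists u, v.
  by rewrite -!morph_pev fmorph_eq0 v0 E rmorphM fmorphV.
move: v0 E; rewrite -!morph_pev fmorph_eq0 => v0 E; split=> //.
by apply: (fmorph_inj g); rewrite E rmorphM fmorphV.
Qed.

End MorphismRational.

(** * Degree two maps to the projective line *)

Section HyperellipticForms.

Variables (k : fieldType) (C : curve k).
Hypothesis k2 : 2%:R = 0 :> k.
Hypothesis k_perfect : forall c : k, exists s, c = s ^+ 2.
Variable t : C.
Hypothesis C_sqr : forall z : C, exists a b, z = a ^+ 2 + b ^+ 2 * t.

Let F2 : 2%:R = 0 :> C := char2_curve C k2.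

Lemma pev_sqr r (p : {poly k}) : exists q, pev (const C) (r ^+ 2) p = pev (const C) r q ^+ 2.
Proof.
elim/poly_ind: p => [|p c [q IH]]; first by exists 0; rewrite !pev0 expr0n.
have [s cE] := k_perfect c.
exists (q * 'X + s%:P); rewrite !pevE IH cE rmorphXn; ring2 F2.
Qed.

Lemma pev_frobenius r (p : {poly k}) :
  exists2 q : {poly k}, size q = size p & pev (const C) (r ^+ 2) q = pev (const C) r p ^+ 2.
Proof.
elim/poly_ind: p => [|p c [q sq IH]]; first by exists 0; rewrite ?pev0 ?expr0n.
exists (q * 'X + (c ^+ 2)%:P).
  by rewrite !size_MXaddC sq sqrf_eq0 -!size_poly_eq0 sq.
by rewrite !pevE IH rmorphXn; ring2 F2.
Qed.

Lemma rat_sqrt r z : ratl (const C) (r ^+ 2) (z ^+ 2) -> ratl (const C) r z.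
Proof.
move=> [u [v [v0 E]]]; have [u' uE] := pev_sqr r u; have [v' vE] := pev_sqr r v.
exists u', v'; rewrite uE vE in v0 E; split.
  by apply: contraNneq v0 => ->; rewrite expr0n.
apply: (addxx_eq0 F2); apply/eqP; rewrite -sqrf_eq0; apply/eqP.
by rewrite (sqrD2 F2) E exprMn exprVn (addxx F2).
Qed.

(** The map of degree two may be inseparable. If it is separable, regular forms have coefficients in
    k(r). If not, the image contains all squares; were [r] not a square, [t] and then everything
    would lie in the image, and if [r = s ^+ 2], then the function field is k(s). *)
Lemma hyperelliptic_ratios (f : curve_hom C (projective_line k)) :
    hom_degree f 2 ->
  exists r, transcendental (const C) r /\ ((forall z, ratl (const C) r z) \/
     ((exists z, ~ ratl (const C) r z) /\
      forall w w' D, regular_form w -> regular_form w' -> derivation (const C) D ->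
        ratl (const C) r (form_at w D / form_at w' D))).
Proof.
move=> deg2; pose K := image_of (pullback f).
have fk c : pullback f (ratfun_const k c) = const C c by rewrite -(pullback_const f).
set r := pullback f (FracField.tofrac 'X).
have tr : transcendental (const C) r := frac_transcendental fk.
have KE z : K z <-> ratl (const C) r z := frac_image fk z.
have sK : is_subfield K by apply: image_subfield.
have [[z0 nz0] h] := degree2P F2 deg2.
have [y [q|]] : exists y, (quad K (fun=> True) y) \/ (forall z, K (z ^+ 2)).
  have [[z [nz nKz]]|hn] := pselect (exists z, ~ K z /\ ~ K (z ^+ 2)); last first.
    exists 0; right=> z; have [Kz|nz] := pselect (K z); first exact: sfX.
    by apply: contrapT => nz2; apply: hn; exists z.
  have [a [b zz]] := h z nz (z ^+ 2).
  have b0 : b != 0.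
    by apply/eqP => b0; apply: nKz; rewrite zz b0 rmorph0 mul0r addr0; exists a.
  have b0' : pullback f b != 0 by rewrite fmorph_eq0.
  exists (z / pullback f b); left; split=> //.
  - exists (a / b ^+ 2); rewrite rmorphM fmorphV rmorphXn.
    have -> : (z / pullback f b) ^+ 2 + z / pullback f b =
      (z ^+ 2 + z * pullback f b) / pullback f b ^+ 2 by field2 F2.
    by rewrite zz; field2 F2.
  - by move=> Iz; apply: nz; rewrite -(divfK b0' z); apply: (sfM sK) => //; exists b.
  - move=> x; split=> // _; have [c [d ->]] := h z nz x.
    exists (pullback f c), (pullback f d * pullback f b).
    split; [by exists c|by exists (d * b); rewrite rmorphM|by field2 F2].
- exists r; split=> //; right; split; first by exists z0 => /KE.
  move=> w w' D rw rw' dD.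
  have {}q : quad (ratl (const C) r) (fun=> True) y := quad_ext KE q.
  have [D0 [dD0 D0r]] := der_ratE F2 tr.
  have [D1 [dD1 D1E _]] := der_extend F2 q (rat_const _ _) dD0.
  have {}dD1 : derivation (const C) D1 := derivation_all (fun=> I) dD1.
  have D1r : D1 r = 1 by rewrite D1E //; apply: rat_gen.
  have E z : D z = D r * D1 z.
    apply: (addxx_eq0 F2); pose D2 z := D z + D r * D1 z.
    have dD2 : derivation (const C) D2 by apply: der_sub => //; apply: der_scale.
    apply: (der_quad0 F2 dD2 q) => // a ra; apply: (der_rat0 F2 dD2 ra).
    by rewrite /D2 D1r mulr1 addxx.
  rewrite (form_at_scale w E) (form_at_scale w' E).
  have [->|Dr0] := eqVneq (D r) 0.
    by rewrite !mul0r; apply: sf0; apply: rat_subfield.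
  rewrite -mulf_div divff // mul1r.
  by apply: (sf_div (rat_subfield _ _)); apply: (hyperelliptic_regular k2 tr _ q dD1 D1r).
- move=> Ksqr; have [[s rE]|ns] := pselect (exists s, r = s ^+ 2).
    exists s; split.
      move=> p p0; have [q sq qE] := pev_frobenius s p.
      have /tr : q != 0 by rewrite -size_poly_eq0 sq size_poly_eq0.
      by rewrite -/r rE qE sqrf_eq0.
    by left=> z; apply: rat_sqrt; rewrite -rE; apply/KE.
  have [a [b rE]] := C_sqr r.
  have b0 : b != 0 by apply/eqP => b0; apply: ns; exists a; rewrite rE b0 expr0n mul0r addr0.
  case: nz0; have [c [d ->]] := C_sqr z0.
  have -> : t = (r + a ^+ 2) / b ^+ 2 by rewrite rE; field2 F2.
  have Kr : K r by apply/KE; apply: rat_gen.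
  by have := (Ksqr a, Ksqr b, Ksqr c, Ksqr d) => -[[[? ?] ?] ?]; sfsolve.
Qed.

End HyperellipticForms.

(** * The Artin-Schreier map of a finite field *)

Section FiniteField.

Variables (k : finFieldType).
Hypothesis k2 : 2%:R = 0 :> k.

Lemma AS0 : AS (0 : k). Proof. by exists 0; ring2 k2. Qed.

Lemma ASD (x y : k) : AS x -> AS y -> AS (x + y).
Proof. by move=> [a ->] [b ->]; exists (a + b); ring2 k2. Qed.

Lemma AS_map (x : k) : AS (x ^+ 2 + x).
Proof. by exists x; rewrite addrC. Qed.

Lemma finite_sqrt (c : k) : exists s, c = s ^+ 2.
Proof.
have inj : injective (fun x : k => x ^+ 2).
  move=> x y /= E; apply: (addxx_eq0 k2); apply/eqP.
  by rewrite -sqrf_eq0 (sqrD2 k2) E addxx.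
by have [g _ h] := injF_bij inj; exists (g c); rewrite h.
Qed.

Let A : {set k} := [set x | [exists a, x == a + a ^+ 2]].

Let inA x : reflect (AS x) (x \in A).
Proof.
rewrite inE; apply: (iffP existsP) => -[a].
  by move/eqP->; exists a.
by move=> ->; exists a.
Qed.

(** The additive map sending [a] to [a + a ^+ 2] has fibres of at most two elements, so its image
    and the disjoint translate by [z] already fill [k]. *)
Lemma AS_coset (z x : k) : ~ AS z -> AS x \/ AS (x + z).
Proof.
move=> nz; pose B : {set k} := [set a + z | a in A].
have dAB : [disjoint A & B].
  apply/pred0P => y /=; apply/negP => /andP[/inA Ay /imsetP[a /inA Aa E]].
  apply: nz; have -> : z = y + a by rewrite E; ring2 k2.
  exact: ASD.
have cB : #|B| = #|A| by apply: card_imset => a b /addIr.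
have cA : (#|k| <= #|A| * 2)%N.
  have -> : A = (fun a : k => a + a ^+ 2) @: [set: k].
    apply/setP => y; apply/idP/imsetP => [/inA[a ->]|[a _ ->]]; first by exists a.
    by apply/inA; exists a.
  rewrite -sum_nat_const -cardsT -sum1_card.
  rewrite (partition_big_imset (fun a : k => a + a ^+ 2)) /=.
  apply: leq_sum => y /imsetP[a _ yE]; rewrite sum1dep_card.
  apply: (@leq_trans #|[set a; a + 1]|); last by rewrite cards2; case: eqP.
  apply: subset_leq_card; apply/fintype.subsetP => b; rewrite inE => /andP[_ /eqP bE].
  have : (b + a) * (b + a + 1) = 0.
    have -> : (b + a) * (b + a + 1) = (b + b ^+ 2) + (a + a ^+ 2) by ring2 k2.
    by rewrite bE yE addxx.
  move/eqP; rewrite mulf_eq0 => /orP[] /eqP /(addxx_eq0 k2) E; rewrite !inE.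
    by rewrite E eqxx.
  by rewrite -E (addrC b) addrA (addxx k2) add0r eqxx orbT.
have AB : A :|: B = [set: k].
  apply/eqP; rewrite eqEcard finset.subsetT cardsT /= cardsU.
  by rewrite finset.disjoint_setI0 // cards0 subn0 cB addnn -muln2.
have : x \in A :|: B by rewrite AB inE.
rewrite inE => /orP[/inA|/imsetP[a /inA Aa ->]]; first by left.
by right; rewrite addxK.
Qed.

(** Otherwise [d / x] would inject the complement of AS(k) into the nonzero elements of AS(k),
    whereas the complement contains a translate of AS(k). *)
Lemma AS_both (r d : k) : ~ AS r -> d != 0 -> exists x, ~ AS x /\ ~ AS (d / x).
Proof.
move=> nr d0; apply: contrapT => /forallNP no.
have sub : [set d / x | x in ~: A] \subset A :\ 0.
  apply/fintype.subsetP => _ /imsetP[x nx ->].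
  have {}nx : ~ AS x by move=> /inA Ax; rewrite inE Ax in nx.
  have x0 : x != 0 by apply/eqP => x0; apply: nx; rewrite x0; apply: AS0.
  rewrite in_setD1 mulf_neq0 ?invr_eq0 //=.
  have := no x; move=> /not_andP[|/contrapT]; first by move/contrapT.
  by move/inA.
have dA : [set a + r | a in A] \subset ~: A.
  apply/fintype.subsetP => _ /imsetP[a /inA Aa ->]; rewrite inE; apply/negP => /inA h.
  apply: nr; have -> : r = (a + r) + a by ring2 k2.
  exact: ASD.
have := subset_leq_card dA; have := subset_leq_card sub.
rewrite (card_imset _ (addIr r)).
rewrite card_imset => [h1 h2|a b /(mulfI d0) /invr_inj //].
have := leq_trans h2 h1.
by rewrite (cardsD1 0 A) (introT (inA 0) AS0) add1n ltnn.
Qed.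

End FiniteField.

Section Trace.

Variables (k : finFieldType) (n : nat).
Hypotheses (card_k : #|k| = (2 ^ n)%N) (n_gt0 : (0 < n)%N).

Lemma char2_card : 2%:R = 0 :> k.
Proof. by have := card_finPcharP card_k isT; rewrite inE => /andP[_ /eqP]. Qed.

(** The trace of [a + a ^+ 2] telescopes to [a + a ^+ #|k|]. *)
Lemma trace_AS (x : k) : AS x -> abs_trace n x = 0.
Proof.
have k2 := char2_card; case=> a ->.
have fr i (u v : k) : (u + v) ^+ (2 ^ i) = u ^+ (2 ^ i) + v ^+ (2 ^ i).
  elim: i => [|i IH]; first by rewrite !expr1.
  by rewrite expnSr !exprM IH (sqrD2 k2).
have E m : \sum_(i < m) (a + a ^+ 2) ^+ (2 ^ i) = a + a ^+ (2 ^ m).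
  elim: m => [|m IH]; first by rewrite big_ord0 expr1 addxx.
  by rewrite big_ord_recr /= IH fr -exprM -expnS; ring2 k2.
by rewrite /abs_trace E -card_k expf_card addxx.
Qed.

End Trace.

(** * Ordinary elliptic curves *)

Section NormalForm.

Variables (k : finFieldType) (r0 : k).
Hypothesis k2 : 2%:R = 0 :> k.
Hypothesis r0_AS : ~ AS r0.
Variable E : elliptic_curve k.
Hypothesis ordE : ordinary E.

(** If [a1] were zero, a point of order two would force [a3 = 0], and then the discriminant
    vanishes. *)
Lemma ordinary_a1 : wa1 E != 0.
Proof.
apply/eqP => a10; have [L [x [y [_]]]] := ordE.
have L2 : 2%:R = 0 :> L by rewrite -(rmorph_nat (in_alg L)) k2 rmorph0.
rewrite a10 rmorph0 mul0r subr0 => yE.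
have a30 : wa3 E = 0.
  apply: (fmorph_inj (in_alg L)); rewrite rmorph0.
  transitivity (- y - in_alg L (wa3 E) - y); first by ring2 L2.
  by rewrite -yE subrr.
have := wdisc_neq0 E; rewrite /wdisc /wb2 /wb4 /wb6 /wb8 a10 a30.
by move/eqP; apply; ring2 k2.
Qed.

Let a1 := wa1 E.
Let a10 : a1 != 0 := ordinary_a1.

Lemma jinvE : jinv E = a1 ^+ 12 / wdisc E.
Proof.
by rewrite /jinv; congr (_ / _); rewrite /wc4 /wb2 -/a1; ring2 k2.
Qed.

Lemma jinv_neq0 : jinv E != 0.
Proof.
by rewrite jinvE mulf_neq0 ?expf_neq0 ?invr_eq0 // wdisc_neq0.
Qed.

Lemma w_isomorphic_normal (e : k) :
  AS ((wa2 E + wa3 E / a1) / a1 ^+ 2 + e) ->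
  w_isomorphic E (Weierstrass 1 e 0 0 (jinv E)^-1).
Proof.
(* The target values of a1, a3 and a4 dictate [u = a1], [r] and [t]; the choice of [s] moves a2
   within its class modulo AS(k). *)
case=> v hv; pose r := wa3 E / a1; pose s := v * a1.
pose t := (wa4 E + r ^+ 2) / a1.
have eE : e = (wa2 E + wa3 E / a1) / a1 ^+ 2 + v + v ^+ 2.
  by rewrite -addrA -hv addrA (addxx k2) add0r.
apply/existsP; exists a1; apply/existsP; exists r; apply/existsP; exists s.
apply/existsP; exists t; rewrite a10 /=.
have D0 := wdisc_neq0 E; rewrite jinvE invf_div.
apply/and5P; split; apply/eqP.
- by rewrite -/a1; field2 k2.
- by rewrite eE /s /r -/a1; field2 k2.
- by rewrite /r -/a1; field2 k2.
- by rewrite /t /s /r -/a1; field2 k2.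
- have -> : wdisc E = a1 ^+ 4 * (a1 ^+ 2 * wa6 E + a1 * wa3 E * wa4 E +
     wa2 E * wa3 E ^+ 2 + wa4 E ^+ 2) + wa3 E ^+ 4 + a1 ^+ 3 * wa3 E ^+ 3.
    by rewrite /wdisc /wb2 /wb4 /wb6 /wb8 -/a1; ring2 k2.
  by rewrite /t /r -/a1; field2 k2.
Qed.

Lemma sgn_normal : w_isomorphic E (Weierstrass 1 (sgn r0 E) 0 0 (jinv E)^-1).
Proof.
rewrite /sgn; case: pickP => [e /andP[_]|no] /=; first by [].
pose c := (wa2 E + wa3 E / a1) / a1 ^+ 2.
have [h|h] := AS_coset k2 c r0_AS.
  have := no 0; rewrite !inE eqxx /= w_isomorphic_normal //.
  by rewrite addr0.
by have := no r0; rewrite !inE eqxx orbT /= w_isomorphic_normal.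
Qed.

Section Model.

Variables (X : curve k) (d : k).
Hypotheses (d0 : d != 0) (dE : (jinv E)^-1 = d ^+ 2).
Let X2 : 2%:R = 0 :> X := char2_curve X k2.
Let kp := const X.

Definition generates (x y : X) := forall S : X -> Prop, is_subfield S ->
  (forall c, S (kp c)) -> S x -> S y -> forall z, S z.

(** Dividing [y ^+ 2 + x * y = x ^+ 3 + e * x ^+ 2 + d ^+ 2] by [x ^+ 2] and taking [(y + d) / x] as
    new ordinate gives this Artin-Schreier equation; [d] is the square root of 1 / j. *)
Definition normal_pair (e : k) (x y : X) :=
  [/\ x != 0, y ^+ 2 + y = x + kp d / x + kp e & generates x y].

Lemma normal_pair_shift e e' x y : AS (e + e') -> normal_pair e x y ->
  exists y', normal_pair e' x y'.
Proof.
case=> v hv [x0 yE gen]; exists (y + kp v); split=> //.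
  have -> : e' = e + (v + v ^+ 2) by rewrite -hv; ring2 k2.
  rewrite !rmorphD rmorphXn.
  have -> : (y + kp v) ^+ 2 + (y + kp v) = (y ^+ 2 + y) + (kp v + kp v ^+ 2) by ring2 X2.
  by rewrite yE; field2 X2.
move=> S sS Sk Sx Sy; apply: gen => //.
by rewrite -(addrK (kp v) y); apply: (sfB sS).
Qed.

Lemma curve_not_const : exists z : X, forall c, z <> kp c.
Proof.
have [phi [hc _]] := curve_finite X.
exists (phi (FracField.tofrac 'X)) => c /eqP.
by rewrite (negPf (transcendental_const c (frac_transcendental hc))).
Qed.

Lemma sgn_substitution : exists u r s t : k, let f := sgn r0 E in
  [/\ u != 0, wa1 E = u, wa2 E = u ^+ 2 * f + s * u + r + s ^+ 2, wa3 E = r * u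
    & wa4 E = t * u + r ^+ 2 /\ wa6 E = u ^+ 6 * d ^+ 2 + r * t * u + r ^+ 3
        + r ^+ 2 * (u ^+ 2 * f + s * u + s ^+ 2) + t ^+ 2].
Proof.
have := sgn_normal; set f := sgn r0 E.
case/existsP => u /existsP[r] /existsP[s] /existsP[t] /= /and5P[u0].
move=> /eqP h1 /eqP h2 /eqP h3 /andP[/eqP h4 /eqP h6].
rewrite dE in h6; exists u, r, s, t => /=.
have e1 : wa1 E = u.
  have -> : wa1 E = wa1 E + 2%:R * s by ring2 k2.
  by rewrite -h1 mulr1.
rewrite !e1 in h2 h3 h4 h6.
have e2 : wa2 E = u ^+ 2 * f + s * u + r + s ^+ 2 by rewrite h2; ring2 k2.
have e3 : wa3 E = r * u.
  by rewrite -[RHS]add0r -(mulr0 (u ^+ 3)) h3; ring2 k2.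
have e4 : wa4 E = t * u + r ^+ 2.
  rewrite -[LHS]addr0 -(mulr0 (u ^+ 4)) h4 e3; ring2 k2.
split=> //; split=> //; rewrite h6 e2 e3 e4; ring2 k2.
Qed.

Lemma normal_pair_model e x y : AS (e + sgn r0 E) -> normal_pair e x y ->
  is_model E X.
Proof.
move=> /normal_pair_shift h /h{h} [{}y [x0 yE gen]].
have [u [r [s [t [u0 e1 e2 e3 [e4 e6]]]]]] := sgn_substitution.
set f := sgn r0 E in yE e2 e6.
have ku0 : kp u != 0 by rewrite fmorph_eq0.
pose x1 := kp u ^+ 2 * x + kp r.
pose y1 := kp u ^+ 3 * (x * y + kp d) + kp s * kp u ^+ 2 * x + kp t.
exists x1, y1; split; last first.
  move=> S sS Sk Sx1 Sy1.
  have Sx : S x.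
    have -> : x = (x1 - kp r) / kp u ^+ 2 by rewrite /x1 addrK mulrC mulKf // expf_neq0.
    by apply: (sf_div sS); [apply: (sfB sS)|apply: (sfX sS)].
  apply: gen => //.
  have -> : y = ((y1 + kp s * kp u ^+ 2 * x + kp t) / kp u ^+ 3 + kp d) / x.
    by rewrite /y1; field2 X2.
  by have := (Sk s, Sk u, Sk t, Sk d) => -[[[? ?] ?] ?]; sfsolve.
have yE' : y ^+ 2 = y + x + kp d / x + kp f.
  have -> : y ^+ 2 = y ^+ 2 + y + y by ring2 X2.
  by rewrite yE; field2 X2.
rewrite /on_weierstrass -/kp e6 e4 e2 e3 e1 /x1 /y1.
rewrite !(rmorphD, rmorphM, rmorphXn).
have -> : (kp u ^+ 3 * (x * y + kp d) + kp s * kp u ^+ 2 * x + kp t) ^+ 2 =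
   kp u ^+ 6 * (x ^+ 2 * y ^+ 2 + kp d ^+ 2) + kp s ^+ 2 * kp u ^+ 4 * x ^+ 2 + kp t ^+ 2.
  by ring2 X2.
by rewrite yE'; field2 X2.
Qed.

Lemma model_normal_pair : is_model E X -> exists x y, normal_pair (sgn r0 E) x y.
Proof.
move=> [x1 [y1 [on gen]]].
have [u [r [s [t [u0 e1 e2 e3 [e4 e6]]]]]] := sgn_substitution.
set f := sgn r0 E in e2 e6 *.
have ku0 : kp u != 0 by rewrite fmorph_eq0.
pose x := (x1 + kp r) / kp u ^+ 2.
pose y2 := (y1 + kp s * kp u ^+ 2 * x + kp t) / kp u ^+ 3.
have x1E : x1 = kp u ^+ 2 * x + kp r by rewrite /x; field2 X2.
have y1E : y1 = kp u ^+ 3 * y2 + kp s * kp u ^+ 2 * x + kp t by rewrite /y2; field2 X2.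
have E2 : y2 ^+ 2 + x * y2 = x ^+ 3 + kp f * x ^+ 2 + kp d ^+ 2.
  move: on; rewrite /on_weierstrass -/kp e6 e4 e2 e3 e1 x1E y1E.
  rewrite !(rmorphD, rmorphM, rmorphXn) => on.
  apply: (addxx_eq0 X2); apply: (mulfI (expf_neq0 6 ku0)); rewrite mulr0.
  move/eqP: on; rewrite -subr_eq0 => /eqP on; rewrite -[RHS]on; ring2 X2.
(* If [x = 0], then [y2 = d] is constant too, and the function field reduces to [k]. *)
have x0 : x != 0.
  apply/eqP => x0; have [z nz] := curve_not_const.
  have [c zE] : image_of kp z.
    have y2E : y2 = kp d.
      apply: (addxx_eq0 X2); apply/eqP; rewrite -sqrf_eq0 (sqrD2 X2).
      have -> : y2 ^+ 2 = y2 ^+ 2 + x * y2 by rewrite x0 mul0r addr0.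
      by rewrite E2 x0 !expr0n mulr0 !add0r addxx.
    have ik c : image_of kp (kp c) by exists c.
    have sI : is_subfield (image_of kp) by apply: image_subfield.
    apply: gen => //; first by rewrite x1E x0 mulr0 add0r.
    rewrite y1E x0 mulr0 addr0 y2E.
    by have := (ik d, ik u, ik t) => -[[? ?] ?]; sfsolve.
  exact: (nz c).
exists x, ((y2 + kp d) / x); split=> //.
  have -> : ((y2 + kp d) / x) ^+ 2 + (y2 + kp d) / x =
     ((y2 ^+ 2 + x * y2) + kp d ^+ 2 + kp d * x) / x ^+ 2 by field2 X2.
  by rewrite E2; field2 X2.
move=> S sS Sk Sx Sy.
have := (Sk s, Sk u, Sk t, Sk d, Sk r) => -[[[[? ?] ?] ?] ?].
have Sy2 : S y2.
  have -> : y2 = (y2 + kp d) / x * x + kp d by field2 X2.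
  by apply: (sfD sS) => //; apply: (sfM sS).
by apply: gen => //; rewrite ?x1E ?y1E; sfsolve.
Qed.

End Model.

End NormalForm.

(** * Construction of Artin-Schreier extensions *)

Definition anything (F : Type) (z : F) := True.

Lemma quad_exists (K : fieldType) (f : K) : 2%:R = 0 :> K ->
    (forall a, a ^+ 2 + a <> f) ->
  exists (L : fieldType) (iota : {rmorphism K -> L}) (y : L),
    quad (image_of iota) (@anything L) y /\ y ^+ 2 + y = iota f.
Proof.
move=> K2 nf; pose p : {poly K} := 'X^2 + ('X + f%:P).
have sp : size p = 3%N.
  have lt : (size ('X + f%:P)%R < size ('X^2 : {poly K}))%N.
    by rewrite size_polyXn size_XaddC.
  by rewrite (size_polyDl lt) size_polyXn.
have ip : irreducible_poly p.
  apply: cubic_irreducible; first by rewrite sp.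
  move=> x; apply/negP; rewrite /root !hornerE => /eqP E; apply: (nf x).
  by apply: (addxx_eq0 K2); exact: E.
have [L dL [z zp zL]] := irredp_FAdjoin ip.
exists L, (in_alg L), z.
have L2 : 2%:R = 0 :> L by rewrite -(rmorph_nat (in_alg L)) K2 rmorph0.
have zE : z ^+ 2 + z = in_alg L f.
  move: zp; rewrite /root !rmorphD /= map_polyXn map_polyX map_polyC !hornerD hornerXn hornerX hornerC.
  by rewrite addrA => /eqP E; apply: (addxx_eq0 L2); exact: E.
split=> //; split.
- exact: image_subfield.
- by exists f.
- case=> a za; apply: (nf a); move: zE.
  by rewrite za -rmorphXn -rmorphD => /(fmorph_inj (in_alg L)).
- move=> x; split=> // _.
  have : x \in <<1; z>>%VS by rewrite zL memvf.
  move=> /Fadjoin_polyP[q /polyOver1P[q' ->] xE].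
  have [c [d xE']] : exists c d : K, x = in_alg L c + in_alg L d * z.
    pose r := q' %% p; have sr : (size r <= 2)%N.
      by rewrite -ltnS -sp ltn_modp -size_poly_eq0 sp.
    exists r`_0, r`_1.
    have -> : x = (map_poly (in_alg L) r).[z].
      rewrite xE {1}(divp_eq q' p) rmorphD rmorphM /= hornerD hornerM (eqP zp).
      by rewrite mulr0 add0r.
    rewrite (horner_coef_wide (n := 2)) ?size_map_poly // big_ord_recl big_ord1 /=.
    by rewrite expr0 mulr1 expr1 !coef_map.
  by exists (in_alg L c), (in_alg L d); split=> //; [exists c|exists d].
Qed.

Section Biquadratic.

Variables (F : fieldType).
Hypothesis F2 : 2%:R = 0 :> F.
Variables (K K1 : F -> Prop) (y1 y2 : F).
Hypothesis q1 : quad K K1 y1.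
Hypothesis q2 : quad K1 (@anything F) y2.
Hypothesis Kf2 : K (y2 ^+ 2 + y2).

Definition span2 (z : F) := exists a b, [/\ K a, K b & z = a + b * y2].

Let sK : is_subfield K. Proof. by case: q1. Qed.
Let KK1 a : K a -> K1 a. Proof. exact: (quad_sub q1). Qed.
Let K10 : K1 0. Proof. by apply: KK1; apply: (sf0 sK). Qed.

Lemma quad_second : quad K span2 y2.
Proof. by split=> // Ky; case: q2 => _ _ ny _; apply/ny/KK1. Qed.

Lemma quad_swap : quad span2 (@anything F) y1.
Proof.
have [_ Kf1 ny1 h1] := q1; have [_ _ ny2 h2] := q2.
split.
- exact: (quad_subfield F2 quad_second).
- exact: (quad_sub quad_second Kf1).
- move=> [a [b [Ka Kb E]]]; apply: ny1.
  have [E1 _] : y1 + a = 0 /\ b = 0.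
    apply: (quad_uniq F2 q2) => //; try exact: KK1.
      by apply: (sfD (quad_subfield F2 q1)); [exact: (quad_gen q1)|exact: KK1].
    by rewrite mul0r addr0 E; ring2 F2.
  by rewrite (addxx_eq0 F2 E1).
- move=> z; split=> // _; have /h2[u [v [/h1[a [b [Ka Kb ->]]] /h1[c [d [Kc Kd ->]]] ->]]] := I : anything z.
  exists (a + c * y2), (b + d * y2); split; [by exists a, c|by exists b, d|].
  by ring2 F2.
Qed.

Lemma biquad_coord z : exists A B C E, [/\ K A, K B, K C & K E] /\
  z = A + B * y1 + C * y2 + E * (y1 * y2).
Proof.
have [_ _ _ h1] := q1; have [_ _ _ h2] := q2.
have /h2[u [v [/h1[a [b [Ka Kb ->]]] /h1[c [d [Kc Kd ->]]] ->]]] := I : anything z.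
by exists a, b, c, d; split=> //; ring2 F2.
Qed.

Lemma biquad_conj : exists tau1 tau2 : {rmorphism F -> F},
  [/\ (forall a, K a -> tau1 a = a /\ tau2 a = a),
      tau1 y1 = y1 + 1 /\ tau1 y2 = y2, tau2 y1 = y1 /\ tau2 y2 = y2 + 1
    & (forall z, tau1 (tau1 z) = z) /\ (forall z, tau2 (tau2 z) = z)].
Proof.
have [t1 t1E] := quad_conj F2 quad_swap (fun=> I).
have [t2 t2E] := quad_conj F2 q2 (fun=> I).
have sK2 := quad_subfield F2 quad_second.
have sK1 := quad_subfield F2 q1.
have KK2 a : K a -> span2 a by apply: (quad_sub quad_second).
have t1K a : span2 a -> t1 a = a.
  by move=> Ka; have := t1E a 0 Ka (sf0 sK2); rewrite mul0r !addr0.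
have t2K a : K1 a -> t2 a = a.
  by move=> Ka; have := t2E a 0 Ka (sf0 sK1); rewrite mul0r !addr0.
have t1y : t1 y1 = y1 + 1.
  by have := t1E 0 1 (sf0 sK2) (sf1 sK2); rewrite mul1r !add0r.
have t2y : t2 y2 = y2 + 1.
  by have := t2E 0 1 (sf0 sK1) (sf1 sK1); rewrite mul1r !add0r.
exists t1, t2; split.
- by move=> a Ka; rewrite t1K ?t2K //; [apply: KK1|apply: KK2].
- by split=> //; apply: t1K; apply: (quad_gen quad_second).
- by split=> //; apply: t2K; apply: (quad_gen q1).
- split=> z.
    have [_ _ _ h] := quad_swap; have /h[a [b [Ka Kb ->]]] := I : anything z.
    by rewrite t1E // !rmorphD t1K // rmorphM (t1K b) // t1y; ring2 F2.
  have [_ _ _ h] := q2; have /h[a [b [Ka Kb ->]]] := I : anything z.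
  by rewrite t2E // !rmorphD t2K // rmorphM (t2K b) // t2y; ring2 F2.
Qed.

End Biquadratic.

Section LocalNorm.

Variables (k F : fieldType) (kap : {rmorphism k -> F}) (O : F -> Prop).
Hypothesis F2 : 2%:R = 0 :> F.
Hypothesis vO : valuation_ring kap O.
Variables (K : F -> Prop) (p : F).
Hypothesis sK : is_subfield K.
Hypothesis up : uniformizer O K p.

Let p0 : p != 0. Proof. by case: up. Qed.
Let mp : maxid O p. Proof. by case: up. Qed.

Let pole A : K A -> ~ O A -> exists x, [/\ O x, x != 0 & A = (p * x)^-1].
Proof.
move=> KA nA; have [_ _ _ h] := up.
have A0 : A != 0 by apply/eqP => A0; apply: nA; rewrite A0; apply: (vr0 vO).
exists (A^-1 / p); split.
- by apply: h; [apply: (sfV sK)|apply: (maxidV nA)].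
- by rewrite mulf_neq0 ?invr_eq0.
- by field2 F2.
Qed.

Lemma maxid_1D x y : maxid O x -> 1 + x = y -> maxid O y -> False.
Proof.
move=> mx E my; apply: (maxid1 vO); have -> : 1 = y - x by rewrite -E addrK.
by apply: (maxidD vO) => //; apply: (maxidN vO).
Qed.

(* A pole of [A] would make [A ^+ 2] dominate, its order being even. *)
Lemma AS_norm_local A B C f : K A -> O B -> O C -> O (p * f) ->
    ~ maxid O (p * f) -> O (A ^+ 2 + A * C + B ^+ 2 * f) ->
  O A /\ maxid O B.
Proof.
move=> KA OB OC Opf nmpf ON.
have Op := maxidW vO mp.
have OA : O A.
  apply: contrapT => nA; have [x [Ox x0 AE]] := pole KA nA.
  set N := _ + _ in ON.
  apply: (maxid_1D (x := p * (x * C + B ^+ 2 * (p * f) * x ^+ 2)) (y := p * (p * x ^+ 2 * N))).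
  - by apply: (maxidMr vO) => //; repeat first [assumption|apply: (vrD vO)|apply: (vrM vO)|apply: (vrX vO)].
  - by rewrite /N AE; field2 F2.
  - by apply: (maxidMr vO) => //; repeat first [assumption|apply: (vrM vO)|apply: (vrX vO)].
split=> //; apply: (maxid_sqr vO).
have m : maxid O (B ^+ 2 * (p * f)).
  have -> : B ^+ 2 * (p * f) = p * ((A ^+ 2 + A * C + B ^+ 2 * f) - (A ^+ 2 + A * C)).
    by ring2 F2.
  apply: (maxidMr vO) => //; apply: (vrB vO) => //.
  by repeat first [assumption|apply: (vrD vO)|apply: (vrM vO)|apply: (vrX vO)].
by case: (maxid_prime vO _ Opf m) => //; apply: (vrX vO).
Qed.

(** A pole of [A] of order m gives [p * A ^+ 2] the odd order 1 - 2m, which [p * A * C] cannot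
    cancel. *)
Lemma odd_norm_local A C : K A -> O C -> O (p * A ^+ 2 + p * A * C) -> O A.
Proof.
move=> KA OC ON; apply: contrapT => nA; have [x [Ox x0 AE]] := pole KA nA.
have Op := maxidW vO mp.
set N := _ + _ in ON.
apply: (maxid_1D (x := p * (x * C)) (y := p * (x ^+ 2 * N))).
- by apply: (maxidMr vO) => //; apply: (vrM vO).
- by rewrite /N AE; field2 F2.
- by apply: (maxidMr vO) => //; repeat first [assumption|apply: (vrM vO)|apply: (vrX vO)].
Qed.

End LocalNorm.

(** * Places and uniformizers of the rational function field *)

Section Valuations.

Variables (k F : fieldType) (kap : {rmorphism k -> F}).
Hypothesis F2 : 2%:R = 0 :> F.

(** At a pole of [z], dividing its equation by a power of [z] would express the leading coefficient
    through positive powers of the non-unit [z^-1]. *)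
Lemma algebraic_valuation (O : F -> Prop) z : valuation_ring kap O ->
  algebraicOver kap z -> O z.
Proof.
move=> vO [p p0 /rootP pz]; apply: contrapT => nz.
have z0 : z != 0 by apply/eqP => z0; apply: nz; rewrite z0; apply: (vr0 vO).
have mz := maxidV nz; have Oz := maxidW vO mz.
have [n sp] : exists n, size p = n.+1.
  by exists (size p).-1; rewrite prednK // size_poly_gt0.
move: pz; rewrite horner_coef size_map_poly sp big_ord_recr /= => E.
have lE : kap p`_n = - \sum_(i < n) kap p`_i * z^-1 ^+ (n - i).
  have zn : z ^+ n != 0 by rewrite expf_neq0.
  apply: (mulIf zn); rewrite mulNr mulr_suml; apply/eqP; rewrite -addr_eq0 addrC.
  rewrite -[X in _ == X]E coef_map; apply/eqP; congr (_ + _); apply: eq_bigr => i _.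
  rewrite coef_map -mulrA; congr (_ * _).
  rewrite exprVn mulrC -[X in z ^+ X / _](@subnK i n) ?(ltnW (ltn_ord i)) //.
  by rewrite exprD mulrAC mulfV ?mul1r // expf_neq0.
have m : maxid O (kap p`_n).
  rewrite lE; apply: (maxidN vO); apply: big_ind; first exact: maxid0.
    exact: (maxidD vO).
  move=> i _; apply: (maxidMl vO); first exact: (vr_const vO).
  have [j ->] : exists j, (n - i = j.+1)%N.
    by exists (n - i).-1; rewrite prednK // subn_gt0.
  by rewrite exprS; apply: (maxidMr vO) => //; apply: (vrX vO).
have l0 : p`_n != 0.
  by have := p0; rewrite -lead_coef_eq0 lead_coefE sp.
apply: (maxid1 vO); have -> : 1 = kap (p`_n)^-1 * kap p`_n.
  by rewrite -rmorphM mulVf // rmorph1.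
by apply: (maxidMl vO) => //; apply: (vr_const vO).
Qed.

Lemma maxid_const (O : F -> Prop) c : valuation_ring kap O -> maxid O (kap c) -> c = 0.
Proof.
move=> vO m; apply/eqP; apply: contraT => c0.
case: (maxid1 vO); have -> : 1 = kap c^-1 * kap c by rewrite -rmorphM mulVf // rmorph1.
by apply: (maxidMl vO) => //; apply: (vr_const vO).
Qed.

Lemma exists_place t (p : {poly k}) : transcendental kap t -> (1 < size p)%N ->
  exists2 O, valuation_ring kap O & O t /\ maxid O (pev kap t p).
Proof.
move=> tr sp.
pose A z := exists p, z = pev kap t p.
have sA : is_subring A.
  split=> [|_ _ [a ->] [b ->]|_ _ [a ->] [b ->]]; first by exists 1; rewrite pev1.
    by exists (a - b); rewrite pevB.
  by exists (a * b); rewrite pevM.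
have p0 : p != 0 by rewrite -size_poly_gt0 ltnW.
have nA : ~ A (pev kap t p)^-1.
  case=> w E; have : p * w = 1.
    by apply: (pev_inj tr); rewrite pevM pev1 -E divff // tr.
  move/(congr1 (fun p : {poly k} => size p)); rewrite size_poly1 => /eqP.
  by rewrite size_mul_eq1 => /andP[/eqP E1 _]; rewrite E1 in sp.
have Ak c : A (kap c) by exists c%:P; rewrite pevC.
have [O vO [AO nO]] := exists_valuation_ring sA Ak (ex_intro _ p erefl) nA.
exists O => //; split; last by right.
by apply: AO; exists 'X; rewrite pev_X.
Qed.

Lemma exists_infinite_place t : transcendental kap t ->
  exists2 O, valuation_ring kap O & ~ O t.
Proof.
move=> tr; have s2 : (1 < size ('X : {poly k}))%N by rewrite size_polyX.
have [O vO [_ m]] := exists_place (transcendentalV tr) s2.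
exists O => //; rewrite pev_X in m; case: m; last by rewrite invrK.
by move/eqP; rewrite invr_eq0 (negPf (transcendental_nz tr)).
Qed.

End Valuations.

Ltac vrsolve vO := repeat first [assumption | apply: (vr_const vO)
  | apply: (vr0 vO) | apply: (vr1 vO) | apply: (vrD vO) | apply: (vrM vO)
  | apply: (vrX vO) | apply: (vrN vO)].

Section Uniformizers.

Variables (k F : fieldType) (kap : {rmorphism k -> F}) (O : F -> Prop).
Hypothesis vO : valuation_ring kap O.

(** When the derivative of [p] is 1, the Leibniz rule for [p = g * q] is itself a Bezout relation.
    In characteristic two this covers every polynomial t^2 + t + c. *)
Lemma deriv1_squarefree (p : {poly k}) : p^`() = 1 ->
  forall g q, p = g * q -> coprimep g q.
Proof.
move=> dp g q E; apply/Bezout_eq1_coprimepP; exists (q^`(), g^`()) => /=.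
by rewrite -dp E derivM addrC [q^`() * g]mulrC.
Qed.

Lemma deriv1_uniformizer t (p : {poly k}) : transcendental kap t -> O t ->
    p^`() = 1 -> maxid O (pev kap t p) ->
  uniformizer O (ratl kap t) (pev kap t p).
Proof.
move=> tr Ot dp mp; have p0 : p != 0.
  by apply/eqP => p0; move/eqP: dp; rewrite p0 deriv0 eq_sym oner_eq0.
split=> //; [exact: rat_pev|exact: tr|].
move=> z; apply: (rat_uniformizer vO) => //; exact: deriv1_squarefree.
Qed.

Lemma linear_uniformizer t c : transcendental kap t -> O t ->
  maxid O (t + kap c) -> uniformizer O (ratl kap t) (t + kap c).
Proof.
move=> tr Ot m; have E : t + kap c = pev kap t ('X + c%:P) by rewrite !pevE.
by rewrite E; apply: deriv1_uniformizer => //; rewrite -?E // derivD derivX derivC addr0.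
Qed.

Lemma inverse_uniformizer t : transcendental kap t -> ~ O t ->
  uniformizer O (ratl kap t) t^-1.
Proof.
move=> tr nt; have mt := maxidV nt; have trV := transcendentalV tr.
have [] := linear_uniformizer (t := t^-1) (c := 0) trV (maxidW vO mt).
  by rewrite rmorph0 addr0.
rewrite rmorph0 addr0 => _ h1 h2 h3; split=> //.
  by apply: (sfV (rat_subfield _ _)); apply: rat_gen.
by move=> z rz; apply/h3/rat_inv.
Qed.

End Uniformizers.

Lemma mul_const_eq0 (k : fieldType) (q p : {poly k}) c :
  (1 < size q)%N -> q * p = c%:P -> p = 0.
Proof.
move=> sq E; apply/eqP; apply: contraT => p0.
have q0 : q != 0 by rewrite -size_poly_gt0 ltnW.
have : (size (q * p)%R <= 1)%N by rewrite E size_polyC leq_b1.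
rewrite size_mul //; move: sq p0; rewrite -size_poly_gt0.
by case: (size q) => [|[|n]] // _; case: (size p) => // m _; rewrite addnS /=.
Qed.

(** * Three branch points *)

Section CaseA.

Variables (k F : fieldType) (kap : {rmorphism k -> F}).
Hypothesis F2 : 2%:R = 0 :> F.
Variables (t y1 y2 : F) (K1 : F -> Prop).
Hypothesis tr : transcendental kap t.
Local Notation K := (ratl kap t).
Hypothesis q1 : quad K K1 y1.
Hypothesis q2 : quad K1 (@anything F) y2.
Variables a b e c1 c2 : k.
Hypotheses (a0 : a != 0) (b0 : b != 0) (e0 : e != 0).
Let f1 := kap a / t + kap b / (t + 1) + kap c1.
Let f2 := kap b / (t + 1) + kap e * t + kap c2.
Hypotheses (y1E : y1 ^+ 2 + y1 = f1) (y2E : y2 ^+ 2 + y2 = f2).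

Let t0 : t != 0. Proof. exact: transcendental_nz tr. Qed.
Let t1 : t + 1 != 0.
Proof.
have := transcendental_const 1 tr; rewrite rmorph1.
by apply: contraNneq => /(addxx_eq0 F2) ->.
Qed.
Let sK : is_subfield K := rat_subfield kap t.
Let Kt : K t := rat_gen kap t.
Let Kc c : K (kap c) := rat_const kap t c.
Let Kf1 : K f1.
Proof. by have := (Kc a, Kc b, Kc c1) => -[[? ?] ?]; rewrite /f1; sfsolve. Qed.
Let Kf2 : K f2.
Proof. by have := (Kc b, Kc e, Kc c2) => -[[? ?] ?]; rewrite /f2; sfsolve. Qed.

Section Local.

Variable O : F -> Prop.
Hypothesis vO : valuation_ring kap O.

Lemma unit_const c : c != 0 -> ~ maxid O (kap c).
Proof. by move=> c0 /(maxid_const vO) /eqP; rewrite (negPf c0). Qed.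

Lemma maxid_add_unit x y : maxid O x -> ~ maxid O y -> ~ maxid O (x + y).
Proof.
move=> mx ny m; apply: ny; have -> : y = (x + y) - x by rewrite addrAC subrr add0r.
by apply: (maxidD vO) => //; apply: (maxidN vO).
Qed.

Lemma caseA_at0 : maxid O t -> [/\ O t, O (t + 1)^-1, uniformizer O K t,
  O (t * f1) & ~ maxid O (t * f1)] /\ O f2.
Proof.
move=> mt; have Ot := maxidW vO mt.
have nt1 : ~ maxid O (t + 1) by apply: maxid_add_unit mt (maxid1 vO).
have Ot1 : O (t + 1) by vrsolve vO.
have Oi := vr_unit Ot1 nt1.
have E : t * f1 = t * (kap b / (t + 1) + kap c1) + kap a by rewrite /f1; field2 F2.
split; last by rewrite /f2; vrsolve vO.
split=> //.
- by have := linear_uniformizer vO (c := 0) tr Ot; rewrite rmorph0 addr0; apply.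
- by rewrite E; vrsolve vO.
- rewrite E; apply: maxid_add_unit (unit_const a0).
  by apply: (maxidMr vO) => //; vrsolve vO.
Qed.

Lemma caseA_at1 : maxid O (t + 1) -> [/\ O t, O t^-1, uniformizer O K (t + 1),
  O ((t + 1) * f1) & ~ maxid O ((t + 1) * f1)] /\
  exists r1 r2, [/\ O r1, O r2, f1 = kap b / (t + 1) + r1
    & f2 = kap b / (t + 1) + r2].
Proof.
move=> mt; have Ot : O t.
  by rewrite -(addxK F2 t 1); apply: (vrD vO); [apply: (maxidW vO)|apply: (vr1 vO)].
have nt : ~ maxid O t.
  have -> : t = (t + 1) + 1 by rewrite addxK.
  exact: maxid_add_unit mt (maxid1 vO).
have Oi := vr_unit Ot nt.
have E : (t + 1) * f1 = (t + 1) * (kap a / t + kap c1) + kap b by rewrite /f1; field2 F2.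
split.
  split=> //.
  - rewrite -(rmorph1 kap); apply: linear_uniformizer => //.
    by rewrite rmorph1.
  - by rewrite E; vrsolve vO.
  - rewrite E; apply: maxid_add_unit (unit_const b0).
    by apply: (maxidMr vO) => //; vrsolve vO.
exists (kap a / t + kap c1), (kap e * t + kap c2).
by split; [vrsolve vO|vrsolve vO|rewrite /f1; field2 F2|rewrite /f2 addrA].
Qed.

Lemma caseA_etale : O t -> ~ maxid O t -> ~ maxid O (t + 1) ->
  [/\ O t^-1, O (t + 1)^-1, O f1 & O f2].
Proof.
move=> Ot nt nt1; have Oi := vr_unit Ot nt.
have Ot1 : O (t + 1) by vrsolve vO.
have Oi1 := vr_unit Ot1 nt1.
by split=> //; rewrite /f1 /f2; vrsolve vO.
Qed.

Lemma caseA_infinite : ~ O t -> [/\ O t^-1, O (t / (t + 1)), O ((t + 1) / t),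
  uniformizer O K t^-1 & O (t^-1 * f2)] /\ ~ maxid O (t^-1 * f2) /\ O f1.
Proof.
move=> nt; have mi := maxidV nt; have Oi := maxidW vO mi.
have u1 : ~ maxid O (1 + t^-1) by rewrite addrC; apply: maxid_add_unit mi (maxid1 vO).
have O1 : O (1 + t^-1) by vrsolve vO.
have E1 : (t + 1) / t = 1 + t^-1 by field2 F2.
have E2 : t / (t + 1) = (1 + t^-1)^-1 by rewrite -E1 invf_div.
have O2 := vr_unit O1 u1; rewrite -E2 in O2; rewrite -E1 in O1.
have E : t^-1 * f2 = t^-1 * (t^-1 * (t / (t + 1)) * kap b + kap c2) + kap e.
  by rewrite /f2; field2 F2.
split; [split=> //|split].
- exact: inverse_uniformizer.
- by rewrite E; vrsolve vO.
- rewrite E; apply: maxid_add_unit (unit_const e0).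
  by apply: (maxidMr vO) => //; vrsolve vO.
- have -> : f1 = kap a * t^-1 + kap b * (t^-1 * (t / (t + 1))) + kap c1.
    by rewrite /f1; field2 F2.
  by vrsolve vO.
Qed.

Let G := t * (t + 1).

Lemma caseA_parameter D : derivation kap D -> D t = 1 -> exists c g,
  [/\ stable O (@anything F) (fun z => c * D z), O g, O (c * D g)
    & ~ maxid O (c * D g)] /\
  ((O t /\ O (c / G) /\ O (G / c)) \/
   (~ O t /\ O (c * t / G) /\ O (G / (c * t)))).
Proof.
move=> dD Dt.
have stK c : O (c * D t) -> O t -> stable O K (fun z => c * D z).
  by move=> h Ot; apply: (stable_rat F2 vO tr _ Ot h); apply: der_scale.
have O1 := vr1 vO.
have dc c : derivation kap (fun z => c * D z) by apply: der_scale.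
have Oy f y : O f -> y ^+ 2 + y = f -> O y.
  by move=> Of yf; apply: (vr_quadratic vO O1 Of); rewrite mul1r.
have st1 : O t -> stable O K D.
  move=> Ot; have -> : D = (fun z => 1 * D z) by apply/funext => z; rewrite mul1r.
  by apply: stK => //; rewrite Dt mulr1.
have sK1 := quad_subfield F2 q1; have KK1 := quad_sub q1.
have [Ot|nt] := pselect (O t).
  have [mt|nmt] := pselect (maxid O t).
    have [[_ Oi up Otf ntf] Of2] := caseA_at0 mt.
    rewrite -y1E in Otf ntf.
    have [s1 h] := stable_ramified F2 vO q1 up Otf ntf dD (st1 Ot).
    have Og := maxidW vO (ramified_maxid F2 vO up Otf).
    have m1 : ~ maxid O (D t) by rewrite Dt; apply: (maxid1 vO).
    exists t, (t * y1); split; [split|left; split=> //; split] => //.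
    + by apply: (stable_etale F2 vO q2) => //; rewrite y2E.
    + by apply: s1 => //; apply: (sfM sK1); [apply: KK1|apply: (quad_gen q1)].
    + exact: h.
    + by have -> : t / G = (t + 1)^-1 by rewrite /G; field2 F2.
    + by have -> : G / t = t + 1; [rewrite /G; field2 F2|vrsolve vO].
  have [mt1|nmt1] := pselect (maxid O (t + 1)).
    have [[_ Oi up Otf ntf] [r1 [r2 [Or1 Or2 f1E f2E]]]] := caseA_at1 mt1.
    rewrite -y1E in Otf ntf.
    have [s1 h] := stable_ramified F2 vO q1 up Otf ntf dD (st1 Ot).
    have Og := maxidW vO (ramified_maxid F2 vO up Otf).
    have m1 : ~ maxid O (D (t + 1)).
      by rewrite (derD dD) Dt (der1 dD) addr0; apply: (maxid1 vO).
    exists (t + 1), ((t + 1) * y1); split; [split|left; split=> //; split] => //.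
    (* The poles of [f1] and [f2] at 1 coincide, so [y2 + y1] generates the second step without
       ramification. *)
    + have q3 := quad_shift F2 q2 (quad_gen q1).
      apply: (stable_etale F2 vO q3) => //.
      have -> : (y2 + y1) ^+ 2 + (y2 + y1) = (y2 ^+ 2 + y2) + (y1 ^+ 2 + y1) by ring2 F2.
      rewrite y1E y2E f1E f2E.
      have -> : kap b / (t + 1) + r2 + (kap b / (t + 1) + r1) = r2 + r1 by field2 F2.
      by vrsolve vO.
    + apply: s1 => //; apply: (sfM sK1); last exact: (quad_gen q1).
      by apply: KK1; apply: (sfD sK) => //; apply: (sf1 sK).
    + exact: h.
    + by have -> : (t + 1) / G = t^-1 by rewrite /G; field2 F2.
    + by have -> : G / (t + 1) = t by rewrite /G; field2 F2.
  have [Oi Oi1 Of1 Of2] := caseA_etale Ot nmt nmt1.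
  exists 1, t; rewrite Dt mulr1; split; [split|left; split=> //; split] => //.
  + have E : (fun z => 1 * D z) = D by apply/funext => z; rewrite mul1r.
    rewrite E; apply: (stable_etale F2 vO q2) => //; first by rewrite y2E.
    by apply: (stable_etale F2 vO q1) => //; [rewrite y1E|apply: st1].
  + exact: (maxid1 vO).
  + by have -> : 1 / G = t^-1 * (t + 1)^-1; [rewrite /G; field2 F2|vrsolve vO].
  + by rewrite divr1 /G; vrsolve vO.
have [[Oi O2 O3 up Osf] [nsf Of1]] := caseA_infinite nt.
rewrite -y2E in Osf nsf.
(* At infinity only [f2] has a pole, so the tower is read in the other order: first [y2], ramified,
   then [y1]. *)
have q2' := quad_second q1 q2; have q1' := quad_swap F2 q1 q2.
rewrite y2E in q2'; have {}q2' := q2' Kf2; have {}q1' : quad (span2 K y2) (@anything F) y1.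
  by apply: q1'; rewrite y2E.
pose D1 z := t ^+ 2 * D z.
have dD1 : derivation kap D1 by apply: dc.
have D1s : D1 t^-1 = 1.
  by rewrite /D1 (derV F2 dD) Dt mulrC divfK // expf_neq0.
have st : stable O K D1.
  have h : O (D1 t^-1) by rewrite D1s.
  move=> z /rat_inv Kz Oz.
  exact: (stable_rat F2 vO (transcendentalV tr) dD1 Oi h Kz Oz).
have [s1 h] := stable_ramified F2 vO q2' up Osf nsf dD1 st.
have Og := maxidW vO (ramified_maxid F2 vO up Osf).
have m1 : ~ maxid O (D1 t^-1) by rewrite D1s; apply: (maxid1 vO).
have tE z : t * D z = t^-1 * D1 z by rewrite /D1; field2 F2.
exists t, (t^-1 * y2); split; [split|right; split=> //; split] => //.
- have -> : (fun z => t * D z) = (fun z => t^-1 * D1 z) by apply/funext => z; apply: tE.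
  by apply: (stable_etale F2 vO q1') => //; [rewrite y1E|apply: der_scale].
- rewrite tE; apply: s1 => //; apply: (sfM (quad_subfield F2 q2')).
    by apply: (quad_sub q2'); apply: (sfV sK).
  exact: (quad_gen q2').
- by rewrite tE; apply: h.
- by have -> : t * t / G = t / (t + 1) by rewrite /G; field2 F2.
- by have -> : G / (t * t) = (t + 1) / t by rewrite /G; field2 F2.
Qed.

End Local.

Let G := t * (t + 1).

(** The expression is the norm of [R + S * y1]. At the two simple poles of [f1] its integrality
    forces [S] to vanish, whence the divisibility by [G]. *)
Lemma caseA_norm1 O R S : valuation_ring kap O -> O t -> K R -> K S -> O S ->
  O (R ^+ 2 + R * S + S ^+ 2 * f1) -> O R /\ O (S / G).
Proof.
move=> vO Ot KR KS OS ON.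
have [mt|nmt] := pselect (maxid O t).
  have [[_ Oi up Otf ntf] _] := caseA_at0 vO mt.
  have [OR mS] := AS_norm_local F2 vO sK up KR OS OS Otf ntf ON.
  have [_ _ _ h] := up; have OSt := h _ KS mS.
  by split=> //; have -> : S / G = S / t * (t + 1)^-1; [rewrite /G; field2 F2|vrsolve vO].
have [mt1|nmt1] := pselect (maxid O (t + 1)).
  have [[_ Oi up Otf ntf] _] := caseA_at1 vO mt1.
  have [OR mS] := AS_norm_local F2 vO sK up KR OS OS Otf ntf ON.
  have [_ _ _ h] := up; have OSt := h _ KS mS.
  by split=> //; have -> : S / G = S / (t + 1) * t^-1; [rewrite /G; field2 F2|vrsolve vO].
have [Oi Oi1 Of1 Of2] := caseA_etale vO Ot nmt nmt1.
split; last by have -> : S / G = S * t^-1 * (t + 1)^-1; [rewrite /G; field2 F2|vrsolve vO].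
apply: (vr_quadratic vO OS (c := R ^+ 2 + R * S + S ^+ 2 * f1 - S ^+ 2 * f1)).
  by vrsolve vO.
by ring2 F2.
Qed.

(** Adding conjugates isolates the coordinates over k(t). The coefficient of [y1 * y2] is divisible
    by [G] and has at most a simple pole at infinity, so it is zero. The coefficient of [y1]
    vanishes at 0 and is a multiple of [t], that of [y2] is constant, and the common pole of [f1]
    and [f2] makes them agree at 1; the remaining coordinate is linear. *)
Lemma caseA_span h : (forall O, valuation_ring kap O -> O t -> O h) ->
    (forall O, valuation_ring kap O -> O t^-1 -> O (h / t)) ->
  exists r0 r1 c : k, h = kap r0 + kap r1 * t + kap c * (t * y1 + y2).
Proof.
pose I z := forall O, valuation_ring kap O -> O t -> O z.
pose J z := forall O, valuation_ring kap O -> O t^-1 -> O z.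
move=> Ih Jh; have trV := transcendentalV tr.
have Kf2' : K (y2 ^+ 2 + y2) by rewrite y2E.
have [tau1 [tau2 [tauK [t1y1 t1y2] [t2y1 t2y2] [tt1 tt2]]]] := biquad_conj F2 q1 q2 Kf2'.
have ID x z : I x -> I z -> I (x + z).
  by move=> h1 h2 O vO Ot; apply: (vrD vO); [apply: h1|apply: h2].
have IM x z : I x -> I z -> I (x * z).
  by move=> h1 h2 O vO Ot; apply: (vrM vO); [apply: h1|apply: h2].
have JD x z : J x -> J z -> J (x + z).
  by move=> h1 h2 O vO Ot; apply: (vrD vO); [apply: h1|apply: h2].
have JM x z : J x -> J z -> J (x * z).
  by move=> h1 h2 O vO Ot; apply: (vrM vO); [apply: h1|apply: h2].
have tvr (tau : {rmorphism F -> F}) O : (forall a, K a -> tau a = a) ->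
    (forall z, tau (tau z) = z) -> valuation_ring kap O ->
    valuation_ring kap (fun z => O (tau z)).
  move=> tK tt; apply: conj_valuation; first by move=> c; apply/tK/rat_const.
  by move=> z; exists (tau z).
have k1 x : K x -> tau1 x = x by move=> Kx; have [] := tauK x Kx.
have k2 x : K x -> tau2 x = x by move=> Kx; have [] := tauK x Kx.
have Kti : K t^-1 by apply: (sfV sK).
have It1 z : I z -> I (tau1 z).
  move=> Iz O vO Ot; apply: (Iz (fun z => O (tau1 z))); first exact: tvr.
  by rewrite k1.
have It2 z : I z -> I (tau2 z).
  move=> Iz O vO Ot; apply: (Iz (fun z => O (tau2 z))); first exact: tvr.
  by rewrite k2.
have Jt1 z : J z -> J (tau1 z).
  move=> Jz O vO Ot; apply: (Jz (fun z => O (tau1 z))); first exact: tvr.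
  by rewrite k1.
have Jt2 z : J z -> J (tau2 z).
  move=> Jz O vO Ot; apply: (Jz (fun z => O (tau2 z))); first exact: tvr.
  by rewrite k2.
have [A [B [C [E [[KA KB KC KE] hE]]]]] := biquad_coord F2 q1 q2 h.
have h2 : tau2 h = h + (C + E * y1).
  by rewrite hE !(rmorphD, rmorphM) (k2 _ KA) (k2 _ KB) (k2 _ KC) (k2 _ KE) t2y1 t2y2; ring2 F2.
have h1 : tau1 h = h + (B + E * y2).
  by rewrite hE !(rmorphD, rmorphM) (k1 _ KA) (k1 _ KB) (k1 _ KC) (k1 _ KE) t1y1 t1y2; ring2 F2.
have IgC : I (C + E * y1).
  have -> : C + E * y1 = tau2 h + h by rewrite h2; ring2 F2.
  by apply: ID => //; apply: It2.
have JgC : J ((C + E * y1) / t).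
  have -> : (C + E * y1) / t = tau2 (h / t) + h / t.
    by rewrite rmorphM (k2 _ Kti) h2; field2 F2.
  by apply: JD => //; apply: Jt2.
have gC1 : tau1 (C + E * y1) = C + E * y1 + E.
  by rewrite !(rmorphD, rmorphM) (k1 _ KC) (k1 _ KE) t1y1; ring2 F2.
have IE : I E.
  have -> : E = tau1 (C + E * y1) + (C + E * y1) by rewrite gC1; ring2 F2.
  by apply: ID => //; apply: It1.
have JE : J (E / t).
  have -> : E / t = tau1 ((C + E * y1) / t) + (C + E * y1) / t.
    by rewrite rmorphM (k1 _ Kti) gC1; field2 F2.
  by apply: JD => //; apply: Jt1.
have sX1 : (1 < size ('X + 1%:P : {poly k})%R)%N by rewrite size_XaddC.
have E0 : E = 0.
  have [p pE] : exists p, E / G = pev kap t p.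
    apply: rat_integral => //; first by rewrite /G; sfsolve.
    move=> O vO Ot; have [] // := caseA_norm1 vO Ot KC KE (IE O vO Ot).
    have -> : C ^+ 2 + C * E + E ^+ 2 * f1 = (C + E * y1) * tau1 (C + E * y1).
      by rewrite gC1 -y1E; ring2 F2.
    by apply: (IM _ _ IgC (It1 _ IgC)).
  have [q qE] : exists q, E / t = pev kap t^-1 q.
    by apply: rat_integral => //; apply: rat_inv; sfsolve.
  (* [E / t] is both [t + 1] times the polynomial [p] in [t] and a polynomial in [1 / t]. *)
  have [c cE] : exists c, ('X + 1%:P) * p = c%:P.
    apply: (poly_in_both tr (q := q)); rewrite !pevE -pE -qE rmorph1 /G.
    by field2 F2.
  have p0 := mul_const_eq0 sX1 cE.
  have G0 : G != 0 by rewrite mulf_neq0.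
  by rewrite -(divfK G0 E) pE p0 pev0 mul0r.
rewrite E0 !mul0r ?addr0 in hE h1 h2 IgC JgC gC1.
have IB : I B.
  have -> : B = tau1 h + h by rewrite h1; ring2 F2.
  by apply: ID => //; apply: It1.
have JB : J (B / t).
  have -> : B / t = tau1 (h / t) + h / t.
    by rewrite rmorphM (k1 _ Kti) h1; field2 F2.
  by apply: JD => //; apply: Jt1.
pose R := A ^+ 2 + A * C + C ^+ 2 * f2 + B ^+ 2 * f1.
pose S := B ^+ 2 + B * C.
have NE : h * tau2 h = R + S * y1.
  have e1 : y1 ^+ 2 = y1 + f1 by rewrite -y1E; ring2 F2.
  have e2 : y2 ^+ 2 = y2 + f2 by rewrite -y2E; ring2 F2.
  by rewrite h2 hE /R /S; ring2 F2 e1 e2.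
have KR : K R by rewrite /R; sfsolve.
have KS : K S by rewrite /S; sfsolve.
have IR : I R.
  move=> O vO Ot; have [] // := caseA_norm1 vO Ot KR KS.
    by rewrite /S; apply: (vrD vO); rewrite ?expr2; apply: (vrM vO); by [apply: IB|apply: IgC].
  have -> : R ^+ 2 + R * S + S ^+ 2 * f1 = (h * tau2 h) * tau1 (h * tau2 h).
    by rewrite NE (rmorphD tau1) (rmorphM tau1) (k1 _ KR) (k1 _ KS) t1y1 -y1E; ring2 F2.
  have IN := IM _ _ Ih (It2 _ Ih).
  by apply: (IM _ _ IN (It1 _ IN)).
have loc O : valuation_ring kap O -> O t ->
    [/\ O A, O (B / t) & O ((B + C) / (t + 1))].
  move=> vO Ot; have OB := IB O vO Ot; have OC := IgC O vO Ot; have OR := IR O vO Ot.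
  have [mt|nmt] := pselect (maxid O t).
    have [[_ Oi up Otf ntf] Of2] := caseA_at0 vO mt.
    have [OA mB] : O A /\ maxid O B.
      apply: (AS_norm_local F2 vO sK up KA OB OC Otf ntf).
      have -> : A ^+ 2 + A * C + B ^+ 2 * f1 = R - C ^+ 2 * f2 by rewrite /R; ring2 F2.
      by vrsolve vO.
    by have [_ _ _ hu] := up; split=> //; [apply: hu|vrsolve vO].
  have [mt1|nmt1] := pselect (maxid O (t + 1)).
    have [[_ Oi up _ _] [r1 [r2 [Or1 Or2 f1E f2E]]]] := caseA_at1 vO mt1.
    have pE : (t + 1) * (kap b / (t + 1)) = kap b by field2 F2.
    have [OA mB] : O A /\ maxid O (B + C).
      apply: (AS_norm_local F2 vO sK up KA (C := C) (f := kap b / (t + 1))) => //.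
      - exact: (vrD vO).
      - by rewrite pE; apply: (vr_const vO).
      - by rewrite pE; apply: unit_const.
      have -> : A ^+ 2 + A * C + (B + C) ^+ 2 * (kap b / (t + 1)) =
          R - B ^+ 2 * r1 - C ^+ 2 * r2 by rewrite /R f1E f2E; field2 F2.
      by vrsolve vO.
    have [_ _ _ hu] := up; split=> //; first by vrsolve vO.
    by apply: hu => //; apply: (sfD sK).
  have [Oi Oi1 Of1 Of2] := caseA_etale vO Ot nmt nmt1.
  split; [|by vrsolve vO|by vrsolve vO].
  apply: (vr_quadratic vO OC (c := R - C ^+ 2 * f2 - B ^+ 2 * f1)); first by vrsolve vO.
  by rewrite /R; ring2 F2.
have inf O : valuation_ring kap O -> ~ O t -> O (A / t) /\ O C.
  move=> vO nt; have [[Oi _ _ up Osf] [nsf Of1]] := caseA_infinite vO nt.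
  have OB := JB O vO Oi; have OC := JgC O vO Oi.
  have Oy1 : O y1.
    by apply: (vr_quadratic vO (vr1 vO) Of1); rewrite mul1r.
  have ON : O (h / t * tau2 (h / t)) := JM _ _ Jh (Jt2 _ Jh) O vO Oi.
  have ORt : O ((A / t) ^+ 2 + (A / t) * (C / t) + (C / t) ^+ 2 * f2).
    have -> : (A / t) ^+ 2 + (A / t) * (C / t) + (C / t) ^+ 2 * f2 =
      h / t * tau2 (h / t) - ((B / t) ^+ 2 + (B / t) * (C / t)) * y1 - (B / t) ^+ 2 * f1.
      rewrite rmorphM (k2 _ Kti).
      have -> : h / t * (tau2 h / t) = (h * tau2 h) / t ^+ 2 by field2 F2.
      by rewrite NE /R /S; field2 F2.
    by vrsolve vO.
  have KAt : K (A / t) by sfsolve.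
  have [OA mC] := AS_norm_local F2 vO sK up KAt OC OC Osf nsf ORt.
  split=> //; have [_ _ _ hu] := up.
  have KCt : K (C / t) by sfsolve.
  by have := hu _ KCt mC; rewrite invrK divfK.
have [c cE] : exists c, C = kap c.
  apply: (rat_integral_both tr KC) => // O vO Ot.
  have [Ot'|nt] := pselect (O t); first exact: IgC.
  by have [] := inf O vO nt.
have [be beE] : exists be, B / t = kap be.
  apply: (rat_integral_both tr) => //; first by sfsolve.
  by move=> O vO Ot; have [] := loc O vO Ot.
have BE : B = kap be * t by rewrite -beE divfK.
have cbe : c = be.
  have [p pE] : exists p, (B + C) / (t + 1) = pev kap t p.
    apply: (rat_integral tr); first by sfsolve.
    by move=> O vO Ot; have [] := loc O vO Ot.
  have E1 : ('X + 1%:P) * (p + be%:P) = (c + be)%:P.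
    apply: (pev_inj tr); rewrite !pevE -pE BE cE rmorph1 rmorphD.
    by field2 F2.
  have E2 := mul_const_eq0 sX1 E1; move: E1; rewrite E2 mulr0 => /esym/eqP.
  rewrite polyC_eq0 => /eqP E3; apply: (fmorph_inj kap); apply: (addxx_eq0 F2).
  by rewrite -rmorphD E3 rmorph0.
have [p pE] : exists p, A = pev kap t p.
  by apply: (rat_integral tr KA) => O vO Ot; have [] := loc O vO Ot.
have [q qE] : exists q, A / t = pev kap t^-1 q.
  apply: (rat_integral trV); first by apply: rat_inv; sfsolve.
  move=> O vO Oi; have [Ot|nt] := pselect (O t).
    by have [OA _ _] := loc O vO Ot; apply: (vrM vO).
  by have [] := inf O vO nt.
have [p' [r0 pE']] : exists (p' : {poly k}) r0, p = p' * 'X + r0%:P.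
  elim/poly_ind: (p) => [|p' r0 _]; last by exists p', r0.
  by exists 0, 0; rewrite mul0r add0r.
have [r1 r1E] : exists r1, p' = r1%:P.
  apply: (poly_in_both tr (q := q + r0%:P * 'X)); rewrite !pevE -qE pE pE' !pevE.
  by field2 F2.
exists r0, r1, c; rewrite hE pE pE' r1E !pevE BE cE cbe; ring2 F2.
Qed.

(** An algebraic element is integral at every place, hence in the span just determined. Above
    infinity, integrality of [c * t], a difference of conjugates, and then of [r1 * t] makes both
    coefficients vanish. *)
Lemma caseA_const z : algebraicOver kap z -> exists c, z = kap c.
Proof.
move=> az; have all O : valuation_ring kap O -> O z.
  by move=> vO; apply: (algebraic_valuation vO).
have [r0 [r1 [c zE]]] := caseA_span (fun O vO _ => all O vO)
  (fun O vO Oi => vrM vO (all O vO) Oi).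
have Kf2' : K (y2 ^+ 2 + y2) by rewrite y2E.
have [tau1 [tau2 [tauK [t1y1 t1y2] _ [tt1 _]]]] := biquad_conj F2 q1 q2 Kf2'.
have k1 x : K x -> tau1 x = x by move=> Kx; have [] := tauK x Kx.
have [O vO nt] := exists_infinite_place tr.
have vO' : valuation_ring kap (fun z => O (tau1 z)).
  apply: conj_valuation => // [a'|x]; first exact: k1.
  by exists (tau1 x).
have no x : O (kap x * t) -> x = 0.
  move=> Ox; apply/eqP; apply: contraT => x0; case: nt.
  have -> : t = kap x^-1 * (kap x * t) by rewrite mulrA -rmorphM mulVf // rmorph1 mul1r.
  by vrsolve vO.
have c0 : c = 0.
  apply: no; have -> : kap c * t = tau1 z - z.
    rewrite zE !(rmorphD, rmorphM) (k1 _ Kt) (k1 _ (Kc r0)) (k1 _ (Kc r1)) (k1 _ (Kc c)).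
    by rewrite t1y1 t1y2; ring2 F2.
  by apply: (vrB vO); [apply: (all _ vO')|apply: all].
have r10 : r1 = 0.
  apply: no; have -> : kap r1 * t = z - kap r0 by rewrite zE c0 rmorph0; ring2 F2.
  by apply: (vrB vO); [apply: all|apply: (vr_const vO)].
by exists r0; rewrite zE c0 r10 rmorph0 !mul0r !addr0.
Qed.

End CaseA.

(** * Two branch points *)

Section CaseB.

Variables (k F : fieldType) (kap : {rmorphism k -> F}).
Hypothesis k2 : 2%:R = 0 :> k.
Hypothesis F2 : 2%:R = 0 :> F.
Hypothesis k_perfect : forall c : k, exists s, c = s ^+ 2.
Variables (t y1 y2 : F) (K1 : F -> Prop).
Hypothesis tr : transcendental kap t.
Local Notation K := (ratl kap t).
Hypothesis q1 : quad K K1 y1.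
Hypothesis q2 : quad K1 (@anything F) y2.
Variables c be al g1 g2 : k.
Hypotheses (c0 : c != 0) (be0 : be != 0) (al0 : al != 0).
Hypothesis N0 : be ^+ 2 + al * be + c * al ^+ 2 != 0.
Let P := t ^+ 2 + t + kap c.
Let f1 := kap be / P + kap g1.
Let f2 := kap al * t / P + kap g2.
Hypotheses (y1E : y1 ^+ 2 + y1 = f1) (y2E : y2 ^+ 2 + y2 = f2).

Let t0 : t != 0. Proof. exact: transcendental_nz tr. Qed.
Let Pev : P = pev kap t ('X^2 + 'X + c%:P). Proof. by rewrite !pevE. Qed.
Let sP : size ('X^2 + 'X + c%:P : {poly k}) = 3%N.
Proof.
have lt : (size ('X + c%:P)%R < size ('X^2 : {poly k})%R)%N.
  by rewrite size_polyXn size_XaddC.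
by rewrite -addrA (size_polyDl lt) size_polyXn.
Qed.
Let P0 : P != 0.
Proof. by rewrite Pev; apply: tr; rewrite -size_poly_eq0 sP. Qed.
Let dP : ('X^2 + 'X + c%:P : {poly k})^`() = 1.
Proof.
rewrite !derivD derivXn derivX derivC addr0 -mulr_natl -polyC_natr k2 polyC0.
by rewrite mul0r add0r.
Qed.
Let sK : is_subfield K := rat_subfield kap t.
Let Kt : K t := rat_gen kap t.
Let Kc x : K (kap x) := rat_const kap t x.
Let KP : K P. Proof. by rewrite Pev; apply: rat_pev. Qed.
Let Kf1 : K f1. Proof. by have := (Kc be, Kc g1) => -[? ?]; rewrite /f1; sfsolve. Qed.
Let Kf2 : K f2. Proof. by have := (Kc al, Kc g2) => -[? ?]; rewrite /f2; sfsolve. Qed.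
Let Pf1 : P * f1 = kap be + kap g1 * P. Proof. by rewrite /f1; field2 F2. Qed.
Let Pf2 : P * f2 = kap al * t + kap g2 * P. Proof. by rewrite /f2; field2 F2. Qed.

Section Local.

Variable O : F -> Prop.
Hypothesis vO : valuation_ring kap O.

(** For a root theta of [P] the quantity in [N0] is the norm of [be + al * theta], so none of [f1],
    [f2] and [f1 + f2] loses its pole at the zeros of [P]. *)
Lemma caseB_ramified : O t -> maxid O P -> [/\ uniformizer O K P, O (P * f1),
    ~ maxid O (P * f1), O (P * f2)
  & ~ maxid O t /\ ~ maxid O (kap al * t + kap be)].
Proof.
move=> Ot mP; have OP := maxidW vO mP.
have nt : ~ maxid O t.
  move=> mt; apply: (unit_const vO c0).
  have -> : kap c = P - t * (t + 1) by rewrite /P; ring2 F2.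
  apply: (maxidD vO) => //; apply: (maxidN vO); apply: (maxidMr vO) => //.
  by vrsolve vO.
split=> //.
- by rewrite Pev; apply: deriv1_uniformizer => //; rewrite -?Pev.
- by rewrite Pf1; vrsolve vO.
- rewrite Pf1 addrC; apply: (maxid_add_unit vO _ (unit_const vO be0)).
  by apply: (maxidMl vO) => //; vrsolve vO.
- by rewrite Pf2; vrsolve vO.
split=> // m; apply: (unit_const vO N0).
have -> : kap (be ^+ 2 + al * be + c * al ^+ 2) =
   kap al ^+ 2 * P + (kap al * t + kap be) * (kap al * t + kap be + kap al).
  by rewrite !(rmorphD, rmorphM, rmorphXn) /P; ring2 F2.
apply: (maxidD vO); first by apply: (maxidMl vO) => //; vrsolve vO.
by apply: (maxidMr vO) => //; vrsolve vO.
Qed.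

Lemma caseB_etale : O t -> ~ maxid O P -> [/\ O P, O P^-1, O f1 & O f2].
Proof.
move=> Ot nP; have OP : O P by rewrite /P; vrsolve vO.
have Oi := vr_unit OP nP.
by split=> //; rewrite /f1 /f2; vrsolve vO.
Qed.

Lemma caseB_infinite : ~ O t ->
  [/\ O t^-1, O (P / t ^+ 2), O (t ^+ 2 / P), O f1 & O f2].
Proof.
move=> nt; have mi := maxidV nt; have Oi := maxidW vO mi.
have E1 : P / t ^+ 2 = t^-1 * (1 + kap c * t^-1) + 1 by rewrite /P; field2 F2.
have u1 : ~ maxid O (P / t ^+ 2).
  rewrite E1; apply: (maxid_add_unit vO _ (maxid1 vO)).
  by apply: (maxidMr vO) => //; vrsolve vO.
have O1 : O (P / t ^+ 2) by rewrite E1; vrsolve vO.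
have O2 := vr_unit O1 u1; rewrite invf_div in O2.
split=> //.
- have -> : f1 = kap be * t^-1 ^+ 2 * (t ^+ 2 / P) + kap g1 by rewrite /f1; field2 F2.
  by vrsolve vO.
- have -> : f2 = kap al * t^-1 * (t ^+ 2 / P) + kap g2 by rewrite /f2; field2 F2.
  by vrsolve vO.
Qed.

(* At the zeros of [P] the second step is ramified for the generator
   [y2 + mu y1], where [mu ^+ 2] interpolates [f2 / f1] there. *)
Lemma caseB_parameter D : derivation kap D -> D t = 1 -> exists s g,
  [/\ stable O (@anything F) (fun z => s * D z), O g, O (s * D g)
    & ~ maxid O (s * D g)] /\
  ((O t /\ forall z, O (s * z / P) <-> O (P * z ^+ 2)) \/
   (~ O t /\ forall z, O (s * z / P) <-> O z)).
Proof.
move=> dD Dt.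
have O1 := vr1 vO.
have dc s : derivation kap (fun z => s * D z) by apply: der_scale.
have sK1 := quad_subfield F2 q1; have KK1 := quad_sub q1.
have st1 : O t -> stable O K D.
  by move=> Ot; apply: (stable_rat F2 vO tr dD Ot); rewrite Dt.
have [Ot|nt] := pselect (O t).
  have [mP|nP] := pselect (maxid O P).
    have [up Opf nmpf Opf2 [nmt nmab]] := caseB_ramified Ot mP.
    rewrite -y1E in Opf nmpf.
    have [_ _ _ hu] := up; have OP := maxidW vO mP.
    have [s1 h] := stable_ramified F2 vO q1 up Opf nmpf dD (st1 Ot).
    have m1 : ~ maxid O (D P).
      by rewrite /P !(derD dD) (der_sqr F2 dD) (der_const dD) Dt add0r addr0; apply: (maxid1 vO).
    have {}h := h m1.
    have uw := ramified_uniformizer F2 vO q1 up Opf nmpf.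
    have [Kw w0 mw _] := uw.
    set w := P * y1 in uw Kw w0 mw h.
    have Ow := maxidW vO mw.
    have [sq sqE] := k_perfect (al / be); have [sc scE] := k_perfect c.
    pose mu := kap sq * (t + kap sc).
    have Kmu : K mu by have := (Kc sq, Kc sc) => -[? ?]; rewrite /mu; sfsolve.
    have kbe0 : kap be != 0 by rewrite fmorph_eq0.
    (* As [sc ^+ 2 = c], the square of [t + sc] is [t + P], which agrees with [t] at the zeros of
       [P]. *)
    have mu2 : mu ^+ 2 = kap al / kap be * (t + P).
      rewrite /mu exprMn -rmorphXn -sqE rmorphM fmorphV (sqrD2 F2) -rmorphXn -scE.
      by rewrite /P; field2 F2.
    have Omu : O mu by rewrite /mu; vrsolve vO.
    have q2' : quad K1 (@anything F) (y2 + mu * y1).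
      by apply: (quad_shift F2 q2); apply: (sfM sK1); [apply: KK1|apply: (quad_gen q1)].
    pose rr := kap al + kap g2 + kap al / kap be * kap g1 * (t + P).
    have fE : (y2 + mu * y1) ^+ 2 + (y2 + mu * y1) = rr + (mu ^+ 2 + mu) * y1.
      have e1 : y1 ^+ 2 = y1 + f1 by rewrite -y1E; ring2 F2.
      have -> : (y2 + mu * y1) ^+ 2 + (y2 + mu * y1) =
         (y2 ^+ 2 + y2) + mu ^+ 2 * y1 ^+ 2 + mu * y1 by ring2 F2.
      have -> : y2 ^+ 2 + y2 + mu ^+ 2 * y1 ^+ 2 + mu * y1 =
         f2 + mu ^+ 2 * f1 + (mu ^+ 2 + mu) * y1 by rewrite y2E e1; ring2 F2.
      by congr (_ + _); rewrite mu2 /rr /f1 /f2; field2 F2.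
    have Ok : O (kap al / kap be) by rewrite -fmorphV; vrsolve vO.
    have Orr : O rr by rewrite /rr; vrsolve vO.
    have wE : w * ((mu ^+ 2 + mu) * y1) = (mu ^+ 2 + mu) * (w + kap be + kap g1 * P).
      have -> : w * ((mu ^+ 2 + mu) * y1) = (mu ^+ 2 + mu) * (w + P * (y1 ^+ 2 + y1)).
        by rewrite /w; ring2 F2.
      by rewrite y1E Pf1 addrA.
    (* That [mu] and [mu + 1] are units expresses that [f2] and [f1 + f2] have poles at the zeros of
       [P]. *)
    have nmu : ~ maxid O (mu ^+ 2 + mu).
      have -> : mu ^+ 2 + mu = mu * (mu + 1) by ring2 F2.
      have Omu1 : O (mu + 1) by vrsolve vO.
      case/(maxid_prime vO Omu Omu1) => m.
        apply: nmt; have -> : t = kap be / kap al * mu ^+ 2 - P.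
          have kal0 : kap al != 0 by rewrite fmorph_eq0.
          by rewrite mu2; field2 F2.
        apply: (maxidD vO); last exact: (maxidN vO).
        apply: (maxidMl vO); first by rewrite -fmorphV; vrsolve vO.
        by rewrite expr2; apply: (maxidMl vO).
      apply: nmab; have -> : kap al * t + kap be = kap be * (mu + 1) ^+ 2 + kap al * P.
        by rewrite (sqrD2 F2) mu2 expr1n; field2 F2.
      apply: (maxidD vO); last by apply: (maxidMl vO) => //; vrsolve vO.
      by apply: (maxidMl vO); [vrsolve vO|rewrite expr2; apply: (maxidMl vO)].
    have Omm : O (mu ^+ 2 + mu) by vrsolve vO.
    have nm2 : ~ maxid O (w * rr + (mu ^+ 2 + mu) * (w + kap be + kap g1 * P)).
      apply: (maxid_add_unit vO); first by apply: (maxidMr vO).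
      case/(maxid_prime vO Omm) => //; first by vrsolve vO.
      rewrite addrAC; apply: (maxid_add_unit vO _ (unit_const vO be0)).
      by apply: (maxidD vO) => //; apply: (maxidMl vO) => //; vrsolve vO.
    have E2 : w * ((y2 + mu * y1) ^+ 2 + (y2 + mu * y1)) =
       w * rr + (mu ^+ 2 + mu) * (w + kap be + kap g1 * P) by rewrite fE mulrDr wE.
    have Ow2 : O (w * ((y2 + mu * y1) ^+ 2 + (y2 + mu * y1))) by rewrite E2; vrsolve vO.
    have nw2 : ~ maxid O (w * ((y2 + mu * y1) ^+ 2 + (y2 + mu * y1))) by rewrite E2.
    have [s2 h2] := stable_ramified F2 vO q2' uw Ow2 nw2 (dc P) s1.
    have Og := maxidW vO (ramified_maxid F2 vO uw Ow2).
    have sE z : w * P * D z = w * (P * D z) by rewrite mulrA.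
    (* Each ramified step contributes its uniformizer: [P] the first, [w] the second. *)
    exists (w * P), (w * (y2 + mu * y1)); split; [split=> //|left; split=> //].
    + by have -> : (fun z => w * P * D z) = (fun z => w * (P * D z)) by apply/funext.
    + by rewrite sE; apply: s2.
    + by rewrite sE; apply: h2.
    move=> z; have -> : w * P * z / P = w * z by field2 F2.
    (* Integrality of [w * z] is tested on its square: [w ^+ 2] is [P] up to a unit, so the
       condition is expressed by an element of k(t). *)
    have w2E : w ^+ 2 = P * (w + (kap be + kap g1 * P)).
      by rewrite -Pf1 -y1E /w; ring2 F2.
    set un := w + _ in w2E.
    have nun : ~ maxid O un.
      rewrite /un addrCA addrC; apply: (maxid_add_unit vO _ (unit_const vO be0)).
      by apply: (maxidD vO) => //; apply: (maxidMl vO) => //; vrsolve vO.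
    have Oun : O un by rewrite /un; vrsolve vO.
    have Oiu := vr_unit Oun nun; have un0 := maxid_nz nun.
    split=> Oz.
      have -> : P * z ^+ 2 = (w * z) ^+ 2 * un^-1 by rewrite exprMn w2E; field2 F2.
      by vrsolve vO.
    apply: (vr_sqr vO); have -> : (w * z) ^+ 2 = P * z ^+ 2 * un.
      by rewrite exprMn w2E; ring2 F2.
    by vrsolve vO.
  have [OP Oi Of1 Of2] := caseB_etale Ot nP.
  exists 1, t; rewrite Dt mulr1; split; [split|left; split] => //.
  + have E : (fun z => 1 * D z) = D by apply/funext => z; rewrite mul1r.
    rewrite E; apply: (stable_etale F2 vO q2) => //; first by rewrite y2E.
    by apply: (stable_etale F2 vO q1) => //; [rewrite y1E|apply: st1].
  + exact: (maxid1 vO).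
  + move=> z; rewrite mul1r; split=> Oz.
      have -> : P * z ^+ 2 = P * P ^+ 2 * (z / P) ^+ 2 by field2 F2.
      by vrsolve vO.
    apply: (vr_sqr vO); have -> : (z / P) ^+ 2 = P * z ^+ 2 * P^-1 ^+ 3 by field2 F2.
    by vrsolve vO.
have [Oi O2 O3 Of1 Of2] := caseB_infinite nt.
pose D1 z := t ^+ 2 * D z.
have dD1 : derivation kap D1 by apply: dc.
have D1s : D1 t^-1 = 1.
  by rewrite /D1 (derV F2 dD) Dt mulrC divfK // expf_neq0.
have st : stable O K D1.
  have h : O (D1 t^-1) by rewrite D1s.
  move=> z /rat_inv Kz Oz.
  exact: (stable_rat F2 vO (transcendentalV tr) dD1 Oi h Kz Oz).
exists (t ^+ 2), t^-1; split; [split|right; split] => //; rewrite -?/(D1 _) ?D1s //.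
- apply: (stable_etale F2 vO q2) => //; first by rewrite y2E.
  by apply: (stable_etale F2 vO q1) => //; rewrite y1E.
- exact: (maxid1 vO).
- move=> z; split=> Oz.
    have -> : z = t ^+ 2 * z / P * (P / t ^+ 2) by field2 F2.
    by vrsolve vO.
  by have -> : t ^+ 2 * z / P = t ^+ 2 / P * z; [field2 F2|vrsolve vO].
Qed.

Lemma caseB_integral A E : O t -> K A -> O E -> O (P * (A ^+ 2 + A * E)) -> O A.
Proof.
move=> Ot KA OE ON; have [mP|nP] := pselect (maxid O P).
  have [up _ _ _ _] := caseB_ramified Ot mP.
  apply: (odd_norm_local F2 vO sK up KA OE).
  by have -> : P * A ^+ 2 + P * A * E = P * (A ^+ 2 + A * E) by ring2 F2.
have [OP Oi _ _] := caseB_etale Ot nP.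
apply: (vr_quadratic vO OE (c := P^-1 * (P * (A ^+ 2 + A * E)))); first exact: (vrM vO).
by field2 F2.
Qed.

End Local.

Let total_const z : K z -> (forall O, valuation_ring kap O -> O z) ->
  exists a, z = kap a.
Proof. by move=> Kz Oz; apply: (rat_integral_both tr Kz) => O vO _; apply: Oz. Qed.

Lemma caseB_place : exists2 O, valuation_ring kap O & O t /\ maxid O P.
Proof. by rewrite Pev; apply: exists_place => //; rewrite sP. Qed.

(** For [z] in k(t) the integrality of [P * z ^+ 2] implies that of [z], because [P] has odd order
    at its zeros. The coordinates isolated by conjugation are therefore integral everywhere and
    constant; the one of [y1 * y2] is shown to be zero by means of the norm at a zero of [P]. *)
Lemma caseB_span h : (forall O, valuation_ring kap O -> O t -> O (P * h ^+ 2)) ->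
    (forall O, valuation_ring kap O -> ~ O t -> O h) ->
  exists r0 r1 r2 : k, h = kap r0 + kap r1 * y1 + kap r2 * y2.
Proof.
pose I z := forall O, valuation_ring kap O -> O t -> O (P * z ^+ 2).
pose J z := forall O, valuation_ring kap O -> ~ O t -> O z.
move=> Ih Jh.
have Kf2' : K (y2 ^+ 2 + y2) by rewrite y2E.
have [tau1 [tau2 [tauK [t1y1 t1y2] [t2y1 t2y2] [tt1 tt2]]]] := biquad_conj F2 q1 q2 Kf2'.
have ID x z : I x -> I z -> I (x + z).
  move=> h1 h2 O vO Ot; rewrite (sqrD2 F2) mulrDr.
  by apply: (vrD vO); [apply: h1|apply: h2].
have IM O x z : valuation_ring kap O -> O t -> I x -> I z -> O (P * (x * z)).
  move=> vO Ot h1 h2; apply: (vr_sqr vO).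
  have -> : (P * (x * z)) ^+ 2 = P * x ^+ 2 * (P * z ^+ 2) by ring2 F2.
  by apply: (vrM vO); [apply: h1|apply: h2].
have JD x z : J x -> J z -> J (x + z).
  by move=> h1 h2 O vO Ot; apply: (vrD vO); [apply: h1|apply: h2].
have JM x z : J x -> J z -> J (x * z).
  by move=> h1 h2 O vO Ot; apply: (vrM vO); [apply: h1|apply: h2].
have tvr (tau : {rmorphism F -> F}) O : (forall a, K a -> tau a = a) ->
    (forall z, tau (tau z) = z) -> valuation_ring kap O ->
    valuation_ring kap (fun z => O (tau z)).
  move=> tK tt; apply: conj_valuation; first by move=> x; apply/tK/rat_const.
  by move=> z; exists (tau z).
have k1 x : K x -> tau1 x = x by move=> Kx; have [] := tauK x Kx.
have k3 x : K x -> tau2 x = x by move=> Kx; have [] := tauK x Kx.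
have It (tau : {rmorphism F -> F}) z : (forall a, K a -> tau a = a) ->
    (forall z, tau (tau z) = z) -> I z -> I (tau z).
  move=> tK tt Iz O vO Ot; rewrite -(tK P KP) -rmorphXn -rmorphM.
  by apply: (Iz (fun z => O (tau z))); [exact: tvr|rewrite tK].
have Jt (tau : {rmorphism F -> F}) z : (forall a, K a -> tau a = a) ->
    (forall z, tau (tau z) = z) -> J z -> J (tau z).
  move=> tK tt Jz O vO nt.
  by apply: (Jz (fun z => O (tau z))); [exact: tvr|rewrite tK].
have It1 z : I z -> I (tau1 z) by apply: It.
have It2 z : I z -> I (tau2 z) by apply: It.
have Jt1 z : J z -> J (tau1 z) by apply: Jt.
have Jt2 z : J z -> J (tau2 z) by apply: Jt.
have Jy1 : J y1.
  move=> O vO nt; have [_ _ _ Of _] := caseB_infinite vO nt.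
  by apply: (vr_quadratic vO (vr1 vO) Of); rewrite mul1r.
have Jy2 : J y2.
  move=> O vO nt; have [_ _ _ _ Of] := caseB_infinite vO nt.
  by apply: (vr_quadratic vO (vr1 vO) Of); rewrite mul1r.
have const_of X Y : K X -> (forall O, valuation_ring kap O -> O Y) ->
    (forall O, valuation_ring kap O -> O t -> O (P * (X ^+ 2 + X * Y))) -> J X ->
    exists x, X = kap x.
  move=> KX OY IX JX; apply: (total_const KX) => O vO.
  have [Ot|nt] := pselect (O t); last exact: JX.
  by apply: (caseB_integral vO Ot KX (OY O vO)); apply: IX.
have [A [B [C [E [[KA KB KC KE] hE]]]]] := biquad_coord F2 q1 q2 h.
have h2 : tau2 h = h + (C + E * y1).
  by rewrite hE !(rmorphD, rmorphM) (k3 _ KA) (k3 _ KB) (k3 _ KC) (k3 _ KE) t2y1 t2y2; ring2 F2.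
have h1 : tau1 h = h + (B + E * y2).
  by rewrite hE !(rmorphD, rmorphM) (k1 _ KA) (k1 _ KB) (k1 _ KC) (k1 _ KE) t1y1 t1y2; ring2 F2.
have gCE : C + E * y1 = tau2 h + h by rewrite h2; ring2 F2.
have IgC : I (C + E * y1) by rewrite gCE; apply: ID => //; apply: It2.
have JgC : J (C + E * y1) by rewrite gCE; apply: JD => //; apply: Jt2.
have gBE : B + E * y2 = tau1 h + h by rewrite h1; ring2 F2.
have IgB : I (B + E * y2) by rewrite gBE; apply: ID => //; apply: It1.
have JgB : J (B + E * y2) by rewrite gBE; apply: JD => //; apply: Jt1.
have gC1 : tau1 (C + E * y1) = C + E * y1 + E.
  by rewrite !(rmorphD, rmorphM) (k1 _ KC) (k1 _ KE) t1y1; ring2 F2.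
have gB1 : tau2 (B + E * y2) = B + E * y2 + E.
  by rewrite !(rmorphD, rmorphM) (k3 _ KB) (k3 _ KE) t2y2; ring2 F2.
have EE : E = tau1 (C + E * y1) + (C + E * y1) by rewrite gC1; ring2 F2.
have IE : I E by rewrite EE; apply: ID => //; apply: It1.
have JE : J E by rewrite EE; apply: JD => //; apply: Jt1.
have [e eE] : exists e, E = kap e.
  apply: (const_of E 0) => // [O vO|O vO Ot]; first exact: (vr0 vO).
  by rewrite mulr0 addr0; apply: IE.
have OE O (vO : valuation_ring kap O) : O E by rewrite eE; apply: (vr_const vO).
have Pf1O O : valuation_ring kap O -> O t -> O (P * f1).
  by move=> vO Ot; rewrite Pf1; vrsolve vO; rewrite /P; vrsolve vO.
have Pf2O O : valuation_ring kap O -> O t -> O (P * f2).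
  by move=> vO Ot; rewrite Pf2; vrsolve vO; rewrite /P; vrsolve vO.
have [r2 r2E] : exists r2, C = kap r2.
  apply: (const_of C E) => // [O vO Ot|O vO nt].
    have -> : P * (C ^+ 2 + C * E) =
        P * ((C + E * y1) * tau1 (C + E * y1)) - E ^+ 2 * (P * f1).
      by rewrite gC1 -y1E; ring2 F2.
    have := Pf1O O vO Ot; have := OE O vO => ? ?.
    apply: (vrB vO); last by vrsolve vO.
    by apply: (IM _ _ _ vO Ot) => //; apply: It1.
  have -> : C = C + E * y1 - E * y1 by rewrite addrK.
  have := (JgC O vO nt, OE O vO, Jy1 O vO nt) => -[[? ?] ?].
  by apply: (vrB vO) => //; apply: (vrM vO).
have [r1 r1E] : exists r1, B = kap r1.
  apply: (const_of B E) => // [O vO Ot|O vO nt].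
    have -> : P * (B ^+ 2 + B * E) =
        P * ((B + E * y2) * tau2 (B + E * y2)) - E ^+ 2 * (P * f2).
      by rewrite gB1 -y2E; ring2 F2.
    have := Pf2O O vO Ot; have := OE O vO => ? ?.
    apply: (vrB vO); last by vrsolve vO.
    by apply: (IM _ _ _ vO Ot) => //; apply: It2.
  have -> : B = B + E * y2 - E * y2 by rewrite addrK.
  have := (JgB O vO nt, OE O vO, Jy2 O vO nt) => -[[? ?] ?].
  by apply: (vrB vO) => //; apply: (vrM vO).
have OB O (vO : valuation_ring kap O) : O B by rewrite r1E; apply: (vr_const vO).
have OC O (vO : valuation_ring kap O) : O C by rewrite r2E; apply: (vr_const vO).
pose S := P * (B ^+ 2 + B * C + B * E) + P * A * E + E ^+ 2 * (P * f2).
pose R := P * (A ^+ 2 + A * C) + (B ^+ 2 + B * E) * (P * f1)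
  + (C ^+ 2 + E ^+ 2 * f1) * (P * f2).
have KR : K R by rewrite /R; sfsolve.
have KS : K S by rewrite /S; sfsolve.
have NE : P * (h * tau2 h) = R + S * y1.
  have e1 : y1 ^+ 2 = y1 + f1 by rewrite -y1E; ring2 F2.
  have e2 : y2 ^+ 2 = y2 + f2 by rewrite -y2E; ring2 F2.
  by rewrite h2 hE /R /S; clearbody P f1 f2; ring2 F2 e1 e2.
have tN : P * (tau1 h * tau1 (tau2 h)) = R + S * y1 + S.
  rewrite -[in LHS](k1 _ KP) -!rmorphM NE (rmorphD tau1) (rmorphM tau1) (k1 _ KR) (k1 _ KS).
  by rewrite t1y1; ring2 F2.
have loc O : valuation_ring kap O -> O t -> maxid O P -> O R /\ maxid O S.
  move=> vO Ot mP; have [up Opf npf _ _] := caseB_ramified vO Ot mP.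
  have O1 : O (R + S * y1) by rewrite -NE; apply: (IM _ _ _ vO Ot) => //; apply: It2.
  have O2 : O (R + S * y1 + S).
    by rewrite -tN; apply: (IM _ _ _ vO Ot); apply: It1 => //; apply: It2.
  have OS : O S.
    have -> : S = R + S * y1 + S - (R + S * y1) by rewrite addrAC subrr add0r.
    exact: (vrB vO).
  apply: (AS_norm_local F2 vO sK up KR OS OS Opf npf).
  have -> : R ^+ 2 + R * S + S ^+ 2 * f1 = (R + S * y1) * (R + S * y1 + S).
    by rewrite -y1E; ring2 F2.
  exact: (vrM vO).
have E0 : E = 0.
  have [O vO [Ot mP]] := caseB_place.
  have [OR mS] := loc O vO Ot mP; have OP := maxidW vO mP.
  have [_ _ _ _ [nmt nmab]] := caseB_ramified vO Ot mP.
  apply: contrapT => /eqP nE; have e0 : e != 0.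
    by apply: contraNneq nE => e0; rewrite eE e0 rmorph0.
  have Oal : O (kap al) by vrsolve vO.
  have Obe : O (kap be) by vrsolve vO.
  have Og1 : O (kap g1) by vrsolve vO.
  have Og2 : O (kap g2) by vrsolve vO.
  have := (OB O vO, OC O vO, OE O vO) => -[[OB' OC'] OE'].
  have OEi : O E^-1 by rewrite eE -fmorphV; vrsolve vO.
  (* The vanishing of [S] says that [P * A] and [E * al * t] agree modulo the maximal ideal.
     Inserted into [P * R], this leaves [E ^+ 2 * (al * t) * (al * t + be)], a unit unless
     [E = 0]. *)
  pose X := P * A + E * kap al * t.
  have mX : maxid O X.
    have -> : X = E^-1 * (S - P * (B ^+ 2 + B * C + B * E + E ^+ 2 * kap g2)).
      by rewrite /S /X Pf2; clearbody P; field2 F2.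
    apply: (maxidMl vO) => //; apply: (maxidD vO) => //; apply: (maxidN vO).
    by apply: (maxidMr vO) => //; vrsolve vO.
  have m2 : maxid O (E ^+ 2 * (kap al * t) * (kap al * t + kap be)).
    have OX := maxidW vO mX.
    have -> : E ^+ 2 * (kap al * t) * (kap al * t + kap be) =
       X * X + P * (R + (B ^+ 2 + B * E) * (kap be + kap g1 * P)
         + (X + E * kap al * t) * C
         + (C ^+ 2 + E ^+ 2 * kap g1) * (kap al * t + kap g2 * P)
         + E ^+ 2 * kap g2 * kap be).
      by rewrite /R Pf1 Pf2 /X /f1; clearbody P; field2 F2.
    apply: (maxidD vO); first by apply: (maxidMr vO).
    by apply: (maxidMr vO) => //; vrsolve vO.
  case/(maxid_prime vO) : m2 => //; try by vrsolve vO.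
  case/(maxid_prime vO); try by vrsolve vO.
    by move/(maxid_sqr vO); rewrite eE; apply: (unit_const vO e0).
  by case/(maxid_prime vO) => //; apply: (unit_const vO al0).
rewrite E0 !(mul0r, addr0) in hE.
have [r0 r0E] : exists r0, A = kap r0.
  apply: (total_const KA) => O vO.
  have [Ot|nt] := pselect (O t); last first.
    have -> : A = h - (B * y1 + C * y2) by rewrite hE; ring2 F2.
    have := (OB O vO, OC O vO, Jy1 O vO nt, Jy2 O vO nt) => -[[[? ?] ?] ?].
    by apply: (vrB vO); [apply: Jh|vrsolve vO].
  have := (OB O vO, OC O vO, Pf1O O vO Ot, Pf2O O vO Ot) => -[[[OB' OC'] ?] ?].
  have [mP|nP] := pselect (maxid O P).
    have [OR _] := loc O vO Ot mP; apply: (caseB_integral vO Ot KA OC').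
    have -> : P * (A ^+ 2 + A * C) = R - (B ^+ 2 * (P * f1) + C ^+ 2 * (P * f2)).
      by rewrite /R E0; ring2 F2.
    by apply: (vrB vO) => //; vrsolve vO.
  have [OP Oi Of1 Of2] := caseB_etale vO Ot nP.
  have Oy1 : O y1 by apply: (vr_quadratic vO (vr1 vO) Of1); rewrite mul1r.
  have Oy2 : O y2 by apply: (vr_quadratic vO (vr1 vO) Of2); rewrite mul1r.
  have Oh : O h.
    apply: (vr_sqr vO); have -> : h ^+ 2 = P^-1 * (P * h ^+ 2) by field2 F2.
    by apply: (vrM vO) => //; apply: Ih.
  have -> : A = h - (B * y1 + C * y2) by rewrite hE; ring2 F2.
  by apply: (vrB vO) => //; vrsolve vO.
by exists r0, r1, r2; rewrite hE r0E r1E r2E.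
Qed.

(** All conjugates of [r0 + r1 * y1 + r2 * y2] are integral at a zero of [P]. This yields
    [r1 * (r1 + r2) = 0] and the vanishing of [r1 ^+ 2 * be + r2 ^+ 2 * (al * t)] there; as [f2] and
    [f1 + f2] have poles, [r1 = r2 = 0]. *)
Lemma caseB_const z : algebraicOver kap z -> exists c, z = kap c.
Proof.
move=> az; have all O : valuation_ring kap O -> O z.
  by move=> vO; apply: (algebraic_valuation vO).
have [|r0 [r1 [r2 zE]]] := caseB_span _ (fun O vO _ => all O vO).
  move=> O vO Ot; have ? := all O vO.
  by vrsolve vO; rewrite /P; vrsolve vO.
have Kf2' : K (y2 ^+ 2 + y2) by rewrite y2E.
have [tau1 [tau2 [tauK [t1y1 t1y2] [t2y1 t2y2] [tt1 tt2]]]] := biquad_conj F2 q1 q2 Kf2'.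
have [O vO [Ot mP]] := caseB_place; have OP := maxidW vO mP.
have [up Opf npf Opf2 [nmt nmab]] := caseB_ramified vO Ot mP.
have k1 x : K x -> tau1 x = x by move=> Kx; have [] := tauK x Kx.
have k3 x : K x -> tau2 x = x by move=> Kx; have [] := tauK x Kx.
have tz (tau : {rmorphism F -> F}) : (forall x, tau (kap x) = kap x) -> O (tau z).
  move=> tk; apply: (algebraic_valuation vO); have [p p0 rp] := az.
  exists p => //; have -> : map_poly kap p = map_poly tau (map_poly kap p).
    by apply/polyP => i; rewrite !coef_map /= tk.
  by rewrite fmorph_root.
pose A := kap r0; pose B := kap r1; pose C := kap r2.
have [[OA OB] OC] : (O A * O B) * O C by split; first split; apply: (vr_const vO).
pose S := B ^+ 2 + B * C; pose R := A ^+ 2 + A * C + C ^+ 2 * f2 + B ^+ 2 * f1.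
have z2 : tau2 z = z + C.
  by rewrite zE !(rmorphD, rmorphM) (k3 _ (Kc r0)) (k3 _ (Kc r1)) (k3 _ (Kc r2)) t2y1 t2y2 /C; ring2 F2.
have NE : z * tau2 z = R + S * y1.
  have e1 : y1 ^+ 2 = y1 + f1 by rewrite -y1E; ring2 F2.
  have e2 : y2 ^+ 2 = y2 + f2 by rewrite -y2E; ring2 F2.
  by rewrite z2 zE -/A -/B -/C /R /S; clearbody A B C f1 f2; ring2 F2 e1 e2.
have KA : K A := Kc r0; have KB : K B := Kc r1; have KC : K C := Kc r2.
have KR : K R by rewrite /R; sfsolve.
have KS : K S by rewrite /S; sfsolve.
have tN : tau1 z * tau1 (tau2 z) = R + S * y1 + S.
  rewrite -rmorphM NE (rmorphD tau1) (rmorphM tau1) (k1 _ KR) (k1 _ KS).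
  by rewrite t1y1; ring2 F2.
have O2 : O (tau2 z) by apply: tz => x; apply: (k3 _ (Kc x)).
have O1 : O (tau1 z) by apply: tz => x; apply: (k1 _ (Kc x)).
have O12 : O (tau1 (tau2 z)).
  by apply: (tz (tau1 \o tau2 : {rmorphism F -> F})) => x /=; rewrite (k3 _ (Kc x)) (k1 _ (Kc x)).
have OS : O S by rewrite /S; vrsolve vO.
have [OR mS] : O R /\ maxid O S.
  apply: (AS_norm_local F2 vO sK up KR OS OS Opf npf).
  have -> : R ^+ 2 + R * S + S ^+ 2 * f1 = (R + S * y1) * (R + S * y1 + S).
    by rewrite -y1E; ring2 F2.
  by rewrite -tN -NE; have ? := all O vO; vrsolve vO.
have m2 : maxid O (B ^+ 2 * kap be + C ^+ 2 * (kap al * t)).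
  have -> : B ^+ 2 * kap be + C ^+ 2 * (kap al * t) =
     P * (R + (A ^+ 2 + A * C) + B ^+ 2 * kap g1 + C ^+ 2 * kap g2).
    by rewrite /R /f1 /f2; clearbody A B C P; field2 F2.
  by apply: (maxidMr vO) => //; vrsolve vO.
have S0 : r1 * (r1 + r2) = 0.
  by apply: (maxid_const vO); rewrite !(rmorphM, rmorphD) mulrDr -expr2.
have no x y : O y -> ~ maxid O y -> maxid O (kap x ^+ 2 * y) -> x = 0.
  move=> Oy ny; case/(maxid_prime vO) => //; first by vrsolve vO.
  by move/(maxid_sqr vO)/(maxid_const vO).
have [r10 r20] : r1 = 0 /\ r2 = 0.
  have [r10|/eqP nr1] := eqVneq r1 0.
    split=> //; apply: (no r2 (kap al * t)); first by vrsolve vO.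
      by case/(maxid_prime vO) => //; [vrsolve vO|apply: (unit_const vO al0)].
    by move: m2; rewrite /B r10 rmorph0 expr0n mul0r add0r.
  move/eqP: S0; rewrite mulf_eq0 => /orP[/eqP //|/eqP /(addxx_eq0 k2) E12].
  case: nr1; apply: (no r1 (kap al * t + kap be)) => //; first by vrsolve vO.
  have -> : kap r1 ^+ 2 * (kap al * t + kap be) = B ^+ 2 * kap be + C ^+ 2 * (kap al * t).
    by rewrite /C -E12 -/B; ring2 F2.
  exact: m2.
by exists r0; rewrite zE r10 r20 rmorph0 !mul0r !addr0.
Qed.

End CaseB.

(** * Biquadratic covers *)

Section QuadLift.

Variables (K X M : fieldType) (iota : {rmorphism K -> X}) (phi : {rmorphism K -> M}).
Variables (y : X) (Y : M) (f : K).
Hypothesis X2 : 2%:R = 0 :> X.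
Hypothesis M2 : 2%:R = 0 :> M.
Hypothesis qy : quad (image_of iota) (@anything X) y.
Hypotheses (yE : y ^+ 2 + y = iota f) (YE : Y ^+ 2 + Y = phi f).

Let coordP z : exists ab : K * K, z = iota ab.1 + iota ab.2 * y.
Proof.
have [_ _ _ h] := qy; have /h[a [b [[a' ->] [b' ->] ->]]] := I : anything z.
by exists (a', b').
Qed.
Let co z := projT1 (cid (coordP z)).
Let lift z := phi (co z).1 + phi (co z).2 * Y.

Let liftE a b : lift (iota a + iota b * y) = phi a + phi b * Y.
Proof.
rewrite /lift /co; case: cid => -[a' b'] /= E.
have im c : image_of iota (iota c) by exists c.
have [E1 E2] := quad_uniq X2 qy (im _) (im _) (im _) (im _) E.
by rewrite (fmorph_inj iota E1) (fmorph_inj iota E2).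
Qed.

Let lift_zmod : zmod_morphism lift.
Proof.
move=> x z; have [[a b] ->] := coordP x; have [[c d] ->] := coordP z => /=.
have -> : iota a + iota b * y - (iota c + iota d * y) =
    iota (a - c) + iota (b - d) * y by rewrite !rmorphB; ring2 X2.
by rewrite !liftE !rmorphB; ring2 M2.
Qed.

Let lift_monoid : monoid_morphism lift.
Proof.
split.
  have -> : 1 = iota 1 + iota 0 * y by rewrite rmorph1 rmorph0 mul0r addr0.
  by rewrite liftE rmorph1 rmorph0 mul0r addr0.
have e1 : y ^+ 2 = y + iota f by rewrite -yE; ring2 X2.
have e2 : Y ^+ 2 = Y + phi f by rewrite -YE; ring2 M2.
move=> x z; have [[a b] ->] := coordP x; have [[c d] ->] := coordP z => /=.
have -> : (iota a + iota b * y) * (iota c + iota d * y) =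
    iota (a * c + b * d * f) + iota (a * d + b * c + b * d) * y.
  by rewrite !rmorphD !rmorphM; ring2 X2 e1.
by rewrite !liftE !rmorphD !rmorphM; ring2 M2 e2.
Qed.

HB.instance Definition _ := GRing.isZmodMorphism.Build X M lift lift_zmod.
HB.instance Definition _ := GRing.isMonoidMorphism.Build X M lift lift_monoid.

Lemma quad_lift : exists g : {rmorphism X -> M},
  (forall a, g (iota a) = phi a) /\ g y = Y.
Proof.
exists (lift : {rmorphism X -> M}); split=> [a|] /=.
  have -> : iota a = iota a + iota 0 * y by rewrite rmorph0 mul0r addr0.
  by rewrite liftE rmorph0 mul0r addr0.
have -> : y = iota 0 + iota 1 * y by rewrite rmorph1 rmorph0 mul1r add0r.
by rewrite liftE rmorph1 rmorph0 mul1r add0r.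
Qed.

End QuadLift.

Lemma quad_degree (F K : fieldType) (phi : {rmorphism F -> K}) y :
    2%:R = 0 :> K -> quad (image_of phi) (@anything K) y ->
  extension_degree phi 2.
Proof.
move=> K2 q; have [_ _ _ h] := q.
exists (fun i : 'I_2 => if i == ord0 then 1 else y) => z.
have E (c : 'rV[F]_2) : \sum_(i < 2) phi (c 0 i) * (if i == ord0 then 1 else y) =
    phi (c 0 ord0) + phi (c 0 ord_max) * y.
  by rewrite big_ord_recl big_ord1 /= mulr1; congr (_ + phi (c 0 _) * _); apply: val_inj.
have /h[a [b [[a' ->] [b' ->] ->]]] := I : anything z.
exists (\row_i if i == ord0 then a' else b'); split=> [|c]; rewrite E ?mxE //.
have im x : image_of phi (phi x) by exists x.
case/(quad_uniq K2 q (im _) (im _) (im _) (im _)) => E1 E2.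
apply/rowP => i; rewrite mxE; case: ifP => [/eqP ->|/negbT ni]; apply: (fmorph_inj phi) => //.
rewrite E2; congr (phi (c 0 _)); apply: val_inj => /=; move: ni.
by case: i => [[|[|]]].
Qed.

Lemma quad_separable (F K : fieldType) (phi : {rmorphism F -> K}) y :
    2%:R = 0 :> K -> quad (image_of phi) (@anything K) y ->
  separable_extension phi.
Proof.
move=> K2 q z; have [_ [f fE] _ h] := q.
have F2 : 2%:R = 0 :> F by apply: (fmorph_inj phi); rewrite rmorph_nat rmorph0.
have /h[a [b [[a' ->] [b' ->] ->]]] := I : anything z.
have [->|b0] := eqVneq b' 0.
  exists ('X - a'%:P).
    by rewrite unlock derivXsubC coprimep1.
  by rewrite rmorphB /= map_polyX map_polyC rmorph0 mul0r addr0 root_XsubC.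
exists ('X^2 + b' *: 'X + (a' ^+ 2 + a' * b' + b' ^+ 2 * f)%:P).
  rewrite unlock; apply/Bezout_eq1_coprimepP; exists (0, b'^-1%:P) => /=.
  rewrite mul0r add0r !derivD derivXn derivZ derivX derivC addr0 -mulr_natl.
  rewrite -polyC_natr F2 polyC0 mul0r add0r alg_polyC -polyCM mulVf //.
rewrite rmorphD (rmorphD _ 'X^2) /= map_polyXn map_polyZ map_polyX map_polyC /root !hornerE /=.
rewrite !(rmorphD, rmorphM, rmorphXn) -fE; apply/eqP.
by ring2 K2.
Qed.

Section Tower.

Variable k : fieldType.
Hypothesis k2 : 2%:R = 0 :> k.
Local Notation Kt := {fraction {poly k}}.
Local Notation t0 := (@FracField.tofrac {poly k} 'X).

Let Kt2 : 2%:R = 0 :> Kt.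
Proof. by rewrite -(rmorph_nat (ratfun_const k)) k2 rmorph0. Qed.

Lemma tower_exists (f1 f2 : Kt) : (forall a, a ^+ 2 + a <> f1) ->
    (forall a, a ^+ 2 + a <> f2) -> (forall a, a ^+ 2 + a <> f1 + f2) ->
  exists (M : fieldType) (phi : {rmorphism Kt -> M}) (y1 y2 : M) (K1 : M -> Prop),
    [/\ quad (image_of phi) K1 y1, quad K1 (@anything M) y2,
        y1 ^+ 2 + y1 = phi f1 & y2 ^+ 2 + y2 = phi f2].
Proof.
move=> n1 n2 n3.
have [L [iota [y [qy yE]]]] := quad_exists Kt2 n1.
have L2 : 2%:R = 0 :> L by rewrite -(rmorph_nat iota) Kt2 rmorph0.
(* If the equation of [f2] became solvable over the first extension, that of [f2] or of [f1 + f2]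
   would be solvable over k(t). *)
have nL a : a ^+ 2 + a <> iota f2.
  move=> aE; have [[b bE]|nK] := pselect (image_of iota a).
    by apply: (n2 b); apply: (fmorph_inj iota); rewrite rmorphD rmorphXn -bE.
  have Ka : image_of iota (a ^+ 2 + a) by exists f2.
  have [b bE] := quad_AS L2 qy I nK Ka.
  apply: (n3 b); apply: (fmorph_inj iota); rewrite !rmorphD rmorphXn -bE -yE -aE.
  by ring2 L2.
have [M [jota [z [qz zE]]]] := quad_exists L2 nL.
have M2 : 2%:R = 0 :> M by rewrite -(rmorph_nat jota) L2 rmorph0.
pose phi : {rmorphism Kt -> M} := (jota \o iota : {rmorphism Kt -> M}).
exists M, phi, (jota y), z, (image_of jota); split=> //; last by rewrite -rmorphXn -rmorphD yE.
have [_ _ ny h] := qy; split.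
- exact: image_subfield.
- by exists f1; rewrite -rmorphXn -rmorphD yE.
- by case=> a /(fmorph_inj jota) E; apply: ny; exists a.
- move=> x; split=> [[a ->]|[a [b [[a' ->] [b' ->] ->]]]].
    have /h[c [d [[c' ->] [d' ->] ->]]] := I : anything a.
    by exists (phi c'), (phi d'); split; [exists c'|exists d'|rewrite rmorphD rmorphM].
  by exists (iota a' + iota b' * y); rewrite rmorphD rmorphM.
Qed.

Lemma biquad_degree (M : fieldType) (phi : {rmorphism Kt -> M}) (y1 y2 : M) K1 :
    quad (image_of phi) K1 y1 -> quad K1 (@anything M) y2 ->
  extension_degree phi 4.
Proof.
move=> q1 q2; have M2 : 2%:R = 0 :> M by rewrite -(rmorph_nat phi) Kt2 rmorph0.
pose e : seq M := [:: 1; y1; y2; y1 * y2].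
exists (fun i : 'I_4 => e`_i) => z.
have E (c : 'rV[Kt]_4) : \sum_(i < 4) phi (c 0 i) * e`_i =
    (phi (c 0 (inord 0)) + phi (c 0 (inord 1)) * y1) +
    (phi (c 0 (inord 2)) + phi (c 0 (inord 3)) * y1) * y2.
  rewrite !big_ord_recl big_ord0 /= mulr1 addr0.
  transitivity (phi (c 0 (inord 0)) + (phi (c 0 (inord 1)) * y1 +
     (phi (c 0 (inord 2)) * y2 + phi (c 0 (inord 3)) * (y1 * y2)))); last by ring2 M2.
  congr (phi (c 0 _) + (phi (c 0 _) * _ + (phi (c 0 _) * _ + phi (c 0 _) * _)));
    by apply: val_inj; rewrite /= inordK.
have [_ _ _ h1] := q1; have [_ _ _ h2] := q2.
have im x : image_of phi (phi x) by exists x.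
have K1m u v : K1 (phi u + phi v * y1) by apply/h1; exists (phi u), (phi v).
have /h2[u [v [/h1[a [b [[a' ->] [b' ->] ->]]] /h1[c [d [[c' ->] [d' ->] ->]]] ->]]] :=
  I : anything z.
exists (\row_i [:: a'; b'; c'; d']`_i); split=> [|x]; rewrite E; first by rewrite !mxE !inordK.
case/(quad_uniq M2 q2 (K1m _ _) (K1m _ _) (K1m _ _) (K1m _ _)).
move=> /(quad_uniq M2 q1 (im _) (im _) (im _) (im _)) [E1 E3].
move=> /(quad_uniq M2 q1 (im _) (im _) (im _) (im _)) [E4 E5].
apply/rowP => i; rewrite mxE -[i]inord_val; apply: (fmorph_inj phi).
by case: i => [[|[|[|[|//]]]]] ?; rewrite inordK.
Qed.

(** The last hypothesis ranges over all towers with these equations, since the field is only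
    produced inside the proof; it makes [k] algebraically closed in that field. *)
Lemma tower_curve (f1 f2 : Kt) : (forall a, a ^+ 2 + a <> f1) ->
    (forall a, a ^+ 2 + a <> f2) -> (forall a, a ^+ 2 + a <> f1 + f2) ->
    (forall (M : fieldType) (kap : {rmorphism k -> M}) (phi : {rmorphism Kt -> M})
        (y1 y2 : M) K1,
      (forall c, phi (ratfun_const k c) = kap c) ->
      quad (ratl kap (phi t0)) K1 y1 -> quad K1 (@anything M) y2 ->
      y1 ^+ 2 + y1 = phi f1 -> y2 ^+ 2 + y2 = phi f2 ->
      forall z, algebraicOver kap z -> exists c, z = kap c) ->
  exists (C : curve k) (phi : {rmorphism Kt -> C}) (y1 y2 : C) K1,
    [/\ (forall c, phi (ratfun_const k c) = const C c),
        quad (ratl (const C) (phi t0)) K1 y1, quad K1 (@anything C) y2,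
        y1 ^+ 2 + y1 = phi f1 & y2 ^+ 2 + y2 = phi f2].
Proof.
move=> n1 n2 n3 hc.
have [M [phi [y1 [y2 [K1 [q1 q2 y1E y2E]]]]]] := tower_exists n1 n2 n3.
pose kap : {rmorphism k -> M} := (phi \o ratfun_const k : {rmorphism k -> M}).
have kc c : phi (ratfun_const k c) = kap c by [].
have q1' := quad_ext (frac_image kc) q1.
have fin : exists phi : {rmorphism Kt -> M},
    (forall c, phi (ratfun_const k c) = kap c) /\ exists n, extension_degree phi n.
  by exists phi; split=> //; exists 4%N; apply: biquad_degree q1 q2.
exists (@Curve k M kap fin (hc M kap phi y1 y2 K1 kc q1' q2 y1E y2E)).
by exists phi, y1, y2, K1.
Qed.

End Tower.

Section Quotient.

Variables (k : fieldType).
Hypothesis k2 : 2%:R = 0 :> k.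
Variable M : curve k.
Local Notation Kt := {fraction {poly k}}.
Variable phi : {rmorphism Kt -> M}.
Hypothesis phi_const : forall c, phi (ratfun_const k c) = const M c.
Local Notation t := (phi (@FracField.tofrac {poly k} 'X)).

(** The intermediate field [L] is a subset and not a type, so the quotient is built afresh as an
    Artin-Schreier extension of k(t) and mapped onto [L] by sending [y] to [Y]. *)
Lemma quotient_curve (L : M -> Prop) (Y Y' : M) (f : Kt) :
    quad (ratl (const M) t) L Y -> quad L (@anything M) Y' -> Y ^+ 2 + Y = phi f ->
  exists (X : curve k) (top : curve_hom M X) (bot : curve_hom X (projective_line k)) (y : X),
    [/\ hom_degree top 2 /\ hom_separable top, hom_degree bot 2 /\ hom_separable bot,
        (forall a, top (bot a) = phi a) /\ (forall z, image_of top z <-> L z),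
        y ^+ 2 + y = bot f & forall z, exists a b, z = bot a + bot b * y].
Proof.
move=> q1 q2 YE; have M2 := char2_curve M k2.
have Kt2 : 2%:R = 0 :> Kt by rewrite -(rmorph_nat (ratfun_const k)) k2 rmorph0.
have imE z : image_of phi z <-> ratl (const M) t z by apply: frac_image.
have nf a : a ^+ 2 + a <> f.
  move=> E; have [_ _ ny _] := q1; apply/ny/imE.
  have : (Y + phi a) * (Y + phi a + 1) = 0.
    have e : Y ^+ 2 = Y + (phi a ^+ 2 + phi a) by rewrite -rmorphXn -rmorphD E -YE; ring2 M2.
    by ring2 M2 e.
  move/eqP; rewrite mulf_eq0 => /orP[]/eqP.
    by move/(addxx_eq0 M2) ->; exists a.
  by rewrite -addrA => /(addxx_eq0 M2) ->; exists (a + 1); rewrite rmorphD rmorph1.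
have [X [iota [y [qy yE]]]] := quad_exists Kt2 nf.
have X2 : 2%:R = 0 :> X by rewrite -(rmorph_nat iota) Kt2 rmorph0.
have [g [gi gy]] := quad_lift X2 M2 qy yE YE.
pose kap : {rmorphism k -> X} := (iota \o ratfun_const k : {rmorphism k -> X}).
have kc c : iota (ratfun_const k c) = kap c by [].
have gk c : g (kap c) = const M c by rewrite /kap /= gi phi_const.
have fin : exists phi : {rmorphism Kt -> X},
    (forall c, phi (ratfun_const k c) = kap c) /\ exists n, extension_degree phi n.
  by exists iota; split=> //; exists 2%N; apply: quad_degree qy.
have closed z : algebraicOver kap z -> exists c, z = kap c.
  case=> p p0 rp; have [|c cE] := curve_const_closed (z := g z).
    exists p => //; have -> : map_poly (const M) p = map_poly g (map_poly kap p).
      by apply/polyP => i; rewrite !coef_map /= gk.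
    by rewrite fmorph_root.
  by exists c; apply: (fmorph_inj g); rewrite cE gk.
pose X' : curve k := @Curve k X kap fin closed.
have [_ _ _ h] := qy.
have imL z : image_of g z <-> L z.
  have [_ _ _ hL] := q1; split.
    case=> x ->; have /h[a [b [[a' ->] [b' ->] ->]]] := I : anything x.
    apply/hL; exists (phi a'), (phi b'); rewrite rmorphD rmorphM !gi gy.
    by split=> //; apply/imE; [exists a'|exists b'].
  case/hL => _ [_ [/imE[a ->] /imE[b ->] ->]].
  by exists (iota a + iota b * y); rewrite rmorphD rmorphM !gi gy.
have q3 : quad (image_of g) (@anything M) Y' by apply: quad_ext q2 => z; rewrite imL.
exists X', (@CurveHom k M X' g gk), (@CurveHom k X' (projective_line k) iota kc), y.
split=> //.
- by split; [apply: (quad_degree M2 q3)|apply: (quad_separable M2 q3)].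
- by split; [apply: (quad_degree X2 qy)|apply: (quad_separable X2 qy)].
move=> z; have /h[a [b [[a' ->] [b' ->] ->]]] := I : anything z.
by exists a', b'.
Qed.

End Quotient.

(** * Differentials on a biquadratic curve *)

Section BiquadraticCurve.

Variable k : fieldType.
Hypothesis k2 : 2%:R = 0 :> k.
Hypothesis k_perfect : forall c : k, exists s, c = s ^+ 2.
Variable C : curve k.
Let F2 : 2%:R = 0 :> C := char2_curve C k2.
Local Notation kap := (const C).
Variables (t y1 y2 : C) (K1 : C -> Prop).
Hypothesis tr : transcendental kap t.
Local Notation K := (ratl kap t).
Hypothesis q1 : quad K K1 y1.
Hypothesis q2 : quad K1 (@anything C) y2.
Hypothesis Kf2 : K (y2 ^+ 2 + y2).

Lemma biquad_derivation : exists D0, [/\ derivation kap D0, D0 t = 1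
  & forall D, derivation kap D -> forall z, D z = D t * D0 z].
Proof.
have [D [dD Dt]] := der_ratE F2 tr.
have [D1 [dD1 D1K _]] := der_extend F2 q1 (rat_const kap t) dD.
have K1c c : K1 (kap c) by apply/(quad_sub q1)/rat_const.
have [D2 [dD2 D2K _]] := der_extend F2 q2 K1c dD1.
have d2 := derivation_all (fun=> I) dD2.
have D2t : D2 t = 1 by rewrite D2K ?D1K //; [exact: rat_gen|apply/(quad_sub q1)/rat_gen].
exists D2; split=> // D' dD' z.
pose D3 z := D' z + D' t * D2 z.
have dD3 : derivation kap D3 by apply: der_sub => //; apply: der_scale.
apply: (addxx_eq0 F2); rewrite -/(D3 z).
have D3K a : K a -> D3 a = 0.
  by move=> Ka; apply: (der_rat0 F2 dD3 Ka); rewrite /D3 D2t mulr1 addxx.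
have D3K1 a : K1 a -> D3 a = 0 by apply: (der_quad0 F2 dD3 q1).
exact: (der_quad0 F2 dD3 q2).
Qed.

Lemma genus_intro g (D0 : C -> C) (B : 'I_g -> C) : derivation kap D0 -> D0 t = 1 ->
    (forall D, derivation kap D -> forall z, D z = D t * D0 z) ->
    (forall i, regular_form [:: (B i, t)]) ->
    (forall w, regular_form w ->
       exists c : 'I_g -> k, form_at w D0 = \sum_i kap (c i) * B i) ->
    (forall c : 'I_g -> k, \sum_i kap (c i) * B i = 0 -> forall i, c i = 0) ->
  has_genus C g.
Proof.
move=> dD0 D0t all rB span free; exists (fun i => [:: (B i, t)]) => // w rw.
have [c cE] := span w rw.
have B0 i : form_at [:: (B i, t)] D0 = B i by rewrite /form_at big_seq1 /= D0t mulr1.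
exists (\row_i c i); split=> [D dD|c' c'E].
  rewrite (form_at_scale w (all D dD)) cE mulr_sumr; apply: eq_bigr => i _.
  by rewrite mxE (form_at_scale _ (all D dD)) B0 mulrCA.
apply/rowP => i; rewrite mxE; apply: (addxx_eq0 k2).
apply: (free (fun i => c i + c' 0 i)).
under eq_bigr => j _ do rewrite rmorphD mulrDl.
rewrite big_split /= -cE -[RHS](addxx F2 (form_at w D0)); congr (_ + _).
by rewrite (c'E D0 dD0); apply: eq_bigr => j _; rewrite B0.
Qed.

(** Elements of this shape form a subfield. It contains [t] and the perfect field [k], hence k(t),
    and each Artin-Schreier generator, as the sum of [y ^+ 2 + y] and a square. *)
Lemma biquad_sqr z : exists a b, z = a ^+ 2 + b ^+ 2 * t.
Proof.
pose S z := exists a b, z = a ^+ 2 + b ^+ 2 * t.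
have sS : is_subfield S.
  split.
  - by exists 1, 0; rewrite expr1n expr0n mul0r addr0.
  - move=> _ _ [a [b ->]] [c [d ->]]; exists (a - c), (b - d).
    by ring2 F2.
  - move=> _ _ [a [b ->]] [c [d ->]]; exists (a * c + b * d * t), (a * d + b * c).
    by ring2 F2.
  - move=> x [a [b xE]]; have [->|x0] := eqVneq x 0.
      by exists 0, 0; rewrite invr0 expr0n mul0r addr0.
    exists (a / x), (b / x); transitivity ((a ^+ 2 + b ^+ 2 * t) / x ^+ 2).
      by rewrite -xE; field2 F2.
    by field2 F2.
have KS x : K x -> S x.
  apply: (rat_min sS) => [c|]; last by exists 0, 1; rewrite expr0n expr1n mul1r add0r.
  by have [s ->] := k_perfect c; exists (kap s), 0; rewrite rmorphXn expr0n mul0r addr0.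
have sq x : S (x ^+ 2) by exists x, 0; rewrite expr0n mul0r addr0.
have AS_gen y : K (y ^+ 2 + y) -> S y.
  move=> Ky; have -> : y = (y ^+ 2 + y) - y ^+ 2 by rewrite addrAC subrr add0r.
  by apply: (sfB sS) => //; apply: KS.
have [_ Kf1 _ h1] := q1; have [_ _ _ h2] := q2.
have K1S x : K1 x -> S x.
  by case/h1=> a [b [Ka Kb ->]]; have := (KS a Ka, KS b Kb, AS_gen y1 Kf1) => -[[? ?] ?]; sfsolve.
have /h2[a [b [Ka Kb ->]]] := I : anything z.
have := (K1S a Ka, K1S b Kb, AS_gen y2 Kf2) => -[[? ?] ?].
by change (S (a + b * y2)); sfsolve.
Qed.

(* On a hyperelliptic curve the ratios of regular forms do not generate. *)
Lemma biquad_nonhyperelliptic w0 D0 : derivation kap D0 -> regular_form w0 ->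
    form_at w0 D0 != 0 ->
    (forall S : C -> Prop, is_subfield S -> (forall c, S (kap c)) ->
      (forall w w', regular_form w -> regular_form w' ->
         S (form_at w D0 / form_at w' D0)) -> forall z, S z) ->
  ~ hyperelliptic C.
Proof.
move=> dD0 r0 nz gen [_ [f deg2]].
have [r [trr [allr|[[z nz'] hr]]]] := hyperelliptic_ratios k2 k_perfect biquad_sqr deg2.
  by move: nz; rewrite (genus0_regular k2 trr allr r0 dD0) eqxx.
apply: nz'; apply: (gen (ratl kap r)); [exact: rat_subfield|exact: rat_const|].
by move=> w w' rw rw'; apply: hr.
Qed.

End BiquadraticCurve.

Section CaseACurve.

Variable k : fieldType.
Hypothesis k2 : 2%:R = 0 :> k.
Hypothesis k_perfect : forall c : k, exists s, c = s ^+ 2.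
Variable C : curve k.
Let F2 : 2%:R = 0 :> C := char2_curve C k2.
Local Notation kap := (const C).
Variables (t y1 y2 : C) (K1 : C -> Prop).
Hypothesis tr : transcendental kap t.
Local Notation K := (ratl kap t).
Hypothesis q1 : quad K K1 y1.
Hypothesis q2 : quad K1 (@anything C) y2.
Variables a b e c1 c2 : k.
Hypotheses (a0 : a != 0) (b0 : b != 0) (e0 : e != 0).
Let f1 := kap a / t + kap b / (t + 1) + kap c1.
Let f2 := kap b / (t + 1) + kap e * t + kap c2.
Hypotheses (y1E : y1 ^+ 2 + y1 = f1) (y2E : y2 ^+ 2 + y2 = f2).

Let t0 : t != 0. Proof. exact: transcendental_nz tr. Qed.
Let t1 : t + 1 != 0.
Proof.
have := transcendental_const 1 tr; rewrite rmorph1.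
by apply: contraNneq => /(addxx_eq0 F2) ->.
Qed.
Let sK : is_subfield K := rat_subfield kap t.
Let Kt : K t := rat_gen kap t.
Let Kc c : K (kap c) := rat_const kap t c.
Let Kf2 : K (y2 ^+ 2 + y2).
Proof.
by rewrite y2E; have := (Kc b, Kc e, Kc c2, sf1 sK) => -[[[? ?] ?] ?]; rewrite /f2; sfsolve.
Qed.
Let G := t * (t + 1).
Let G0 : G != 0. Proof. by rewrite mulf_neq0. Qed.
Let B (i : 'I_3) := [:: 1 / G; t / G; (t * y1 + y2) / G]`_i.

(** The combination h = [t * y1 + y2] satisfies h^2 + h = [G * y1 + (t ^+ 2 * f1 + f2)], where
    [t ^+ 2] removes the pole at 0 and the poles at 1 cancel. *)
Let numer_finite O : valuation_ring kap O -> O t -> O (t * y1 + y2).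
Proof.
move=> vO Ot; have Og : O (G * y1).
  apply: (vr_quadratic vO (b := G) (c := G ^+ 2 * f1)).
  - by rewrite /G; vrsolve vO.
  - have -> : G ^+ 2 * f1 = G * (kap a * (t + 1) + kap b * t + G * kap c1).
      by rewrite /G /f1; field2 F2.
    by rewrite /G; vrsolve vO.
  - by rewrite -y1E; ring2 F2.
apply: (vr_quadratic vO (b := 1) (c := G * y1 + (t ^+ 2 * f1 + f2))) => //.
- exact: (vr1 vO).
- have -> : t ^+ 2 * f1 + f2 =
      kap a * t + kap b * (t + 1) + kap c1 * t ^+ 2 + kap e * t + kap c2.
    by rewrite /f1 /f2; field2 F2.
  by vrsolve vO.
- have e1 : y1 ^+ 2 = y1 + f1 by rewrite -y1E; ring2 F2.
  have e2 : y2 ^+ 2 = y2 + f2 by rewrite -y2E; ring2 F2.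
  by rewrite /G; clearbody f1 f2; ring2 F2 e1 e2.
Qed.

Let numer_infinite O : valuation_ring kap O -> ~ O t -> O ((t * y1 + y2) / t).
Proof.
move=> vO nt; have [[Oi _ _ _ Osf] [_ Of1]] := caseA_infinite F2 tr a b c1 c2 e0 vO nt.
have Oy1 : O y1 by apply: (vr_quadratic vO (vr1 vO) Of1); rewrite mul1r.
have Oy2 : O (y2 / t).
  apply: (vr_quadratic vO (b := t^-1) (c := t^-1 * (t^-1 * f2))) => //.
    exact: (vrM vO).
  by rewrite -y2E; field2 F2.
have -> : (t * y1 + y2) / t = y1 + y2 / t by field2 F2.
exact: (vrD vO).
Qed.

Let B_regular D0 : derivation kap D0 -> D0 t = 1 ->
    (forall D, derivation kap D -> forall z, D z = D t * D0 z) ->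
  forall i, regular_form [:: (B i, t)].
Proof.
move=> dD0 D0t all i; apply: (regular_intro k2 dD0 all) => O vO.
have [c [g [[_ Og Oc nc] h]]] := caseA_parameter F2 tr q1 q2 a0 b0 e0 y1E y2E vO dD0 D0t.
exists c, g; split=> //; first exact: maxid_nz nc.
rewrite /form_at big_seq1 /= D0t mulr1; apply: (vrM vO); last exact: (vr_unit Oc nc).
case: h => [[Ot [O1 _]]|[nt [O1 _]]].
  have -> : c * B i = c / G * (G * B i) by field2 F2.
  apply: (vrM vO) => //; rewrite mulrC /B; have O2 := numer_finite vO Ot; have O3 := vr1 vO.
  by case: i => [[|[|[|//]]]] ? /=; rewrite divfK.
have -> : c * B i = c * t / G * (G * B i / t) by field2 F2.
have O2 := numer_infinite vO nt; have O3 := vr1 vO; have O4 := maxidW vO (maxidV nt).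
apply: (vrM vO) => //; rewrite mulrC [G * _]mulrC /B.
case: i => [[|[|[|//]]]] ? /=; rewrite divfK //.
- by rewrite mulr1.
- by rewrite mulVf.
- by rewrite mulrC.
Qed.

Let B_sum (c : 'I_3 -> k) : \sum_i kap (c i) * B i =
  (kap (c (inord 0)) + kap (c (inord 1)) * t + kap (c (inord 2)) * (t * y1 + y2)) / G.
Proof.
rewrite /B; transitivity (kap (c (inord 0)) * (1 / G) + (kap (c (inord 1)) * (t / G) +
   kap (c (inord 2)) * ((t * y1 + y2) / G))); last by field2 F2.
rewrite !big_ord_recl big_ord0 addr0.
by congr (kap (c _) * _ + (kap (c _) * _ + kap (c _) * _)); apply: val_inj; rewrite /= inordK.
Qed.

Lemma caseA_genus : has_genus C 3.
Proof.
have [D0 [dD0 D0t all]] := biquad_derivation k2 tr q1 q2.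
have rB := B_regular dD0 D0t all.
apply: (genus_intro k2 dD0 D0t all rB) => [w rw|c].
  have hO O : valuation_ring kap O -> (O t -> O (form_at w D0 * G)) /\
      (~ O t -> O (form_at w D0 * G / t)).
    move=> vO.
    have [c [g [[st _ _ nc] h]]] :=
      caseA_parameter F2 tr q1 q2 a0 b0 e0 y1E y2E vO dD0 D0t.
    have Ow : O (c * form_at w D0).
      rewrite -(form_at_scale w (D := fun z => c * D0 z) (fun z => erefl)).
      by apply: (regular_stable rw vO (der_scale F2 dD0 c)) => z Oz; apply: st.
    have : c != 0 by apply: contraNneq (maxid_nz nc) => ->; rewrite mul0r.
    move=> c0.
    case: h => [[Ot [_ O1]]|[nt [_ O1]]]; split=> // _.
      have -> : form_at w D0 * G = c * form_at w D0 * (G / c) by field2 F2.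
      exact: (vrM vO).
    have -> : form_at w D0 * G / t = c * form_at w D0 * (G / (c * t)) by field2 F2.
    exact: (vrM vO).
  have [||r0 [r1 [c hE]]] := caseA_span F2 tr q1 q2 a0 b0 e0 y1E y2E (h := form_at w D0 * G).
  - by move=> O vO Ot; apply: (proj1 (hO O vO)).
  - move=> O vO Oi; have [Ot|nt] := pselect (O t); last by apply: (proj2 (hO O vO)).
    by apply: (vrM vO) => //; apply: (proj1 (hO O vO)).
  exists (fun i => [:: r0; r1; c]`_i); rewrite B_sum !inordK //= -hE.
  by rewrite mulfK.
rewrite B_sum => /eqP; rewrite mulf_eq0 invr_eq0 (negPf G0) orbF => /eqP E.
set x0 := c (inord 0) in E; set x1 := c (inord 1) in E; set x2 := c (inord 2) in E.
have K1K := quad_sub q1; have sK1 := quad_subfield F2 q1; have K1y := quad_gen q1.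
have [E1 E2] : kap x0 + kap x1 * t + kap x2 * t * y1 = 0 /\ kap x2 = 0.
  apply: (quad_uniq F2 q2); last by rewrite mul0r addr0 -[RHS]E; ring2 F2.
  - have := (K1K _ (Kc x0), K1K _ (Kc x1), K1K _ (Kc x2), K1K _ Kt) => -[[[? ?] ?] ?].
    by sfsolve.
  - by apply: K1K.
  - exact: (sf0 sK1).
  - exact: (sf0 sK1).
have x20 : x2 = 0 by apply: (fmorph_inj kap); rewrite E2 rmorph0.
have : pev kap t (x1 *: 'X + x0%:P) = 0.
  by rewrite !pevE -[RHS]E1 x20 rmorph0; ring2 F2.
have [p0 _|nz /eqP] := eqVneq (x1 *: 'X + x0%:P) 0; last by rewrite (negPf (tr nz)).
have x00 : x0 = 0 by have := coef0 k 0; rewrite -p0 coefD coefZ coefX coefC mulr0 add0r.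
have x10 : x1 = 0 by have := coef0 k 1; rewrite -p0 coefD coefZ coefX coefC mulr1 addr0.
move=> i; rewrite -[i]inord_val.
by case: i => [[|[|[|//]]]].
Qed.

(** The ratios of the basis forms are [t] and [t * y1 + y2], and the quadratic equation of the
    latter returns [y1]; hence they generate the whole field. *)
Lemma caseA_nonhyperelliptic : ~ hyperelliptic C.
Proof.
have [D0 [dD0 D0t all]] := biquad_derivation k2 tr q1 q2.
have rB := B_regular dD0 D0t all.
have BE i : form_at [:: (B i, t)] D0 = B i by rewrite /form_at big_seq1 /= D0t mulr1.
apply: (biquad_nonhyperelliptic k2 k_perfect q1 q2 Kf2 dD0 (rB (inord 0))).
  by rewrite BE /B inordK //= mul1r invr_eq0.
move=> S sS Sk Sr.
have St : S t.
  have := Sr _ _ (rB (inord 1)) (rB (inord 0)); rewrite !BE /B !inordK //=.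
  by have -> : t / G / (1 / G) = t by field2 F2.
have Sh : S (t * y1 + y2).
  have := Sr _ _ (rB (inord 2)) (rB (inord 0)); rewrite !BE /B !inordK //=.
  by have -> : (t * y1 + y2) / G / (1 / G) = t * y1 + y2 by field2 F2.
have S1 := sf1 sS; have := (Sk a, Sk b, Sk e, Sk c1, Sk c2) => -[[[[? ?] ?] ?] ?].
have Sy1 : S y1.
  have -> : y1 = ((t * y1 + y2) ^+ 2 + (t * y1 + y2) + (t ^+ 2 * f1 + f2)) / G.
    have e1 : y1 ^+ 2 = y1 + f1 by rewrite -y1E; ring2 F2.
    have e2 : y2 ^+ 2 = y2 + f2 by rewrite -y2E; ring2 F2.
    apply: (mulIf G0); rewrite divfK // /G; clearbody f1 f2; ring2 F2 e1 e2.
  by rewrite /f1 /f2 /G; sfsolve.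
have Sy2 : S y2.
  have -> : y2 = (t * y1 + y2) - t * y1 by rewrite addrAC subrr add0r.
  by apply: (sfB sS) => //; apply: (sfM sS).
have KS x : K x -> S x by apply: (rat_min sS).
move=> z; have [A [B' [C' [E [[KA KB KC KE] ->]]]]] := biquad_coord F2 q1 q2 z.
by have := (KS _ KA, KS _ KB, KS _ KC, KS _ KE) => -[[[? ?] ?] ?]; sfsolve.
Qed.

End CaseACurve.

Section CaseBCurve.

Variable k : fieldType.
Hypothesis k2 : 2%:R = 0 :> k.
Hypothesis k_perfect : forall c : k, exists s, c = s ^+ 2.
Variable C : curve k.
Let F2 : 2%:R = 0 :> C := char2_curve C k2.
Local Notation kap := (const C).
Variables (t y1 y2 : C) (K1 : C -> Prop).
Hypothesis tr : transcendental kap t.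
Local Notation K := (ratl kap t).
Hypothesis q1 : quad K K1 y1.
Hypothesis q2 : quad K1 (@anything C) y2.
Variables c be al g1 g2 : k.
Hypotheses (c0 : c != 0) (be0 : be != 0) (al0 : al != 0).
Hypothesis N0 : be ^+ 2 + al * be + c * al ^+ 2 != 0.
Let P := t ^+ 2 + t + kap c.
Let f1 := kap be / P + kap g1.
Let f2 := kap al * t / P + kap g2.
Hypotheses (y1E : y1 ^+ 2 + y1 = f1) (y2E : y2 ^+ 2 + y2 = f2).

Let P0 : P != 0.
Proof.
have -> : P = pev kap t ('X^2 + ('X + c%:P)) by rewrite !pevE addrA.
apply: tr; rewrite -size_poly_eq0 size_polyDl ?size_polyXn //.
by rewrite size_XaddC.
Qed.
Let sK : is_subfield K := rat_subfield kap t.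
Let Kt : K t := rat_gen kap t.
Let Kc x : K (kap x) := rat_const kap t x.
Let Kf2 : K (y2 ^+ 2 + y2).
Proof.
by rewrite y2E; have := (Kc al, Kc c, Kc g2, sf1 sK) => -[[[? ?] ?] ?]; rewrite /f2 /P; sfsolve.
Qed.
Let numer (i : 'I_3) := [:: 1; y1; y2]`_i.
Let B (i : 'I_3) := numer i / P.

(** [P * y] is integral because [P * f] is, and [P * y ^+ 2 = P * y + P * f]. *)
Let numer_finite O i : valuation_ring kap O -> O t -> O (P * numer i ^+ 2).
Proof.
move=> vO Ot; have OP : O P by rewrite /P; vrsolve vO.
have h y f : y ^+ 2 + y = f -> O (P * f) -> O (P * y ^+ 2).
  move=> yE Of; have Oy : O (P * y).
    apply: (vr_quadratic vO OP (vrM vO OP Of)); rewrite -yE; ring2 F2.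
  have -> : P * y ^+ 2 = P * y + P * f by rewrite -yE; ring2 F2.
  exact: (vrD vO).
rewrite /numer; case: i => [[|[|[|//]]]] ? /=.
- by rewrite expr1n mulr1.
- apply: (h _ _ y1E); have -> : P * f1 = kap be + kap g1 * P by rewrite /f1; field2 F2.
  by vrsolve vO.
- apply: (h _ _ y2E); have -> : P * f2 = kap al * t + kap g2 * P by rewrite /f2; field2 F2.
  by vrsolve vO.
Qed.

Let numer_infinite O i : valuation_ring kap O -> ~ O t -> O (numer i).
Proof.
move=> vO nt; have t0 := transcendental_nz tr.
have [_ _ _ Of1 Of2] := caseB_infinite F2 tr c be al g1 g2 vO nt.
rewrite /numer; case: i => [[|[|[|//]]]] ? /=; first exact: (vr1 vO).
  by apply: (vr_quadratic vO (vr1 vO) Of1); rewrite mul1r.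
by apply: (vr_quadratic vO (vr1 vO) Of2); rewrite mul1r.
Qed.

Let B_regular D0 : derivation kap D0 -> D0 t = 1 ->
    (forall D, derivation kap D -> forall z, D z = D t * D0 z) ->
  forall i, regular_form [:: (B i, t)].
Proof.
move=> dD0 D0t all i; apply: (regular_intro k2 dD0 all) => O vO.
have [s [g [[_ Og Os ns] h]]] :=
  caseB_parameter k2 F2 k_perfect tr q1 q2 c0 be0 al0 N0 y1E y2E vO dD0 D0t.
exists s, g; split=> //; first exact: maxid_nz ns.
rewrite /form_at big_seq1 /= D0t mulr1; apply: (vrM vO); last exact: (vr_unit Os ns).
rewrite /B mulrA; case: h => [[Ot h]|[nt h]]; apply/h.
  exact: numer_finite.
exact: numer_infinite.
Qed.

Let B_sum (x : 'I_3 -> k) : \sum_i kap (x i) * B i =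
  (kap (x (inord 0)) + kap (x (inord 1)) * y1 + kap (x (inord 2)) * y2) / P.
Proof.
rewrite /B; transitivity (kap (x (inord 0)) * (1 / P) + (kap (x (inord 1)) * (y1 / P) +
   kap (x (inord 2)) * (y2 / P))); last by field2 F2.
rewrite !big_ord_recl big_ord0 addr0.
by congr (kap (x _) * _ + (kap (x _) * _ + kap (x _) * _)); apply: val_inj; rewrite /= inordK.
Qed.

Lemma caseB_genus : has_genus C 3.
Proof.
have [D0 [dD0 D0t all]] := biquad_derivation k2 tr q1 q2.
have rB := B_regular dD0 D0t all.
apply: (genus_intro k2 dD0 D0t all rB) => [w rw|x].
  have hO O : valuation_ring kap O -> (O t -> O (P * (form_at w D0 * P) ^+ 2)) /\
      (~ O t -> O (form_at w D0 * P)).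
    move=> vO; have [s [g [[st _ _ _] h]]] :=
      caseB_parameter k2 F2 k_perfect tr q1 q2 c0 be0 al0 N0 y1E y2E vO dD0 D0t.
    have Ow : O (s * (form_at w D0 * P) / P).
      rewrite mulrA mulfK // -(form_at_scale w (D := fun z => s * D0 z) (fun z => erefl)).
      by apply: (regular_stable rw vO (der_scale F2 dD0 s)) => z Oz; apply: st.
    by case: h => [[Ot h]|[nt h]]; split=> // _; apply/h.
  have [||r0 [r1 [r2 hE]]] := caseB_span k2 F2 tr q1 q2 c0 be0 al0 N0 y1E y2E
     (h := form_at w D0 * P).
  - by move=> O vO Ot; apply: (proj1 (hO O vO)).
  - by move=> O vO Oi; apply: (proj2 (hO O vO)).
  exists (fun i => [:: r0; r1; r2]`_i); rewrite B_sum !inordK //= -hE.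
  by rewrite mulfK.
rewrite B_sum => /eqP; rewrite mulf_eq0 invr_eq0 (negPf P0) orbF => /eqP E.
set x0 := x (inord 0) in E; set x1 := x (inord 1) in E; set x2 := x (inord 2) in E.
have K1K := quad_sub q1; have sK1 := quad_subfield F2 q1; have K1y := quad_gen q1.
have [E1 E2] : kap x0 + kap x1 * y1 = 0 /\ kap x2 = 0.
  apply: (quad_uniq F2 q2); last by rewrite mul0r addr0 -[RHS]E; ring2 F2.
  - by have := (K1K _ (Kc x0), K1K _ (Kc x1)) => -[? ?]; sfsolve.
  - by apply: K1K.
  - exact: (sf0 sK1).
  - exact: (sf0 sK1).
have [E3 E4] : kap x0 = 0 /\ kap x1 = 0.
  apply: (quad_uniq F2 q1) => //; try exact: (sf0 sK).
  by rewrite mul0r addr0 -[RHS]E1.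
have z y : kap y = 0 -> y = 0 by rewrite -[0 in X in X -> _](rmorph0 kap) => /fmorph_inj.
move=> i; rewrite -[i]inord_val.
by case: i => [[|[|[|//]]]] ? /=; apply: z.
Qed.

(** The ratios of the basis forms are [y1] and [y2]; the equation of the first returns [P], and then
    that of the second returns [t]. *)
Lemma caseB_nonhyperelliptic : ~ hyperelliptic C.
Proof.
have [D0 [dD0 D0t all]] := biquad_derivation k2 tr q1 q2.
have rB := B_regular dD0 D0t all.
have BE i : form_at [:: (B i, t)] D0 = numer i / P by rewrite /form_at big_seq1 /= D0t mulr1.
apply: (biquad_nonhyperelliptic k2 k_perfect q1 q2 Kf2 dD0 (rB (inord 0))).
  by rewrite BE /numer inordK //= mul1r invr_eq0.
move=> S sS Sk Sr.
have Sy1 : S y1.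
  have := Sr _ _ (rB (inord 1)) (rB (inord 0)); rewrite !BE /numer !inordK //=.
  by have -> : y1 / P / (1 / P) = y1 by field2 F2.
have Sy2 : S y2.
  have := Sr _ _ (rB (inord 2)) (rB (inord 0)); rewrite !BE /numer !inordK //=.
  by have -> : y2 / P / (1 / P) = y2 by field2 F2.
have S1 := sf1 sS; have := (Sk be, Sk al, Sk g1, Sk g2) => -[[[? ?] ?] ?].
have kbe0 : kap be != 0 by rewrite fmorph_eq0.
have kal0 : kap al != 0 by rewrite fmorph_eq0.
have bP0 : y1 ^+ 2 + y1 + kap g1 != 0.
  have -> : y1 ^+ 2 + y1 + kap g1 = kap be / P by rewrite y1E /f1; field2 F2.
  by rewrite mulf_neq0 ?invr_eq0.
have SP : S P.
  have -> : P = kap be / (y1 ^+ 2 + y1 + kap g1).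
    by apply: (mulIf bP0); rewrite divfK // y1E /f1; field2 F2.
  by sfsolve.
have St : S t.
  have -> : t = (y2 ^+ 2 + y2 + kap g2) * P / kap al by rewrite y2E /f2; field2 F2.
  by sfsolve.
have KS x : K x -> S x by apply: (rat_min sS).
move=> z; have [A [B' [C' [E [[KA KB KC KE] ->]]]]] := biquad_coord F2 q1 q2 z.
by have := (KS _ KA, KS _ KB, KS _ KC, KS _ KE) => -[[[? ?] ?] ?]; sfsolve.
Qed.

End CaseBCurve.

(** A curve bundled with both its maps, so that the three quotients are obtained by one application
    of choice. *)
Record quotient (k : fieldType) (C : curve k) := Quotient {
  quo_curve : curve k;
  quo_top : curve_hom C quo_curve;
  quo_bot : curve_hom quo_curve (projective_line k)
}.

(** * Assembling the diagram of a cover *)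

Section Covers.

Variable k : fieldType.
Hypothesis k2 : 2%:R = 0 :> k.
Local Notation Kt := {fraction {poly k}}.
Local Notation t0 := (@FracField.tofrac {poly k} 'X).
Local Notation kap0 := (ratfun_const k).

(** The three quotients belong to [y1], [y2] and [y2 + y1]. The hypothesis on models concerns any
    curve with the right equation over k(t), so that the elliptic curves are recognized from their
    equations alone. *)
Lemma biquad_cover (E : 3.-tuple (elliptic_curve k)) (C : curve k)
    (phi : {rmorphism Kt -> C}) (y1 y2 : C) K1 (f1 f2 : Kt) :
    (forall c, phi (kap0 c) = const C c) ->
    quad (ratl (const C) (phi t0)) K1 y1 -> quad K1 (@anything C) y2 ->
    y1 ^+ 2 + y1 = phi f1 -> y2 ^+ 2 + y2 = phi f2 -> has_genus C 3 ->
    (forall (i : 'I_3) (X : curve k) (bot : curve_hom X (projective_line k)) (y : X),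
      y ^+ 2 + y = bot [:: f1; f2; f1 + f2]`_i ->
      (forall z, exists a b, z = bot a + bot b * y) -> is_model (tnth E i) X) ->
  exists C' : artin_schreier_cover E, as_curve C' = C.
Proof.
move=> hphi q1 q2 y1E y2E g3 mod; have F2 := char2_curve C k2.
set K := ratl _ _ in q1.
have imK z : image_of phi z <-> K z by apply: frac_image.
have Kf1 : K (y1 ^+ 2 + y1) by rewrite y1E; apply/imK; exists f1.
have Kf2 : K (y2 ^+ 2 + y2) by rewrite y2E; apply/imK; exists f2.
have [sK _ _ _] := q1; have sK1 := quad_subfield F2 q1; have K1y := quad_gen q1.
have q3 := quad_shift F2 q2 K1y.
have y3E : (y2 + y1) ^+ 2 + (y2 + y1) = phi (f1 + f2).
  by rewrite rmorphD -y1E -y2E; ring2 F2.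
have Kf3 : K ((y2 + y1) ^+ 2 + (y2 + y1)) by rewrite y3E; apply/imK; exists (f1 + f2).
pose Y (i : 'I_3) : C := [:: y1; y2; y2 + y1]`_i.
pose L (i : 'I_3) : C -> Prop := nth K1 [:: K1; span2 K y2; span2 K (y2 + y1)] i.
pose f (i : 'I_3) : Kt := [:: f1; f2; f1 + f2]`_i.
have qL i : quad K (L i) (Y i) /\ exists Y', quad (L i) (@anything C) Y'.
  case: i => [[|[|[|//]]]] ?; rewrite /L /Y /=.
  - by split=> //; exists y2.
  - split; first exact: (quad_second q1 q2 Kf2).
    by exists y1; apply: (quad_swap F2 q1 q2 Kf2).
  - split; first exact: (quad_second q1 q3 Kf3).
    by exists y1; apply: (quad_swap F2 q1 q3 Kf3).
have YE i : Y i ^+ 2 + Y i = phi (f i) by case: i => [[|[|[|//]]]].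
have : forall i, exists Q : quotient C,
   [/\ is_model (tnth E i) (quo_curve Q),
       hom_degree (quo_top Q) 2 /\ hom_separable (quo_top Q),
       hom_degree (quo_bot Q) 2 /\ hom_separable (quo_bot Q),
       forall a, quo_top Q (quo_bot Q a) = phi a
     & forall z, image_of (quo_top Q) z <-> L i z].
  move=> i; have [qi [Y' qi']] := qL i.
  have [X [top [bot [y [h1 h2 [h3 h4] yE h5]]]]] := quotient_curve k2 hphi qi qi' (YE i).
  by exists (Quotient top bot); split=> //; apply: (mod i X bot y).
case/choice=> Q hQ.
have dist : forall i j, i != j -> ~ (forall z, (exists a, z = quo_top (Q i) a) <->
     (exists a, z = quo_top (Q j) a)).
  have hL i j : (forall z, (exists a, z = quo_top (Q i) a) <->
     (exists a, z = quo_top (Q j) a)) -> forall z, L i z -> L j z.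
    have [_ _ _ _ h1] := hQ i; have [_ _ _ _ h2] := hQ j.
    by move=> h z /h1 /h /h2.
  have key (i j : 'I_3) : (i < j)%N -> ~ (forall z, (exists a, z = quo_top (Q i) a) <->
     (exists a, z = quo_top (Q j) a)).
    have [_ _ n2 _] := q2; have [_ _ n1 _] := quad_swap F2 q1 q2 Kf2.
    have s2 := quad_subfield F2 (quad_second q1 q2 Kf2).
    have g2 := quad_gen (quad_second q1 q2 Kf2).
    have g3' := quad_gen (quad_second q1 q3 Kf3).
    move=> ij h; have {}h := hL j i (fun z => iff_sym (h z)).
    case: i j ij h => [[|[|[|//]]]] ? [[|[|[|//]]]] ? //= _; rewrite /L /= => h.
    - by apply/n2/h.
    - by apply: n2; rewrite -(addxK F2 y2 y1); apply: (sfD sK1) => //; apply: h.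
    - apply: n1; have -> : y1 = (y2 + y1) + y2 by ring2 F2.
      by apply: (sfD s2) => //; apply: h.
  move=> i j; rewrite -val_eqE neq_ltn => /orP[]; first exact: key.
  by move=> ji h; apply: (key _ _ ji) => z; have [h1 h2] := h z; split.
unshelve eexists.
  apply: (@ArtinSchreierCover k E C g3 (fun i => quo_curve (Q i)) _
    (fun i => quo_top (Q i)) (fun i => quo_bot (Q i)) _ _ _ dist) => i.
  - by have [] := hQ i.
  - by have [] := hQ i.
  - by have [] := hQ i.
  - by move=> j z; have [_ _ _ h _] := hQ i; have [_ _ _ h' _] := hQ j; rewrite h h'.
by [].
Qed.

Let Kt2 : 2%:R = 0 :> Kt.
Proof. by rewrite -(rmorph_nat (ratfun_const k)) k2 rmorph0. Qed.
Let tr0 : transcendental kap0 t0.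
Proof. exact: (@frac_transcendental k Kt kap0 (idfun : {rmorphism Kt -> Kt})). Qed.
Let rat0 z : ratl kap0 t0 z.
Proof.
by apply/(@frac_image k Kt kap0 (idfun : {rmorphism Kt -> Kt}) (fun=> erefl)); exists z.
Qed.

Let no_AS O p f : valuation_ring kap0 O -> uniformizer O (ratl kap0 t0) p ->
  O (p * f) -> ~ maxid O (p * f) -> forall r, r ^+ 2 + r <> f.
Proof.
move=> vO up O1 n1 r.
exact: (uniformizer_noAS Kt2 vO (rat_subfield kap0 t0) up O1 n1 (rat0 r)).
Qed.

Section CaseA.

Hypothesis k_perfect : forall c : k, exists s, c = s ^+ 2.
Variables a b e c1 c2 : k.
Hypotheses (a0 : a != 0) (b0 : b != 0) (e0 : e != 0).
Let f1 := kap0 a / t0 + kap0 b / (t0 + 1) + kap0 c1.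
Let f2 := kap0 b / (t0 + 1) + kap0 e * t0 + kap0 c2.

Lemma caseA_cover (E : 3.-tuple (elliptic_curve k)) :
    (forall (i : 'I_3) (X : curve k) (bot : curve_hom X (projective_line k)) (y : X),
      y ^+ 2 + y = bot [:: f1; f2; f1 + f2]`_i ->
      (forall z, exists a b, z = bot a + bot b * y) -> is_model (tnth E i) X) ->
  exists C : artin_schreier_cover E, ~ hyperelliptic C.
Proof.
move=> mod.
have sX : (1 < size ('X : {poly k}))%N by rewrite size_polyX.
have [O vO [Ot]] := exists_place tr0 sX; rewrite pev_X => mt.
have [[_ _ up O1 n1] O2] := caseA_at0 Kt2 tr0 b e c1 c2 a0 vO mt.
have [O' vO' nt] := exists_infinite_place tr0.
have [[_ _ _ up' O1'] [n1' _]] := caseA_infinite Kt2 tr0 a b c1 c2 e0 vO' nt.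
(* The three equations are unsolvable over k(t) because of simple poles: of [f1] and [f1 + f2] at 0,
   of [f2] at infinity. *)
have [||||C [phi [y1 [y2 [K1 [hphi q1 q2 y1E y2E]]]]]] := tower_curve k2 (f1 := f1) (f2 := f2).
- exact: no_AS up O1 n1.
- exact: no_AS up' O1' n1'.
- apply: (no_AS vO up); rewrite mulrDr.
    by apply: (vrD vO) => //; apply: (vrM vO).
  by rewrite addrC; apply: (maxid_add_unit vO) => //; apply: (maxidMr vO).
- move=> M kap phi y1 y2 K1 hphi q1 q2 y1E y2E z az.
  have M2 : 2%:R = 0 :> M by rewrite -(rmorph_nat phi) Kt2 rmorph0.
  move: y1E y2E; rewrite /f1 /f2 !(rmorphD phi) !(rmorphM phi) !(fmorphV phi) rmorphD rmorph1 !hphi.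
  move=> y1E y2E.
  exact: (caseA_const M2 (frac_transcendental hphi) q1 q2 a0 b0 e0 y1E y2E az).
move: (y1E) (y2E); rewrite /f1 /f2 !(rmorphD phi) !(rmorphM phi) !(fmorphV phi) rmorphD rmorph1 !hphi.
move=> y1E' y2E'.
have tr := frac_transcendental hphi.
have g3 := caseA_genus k2 tr q1 q2 a0 b0 e0 y1E' y2E'.
have nh := caseA_nonhyperelliptic k2 k_perfect tr q1 q2 a0 b0 e0 y1E' y2E'.
have [C' C'E] := biquad_cover hphi q1 q2 y1E y2E g3 mod.
by exists C'; rewrite C'E.
Qed.

End CaseA.

Section CaseB.

Hypothesis k_perfect : forall c : k, exists s, c = s ^+ 2.
Variables c be al g1 g2 : k.
Hypotheses (c0 : c != 0) (be0 : be != 0) (al0 : al != 0).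
Hypothesis N0 : be ^+ 2 + al * be + c * al ^+ 2 != 0.
Let P := t0 ^+ 2 + t0 + kap0 c.
Let f1 := kap0 be / P + kap0 g1.
Let f2 := kap0 al * t0 / P + kap0 g2.

Lemma caseB_cover (E : 3.-tuple (elliptic_curve k)) :
    (forall (i : 'I_3) (X : curve k) (bot : curve_hom X (projective_line k)) (y : X),
      y ^+ 2 + y = bot [:: f1; f2; f1 + f2]`_i ->
      (forall z, exists a b, z = bot a + bot b * y) -> is_model (tnth E i) X) ->
  exists C : artin_schreier_cover E, ~ hyperelliptic C.
Proof.
move=> mod.
have sP : size ('X^2 + ('X + c%:P) : {poly k}) = 3%N.
  by rewrite size_polyDl ?size_polyXn // size_XaddC.
have [|O vO [Ot]] := exists_place (p := 'X^2 + ('X + c%:P)) tr0; first by rewrite sP.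
rewrite !pevE addrA -/P => mP.
have [up O1 n1 O2 [nt nab]] := caseB_ramified k2 Kt2 tr0 g1 g2 c0 be0 N0 vO Ot mP.
have P0 : P != 0 by case: up.
have e2 : P * f2 = kap0 al * t0 + kap0 g2 * P by rewrite /f2; field2 Kt2.
have e1 : P * f1 = kap0 be + kap0 g1 * P by rewrite /f1; field2 Kt2.
have mg g : maxid O (kap0 g * P) by apply: (maxidMl vO) => //; apply: (vr_const vO).
have [||||C [phi [y1 [y2 [K1 [hphi q1 q2 y1E y2E]]]]]] := tower_curve k2 (f1 := f1) (f2 := f2).
- exact: no_AS up O1 n1.
- apply: (no_AS vO up) => //; rewrite e2 addrC; apply: (maxid_add_unit vO) => //.
  case/(maxid_prime vO) => //; first by apply: (vr_const vO).
  exact: (unit_const vO al0).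
- apply: (no_AS vO up); rewrite mulrDr; first exact: (vrD vO).
  have -> : P * f1 + P * f2 = kap0 (g1 + g2) * P + (kap0 al * t0 + kap0 be).
    by rewrite e1 e2 rmorphD; ring2 Kt2.
  exact: (maxid_add_unit vO).
- move=> M kap phi y1 y2 K1 hphi q1 q2 y1E y2E z az.
  have M2 : 2%:R = 0 :> M by rewrite -(rmorph_nat phi) Kt2 rmorph0.
  move: y1E y2E; rewrite /f1 /f2 /P !(rmorphD phi) !(rmorphM phi) !(fmorphV phi) !rmorphD rmorphXn !hphi.
  move=> y1E y2E.
  exact: (caseB_const k2 M2 (frac_transcendental hphi) q1 q2 c0 be0 al0 N0 y1E y2E az).
move: (y1E) (y2E); rewrite /f1 /f2 /P !(rmorphD phi) !(rmorphM phi) !(fmorphV phi) !rmorphD rmorphXn !hphi.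
move=> y1E' y2E'.
have tr := frac_transcendental hphi.
have g3 := caseB_genus k2 k_perfect tr q1 q2 c0 be0 al0 N0 y1E' y2E'.
have nh := caseB_nonhyperelliptic k2 k_perfect tr q1 q2 c0 be0 al0 N0 y1E' y2E'.
have [C' C'E] := biquad_cover hphi q1 q2 y1E y2E g3 mod.
by exists C'; rewrite C'E.
Qed.

End CaseB.

End Covers.

(** * Elliptic models of Artin-Schreier curves *)

Section Models.

Variable k : finFieldType.
Hypothesis k2 : 2%:R = 0 :> k.
Variable X : curve k.
Let X2 : 2%:R = 0 :> X := char2_curve X k2.
Local Notation kap := (const X).

(** Simple poles at zero and infinity of a coordinate [s] are normalized by taking [b * s] as
    abscissa; the product of the two residues becomes the invariant. *)
Lemma split_pair (a b g : k) (s y : X) : b != 0 -> s != 0 ->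
    y ^+ 2 + y = kap b * s + kap a / s + kap g -> generates s y ->
  normal_pair (a * b) g (kap b * s) y.
Proof.
move=> b0 s0 yE gen; have kb0 : kap b != 0 by rewrite fmorph_eq0.
split; first by rewrite mulf_neq0.
  by rewrite yE rmorphM; field2 X2.
move=> S sS Sk Ss Sy; apply: gen => //.
have -> : s = kap b * s / kap b by field2 X2.
exact: (sf_div sS).
Qed.

Lemma generates_trans (t s y : X) : generates t y ->
  (forall S, is_subfield S -> (forall c, S (kap c)) -> S s -> S t) ->
  generates s y.
Proof. by move=> gen st S sS Sk Ss Sy; apply: gen => //; apply: st. Qed.

Variables (t y : X).
Hypothesis tr : transcendental kap t.
Hypothesis gen : generates t y.

Let t0 : t != 0. Proof. exact: transcendental_nz tr. Qed.
Let tc x : t + kap x != 0.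
Proof.
have := transcendental_const x tr.
by apply: contraNneq => /(addxx_eq0 X2) ->.
Qed.
Let t1 : t + 1 != 0. Proof. by rewrite -(rmorph1 kap). Qed.

(** The coordinate [t / (t + 1)] moves the poles 0 and 1 to 0 and infinity, which adds [a + b] to
    the constant. *)
Lemma caseA_pair1 (a b g : k) : b != 0 ->
    y ^+ 2 + y = kap a / t + kap b / (t + 1) + kap g ->
  exists x y' : X, normal_pair (a * b) (a + b + g) x y'.
Proof.
move=> b0 yE; exists (kap b * (t / (t + 1))), y; apply: split_pair => //.
- by rewrite mulf_neq0 ?invr_eq0.
- by rewrite yE !rmorphD; field2 X2.
apply: (generates_trans gen) => S sS Sk Ss; have S1 := sf1 sS.
have s1 : t / (t + 1) + 1 != 0.
  have -> : t / (t + 1) + 1 = (t + 1)^-1 by field2 X2.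
  by rewrite invr_eq0.
have -> : t = t / (t + 1) / (t / (t + 1) + 1).
  by apply: (mulIf s1); rewrite divfK //; field2 X2.
by sfsolve.
Qed.

Lemma caseA_pair2 (b e g : k) : e != 0 ->
    y ^+ 2 + y = kap b / (t + 1) + kap e * t + kap g ->
  exists x y' : X, normal_pair (b * e) (e + g) x y'.
Proof.
move=> b0 yE; exists (kap e * (t + 1)), y; apply: split_pair => //.
- by rewrite yE !rmorphD; field2 X2.
apply: (generates_trans gen) => S sS Sk Ss.
by rewrite -(addxK X2 t 1); apply: (sfD sS) => //; apply: sf1.
Qed.

Lemma caseA_pair3 (a e g : k) : e != 0 ->
    y ^+ 2 + y = kap a / t + kap e * t + kap g ->
  exists x y' : X, normal_pair (a * e) g x y'.
Proof.
move=> e0 yE; exists (kap e * t), y; apply: split_pair => //.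
by rewrite yE [_ / t + _]addrC.
Qed.

Section CaseB.

Variables al be g c : k.
Let P := t ^+ 2 + t + kap c.
Let d := be ^+ 2 + al * be + c * al ^+ 2.
Hypothesis d0 : d != 0.
Hypothesis yE : y ^+ 2 + y = (kap al * t + kap be) / P + kap g.

(** Here the roots [r] and [r + 1] of [P] are rational and can be moved to 0 and infinity; [d] is
    the product of the values of [al * t + be] at these roots. *)
Let pair_split : AS c -> exists e (x y' : X), AS (e + (g + al + c)) /\ normal_pair d e x y'.
Proof.
case=> r cE.
have rE : kap c = kap r + kap r ^+ 2 by rewrite cE rmorphD rmorphXn.
have PE : P = (t + kap r) * (t + kap r + 1) by rewrite /P rE; ring2 X2.
have u0 := tc r; have u1 : t + kap r + 1 != 0 by rewrite -(rmorph1 kap) -addrA -rmorphD.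
have dE : d = (al * r + be) * (al * (r + 1) + be) by rewrite /d cE; ring2 k2.
have := d0; rewrite dE mulf_eq0 negb_or => /andP[_ b0].
exists (g + al), (kap (al * (r + 1) + be) * ((t + kap r) / (t + kap r + 1))), y.
split; first by exists r; rewrite -cE; ring2 k2.
apply: split_pair => //; first by rewrite mulf_neq0 ?invr_eq0.
  rewrite yE PE !rmorphD !rmorphM rmorphD rmorph1; field2 X2.
apply: (generates_trans gen) => S sS Sk Ss; have S1 := sf1 sS; have Sr := Sk r.
set s := _ / _ in Ss.
have s1 : s + 1 != 0.
  have -> : s + 1 = (t + kap r + 1)^-1 by rewrite /s; field2 X2.
  by rewrite invr_eq0.
have -> : t = s / (s + 1) + kap r.
  apply: (mulIf s1); rewrite mulrDl divfK // /s; field2 X2.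
by sfsolve.
Qed.

(* An element of norm 1 of [k(theta)], [theta ^+ 2 + theta = c], for which the
   product of the [theta]-coordinates below agrees with [g] modulo [AS k]. *)
Let norm_solution : ~ AS c -> exists a0 a2 c0 c2 l : k,
  [/\ a0 ^+ 2 + a0 * a2 + c * a2 ^+ 2 = 1, c0 ^+ 2 + c0 * c2 + c * c2 ^+ 2 = d,
      a2 * c2 = g + l ^+ 2 + l, a0 * c0 = be + c * (a2 * c2)
    & a0 * c2 + a2 * c0 = al + a2 * c2].
Proof.
move=> nc; have [q dE] := finite_sqrt k2 d.
have q0 : q != 0 by apply: contraNneq d0 => q0; rewrite dE q0 expr0n.
(* These choices mean that [be + al * theta] is [q] times the square of [z0 + z1 * theta]; comparing
   norms, the latter has norm 1. *)
have [z1 z1E] := finite_sqrt k2 (al / q).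
have [z0 z0E] := finite_sqrt k2 ((be + c * al) / q).
have alE : al = q * z1 ^+ 2 by rewrite -z1E; field2 k2.
have beE : be = q * (z0 ^+ 2 + c * z1 ^+ 2) by rewrite -z1E -z0E; field2 k2.
have Nz : z0 ^+ 2 + z0 * z1 + c * z1 ^+ 2 = 1.
  apply: (addxx_eq0 k2); apply/eqP; rewrite -sqrf_eq0 -(mulrI_eq0 _ (mulfI (expf_neq0 2 q0))).
  apply/eqP; transitivity (d + q ^+ 2); last by rewrite dE addxx.
  by rewrite /d alE beE; ring2 k2.
(* With u = [u0 + u1 * theta] of norm 1 and z = [z0 + z1 * theta], the factors z u and q z conj(u)
   have product [be + al * theta], and the product of their theta-coordinates is
   [q * u1 ^+ 2 + al]. *)
have [u0 [u1 [l [Nu lE]]]] : exists u0 u1 l, u0 ^+ 2 + u0 * u1 + c * u1 ^+ 2 = 1 /\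
    q * u1 ^+ 2 + al = g + l ^+ 2 + l.
  have [[l lE]|n] := pselect (AS (g + al)).
    exists 1, 0, l; split; first by rewrite expr1n !expr0n !mulr0 !addr0.
    rewrite expr0n mulr0 add0r -[RHS]addrA [l ^+ 2 + l]addrC -lE; ring2 k2.
  (* With [x = q * u1 ^+ 2], the element [u1 * (v + theta)] has norm 1 when [q / x + c] is
     [v + v ^+ 2]. So [q / x] has to lie outside AS(k), and so does [x], in order to correct the
     class of [g + al]. *)
  have [x [nx nqx]] := AS_both k2 nc q0.
  have x0 : x != 0 by apply/eqP => x0; apply: nx; rewrite x0; apply: AS0.
  have [u1 u1E] := finite_sqrt k2 (x / q).
  have u10 : u1 != 0.
    by apply/eqP => u10; move: u1E; rewrite u10 expr0n => /eqP;
      rewrite mulf_eq0 invr_eq0 (negPf x0) (negPf q0).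
  have xE : x = q * u1 ^+ 2 by rewrite -u1E; field2 k2.
  have [//|[v vE]] := AS_coset k2 (q / x) nc.
  have [//|[l lE]] := AS_coset k2 x n.
  exists (v * u1), u1, l; split.
    have -> : (v * u1) ^+ 2 + v * u1 * u1 + c * u1 ^+ 2 = (v + v ^+ 2 + c) * u1 ^+ 2.
      by ring2 k2.
    by rewrite -vE xE; field2 k2.
  by rewrite -xE -[RHS]addrA [l ^+ 2 + l]addrC -lE; ring2 k2.
exists (z0 * u0 + c * (z1 * u1)), (z0 * u1 + z1 * u0 + z1 * u1).
exists (q * (z0 * (u0 + u1) + c * (z1 * u1))), (q * (z0 * u1 + z1 * u0)), l.
have e1 : z0 ^+ 2 = z0 * z1 + c * z1 ^+ 2 + 1 by rewrite -Nz; ring2 k2.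
have e2 : u0 ^+ 2 = u0 * u1 + c * u1 ^+ 2 + 1 by rewrite -Nu; ring2 k2.
split.
- by ring2 k2 e1 e2.
- by rewrite dE; ring2 k2 e1 e2.
- by rewrite -lE alE; ring2 k2 e1 e2.
- by rewrite beE; ring2 k2 e1 e2.
- by rewrite alE; ring2 k2 e1 e2.
Qed.

(** With linear forms [a], [b] in [t] such that [P * (w ^+ 2 + w) = a * b], the element [x]
    satisfies [a ^+ 2 * x ^+ 2 + P * x + b ^+ 2 = 0], which is quadratic in [t] as well. Solving for
    [t] gives an Artin-Schreier equation over k(x) whose residues are the norms 1 and [d]. *)
Let pair_norm : ~ AS c -> exists e (x y' : X), AS (e + (g + al + c)) /\ normal_pair d e x y'.
Proof.
case/norm_solution=> a0 [a2 [c0 [c2 [l [Na Nc h1 h2 h3]]]]].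
have P0 : P != 0.
  have -> : P = pev kap t ('X^2 + ('X + c%:P)) by rewrite !pevE addrA.
  apply: tr; rewrite -size_poly_eq0 size_polyDl ?size_polyXn //.
  by rewrite size_XaddC.
pose a := kap a0 + kap a2 * t; pose b := kap c0 + kap c2 * t.
have nz u v : ~~ ((u == 0) && (v == 0)) -> kap u + kap v * t != 0.
  move=> uv; have -> : kap u + kap v * t = pev kap t (v *: 'X + u%:P).
    by rewrite !pevE addrC.
  apply: tr; apply: contraNneq uv => E; apply/andP; split; apply/eqP.
    by have := coef0 k 0; rewrite -E coefD coefZ coefX coefC mulr0 add0r.
  by have := coef0 k 1; rewrite -E coefD coefZ coefX coefC mulr1 addr0.
have na : a != 0.
  apply: nz; apply/negP => /andP[/eqP u /eqP v]; move/eqP: Na.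
  by rewrite u v !expr0n !mulr0 !addr0 eq_sym oner_eq0.
have nb : b != 0.
  apply: nz; apply/negP => /andP[/eqP u /eqP v]; move/eqP: d0; apply.
  by rewrite -Nc u v !expr0n !mulr0 !addr0.
pose w := y + kap l.
have wE : P * (w ^+ 2 + w) = a * b.
  have -> : w ^+ 2 + w = (y ^+ 2 + y) + (kap l ^+ 2 + kap l) by rewrite /w; ring2 X2.
  have -> : a * b = kap (a0 * c0) + kap (a0 * c2 + a2 * c0) * t + kap (a2 * c2) * t ^+ 2.
    by rewrite /a /b !(rmorphD, rmorphM); ring2 X2.
  rewrite h3 h2 h1 !(rmorphD, rmorphM, rmorphXn) yE.
  by rewrite mulrDr mulrDr mulrCA divff // /P; clearbody P; field2 X2.
pose x := (P * w + a * b) / a ^+ 2.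
have xE : a ^+ 2 * x ^+ 2 + P * x + b ^+ 2 = 0.
  have -> : a ^+ 2 * x ^+ 2 + P * x + b ^+ 2 = P * (P * (w ^+ 2 + w) + a * b) / a ^+ 2.
    by rewrite /x; field2 X2.
  by rewrite wE addxx // mulr0 mul0r.
have x0 : x != 0.
  apply/eqP => x0; move/eqP: xE; rewrite x0 expr0n !mulr0 !add0r sqrf_eq0.
  by rewrite (negPf nb).
have q0 : kap a2 ^+ 2 * x ^+ 2 + x + kap c2 ^+ 2 != 0.
  apply/eqP => q0.
  have [|u uE] := curve_const_closed (z := x).
    exists ((a2 ^+ 2) *: 'X^2 + ('X + (c2 ^+ 2)%:P)).
      apply/eqP => E; have := coef0 k 1.
      by rewrite -E !coefD coefZ coefXn coefX coefC mulr0 add0r addr0 => /eqP; rewrite oner_eq0.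
    apply/rootP; rewrite -/(pev kap x _) !pevE addrA !rmorphXn; exact: q0.
  have u0 : kap u != 0 by rewrite -uE.
  have : pev kap t ((u + a2 ^+ 2 * u ^+ 2 + c2 ^+ 2) *: 'X^2
     + (u *: 'X + (a0 ^+ 2 * u ^+ 2 + c * u + c0 ^+ 2)%:P)) = 0.
    rewrite -[RHS]xE !pevE uE !(rmorphD, rmorphM, rmorphXn) /a /b /P; ring2 X2.
  have [E _|nE /eqP] := eqVneq ((u + a2 ^+ 2 * u ^+ 2 + c2 ^+ 2) *: 'X^2
     + (u *: 'X + (a0 ^+ 2 * u ^+ 2 + c * u + c0 ^+ 2)%:P)) 0; last by rewrite (negPf (tr nE)).
  have := coef0 k 1; rewrite -E !coefD !coefZ coefXn coefX coefC mulr0 add0r mulr1 addr0.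
  by move=> uu; move: u0; rewrite uu rmorph0 eqxx.
(* [T] turns the quadratic equation of [t] over k(x) into an Artin-Schreier equation; the correction
   in [Y] reduces its double poles at 0 and infinity to simple ones. *)
pose T := t * (kap a2 ^+ 2 * x ^+ 2 + x + kap c2 ^+ 2) / x.
pose Y := T + kap a0 * kap a2 * x + kap c0 * kap c2 / x.
exists (a2 ^+ 2 * c0 ^+ 2 + c2 ^+ 2 * a0 ^+ 2 + c), x, Y; split.
  exists (a2 * c0 + c2 * a0 + l).
  have -> : g = a2 * c2 + l ^+ 2 + l by rewrite h1; ring2 k2.
  have -> : al = a0 * c2 + a2 * c0 + a2 * c2 by rewrite h3; ring2 k2.
  by ring2 k2.
split=> //.
  have TE : T ^+ 2 + T = (kap a2 ^+ 2 * x ^+ 2 + x + kap c2 ^+ 2) *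
      (kap a0 ^+ 2 * x ^+ 2 + kap c * x + kap c0 ^+ 2) / x ^+ 2.
    apply: (addxx_eq0 X2).
    transitivity ((kap a2 ^+ 2 * x ^+ 2 + x + kap c2 ^+ 2) *
       (a ^+ 2 * x ^+ 2 + P * x + b ^+ 2) / x ^+ 2); last by rewrite xE mulr0 mul0r.
    by rewrite /T /a /b /P; field2 X2.
  have -> : Y ^+ 2 + Y = (T ^+ 2 + T) + (kap a0 * kap a2 * x + kap c0 * kap c2 / x) ^+ 2
     + (kap a0 * kap a2 * x + kap c0 * kap c2 / x) by rewrite /Y; clearbody T; field2 X2.
  have Na' : kap a0 ^+ 2 = kap a0 * kap a2 + kap c * kap a2 ^+ 2 + 1.
    by rewrite -(rmorph1 kap) -Na !(rmorphD, rmorphM, rmorphXn); ring2 X2.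
  have Nc' : kap c0 ^+ 2 = kap c0 * kap c2 + kap c * kap c2 ^+ 2 + kap d.
    by rewrite -Nc !(rmorphD, rmorphM, rmorphXn); ring2 X2.
  have -> : kap (a2 ^+ 2 * c0 ^+ 2 + c2 ^+ 2 * a0 ^+ 2 + c) =
     kap a2 ^+ 2 * kap c0 ^+ 2 + kap c2 ^+ 2 * kap a0 ^+ 2 + kap c.
    by rewrite !(rmorphD, rmorphM, rmorphXn).
  by rewrite TE; field2 X2 Na' Nc'.
move=> S sS Sk Sx SY; have S1 := sf1 sS.
have := (Sk a0, Sk a2, Sk c0, Sk c2, Sk c, Sk l) => -[[[[[? ?] ?] ?] ?] ?].
have ST : S T.
  have -> : T = Y + (kap a0 * kap a2 * x + kap c0 * kap c2 / x).
    by rewrite /Y; clearbody T; field2 X2.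
  by sfsolve.
have St : S t.
  have -> : t = T * x / (kap a2 ^+ 2 * x ^+ 2 + x + kap c2 ^+ 2).
    by apply: (mulIf q0); rewrite divfK // /T; field2 X2.
  by sfsolve.
apply: gen => //.
have -> : y = (a ^+ 2 * x + a * b) / P + kap l.
  by rewrite /x /w; clearbody P; field2 X2.
by rewrite /a /b /P; sfsolve.
Qed.

Lemma caseB_pair : exists e (x y' : X), AS (e + (g + al + c)) /\ normal_pair d e x y'.
Proof. by have [/pair_split|/pair_norm] := pselect (AS c). Qed.

End CaseB.

End Models.

(** * Sufficiency: prescribing the invariants of the three quotients *)

Section Triples.

Variables (k : finFieldType) (r0 : k).
Hypothesis k2 : 2%:R = 0 :> k.
Hypothesis r0_AS : ~ AS r0.
Variables E1 E2 E3 : elliptic_curve k.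
Hypotheses (ord1 : ordinary E1) (ord2 : ordinary E2) (ord3 : ordinary E3).
Variables d1 d2 d3 : k.
Hypotheses (dE1 : (jinv E1)^-1 = d1 ^+ 2) (dE2 : (jinv E2)^-1 = d2 ^+ 2)
  (dE3 : (jinv E3)^-1 = d3 ^+ 2).
Let s1 := sgn r0 E1.
Let s2 := sgn r0 E2.
Let s3 := sgn r0 E3.
Let s := s1 + s2 + s3.

Lemma jinv_sqrt_nz (E : elliptic_curve k) d : ordinary E -> (jinv E)^-1 = d ^+ 2 -> d != 0.
Proof.
move=> ordE dE; have := jinv_neq0 k2 ordE; rewrite -invr_eq0 dE.
by rewrite expf_eq0.
Qed.

Let d10 := jinv_sqrt_nz ord1 dE1.
Let d20 := jinv_sqrt_nz ord2 dE2.
Let d30 := jinv_sqrt_nz ord3 dE3.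
Let jE1 : jinv E1 = (d1 ^+ 2)^-1. Proof. by rewrite -dE1 invrK. Qed.
Let jE2 : jinv E2 = (d2 ^+ 2)^-1. Proof. by rewrite -dE2 invrK. Qed.
Let jE3 : jinv E3 = (d3 ^+ 2)^-1. Proof. by rewrite -dE3 invrK. Qed.
Let Ta := (jinv E1 + jinv E2 + jinv E3) ^+ 2 / (jinv E1 * jinv E2 * jinv E3).
Let Tb := (jinv E1 * jinv E2 * jinv E3 ^+ 2) /
  (jinv E1 * jinv E2 + jinv E1 * jinv E3 + jinv E2 * jinv E3) ^+ 2.

(** The fourth power is harmless for the condition: [z ^+ 4 + z] is always in AS(k). *)
Lemma TaE a b e : d1 = a * b -> d2 = b * e -> d3 = a * e -> Ta = (a + b + e) ^+ 4.
Proof.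
move=> E1' E2' E3'; have := d10; rewrite E1' mulf_eq0 negb_or => /andP[a0 b0].
have := d20; rewrite E2' mulf_eq0 negb_or => /andP[_ e0].
by rewrite /Ta jE1 jE2 jE3 E1' E2' E3'; field2 k2.
Qed.

Lemma Tb_denominator : (jinv E1 * jinv E2 + jinv E1 * jinv E3 + jinv E2 * jinv E3 != 0)
  = (d1 + d2 + d3 != 0).
Proof.
have -> : jinv E1 * jinv E2 + jinv E1 * jinv E3 + jinv E2 * jinv E3 =
   ((d1 + d2 + d3) / (d1 * d2 * d3)) ^+ 2 by rewrite jE1 jE2 jE3; field2 k2.
by rewrite sqrf_eq0 mulf_eq0 invr_eq0 !mulf_eq0 (negPf d10) (negPf d20) (negPf d30) !orbF.
Qed.

Lemma TbE : d1 + d2 + d3 != 0 -> Tb = (d1 * d2 / (d1 + d2 + d3) ^+ 2) ^+ 2.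
Proof.
move=> D0; rewrite /Tb.
have -> : jinv E1 * jinv E2 + jinv E1 * jinv E3 + jinv E2 * jinv E3 =
   ((d1 + d2 + d3) / (d1 * d2 * d3)) ^+ 2 by rewrite jE1 jE2 jE3; field2 k2.
by rewrite jE1 jE2 jE3; field2 k2.
Qed.

Lemma AS_coset_sum (x y : k) : (exists2 a, AS a & x = y + a) <-> AS (x + y).
Proof.
split=> [[a Aa ->]|h]; first by rewrite addrAC addxx // add0r.
by exists (x + y) => //; ring2 k2.
Qed.

Let kp := @finite_sqrt k k2.

Lemma cover_of_Ta : (exists2 a, AS a & Ta = s + a) ->
  exists C : artin_schreier_cover [tuple E1; E2; E3], ~ hyperelliptic C.
Proof.
(* The factorization [d1 = a * b], [d2 = b * e], [d3 = a * e] forces this value of [a ^+ 2]. *)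
move/AS_coset_sum; have [a aE] := kp (d1 * d3 / d2).
have a0 : a != 0.
  apply/eqP => a0; move/eqP: aE; rewrite a0 expr0n !mulf_eq0 invr_eq0.
  by rewrite (negPf d10) (negPf d20) (negPf d30).
pose b := d1 / a; pose e := d3 / a.
have E1' : d1 = a * b by rewrite /b; field2 k2.
have E3' : d3 = a * e by rewrite /e; field2 k2.
have E2' : d2 = b * e.
  have -> : b * e = d1 * d3 / a ^+ 2 by rewrite /b /e; field2 k2.
  by rewrite -aE; field2 k2.
have b0 : b != 0 by rewrite mulf_neq0 ?invr_eq0.
have e0 : e != 0 by rewrite mulf_neq0 ?invr_eq0.
rewrite (TaE E1' E2' E3') => h.
have {}h : AS (a + b + e + s).
  have h4 : AS ((a + b + e) ^+ 4 + (a + b + e)).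
    have -> : (a + b + e) ^+ 4 + (a + b + e) =
      (((a + b + e) ^+ 2) ^+ 2 + (a + b + e) ^+ 2) + ((a + b + e) ^+ 2 + (a + b + e)).
      by ring2 k2.
    by apply: (ASD k2); apply: AS_map.
  have -> : a + b + e + s = ((a + b + e) ^+ 4 + (a + b + e)) + ((a + b + e) ^+ 4 + s).
    by ring2 k2.
  exact: (ASD k2).
have X2 (X : curve k) := char2_curve X k2.
(* The constants anticipate the shifts [a + b] and [e] of the normal forms, so that the first two
   quotients get the signatures [s1] and [s2]. The third has constant [a + b + e + s1 + s2], which
   by hypothesis is [s3] modulo AS(k). *)
apply: (caseA_cover k2 kp (c1 := s1 + a + b) (c2 := s2 + e) a0 b0 e0) => i X bot y.
have hbot := pullback_const bot.
have tr := frac_transcendental (phi := bot) hbot.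
set t := bot _ in tr => yE all.
have gen : generates t y.
  move=> S sS Sk St Sy z; have [u [v ->]] := all z.
  have KS x : ratl (const X) t x -> S x by apply: (rat_min sS).
  apply: (sfD sS); last apply: (sfM sS) => //; apply/KS/(frac_image hbot); last by exists v.
  by exists u.
have t0 := transcendental_nz tr.
have t1 : t + 1 != 0.
  have := transcendental_const 1 tr; rewrite rmorph1.
  by apply: contraNneq => /(addxx_eq0 (X2 X)) ->.
case: i yE => [[|[|[|//]]]] i3 /=; rewrite /tnth /=.
- rewrite !(rmorphD bot) !(rmorphM bot) !(fmorphV bot) rmorphD rmorph1 -/t !hbot => yE.
  have [x [y' np]] := caseA_pair1 k2 tr gen b0 yE.
  apply: (normal_pair_model k2 r0_AS ord1 _ _ np); first by rewrite dE1 E1'.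
  by have -> : a + b + (s1 + a + b) + sgn r0 E1 = 0; [rewrite /s1; ring2 k2|apply: AS0].
- rewrite !(rmorphD bot) !(rmorphM bot) !(fmorphV bot) rmorphD rmorph1 -/t !hbot => yE.
  have [x [y' np]] := caseA_pair2 k2 tr gen e0 yE.
  apply: (normal_pair_model k2 r0_AS ord2 _ _ np); first by rewrite dE2 E2'.
  by have -> : e + (s2 + e) + sgn r0 E2 = 0; [rewrite /s2; ring2 k2|apply: AS0].
- rewrite !(rmorphD bot) !(rmorphM bot) !(fmorphV bot) rmorphD rmorph1 -/t !hbot => yE.
  have yE' : y ^+ 2 + y = const X a / t + const X e * t + const X (a + b + e + s1 + s2).
    rewrite yE !(rmorphD (const X)); have F2 := X2 X.
    by field2 F2.
  have [x [y' np]] := caseA_pair3 k2 tr gen e0 yE'.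
  apply: (normal_pair_model k2 r0_AS ord3 _ _ np); first by rewrite dE3 E3'.
  by have -> : a + b + e + s1 + s2 + sgn r0 E3 = a + b + e + s by rewrite /s /s3; ring2 k2.
Qed.

Lemma cover_of_Tb : d1 + d2 + d3 != 0 -> (exists2 a, AS a & Tb = s + a) ->
  exists C : artin_schreier_cover [tuple E1; E2; E3], ~ hyperelliptic C.
Proof.
set D := d1 + d2 + d3 => D0 /AS_coset_sum; rewrite (TbE D0) -/D.
(* The invariants of the quotients are the norms of [be], [al * theta] and [be + al * theta], theta
   being a root of the denominator. Their sum is [al * be], so prescribing them determines [be],
   [al] and [c]. *)
have [be beE] := kp d1; pose al := D / be; pose c := d1 * d2 / D ^+ 2.
have be0 : be != 0 by apply/eqP => be0; move: d10; rewrite beE be0 expr0n eqxx.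
rewrite -/c => h; have {}h : AS (c + s).
  by have -> : c + s = (c ^+ 2 + c) + (c ^+ 2 + s);
    [ring2 k2|apply: (ASD k2) => //; apply: AS_map].
have al0 : al != 0 by rewrite mulf_neq0 ?invr_eq0.
have c0 : c != 0 by rewrite mulf_neq0 ?invr_eq0 ?expf_neq0 // mulf_neq0.
have dB1 : be ^+ 2 + 0 * be + c * 0 ^+ 2 = d1 by rewrite beE; ring2 k2.
have dB2 : 0 ^+ 2 + al * 0 + c * al ^+ 2 = d2.
  have -> : 0 ^+ 2 + al * 0 + c * al ^+ 2 = d1 * d2 / be ^+ 2.
    by rewrite /al /c; clearbody D; field2 k2.
  by rewrite -beE; field2 k2.
have dB3 : be ^+ 2 + al * be + c * al ^+ 2 = d3.
  transitivity (d1 + D + d2); last by rewrite /D; ring2 k2.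
  rewrite -[in RHS]dB1 -[in RHS]dB2 /al; clearbody D c; field2 k2.
have N0 : be ^+ 2 + al * be + c * al ^+ 2 != 0 by rewrite dB3.
have X2 (X : curve k) := char2_curve X k2.
(* Numerator [al * t + be] and constant [g] give the signature [g + al + c]. The chosen constants
   make it [s1] and [s2] and leave [s1 + s2 + c] for the third quotient. *)
apply: (caseB_cover k2 kp (g1 := s1 + c) (g2 := s2 + al + c) c0 be0 al0 N0) => i X bot y.
have hbot := pullback_const bot.
have tr := frac_transcendental (phi := bot) hbot.
set t := bot _ in tr => yE all.
have gen : generates t y.
  move=> S sS Sk St Sy z; have [u [v ->]] := all z.
  have KS x : ratl (const X) t x -> S x by apply: (rat_min sS).
  apply: (sfD sS); last apply: (sfM sS) => //; apply/KS/(frac_image hbot); last by exists v.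
  by exists u.
have P0 : t ^+ 2 + t + const X c != 0.
  have -> : t ^+ 2 + t + const X c = pev (const X) t ('X^2 + ('X + c%:P)).
    by rewrite !pevE addrA.
  apply: tr; rewrite -size_poly_eq0 size_polyDl ?size_polyXn //.
  by rewrite size_XaddC.
case: i yE => [[|[|[|//]]]] i3 /=; rewrite /tnth /=.
- rewrite !(rmorphD bot) !(rmorphM bot) !(fmorphV bot) !rmorphD rmorphXn -/t !hbot => yE.
  have yE' : y ^+ 2 + y = (const X 0 * t + const X be) / (t ^+ 2 + t + const X c)
      + const X (s1 + c).
    by rewrite yE !rmorphD rmorph0 mul0r add0r.
  have d0 : be ^+ 2 + 0 * be + c * 0 ^+ 2 != 0 by rewrite dB1.
  have [e [x [y' [he np]]]] := caseB_pair k2 tr gen d0 yE'.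
  apply: (normal_pair_model k2 r0_AS ord1 _ _ np); first by rewrite dB1.
  have -> : e + sgn r0 E1 = e + (s1 + c + 0 + c) by rewrite /s1; ring2 k2.
  exact: he.
- rewrite !(rmorphD bot) !(rmorphM bot) !(fmorphV bot) !rmorphD rmorphXn -/t !hbot => yE.
  have yE' : y ^+ 2 + y = (const X al * t + const X 0) / (t ^+ 2 + t + const X c)
      + const X (s2 + al + c).
    by rewrite yE !rmorphD rmorph0 addr0.
  have d0 : 0 ^+ 2 + al * 0 + c * al ^+ 2 != 0 by rewrite dB2.
  have [e [x [y' [he np]]]] := caseB_pair k2 tr gen d0 yE'.
  apply: (normal_pair_model k2 r0_AS ord2 _ _ np); first by rewrite dB2.
  have -> : e + sgn r0 E2 = e + (s2 + al + c + al + c) by rewrite /s2; ring2 k2.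
  exact: he.
- rewrite !(rmorphD bot) !(rmorphM bot) !(fmorphV bot) !rmorphD rmorphXn -/t !hbot => yE.
  have yE' : y ^+ 2 + y = (const X al * t + const X be) / (t ^+ 2 + t + const X c)
      + const X (s1 + s2 + al).
    by rewrite yE !rmorphD; have F2 := X2 X; field2 F2.
  have [e [x [y' [he np]]]] := caseB_pair k2 tr gen N0 yE'.
  apply: (normal_pair_model k2 r0_AS ord3 _ _ np); first by rewrite dB3.
  have -> : e + sgn r0 E3 = (e + (s1 + s2 + al + al + c)) + (c + s).
    by rewrite /s /s3; ring2 k2.
  exact: (ASD k2).
Qed.

End Triples.

(** * Bivariate relations *)

Section GaussLemma.

Variable k : fieldType.
Implicit Types (F Q S : {poly {poly k}}) (p a : {poly k}).

Definition primitive F := forall p, irreducible_poly p -> exists i, ~~ (p %| F`_i).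

Lemma irreducible_dvd a : (1 < size a)%N -> exists2 p, irreducible_poly p & p %| a.
Proof.
move=> sa; have a0 : a != 0 by rewrite -size_poly_gt0 ltnW.
have hM (u v : {poly k}) : (1 < size (u * v)%R)%N -> (1 < size u)%N \/ (1 < size v)%N.
  have [u1|//] := leqP (size u) 1; last by left.
  have [v1|] := leqP (size v) 1; last by right.
  rewrite ltnNge => /negP[]; apply: (leq_trans (size_polyMleq _ _)).
  by case: (size u) u1 (size v) v1 => [|[|?]] // _ [|[|?]].
have [p [ip pa _]] := irreducible_factor hM (fun _ _ h => h) a0 sa.
by exists p.
Qed.

Lemma irreducible_dvdM p u v : irreducible_poly p -> p %| u * v -> (p %| u) || (p %| v).
Proof.
move=> ip; case: (boolP (p %| u)) => //= nu.
by rewrite (Gauss_dvdpr _ (irreducible_coprime ip nu)).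
Qed.

(** Gauss's argument: take the first coefficients of [S] and of [F] not divisible by [p]; the
    coefficient of the product at the sum of their indices is not divisible by [p] either. *)
Lemma irreducible_dvd_factor p F S : irreducible_poly p ->
    (exists i, ~~ (p %| F`_i)) -> (forall i, p %| (S * F)`_i) ->
  forall j, p %| S`_j.
Proof.
move=> ip exF dvd j; apply/negPn/negP => nj.
have exS : exists j, ~~ (p %| S`_j) by exists j.
case: (ex_minnP exF) => i0 ni0 mini; case: (ex_minnP exS) => j0 nj0 minj.
have := dvd (j0 + i0)%N; rewrite coefM.
have lt : (j0 < (j0 + i0).+1)%N by rewrite ltnS leq_addr.
rewrite (bigD1 (Ordinal lt)) //= addKn dvdp_addl.
  by move/(irreducible_dvdM ip); rewrite (negPf nj0) (negPf ni0).
rewrite big_seq_cond; apply: (big_ind (fun u => p %| u)) => [|u v|i]; first exact: dvdp0.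
  exact: dvdp_add.
rewrite -val_eqE /= => /andP[_]; rewrite neq_ltn => /orP[lti|gti].
  apply: dvdp_mulr; apply/negPn/negP => h.
  by have := minj _ h; rewrite leqNgt lti.
apply: dvdp_mull; apply/negPn/negP => h.
have := mini _ h; rewrite leqNgt; case: i gti h => i /= ltS gti h.
by rewrite ltn_subLR ?ltn_add2r ?gti // -ltnS.
Qed.

(** Induction on the degree of [a]: an irreducible factor of [a] divides all coefficients of [S], as
    [F] is primitive, and can be cancelled. *)
Lemma gauss_lemma F : primitive F -> forall a Q S, a != 0 -> a *: Q = S * F ->
  exists S', Q = S' * F.
Proof.
move=> pF a; have [n] := ubnP (size a); elim: n a => // n IH a; rewrite ltnS => sa Q S a0 E.
have [sa1|sa1] := leqP (size a) 1.
  have := size1_polyC sa1; set c := a`_0 => aE.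
  have c0 : c != 0 by move: a0; rewrite aE polyC_eq0.
  exists ((c^-1)%:P *: S); rewrite -scalerAl -E scalerA aE -polyCM mulVf // scale1r.
  by [].
have [p ip /dvdpP[b aE]] := irreducible_dvd sa1.
have p0 : p != 0 by move: a0; rewrite aE mulf_eq0 negb_or => /andP[].
have b0 : b != 0 by move: a0; rewrite aE mulf_eq0 negb_or => /andP[].
have dS : forall j, p %| S`_j.
  apply: (irreducible_dvd_factor ip (pF p ip)) => i.
  by rewrite -E coefZ aE -mulrA mulrCA dvdp_mulIl.
pose S1 : {poly {poly k}} := \poly_(i < size S) (S`_i %/ p).
have SE : S = p *: S1.
  apply/polyP => i; rewrite coefZ coef_poly; case: ltnP => [_|le].
    by rewrite mulrC divpK.
  by rewrite mulr0 nth_default.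
apply: (IH b _ Q S1 b0).
  apply: (leq_trans _ sa); rewrite aE size_mul // -subn1.
  have [sp _] := ip; case: (size p) sp => [|[|m]] // _.
  by rewrite !addnS subn1 /= ltnS leq_addr.
apply/polyP => i; apply: (mulfI p0).
have := congr1 (fun q : {poly {poly k}} => q`_i) E.
by rewrite aE SE -scalerAl !coefZ => <-; rewrite mulrA [p * b]mulrC.
Qed.

End GaussLemma.

Lemma sizeY_mul (k : fieldType) (S F : {poly {poly k}}) : S != 0 -> F != 0 ->
  sizeY (S * F) = (sizeY S + sizeY F).-1.
Proof. by move=> S0 F0; rewrite !sizeYE rmorphM /= size_mul ?swapXY_eq0. Qed.

Section BivariateEvaluation.

Variables (k F : fieldType) (kap : {rmorphism k -> F}).

Section Morphism.
Variable t : F.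
Let pev_zmod : zmod_morphism (pev kap t). Proof. by move=> p q; rewrite pevB. Qed.
Let pev_monoid : monoid_morphism (pev kap t).
Proof. by split=> [|p q]; rewrite ?pev1 ?pevM. Qed.
HB.instance Definition _ := GRing.isZmodMorphism.Build {poly k} F (pev kap t) pev_zmod.
HB.instance Definition _ := GRing.isMonoidMorphism.Build {poly k} F (pev kap t) pev_monoid.
End Morphism.

Definition bev t x (Q : {poly {poly k}}) := (map_poly (pev kap t) Q).[x].

Lemma bevD t x P Q : bev t x (P + Q) = bev t x P + bev t x Q.
Proof. by rewrite /bev rmorphD hornerD. Qed.

Lemma bevM t x P Q : bev t x (P * Q) = bev t x P * bev t x Q.
Proof. by rewrite /bev rmorphM hornerM. Qed.

Lemma bevC t x p : bev t x p%:P = pev kap t p.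
Proof. by rewrite /bev map_polyC hornerC. Qed.

Lemma bev_X t x : bev t x 'X = x.
Proof. by rewrite /bev map_polyX hornerX. Qed.

Lemma bevX t x P n : bev t x (P ^+ n) = bev t x P ^+ n.
Proof. by rewrite /bev rmorphXn horner_exp. Qed.

Definition bevE := (bevD, bevM, bevC, bev_X, bevX).

(** Pseudo-division followed by Gauss's lemma: a primitive relation of least degree in [x] divides
    every relation over k[t]. Degrees in both variables can then be compared. *)
Lemma bev_dvd t x (P Q : {poly {poly k}}) : transcendental kap t -> P != 0 -> primitive P -> bev t x P = 0 ->
    (forall R : {poly {poly k}}, (size R < size P)%N -> bev t x R = 0 -> R = 0) -> bev t x Q = 0 ->
  exists S, Q = S * P.
Proof.
move=> tr P0 pP Pz minP Qz.
have := Pdiv.Idomain.divp_eq Q P; set a := lead_coef P ^+ _.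
have -> : Q %% P = 0.
  apply: minP; first by rewrite ltn_modp.
  have := congr1 (bev t x) (Pdiv.Idomain.divp_eq Q P).
  by rewrite -mul_polyC !bevE Pz Qz !mulr0 add0r.
rewrite addr0; apply: gauss_lemma => //.
by rewrite expf_neq0 ?lead_coef_eq0.
Qed.

Lemma bev_quadratic t x (A B C : {poly k}) :
  bev t x (A%:P * 'X^2 + (B%:P * 'X + C%:P)) =
  pev kap t A * x ^+ 2 + pev kap t B * x + pev kap t C.
Proof. by rewrite !bevE addrA. Qed.

End BivariateEvaluation.

(** * The invariant derivation of an elliptic curve *)

(** The part of [p] from degree two on, divided by t^2, is a polynomial in [t] and in [1 / t], hence
    constant. *)
Lemma degree2_bound (k F : fieldType) (kap : {rmorphism k -> F}) (F2 : 2%:R = 0 :> F)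
    t (p : {poly k}) z :
    transcendental kap t -> ratl kap t z -> z = pev kap t p ->
    (forall O, valuation_ring kap O -> O t^-1 -> O (z / t ^+ 2)) ->
  (size p <= 3)%N.
Proof.
move=> tr rz zE h; have t0 := transcendental_nz tr.
have [q qE] : exists q, z / t ^+ 2 = pev kap t^-1 q.
  apply: (rat_integral (transcendentalV tr)); last exact: h.
  have sK := rat_subfield kap t; have Kt := rat_gen kap t.
  by apply: rat_inv; sfsolve.
have pE : p = (p`_0)%:P + p`_1 *: 'X + drop_poly 2 p * 'X^2.
  rewrite -{1}(poly_take_drop 2 p); congr (_ + _).
  apply/polyP => i; rewrite coef_take_poly coefD coefC coefZ coefX.
  by case: i => [|[|i]] //=; rewrite ?mulr0 ?mulr1 ?addr0 ?add0r.
have [c cE] : exists c, drop_poly 2 p = c%:P.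
  apply: (poly_in_both tr (q := q + (p`_0)%:P * 'X^2 + (p`_1)%:P * 'X)).
  rewrite !pevE -qE zE {2}pE !pevE; field2 F2.
rewrite pE cE; apply/leq_sizeP => j; case: j => [|[|[|j]]] // _.
by rewrite !coefD coefC coefZ coefX mulr0 coefCM coefXn mulr0 !addr0.
Qed.

Section Elliptic.

Variable k : finFieldType.
Hypothesis k2 : 2%:R = 0 :> k.
Variable X : curve k.
Let X2 : 2%:R = 0 :> X := char2_curve X k2.
Local Notation kap := (const X).
Variables (d e : k) (x Y : X).
Hypothesis d0 : d != 0.
Hypothesis np : normal_pair d e x Y.

Let x0 : x != 0. Proof. by case: np. Qed.
Let YE : Y ^+ 2 + Y = x + kap d / x + kap e. Proof. by case: np. Qed.

Lemma normal_transcendental : transcendental kap x.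
Proof.
move=> p p0; apply/negP => /eqP px.
have [a aE] : exists a, x = kap a.
  by apply: curve_const_closed; exists p => //; apply/rootP.
have [b bE] : exists b, Y = kap b.
  apply: curve_const_closed; exists ('X^2 + ('X + (a + d / a + e)%:P)).
    by rewrite -size_poly_eq0 size_polyDl ?size_polyXn // size_XaddC.
  apply/rootP; rewrite -/(pev kap Y _) !pevE addrA YE aE !rmorphD rmorphM fmorphV.
  by rewrite addxx.
have [z nz] := curve_not_const X.
have [_ _ gen] := np.
have [c] : image_of kap z by apply: gen; [exact: image_subfield|move=> c; exists c|exists a|exists b].
exact: nz.
Qed.

Let trx := normal_transcendental.
Local Notation Kx := (ratl kap x).
Let sKx : is_subfield Kx := rat_subfield kap x.

(* [x + d / x + e] has a simple pole at infinity. *)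
Lemma normal_infinite O : valuation_ring kap O -> ~ O x ->
  O (x^-1 * (Y ^+ 2 + Y)) /\ ~ maxid O (x^-1 * (Y ^+ 2 + Y)).
Proof.
move=> vO nx; have mi := maxidV nx; have Oi := maxidW vO mi.
have -> : x^-1 * (Y ^+ 2 + Y) = x^-1 * (kap d * x^-1 + kap e) + 1 by rewrite YE; field2 X2.
split; first by vrsolve vO.
by apply: (maxid_add_unit vO _ (maxid1 vO)); apply: (maxidMr vO) => //; vrsolve vO.
Qed.

Lemma normal_zero O : valuation_ring kap O -> maxid O x ->
  O (x * (Y ^+ 2 + Y)) /\ ~ maxid O (x * (Y ^+ 2 + Y)).
Proof.
move=> vO mx; have Ox := maxidW vO mx.
have -> : x * (Y ^+ 2 + Y) = x * (x + kap e) + kap d by rewrite YE; field2 X2.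
split; first by vrsolve vO.
by apply: (maxid_add_unit vO _ (unit_const vO d0)); apply: (maxidMr vO) => //; vrsolve vO.
Qed.

Lemma normal_quad : quad Kx (@anything X) Y.
Proof.
have q : quad Kx (fun z => exists a b, [/\ Kx a, Kx b & z = a + b * Y]) Y.
  split=> //.
    by rewrite YE; have := (rat_gen kap x, rat_const kap x d, rat_const kap x e) => -[[? ?] ?]; sfsolve.
  have [O vO nx] := exists_infinite_place trx.
  have [O1 n1] := normal_infinite vO nx.
  have up := inverse_uniformizer (kap := kap) vO trx nx.
  by move=> KY; apply: (uniformizer_noAS X2 vO sKx up O1 n1 KY erefl).
have sL := quad_subfield X2 q.
have [_ _ gen] := np; have [_ h1 h2 h3] := q.
split=> // z; split=> // _; apply/h3; apply: (gen (fun z => exists a b, [/\ Kx a, Kx b & z = a + b * Y])) => //.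
- by move=> c; apply: (quad_sub q); apply: rat_const.
- by apply: (quad_sub q); apply: rat_gen.
- exact: (quad_gen q).
Qed.

Lemma normal_derivation : exists D0, [/\ derivation kap D0, D0 x = 1
  & forall D, derivation kap D -> forall z, D z = D x * D0 z].
Proof.
have [D [dD Dt]] := der_ratE X2 trx.
have [D1 [dD1 D1K _]] := der_extend X2 normal_quad (rat_const kap x) dD.
have d1 := derivation_all (fun=> I) dD1.
have D1x : D1 x = 1 by rewrite D1K //; exact: rat_gen.
exists D1; split=> // D' dD' z.
pose D3 z := D' z + D' x * D1 z.
have dD3 : derivation kap D3 by apply: der_sub => //; apply: der_scale.
apply: (addxx_eq0 X2); rewrite -/(D3 z).
have D3K a : Kx a -> D3 a = 0.
  by move=> Ka; apply: (der_rat0 X2 dD3 Ka); rewrite /D3 D1x mulr1 addxx.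
exact: (der_quad0 X2 dD3 normal_quad).
Qed.

Section Derivation.

Variable D0 : X -> X.
Hypotheses (dD0 : derivation kap D0) (D0x : D0 x = 1).
Hypothesis all : forall D, derivation kap D -> forall z, D z = D x * D0 z.

(* [x * D0] is the derivation dual to the regular form [dx / x]. *)
Lemma invariant_stable O : valuation_ring kap O ->
  stable O (@anything X) (fun z => x * D0 z) /\
  exists g, [/\ O g, O (x * D0 g) & ~ maxid O (x * D0 g)].
Proof.
move=> vO; have q := normal_quad.
have [Ox|nx] := pselect (O x).
  have st : stable O Kx D0.
    by apply: (stable_rat X2 vO trx dD0 Ox); rewrite D0x; apply: (vr1 vO).
  have [mx|nmx] := pselect (maxid O x).
    have [O1 n1] := normal_zero vO mx.
    have up : uniformizer O Kx x.
      by have := linear_uniformizer vO (c := 0) trx Ox; rewrite rmorph0 addr0; apply.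
    have [s1 h] := stable_ramified X2 vO q up O1 n1 dD0 st.
    have Og := maxidW vO (ramified_maxid X2 vO up O1).
    split=> //; exists (x * Y); split=> //; first by apply: s1.
    by apply: h; rewrite D0x; apply: (maxid1 vO).
  have Oi := vr_unit Ox nmx.
  have s1 : stable O (@anything X) D0.
    by apply: (stable_etale X2 vO q) => //; rewrite YE; vrsolve vO.
  split; first by move=> z _ Oz; apply: (vrM vO) => //; apply: s1.
  by exists x; rewrite D0x mulr1.
have [O1 n1] := normal_infinite vO nx.
have up := inverse_uniformizer vO trx nx.
pose D1 z := x ^+ 2 * D0 z.
have dD1 : derivation kap D1 by apply: der_scale.
have D1s : D1 x^-1 = 1.
  by rewrite /D1 (derV X2 dD0) D0x mulrC divfK // expf_neq0.
have Oi := maxidW vO (maxidV nx).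
have st : stable O Kx D1.
  have h : O (D1 x^-1) by rewrite D1s; apply: (vr1 vO).
  move=> z /rat_inv Kz Oz.
  exact: (stable_rat X2 vO (transcendentalV trx) dD1 Oi h Kz Oz).
have [s1 h] := stable_ramified X2 vO q up O1 n1 dD1 st.
have Og := maxidW vO (ramified_maxid X2 vO up O1).
have E z : x * D0 z = x^-1 * D1 z by rewrite /D1; field2 X2.
have -> : (fun z => x * D0 z) = (fun z => x^-1 * D1 z) by apply/funext => z; apply: E.
split=> //; exists (x^-1 * Y); rewrite E; split=> //; first by apply: s1.
by apply: h; rewrite D1s; apply: (maxid1 vO).
Qed.

Lemma invariant_form : regular_form [:: (x^-1, x)].
Proof.
apply: (regular_intro k2 dD0 all) => O vO.
have [_ [g [Og O1 n1]]] := invariant_stable vO.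
exists x, g; split=> //; first exact: maxid_nz n1.
rewrite /form_at big_seq1 /= D0x mulr1 divff // mul1r.
exact: (vr_unit O1 n1).
Qed.

(** In characteristic two the square of a derivation is a derivation. This one kills [x], and a
    derivation is determined by its value at [x]. *)
Lemma invariant_idempotent z : D0 (D0 z) = 0.
Proof.
pose D2 z := D0 (D0 z).
have dD2 : derivation kap D2.
  split=> [c|u v|u v]; rewrite /D2.
  - by rewrite (der_const dD0) (der0 dD0).
  - by rewrite (derD dD0) (derD dD0).
  - by rewrite (derM dD0) (derD dD0) !(derM dD0); ring2 X2.
by rewrite -/(D2 z) (all dD2) /D2 D0x (der1 dD0) mul0r.
Qed.

(** As dx / x is regular, its coefficient with respect to dt lies in k(t), and so does [x * D0 t].
    The derivation [x * D0] preserves all valuation rings, so this value is a polynomial [G] of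
    degree at most two; applying [x * D0] once more reproduces it, which means that [G] has
    derivative 1. *)
Lemma invariant_quadratic t y0 : transcendental kap t ->
    quad (ratl kap t) (@anything X) y0 ->
  exists G : {poly k}, [/\ (size G <= 3)%N, G^`() = 1 & x * D0 t = pev kap t G].
Proof.
move=> trt qt; have t0 := transcendental_nz trt.
have [D [dD Dt]] := der_ratE X2 trt.
have [D1 [dD1 D1K _]] := der_extend X2 qt (rat_const kap t) dD.
have {}dD1 := derivation_all (fun=> I) dD1.
have D1t : D1 t = 1 by rewrite D1K //; exact: rat_gen.
have G_nz : D1 x * D0 t = 1 by rewrite -all.
have [D1x0 D0t0] : D1 x != 0 /\ D0 t != 0.
  by apply/andP; rewrite -negb_or -mulf_eq0 G_nz oner_eq0.
have KG : ratl kap t (x * D0 t).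
  have := hyperelliptic_regular k2 trt (fun=> I) qt dD1 D1t invariant_form.
  rewrite /form_at big_seq1 /= => /(sfV (rat_subfield kap t)).
  have -> // : (x^-1 * D1 x)^-1 = x * D0 t.
  by rewrite invfM invrK -[D0 t]mul1r -(mulVf D1x0) -mulrA G_nz mulr1.
have [G GE] : exists G, x * D0 t = pev kap t G.
  apply: (rat_integral trt KG) => O vO Ot.
  by have [st _] := invariant_stable vO; apply: st.
exists G; split=> //.
  apply: (degree2_bound X2 trt KG GE) => O vO Oi.
  have [st _] := invariant_stable vO; have := st _ I Oi.
  by rewrite (derV X2 dD0) mulrA.
apply: (pev_inj trt); rewrite pev1.
have nG : x * D0 t != 0 by rewrite mulf_neq0.
apply: (mulIf nG); rewrite mul1r.
rewrite mulrCA -(der_pev X2 dD0) -GE (derM dD0) invariant_idempotent mulr0 add0r D0x.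
by rewrite mulr1.
Qed.

End Derivation.

End Elliptic.

(** * Quadratic maps from an elliptic curve to the line *)

Lemma quad_replace (F : fieldType) (F2 : 2%:R = 0 :> F) K L (y z : F) : quad K L y -> L z -> ~ K z -> K (z ^+ 2 + z) ->
  quad K L z.
Proof.
move=> q Lz nz Kz; have [sK _ _ h] := q; have /h[a [b [Ka Kb zE]]] := Lz.
have b0 : b != 0 by apply/eqP => b0; apply: nz; rewrite zE b0 mul0r addr0.
by split=> // w; rewrite zE; apply: (quad_other F2 q).
Qed.

Section QuadraticRelations.

Variables (k F : fieldType) (kap : {rmorphism k -> F}).
Hypothesis k2 : 2%:R = 0 :> k.
Let F2 : 2%:R = 0 :> F. Proof. by rewrite -(rmorph_nat kap) k2 rmorph0. Qed.

Lemma quad_relation t y x : quad (ratl kap t) (@anything F) y ->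
  exists A B C : {poly k}, [/\ A != 0, (B = 0 -> ratl kap t x)
    & pev kap t A * x ^+ 2 + pev kap t B * x + pev kap t C = 0].
Proof.
move=> q; have [sK Kf _ h] := q; have /h[a [b [Ka Kb xE]]] := I : anything x.
have [u1 [v1 [v10 bE]]] := Kb.
have [u2 [v2 [v20 cE]]] : ratl kap t (a ^+ 2 + a * b + b ^+ 2 * (y ^+ 2 + y)) by sfsolve.
have nz v : pev kap t v != 0 -> v != 0 by apply: contraNneq => ->; rewrite pev0.
exists (v1 * v2), (u1 * v2), (u2 * v1); split; first by rewrite mulf_neq0 ?nz.
  move/eqP; rewrite mulf_eq0 (negPf (nz _ v20)) orbF => /eqP u10.
  by rewrite xE bE u10 pev0 !mul0r addr0.
have E : x ^+ 2 + b * x + (a ^+ 2 + a * b + b ^+ 2 * (y ^+ 2 + y)) = 0.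
  by rewrite xE; ring2 F2.
rewrite cE bE in E; rewrite !pevM -[RHS](mulr0 (pev kap t v1 * pev kap t v2)) -E.
by field2 F2.
Qed.

Lemma primitive_triple (A B C : {poly k}) : A != 0 -> exists g A' B' C',
  [/\ A = g * A', B = g * B', C = g * C' &
      forall p, irreducible_poly p -> [|| ~~ (p %| A'), ~~ (p %| B') | ~~ (p %| C')]].
Proof.
move=> A0; pose g := gcdp A (gcdp B C).
have gA : g %| A by apply: dvdp_gcdl.
have gB : g %| B by apply: dvdp_trans (dvdp_gcdr _ _) (dvdp_gcdl _ _).
have gC : g %| C by apply: dvdp_trans (dvdp_gcdr _ _) (dvdp_gcdr _ _).
have g0 : g != 0 by rewrite gcdp_eq0 negb_and A0.
exists g, (A %/ g), (B %/ g), (C %/ g); split; try by rewrite mulrC divpK.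
move=> p [sp _]; rewrite -!negb_and; apply/negP => /and3P[pA pB pC].
have : g * p %| g.
  by rewrite !dvdp_gcd -{1}(divpK gA) -{1}(divpK gB) -{1}(divpK gC) ![g * p]mulrC !dvdp_mul.
rewrite -[X in _ %| X]mulr1 dvdp_mul2l // => /dvdp_leq.
by rewrite oner_eq0 size_poly1 leqNgt sp => /(_ isT).
Qed.

Lemma bev_swap_map t x (p : {poly k}) : bev kap t x (map_poly polyC p) = pev kap x p.
Proof.
elim/poly_ind: p => [|p c IH]; first by rewrite rmorph0 pev0 /bev rmorph0 horner0.
by rewrite rmorphD rmorphM /= map_polyX map_polyC /= !bevE IH !pevE.
Qed.

Lemma bev_swap_quadratic t x (L M N : {poly k}) :
  bev kap t x (swapXY (L%:P * 'X^2 + (M%:P * 'X + N%:P))) =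
  pev kap x L * t ^+ 2 + pev kap x M * t + pev kap x N.
Proof.
rewrite rmorphD rmorphM rmorphXn rmorphD rmorphM /= swapXY_X !swapXY_polyC.
by rewrite !bevE !bev_swap_map pev_X addrA.
Qed.

Lemma sizeY_dvd (P Q S : {poly {poly k}}) : Q = S * P -> Q != 0 -> (sizeY P <= sizeY Q)%N.
Proof.
move=> -> ; rewrite mulf_eq0 negb_or => /andP[S0 P0]; rewrite sizeY_mul //.
have : (0 < sizeY S)%N by rewrite lt0n sizeY_eq0.
by case: (sizeY S) => // n _; rewrite addSn /= leq_addl.
Qed.

Lemma coefs3 (p : {poly k}) : (size p <= 3)%N ->
  p = (p`_0)%:P + p`_1 *: 'X + p`_2 *: 'X^2.
Proof.
move=> sp; apply/polyP => i; rewrite !coefD !coefZ coefC coefX coefXn.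
case: i => [|[|[|i]]] /=; rewrite ?mulr0 ?mulr1 ?addr0 ?add0r //.
by rewrite nth_default //; apply: leq_trans sp _.
Qed.

Lemma coefs2 (p : {poly k}) : (size p <= 2)%N -> p = (p`_0)%:P + p`_1 *: 'X.
Proof.
move=> sp; apply/polyP => i; rewrite !coefD !coefZ coefC coefX.
case: i => [|[|i]] /=; rewrite ?mulr0 ?mulr1 ?addr0 ?add0r //.
by rewrite nth_default //; apply: leq_trans sp _.
Qed.

(** The primitive relation [v * 'X - u] divides the one that expresses [t] by [x], which is linear
    in [t]; so [u] and [v] are at most linear. A vanishing determinant would make [x] constant. *)
Lemma mobius t x : transcendental kap t -> transcendental kap x -> ratl kap t x ->
    ratl kap x t ->
  exists p q r s : k, [/\ p * s + q * r != 0, kap r + kap s * t != 0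
    & x * (kap r + kap s * t) = kap p + kap q * t].
Proof.
move=> trt trx /rat_coprime[u [v [cuv v0 xE]]] [u2 [v2 [v20 tE]]].
have vn : v != 0 by apply: contraNneq v0 => ->; rewrite pev0.
have v2n : v2 != 0 by apply: contraNneq v20 => ->; rewrite pev0.
pose P : {poly {poly k}} := v%:P * 'X - u%:P.
have P0 : P`_0 = - u by rewrite coefB coefCM coefX mulr0 coefC sub0r.
have P1 : P`_1 = v by rewrite coefB coefCM coefX mulr1 coefC subr0.
have sP : size P = 2%N.
  by rewrite /P -polyCN size_MXaddC polyC_eq0 (negPf vn) /= size_polyC vn.
have Pn : P != 0 by rewrite -size_poly_eq0 sP.
have prP : primitive P.
  move=> p [sp _]; have [pv|nv] := boolP (p %| v); last by exists 1%N; rewrite P1.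
  exists 0%N; rewrite P0 dvdpNr; apply/negP => pu; move: cuv.
  rewrite /coprimep => /eqP g1; have : p %| gcdp u v by rewrite dvdp_gcd pu.
  by move/dvdp_leq; rewrite -size_poly_eq0 g1 leqNgt sp => /(_ isT).
have ePx : bev kap t x P = 0.
  by rewrite /P -polyCN !bevE pevN xE; field2 F2.
have minP (R : {poly {poly k}}) : (size R < size P)%N -> bev kap t x R = 0 -> R = 0.
  rewrite sP ltnS => /size1_polyC ->; rewrite bevC; case: (eqVneq R`_0 0) => [->//|n0].
  by move/eqP; rewrite (negPf (trt _ n0)).
pose Q := swapXY (0%:P * 'X^2 + (v2%:P * 'X + (- u2)%:P) : {poly {poly k}}).
have eQ : bev kap t x Q = 0.
  by rewrite bev_swap_quadratic pev0 pevN tE; field2 F2.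
have [S QE] := bev_dvd trt Pn prP ePx minP eQ.
have sQ : (sizeY Q <= 2)%N.
  by rewrite sizeYE swapXYK polyC0 mul0r add0r size_MXaddC polyC_eq0 (negPf v2n) /= size_polyC v2n.
have Qn : Q != 0.
  rewrite swapXY_eq0 polyC0 mul0r add0r -size_poly_eq0 size_MXaddC polyC_eq0.
  by rewrite (negPf v2n).
have sY := leq_trans (sizeY_dvd QE Qn) sQ.
have su : (size u <= 2)%N.
  by apply: leq_trans sY; rewrite -size_polyN -P0 max_size_coefXY.
have sv : (size v <= 2)%N by apply: leq_trans sY; rewrite -P1 max_size_coefXY.
have vE : pev kap t v = kap v`_0 + kap v`_1 * t by rewrite {1}(coefs2 sv) !pevE.
have uE : pev kap t u = kap u`_0 + kap u`_1 * t by rewrite {1}(coefs2 su) !pevE.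
have xE' : x * pev kap t v = pev kap t u by rewrite xE divfK.
exists u`_0, u`_1, v`_0, v`_1; rewrite -vE -uE; split=> //.
apply: contraNneq (v0) => /(addxx_eq0 k2) D.
have no a : x != kap a by apply: transcendental_const.
rewrite vE; have [r0|r0] := eqVneq v`_0 0.
  have [s0|s0] := eqVneq v`_1 0; first by rewrite r0 s0 !rmorph0 mul0r addr0.
  have p0 : u`_0 = 0.
    by move: D; rewrite r0 mulr0 => /eqP; rewrite mulf_eq0 (negPf s0) orbF => /eqP.
  have t0 := transcendental_nz trt; have ks0 : kap v`_1 != 0 by rewrite fmorph_eq0.
  case/eqP: (no (u`_1 / v`_1)); apply: (mulIf v0); rewrite xE' uE vE r0 p0.
  by rewrite rmorphM fmorphV rmorph0; field2 F2.
have kr0 : kap v`_0 != 0 by rewrite fmorph_eq0.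
case/eqP: (no (u`_0 / v`_0)); apply: (mulIf v0); rewrite xE' uE vE.
have -> : u`_1 = u`_0 * v`_1 / v`_0 by rewrite D mulfK.
by rewrite !rmorphM fmorphV; field2 F2.
Qed.

End QuadraticRelations.

Section CoverForm.

Variable k : finFieldType.
Hypothesis k2 : 2%:R = 0 :> k.
Variable X : curve k.
Let X2 : 2%:R = 0 :> X := char2_curve X k2.
Local Notation kap := (const X).
Variables (d e : k) (x Y : X).
Hypothesis d0 : d != 0.
Hypothesis np : normal_pair d e x Y.
Variables (t y0 : X).
Hypothesis trt : transcendental kap t.
Local Notation K := (ratl kap t).
Local Notation Kx := (ratl kap x).
Hypothesis qt : quad K (@anything X) y0.

Let x0 : x != 0. Proof. by case: np. Qed.
Let YE : Y ^+ 2 + Y = x + kap d / x + kap e. Proof. by case: np. Qed.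
Let trx : transcendental kap x := normal_transcendental k2 np.
Let qx : quad Kx (@anything X) Y := normal_quad k2 np.
Let sK : is_subfield K := rat_subfield kap t.
Let sKx : is_subfield Kx := rat_subfield kap x.
Let Kt : K t := rat_gen kap t.
Let Kc a : K (kap a) := rat_const kap t a.
Let Kxx : Kx x := rat_gen kap x.
Let Kxc a : Kx (kap a) := rat_const kap x a.

(* An Artin-Schreier equation over [k(t)] from which the invariants [d] and [e]
   can be read off; [d] is the resultant of numerator and denominator. *)
Definition cover_form := exists h0 h1 h2 g0 g2 y,
  [/\ quad K (@anything X) y,
      (kap g0 + t + kap g2 * t ^+ 2) * (y ^+ 2 + y) = kap h0 + kap h1 * t + kap h2 * t ^+ 2,
      (g0 * h2 + g2 * h0) ^+ 2 + (h0 + g0 * h1) * (h2 + g2 * h1) = d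
    & AS (h1 + g0 * g2 + e)].

Let not_all : ~ forall z, K z.
Proof. by move=> all; case: qt => _ _ ny _; apply: ny. Qed.

(** Here [x] is a coordinate of the line, hence a quotient [c / a] of linear forms in [t]. Scaled to
    determinant 1, the product [a * c] has linear coefficient 1, and clearing denominators in x + d
    / x + e gives the required form. *)
Lemma cover_form_rational : K x -> cover_form.
Proof.
move=> Kx_; have [_ _ gen] := np.
have nY : ~ K Y by move=> KY; apply: not_all; apply: (gen K).
have Kxt : Kx t.
  have [_ _ _ h] := qx; have /h[a [b [Ka Kb tE]]] := I : anything t.
  have xK z : Kx z -> K z by apply: (rat_min sK).
  have [b0|b0] := eqVneq b 0; first by rewrite tE b0 mul0r addr0.
  case: nY; have -> : Y = (t + a) / b by rewrite tE; field2 X2.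
  have := (xK _ Ka, xK _ Kb) => -[? ?]; sfsolve.
have [p [q [r [s [n0 v0 xE]]]]] := mobius k2 trt trx Kx_ Kxt.
have [l lE] := finite_sqrt k2 (p * s + q * r)^-1.
have l0 : l != 0.
  by apply: contraNneq n0 => l0; move/eqP: lE; rewrite l0 expr0n invr_eq0.
have [[p' pE] [q' qE]] : (exists p', l * p = p') /\ exists q', l * q = q' by split; eexists.
have [[r' rE] [s' sE]] : (exists r', l * r = r') /\ exists s', l * s = s' by split; eexists.
have det : p' * s' = q' * r' + 1.
  apply: (addxx_eq0 k2); rewrite -pE -qE -rE -sE.
  have -> : l * p * (l * s) + (l * q * (l * r) + 1) = l ^+ 2 * (p * s + q * r) + 1 by ring2 k2.
  by rewrite -lE mulVf // addxx.
pose a := kap r' + kap s' * t; pose c := kap p' + kap q' * t.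
have kl0 : kap l != 0 by rewrite fmorph_eq0.
have aE : a = kap l * (kap r + kap s * t) by rewrite /a -rE -sE !rmorphM; ring2 X2.
have a0 : a != 0 by rewrite aE mulf_neq0.
have cE : x * a = c by rewrite aE mulrCA xE /c -pE -qE !rmorphM; ring2 X2.
have c0 : c != 0 by rewrite -cE mulf_neq0.
exists (p' ^+ 2 + d * r' ^+ 2 + e * p' * r'), e, (q' ^+ 2 + d * s' ^+ 2 + e * q' * s').
exists (p' * r'), (q' * s'), Y; split.
- by apply: (quad_replace X2 qt) => //; rewrite YE; have Kd := Kc d; have Ke := Kc e; sfsolve.
- have -> : kap (p' * r') + t + kap (q' * s') * t ^+ 2 = a * c.
    have kdet : kap p' * kap s' = kap q' * kap r' + 1 by rewrite -!rmorphM det rmorphD rmorph1.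
    by rewrite /a /c !rmorphM; ring2 X2 kdet.
  have -> : a * c * (Y ^+ 2 + Y) = c ^+ 2 + kap d * a ^+ 2 + kap e * (a * c).
    by rewrite YE -cE; field2 X2.
  have kdet : kap p' * kap s' = kap q' * kap r' + 1 by rewrite -!rmorphM det rmorphD rmorph1.
  have -> : kap e * (a * c) =
      kap e * kap p' * kap r' + kap e * t + kap e * kap q' * kap s' * t ^+ 2.
    by rewrite /a /c; ring2 X2 kdet.
  by rewrite /a /c !(rmorphD, rmorphM, rmorphXn); ring2 X2.
- by ring2 k2 det.
- exists (p' * s'); have -> : e + p' * r' * (q' * s') + e = p' * s' * (q' * r') by ring2 k2.
  by rewrite det; ring2 k2.
Qed.

Hypothesis nKx : ~ K x.

(** Otherwise k(t) would be contained in k(x), and as [x] generates the whole field over k(t), this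
    field would be k(x). *)
Let t_notin : ~ Kx t.
Proof.
move=> Kxt; have tK z : K z -> Kx z by apply: (rat_min sKx).
have [_ _ _ h] := qt; have /h[a [b [Ka Kb xE]]] := I : anything x.
have b0 : b != 0 by apply/eqP => b0; apply: nKx; rewrite xE b0 mul0r addr0.
have Ky0 : Kx y0.
  have -> : y0 = (x + a) / b by rewrite [in RHS]xE; field2 X2.
  by have := (tK _ Ka, tK _ Kb) => -[? ?]; sfsolve.
have [_ _ nY _] := qx; apply: nY.
have /h[u [v [Ku Kv ->]]] := I : anything Y.
by have := (tK _ Ku, tK _ Kv) => -[? ?]; sfsolve.
Qed.

(* The simple pole of [x + d / x + e] at infinity, resp. zero. *)
Let no_pole a b c r : Kx r -> r ^+ 2 + r = kap a * x + kap b / x + kap c -> a = 0 /\ b = 0.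
Proof.
move=> Kr rE; split.
  apply/eqP; apply: contraT => a0.
  have [O vO nx] := exists_infinite_place trx.
  have up := inverse_uniformizer vO trx nx.
  have mi := maxidV nx; have Oi := maxidW vO mi.
  have E : x^-1 * (kap a * x + kap b / x + kap c) = x^-1 * (kap b * x^-1 + kap c) + kap a.
    by field2 X2.
  case: (uniformizer_noAS X2 vO sKx up (f := kap a * x + kap b / x + kap c) _ _ Kr rE).
    by rewrite E; vrsolve vO.
  rewrite E; apply: (maxid_add_unit vO _ (unit_const vO a0)).
  by apply: (maxidMr vO) => //; vrsolve vO.
apply/eqP; apply: contraT => b0.
have sX : (1 < size ('X : {poly k}))%N by rewrite size_polyX.
have [O vO [Ox]] := exists_place trx sX; rewrite pev_X => mx.
have up : uniformizer O Kx x.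
  by have := linear_uniformizer vO (c := 0) trx Ox; rewrite rmorph0 addr0; apply.
have E : x * (kap a * x + kap b / x + kap c) = x * (kap a * x + kap c) + kap b.
  by field2 X2.
case: (uniformizer_noAS X2 vO sKx up (f := kap a * x + kap b / x + kap c) _ _ Kr rE).
  by rewrite E; vrsolve vO.
rewrite E; apply: (maxid_add_unit vO _ (unit_const vO b0)).
by apply: (maxidMr vO) => //; vrsolve vO.
Qed.

Let const_AS r c : r ^+ 2 + r = kap c -> AS c.
Proof.
move=> rE; have [a aE] : exists a, r = kap a.
  apply: curve_const_closed; exists ('X^2 + ('X + c%:P)).
    by rewrite -size_poly_eq0 size_polyDl ?size_polyXn // size_XaddC.
  by apply/rootP; rewrite -/(pev kap r _) !pevE addrA rE addxx.
exists a; apply: (fmorph_inj kap); rewrite -rE aE rmorphD rmorphXn addrC.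
by [].
Qed.

(** The relation can be solved for either variable: [y] is an Artin-Schreier generator over k(t),
    and [Z] is one over k(x). As [Y] is another one, [Y + Z] is in k(x); the absence of simple poles
    identifies the norms [Na] and [Nc] with 1 and [d], and the remaining constant gives the
    signature. *)
Lemma cover_form_square a0 a2 c0 c2 g0 g2 :
    kap a0 + kap a2 * t != 0 ->
    (kap a0 + kap a2 * t) ^+ 2 * x ^+ 2 + (kap g0 + t + kap g2 * t ^+ 2) * x
      + (kap c0 + kap c2 * t) ^+ 2 = 0 ->
  cover_form.
Proof.
set a := kap a0 + _; set c := kap c0 + _; set g := kap g0 + _ + _ => na E.
have Ka : K a by have := (Kc a0, Kc a2) => -[? ?]; rewrite /a; sfsolve.
have Kcc : K c by have := (Kc c0, Kc c2) => -[? ?]; rewrite /c; sfsolve.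
have Kg : K g by have := (Kc g0, Kc g2) => -[? ?]; rewrite /g; sfsolve.
have g_nz : g != 0.
  have -> : g = pev kap t (g2 *: 'X^2 + ('X + g0%:P)) by rewrite !pevE /g; ring2 X2.
  apply: trt; apply/eqP => E0; have := coef0 k 1.
  by rewrite -E0 coefD coefZ coefXn mulr0 add0r coefD coefX coefC addr0 => /eqP; rewrite oner_eq0.
have gx : g * x = a ^+ 2 * x ^+ 2 + c ^+ 2 by apply: (addxx_eq0 X2); rewrite -[RHS]E; ring2 X2.
pose y := (a ^+ 2 * x + a * c) / g.
have yE : g * (y ^+ 2 + y) = a * c.
  transitivity (a * c + a ^+ 2 * (a ^+ 2 * x ^+ 2 + g * x + c ^+ 2) / g); last first.
    by rewrite E mulr0 mul0r addr0.
  by rewrite /y; field2 X2.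
have ny : ~ K y.
  move=> Ky; apply: nKx; have -> : x = (g * y + a * c) / a ^+ 2 by rewrite /y; field2 X2.
  by sfsolve.
have Ky2 : K (y ^+ 2 + y).
  have -> : y ^+ 2 + y = a * c / g by rewrite -yE; field2 X2.
  by sfsolve.
have qy := quad_replace X2 qt I ny Ky2.
pose Na := g2 * a0 ^+ 2 + a0 * a2 + g0 * a2 ^+ 2.
pose Nc := g2 * c0 ^+ 2 + c0 * c2 + g0 * c2 ^+ 2.
pose Ec := a2 ^+ 2 * c0 ^+ 2 + a0 ^+ 2 * c2 ^+ 2 + g0 * g2.
pose q := kap a2 ^+ 2 * x ^+ 2 + kap g2 * x + kap c2 ^+ 2.
pose n := kap a0 ^+ 2 * x ^+ 2 + kap g0 * x + kap c0 ^+ 2.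
have tE : t ^+ 2 * q + t * x + n = 0 by rewrite -[RHS]E /a /c /g /q /n; ring2 X2.
have := (Kxc a0, Kxc a2, Kxc c0, Kxc c2) => -[[[? ?] ?] ?].
have := (Kxc g0, Kxc g2) => -[? ?].
have Kq : Kx q by rewrite /q; sfsolve.
have Kn : Kx n by rewrite /n; sfsolve.
have q0 : q != 0.
  apply/eqP => q0; apply: t_notin; have -> : t = n / x.
    apply: (mulIf x0); rewrite divfK //; apply: (addxx_eq0 X2).
    by rewrite -[RHS]tE q0 mulr0 add0r.
  by sfsolve.
pose T := t * q / x.
have TE : T ^+ 2 + T = q * n / x ^+ 2.
  apply: (addxx_eq0 X2); transitivity (q * (t ^+ 2 * q + t * x + n) / x ^+ 2).
    by rewrite /T; clearbody q n; field2 X2.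
  by rewrite tE mulr0 mul0r.
pose Z := T + (kap a0 * kap a2 * x + kap c0 * kap c2 / x).
have ZE : Z ^+ 2 + Z = kap Na * x + kap Nc / x + kap Ec.
  have -> : Z ^+ 2 + Z = (T ^+ 2 + T) + (kap a0 * kap a2 * x + kap c0 * kap c2 / x) ^+ 2
     + (kap a0 * kap a2 * x + kap c0 * kap c2 / x) by rewrite /Z; clearbody T; field2 X2.
  by rewrite TE /q /n /Na /Nc /Ec !(rmorphD, rmorphM, rmorphXn); field2 X2.
have nZ : ~ Kx Z.
  move=> KZ; apply: t_notin.
  have -> : t = (Z + (kap a0 * kap a2 * x + kap c0 * kap c2 / x)) * x / q.
    by rewrite /Z /T; clearbody q; field2 X2.
  by sfsolve.
have KZ2 : Kx (Z ^+ 2 + Z).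
  by rewrite ZE; have := (Kxc Na, Kxc Nc, Kxc Ec) => -[[? ?] ?]; sfsolve.
have Kr := quad_AS X2 qx I nZ KZ2.
have rE : (Y + Z) ^+ 2 + (Y + Z) = kap (Na + 1) * x + kap (Nc + d) / x + kap (Ec + e).
  have -> : (Y + Z) ^+ 2 + (Y + Z) = (Y ^+ 2 + Y) + (Z ^+ 2 + Z) by ring2 X2.
  by rewrite YE ZE !rmorphD rmorph1; field2 X2.
have [/(addxx_eq0 k2) Na1 /(addxx_eq0 k2) Ncd] := no_pole Kr rE.
have ASe : AS (Ec + e).
  apply: (const_AS (r := Y + Z)); rewrite rE Na1 Ncd !(addxx k2) rmorph0.
  by rewrite !mul0r !add0r.
exists (a0 * c0), (a0 * c2 + a2 * c0), (a2 * c2), g0, g2, y; split=> //.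
- by rewrite -/g yE /a /c !(rmorphD, rmorphM); ring2 X2.
- transitivity (Na * Nc); last by rewrite Na1 mul1r.
  by rewrite /Na /Nc; ring2 k2.
have -> : a0 * c2 + a2 * c0 + g0 * g2 + e =
    (Ec + e) + ((a0 * c2 + a2 * c0) ^+ 2 + (a0 * c2 + a2 * c0)) by rewrite /Ec; ring2 k2.
by apply: (ASD k2) => //; apply: AS_map.
Qed.

(* In the exceptional case both coordinates of [Y] over [k(t)] would satisfy an
   Artin-Schreier equation with a simple pole at a root of [G]. *)
Lemma constant_norm_false (p G B : {poly k}) (a c : k) : a != 0 -> G^`() = 1 ->
    irreducible_poly p -> p %| G -> ~~ (p %| B) ->
    kap a * pev kap t G * x ^+ 2 + pev kap t B * x + kap c * pev kap t G = 0 -> False.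
Proof.
move=> a0 dG ip /dvdpP[G' GE] nB.
have [sp _] := ip; have [O vO [Ot mp]] := exists_place trt sp.
have mG : maxid O (pev kap t G).
  by rewrite GE pevM; apply: (maxidMl vO) => //; apply: (vr_pev vO).
have up := deriv1_uniformizer vO trt Ot dG mG.
have nb : ~ maxid O (pev kap t B).
  by move=> mB; apply: (maxid_coprime vO Ot (irreducible_coprime ip nB) mp mB).
have Ob : O (pev kap t B) by apply: (vr_pev vO).
have KG := rat_pev kap t G; have KB := rat_pev kap t B.
move: (pev kap t G) (pev kap t B) up nb Ob KG KB mG => g b up nb Ob Kg Kb mg rel.
have Og := maxidW vO mg; have b0 := maxid_nz nb; have Obi := vr_unit Ob nb.
have g0 : g != 0 by case: up.
have ka0 : kap a != 0 by rewrite fmorph_eq0.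
have := (Kc a, Kc c, Kc d, Kc e) => -[[[? ?] ?] ?].
have kc0 : kap c != 0.
  apply/eqP => c0; apply: nKx; have -> : x = b / (kap a * g).
    have h : x * (kap a * g * x + b) = 0 by rewrite -[RHS]rel c0; ring2 X2.
    move/eqP: h; rewrite mulf_eq0 (negPf x0) /= => /eqP /(addxx_eq0 X2) <-.
    by field2 X2.
  by sfsolve.
pose w := kap a * g * x / b.
have wE : w ^+ 2 + w = kap c * kap a * g ^+ 2 / b ^+ 2.
  apply: (addxx_eq0 X2); transitivity (kap a * g / b ^+ 2 *
     (kap a * g * x ^+ 2 + b * x + kap c * g)); last by rewrite rel mulr0.
  by rewrite /w; field2 X2.
have nw : ~ K w.
  move=> Kw; apply: nKx; have -> : x = w * b / (kap a * g) by rewrite /w; field2 X2.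
  by sfsolve.
have Kw2 : K (w ^+ 2 + w) by rewrite wE; sfsolve.
have qw := quad_replace X2 qt I nw Kw2.
have [_ _ _ h] := qw; have /h[u [v [Ku Kv YuE]]] := I : anything Y.
pose q := kap a^-1 + kap d / kap c.
have xE : x = b / (kap a * g) * w by rewrite /w; field2 X2.
have xi : kap d / x = kap d * b / (kap c * g) * (w + 1).
  apply: (mulIf x0); rewrite divfK //; apply: (addxx_eq0 X2).
  transitivity (kap d / (kap c * g) * (kap a * g * x ^+ 2 + b * x + kap c * g)); last first.
    by rewrite rel mulr0.
  by rewrite /w; field2 X2.
have [E1 E2] : u ^+ 2 + u + v ^+ 2 * (w ^+ 2 + w) = kap d * b / (kap c * g) + kap e /\
    v ^+ 2 + v = kap (a^-1 + d / c) * (b / g).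
  have Kq := Kc (a^-1 + d / c).
  apply: (quad_uniq X2 qw); try by sfsolve.
  transitivity (Y ^+ 2 + Y); first by rewrite YuE; ring2 X2.
  rewrite YE xi {1}xE rmorphD rmorphM !fmorphV; field2 X2.
have pole r s z : s != 0 -> O z -> K r -> r ^+ 2 + r = kap s * (b / g) + z -> False.
  move=> s0 Oz Kr rE.
  have gE : g * (kap s * (b / g) + z) = g * z + kap s * b by field2 X2.
  case: (uniformizer_noAS X2 vO sK up (f := kap s * (b / g) + z) _ _ Kr rE).
    by rewrite gE; vrsolve vO.
  rewrite gE; apply: (maxid_add_unit vO); first exact: (maxidMr vO).
  by case/(maxid_prime vO) => //; [vrsolve vO|apply: (unit_const vO s0)].
have q0 : a^-1 + d / c = 0.
  apply/eqP; apply: contraT => n0; case: (pole v _ 0 n0 (vr0 vO) Kv).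
  by rewrite addr0.
have Ov : O v.
  have : v * (v + 1) = 0 by rewrite mulrDr -expr2 mulr1 E2 q0 rmorph0 mul0r.
  move/eqP; rewrite mulf_eq0 => /orP[/eqP ->|/eqP /(addxx_eq0 X2) ->].
    exact: (vr0 vO).
  exact: (vr1 vO).
have c0 : c != 0 by apply: contraNneq kc0 => ->; rewrite rmorph0.
apply: (pole u (d / c) (kap e + v ^+ 2 * (w ^+ 2 + w))) => //.
- by rewrite mulf_neq0 ?invr_eq0.
- by rewrite wE -exprVn; vrsolve vO.
apply: (addIr (v ^+ 2 * (w ^+ 2 + w))); rewrite E1 rmorphM fmorphV; clearbody w.
by field2 X2.
Qed.

Section Relation.

Variables A B C : {poly k}.
Local Notation ev := (pev kap t).
Hypotheses (A0 : A != 0) (B0 : B != 0).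
Hypothesis prim : forall p, irreducible_poly p ->
  [|| ~~ (p %| A), ~~ (p %| B) | ~~ (p %| C)].
Hypothesis rel : ev A * x ^+ 2 + ev B * x + ev C = 0.
Let P : {poly {poly k}} := A%:P * 'X^2 + (B%:P * 'X + C%:P).

Let coefP : [/\ P`_0 = C, P`_1 = B & P`_2 = A].
Proof.
by rewrite /P !coefD !coefCM !coefXn !coefX !coefC /= !mulr0 !mulr1 !add0r !addr0.
Qed.

Let sP : size P = 3%N.
Proof.
have s2 : (size (B%:P * 'X + C%:P : {poly {poly k}})%R <= 2)%N.
  by rewrite size_MXaddC; case: ifP => // _; rewrite ltnS size_polyC leq_b1.
have s3 : size (A%:P * 'X^2 : {poly {poly k}})%R = 3%N.
  by rewrite size_mulXn ?polyC_eq0 // size_polyC A0.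
by rewrite size_polyDl s3.
Qed.

Let Pn : P != 0. Proof. by rewrite -size_poly_eq0 sP. Qed.

Let dvdP Q : bev kap t x Q = 0 -> exists S, Q = S * P.
Proof.
have [c0 c1 c2] := coefP; apply: bev_dvd => //.
- move=> p ip; case/or3P: (prim ip) => h.
  + by exists 2%N; rewrite c2.
  + by exists 1%N; rewrite c1.
  + by exists 0%N; rewrite c0.
- by rewrite bev_quadratic.
move=> R; rewrite sP ltnS => sR.
have RE : R = (R`_1)%:P * 'X + (R`_0)%:P.
  apply/polyP => i; rewrite coefD coefCM coefX coefC.
  case: i => [|[|i]] /=; rewrite ?mulr0 ?mulr1 ?addr0 ?add0r //.
  by rewrite nth_default //; apply: leq_trans sR _.
rewrite {1}RE !bevE => E.
have R1 : R`_1 = 0.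
  apply/eqP; apply: contraT => n1; case: nKx; have n1' := trt n1.
  have -> : x = ev R`_0 / ev R`_1.
    by apply: (mulIf n1'); rewrite divfK // mulrC; apply: (addxx_eq0 X2).
  by apply: (sf_div sK); apply: rat_pev.
move: E; rewrite R1 pev0 mul0r add0r => E; rewrite RE R1.
have [->|n0] := eqVneq R`_0 0; first by rewrite polyC0 mul0r addr0.
by move/eqP: E; rewrite (negPf (trt n0)).
Qed.

(** [t] is quadratic over k(x) too, and [P] divides the corresponding relation after an exchange of
    the variables. *)
Let sYP : (sizeY P <= 3)%N.
Proof.
have [L [M [N [L0 _ E]]]] := quad_relation k2 t qx.
pose R : {poly {poly k}} := L%:P * 'X^2 + (M%:P * 'X + N%:P).
have [|S QE] := dvdP (Q := swapXY R); first by rewrite bev_swap_quadratic.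
have sR : size R = 3%N.
  have s2 : (size (M%:P * 'X + N%:P : {poly {poly k}})%R <= 2)%N.
    by rewrite size_MXaddC; case: ifP => // _; rewrite ltnS size_polyC leq_b1.
  have s3 : size (L%:P * 'X^2 : {poly {poly k}})%R = 3%N.
    by rewrite size_mulXn ?polyC_eq0 // size_polyC L0.
  by rewrite size_polyDl s3.
have Rn : swapXY R != 0 by rewrite swapXY_eq0 -size_poly_eq0 sR.
by have := sizeY_dvd QE Rn; rewrite [sizeY (swapXY R)]sizeYE swapXYK sR.
Qed.

Let sA : (size A <= 3)%N.
Proof. by have [_ _ <-] := coefP; apply: leq_trans (max_size_coefXY _ _) sYP. Qed.
Let sB : (size B <= 3)%N.
Proof. by have [_ <- _] := coefP; apply: leq_trans (max_size_coefXY _ _) sYP. Qed.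
Let sC : (size C <= 3)%N.
Proof. by have [<- _ _] := coefP; apply: leq_trans (max_size_coefXY _ _) sYP. Qed.

(* If [t] occurred linearly, it would belong to [k(x)]. *)
Let sYP3 : sizeY P = 3%N.
Proof.
apply/eqP; rewrite eqn_leq sYP ltnNge; apply/negP => le2.
have [c0 c1 c2] := coefP.
have lin (q : {poly k}) : (size q <= 2)%N -> ev q = kap q`_0 + kap q`_1 * t.
  by move=> sq; rewrite {1}(coefs2 sq) !pevE.
have lA := leq_trans (max_size_coefXY P 2) le2; rewrite c2 in lA.
have lB := leq_trans (max_size_coefXY P 1) le2; rewrite c1 in lB.
have lC := leq_trans (max_size_coefXY P 0) le2; rewrite c0 in lC.
pose m i : {poly k} := A`_i *: 'X^2 + (B`_i *: 'X + (C`_i)%:P).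
have mE i : pev kap x (m i) = kap A`_i * x ^+ 2 + (kap B`_i * x + kap C`_i).
  by rewrite /m !pevE.
have E : pev kap x (m 1%N) * t + pev kap x (m 0%N) = 0.
  by rewrite -[RHS]rel !mE (lin _ lA) (lin _ lB) (lin _ lC); ring2 X2.
have m0 i : m i = 0 -> [/\ A`_i = 0, B`_i = 0 & C`_i = 0].
  move=> mi; have h j : (m i)`_j = 0 by rewrite mi coef0.
  have := h 0%N; have := h 1%N; have := h 2%N.
  by rewrite /m !coefD !coefZ !coefXn !coefX !coefC /= !mulr0 !mulr1 !add0r !addr0.
have [m1|n1] := eqVneq (m 1%N) 0; last first.
  case: t_notin; have n1' := trx n1.
  have -> : t = pev kap x (m 0%N) / pev kap x (m 1%N).
    by apply: (mulIf n1'); rewrite divfK // mulrC; apply: (addxx_eq0 X2).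
  by apply: (sf_div sKx); apply: rat_pev.
have [m00|n0] := eqVneq (m 0%N) 0; last first.
  by move/eqP: E; rewrite m1 pev0 mul0r add0r (negPf (trx n0)).
have [a1 _ _] := m0 _ m1; have [a0 _ _] := m0 _ m00.
by move: A0; rewrite (coefs2 lA) a1 a0 scale0r addr0 polyC0 eqxx.
Qed.

Variables (D0 : X -> X) (G : {poly k}).
Hypotheses (dD0 : derivation kap D0) (D0x : D0 x = 1).
Hypotheses (sG : (size G <= 3)%N) (dG : G^`() = 1) (GE : x * D0 t = ev G).

Let G1 : G`_1 = 1.
Proof. by have := congr1 (fun p : {poly k} => p`_0) dG; rewrite coef_deriv coef1 mulr1n. Qed.

Let Gn : G != 0.
Proof. by apply/eqP => G0; move/eqP: G1; rewrite G0 coef0 eq_sym oner_eq0. Qed.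

Let deriv3 (q : {poly k}) : (size q <= 3)%N -> q^`() = (q`_1)%:P.
Proof.
move=> sq; apply/polyP => i; rewrite coef_deriv coefC.
case: i => [|[|i]] //=; first by rewrite -mulr_natl k2 mul0r.
by rewrite nth_default ?mul0rn //; apply: leq_trans sq _.
Qed.

(* Applying the derivation to the relation gives another one of the same
   bidegree, which is a constant multiple of it. *)
Lemma relation_derivative : exists r : k,
  [/\ A`_1 *: G = r *: A, B`_1 *: G + B = r *: B & C`_1 *: G = r *: C].
Proof.
have [c0 c1 c2] := coefP.
have Dev q : x * D0 (ev q) = ev q^`() * ev G.
  by rewrite (der_pev X2 dD0) mulrCA GE.
pose Q : {poly {poly k}} := (A`_1 *: G)%:P * 'X^2 + ((B`_1 *: G + B)%:P * 'X + (C`_1 *: G)%:P).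
have eQ : bev kap t x Q = 0.
  rewrite bev_quadratic !pevD !pevZ.
  transitivity (x * D0 (ev A * x ^+ 2 + ev B * x + ev C)); last first.
    by rewrite rel (der0 dD0) mulr0.
  rewrite !(derD dD0) (derM dD0 _ (x ^+ 2)) (der_sqr X2 dD0) (derM dD0 _ x) D0x.
  have -> (u v w z : X) : x * (u * 0 + x ^+ 2 * v + (w * 1 + x * z) + D0 (ev C)) =
     x ^+ 2 * (x * v) + w * x + x * (x * z) + x * D0 (ev C) by ring2 X2.
  by rewrite !Dev !deriv3 // !pevC; ring2 X2.
have coefQ : [/\ Q`_0 = C`_1 *: G, Q`_1 = B`_1 *: G + B & Q`_2 = A`_1 *: G].
  by rewrite /Q !coefD !coefCM !coefXn !coefX !coefC /= !mulr0 !mulr1 !add0r !addr0.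
have [S QE] := dvdP eQ.
have sQ : (size Q <= 3)%N.
  rewrite (leq_trans (size_polyD _ _)) // geq_max; apply/andP; split.
    rewrite (leq_trans (size_polyMleq _ _)) // size_polyXn addnS /=.
    by rewrite -[3%N]/(1 + 2)%N leq_add2r size_polyC leq_b1.
  by rewrite size_MXaddC; case: ifP => // _; rewrite ltnS (leq_trans (size_polyC_leq1 _)).
have sYQ : (sizeY Q <= 3)%N.
  have sz (u : k) : (size (u *: G)%R <= 3)%N by apply: leq_trans (size_scale_leq _ _) sG.
  have [q0 q1 q2] := coefQ; apply/bigmax_leqP => i _.
  case: i => [[|[|[|i]]]] /= lti; rewrite ?q0 ?q1 ?q2 ?sz //.
    by rewrite (leq_trans (size_polyD _ _)) // geq_max sz sB.
  by have := leq_trans lti sQ.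
have [r SE] : exists r : k, S = r%:P%:P.
  have [->|S0] := eqVneq S 0; first by exists 0.
  have s1 : (size S <= 1)%N.
    by move: sQ; rewrite QE size_mul // sP; case: (size S) => [|[|n]] //; rewrite !addSn addnC.
  have s2 : (sizeY S <= 1)%N.
    by move: sYQ; rewrite QE sizeY_mul // sYP3; case: (sizeY S) => [|[|n]] //; rewrite !addSn addnC.
  exists (S`_0)`_0; rewrite {1}(size1_polyC s1); congr (_%:P); apply: size1_polyC.
  exact: leq_trans (max_size_coefXY _ _) s2.
exists r; have [q0 q1 q2] := coefQ.
by rewrite -q0 -q1 -q2 QE SE !coefCM c0 c1 c2 !mul_polyC.
Qed.

Lemma relation_cover_form : cover_form.
Proof.
have [r [rA rB rC]] := relation_derivative.
have Gt0 : ev G != 0 by apply: trt.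
have GtE : ev G = kap G`_0 + t + kap G`_2 * t ^+ 2.
  by rewrite {1}(coefs3 sG) !pevE G1 rmorph1 mul1r.
(* If [r = 0], then [A] and [C] have no linear term and are squares up to a constant, while [B] is a
   multiple of [G]: the relation is of the square type. Otherwise [A] and [C] are multiples of
   [G]. *)
have [r0|r0] := eqVneq r 0.
  have zero (u : k) : u *: G = 0 -> u = 0.
    by move/eqP; rewrite scaler_eq0 (negPf Gn) orbF => /eqP.
  have A1 : A`_1 = 0 by apply: zero; rewrite rA r0 scale0r.
  have C1 : C`_1 = 0 by apply: zero; rewrite rC r0 scale0r.
  have BE : ev B = kap B`_1 * ev G.
    by apply/esym/(addxx_eq0 X2); rewrite -pevZ -pevD rB r0 scale0r pev0.
  have b0 : B`_1 != 0.
    by apply: contraNneq (trt B0) => b0; rewrite BE b0 rmorph0 mul0r.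
  have kb0 : kap B`_1 != 0 by rewrite fmorph_eq0.
  have sq c : exists s, c = B`_1 * s ^+ 2.
    have [s sE] := finite_sqrt k2 (c / B`_1); exists s.
    by rewrite -sE mulrC divfK.
  have [a0 a0E] := sq A`_0; have [a2 a2E] := sq A`_2.
  have [u0 u0E] := sq C`_0; have [u2 u2E] := sq C`_2.
  have evA : ev A = kap B`_1 * (kap a0 + kap a2 * t) ^+ 2.
    by rewrite {1}(coefs3 sA) A1 a0E a2E scale0r addr0 !pevE !(rmorphM, rmorphXn); ring2 X2.
  have evC : ev C = kap B`_1 * (kap u0 + kap u2 * t) ^+ 2.
    by rewrite {1}(coefs3 sC) C1 u0E u2E scale0r addr0 !pevE !(rmorphM, rmorphXn); ring2 X2.
  apply: (@cover_form_square a0 a2 u0 u2 G`_0 G`_2).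
    by apply: contraNneq (trt A0) => h; rewrite evA h expr0n mulr0.
  apply: (mulfI kb0); by rewrite mulr0 -[RHS]rel evA evC BE GtE -!mulrA -!mulrDr.
have div_scale (u : k) (q : {poly k}) : u *: G = r *: q -> q = (u / r) *: G.
  by move=> h; rewrite mulrC -scalerA h scalerA mulVf // scale1r.
have AE := div_scale _ _ rA; have CE := div_scale _ _ rC.
have sGgt : (1 < size G)%N.
  by rewrite ltnNge; apply/negP => /leq_sizeP/(_ 1%N isT)/eqP; rewrite G1 oner_eq0.
have [p ip pG] := irreducible_dvd sGgt.
have nB : ~~ (p %| B).
  have dvdZ u : p %| u *: G by rewrite -mul_polyC dvdp_mull.
  case/or3P: (prim ip) => //.
    by rewrite AE dvdZ.
  by rewrite CE dvdZ.
(* For any other value [B] would also be a multiple of [G], against primitivity; [r = 1] is the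
   exceptional case excluded before. *)
have r1 : r = 1.
  apply: contrapT => /eqP r1; move/negP: nB; apply.
  have r10 : r + 1 != 0 by apply: contraNneq r1 => /(addxx_eq0 k2) ->.
  have BE : B`_1 *: G = (r + 1) *: B.
    apply: (addIr B); rewrite rB scalerDl scale1r -addrA -mulr2n.
    by rewrite -scaler_nat k2 scale0r addr0.
  have -> : B = ((r + 1)^-1 * B`_1) *: G by rewrite -scalerA BE scalerA mulVf // scale1r.
  by rewrite -mul_polyC dvdp_mull.
have a0 : A`_1 != 0.
  by apply: contraNneq A0 => a0; rewrite AE a0 mul0r scale0r.
case: (@constant_norm_false p G B A`_1 C`_1 a0 dG ip pG nB).
have evA : ev A = kap A`_1 * ev G by rewrite {1}AE r1 divr1 pevZ.
have evC : ev C = kap C`_1 * ev G by rewrite {1}CE r1 divr1 pevZ.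
by rewrite -evA -evC.
Qed.

End Relation.

End CoverForm.

Lemma cover_form_exists (k : finFieldType) (k2 : 2%:R = 0 :> k) (X : curve k) (d e : k)
    (x Y : X) : d != 0 -> normal_pair d e x Y ->
  forall t y0 : X, transcendental (const X) t -> quad (ratl (const X) t) (@anything X) y0 ->
  cover_form d e t.
Proof.
move=> d0 np t y0 trt qt; have X2 := char2_curve X k2.
have [Kx|nKx] := pselect (ratl (const X) t x); first exact: (cover_form_rational k2 np trt qt Kx).
have [A0 [B0 [C0 [A00 B00 rel0]]]] := quad_relation k2 x qt.
have [g [A [B [C [AE BE CE prim]]]]] := primitive_triple B0 C0 A00.
have gn : g != 0 by apply: contraNneq A00 => g0; rewrite AE g0 mul0r.
have An : A != 0 by apply: contraNneq A00 => g0; rewrite AE g0 mulr0.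
have Bn : B != 0 by apply/eqP => B_0; apply/nKx/B00; rewrite BE B_0 mulr0.
have rel : pev (const X) t A * x ^+ 2 + pev (const X) t B * x + pev (const X) t C = 0.
  apply: (mulfI (trt _ gn)); rewrite mulr0 -[RHS]rel0 AE BE CE !pevM.
  by rewrite -!mulrA -!mulrDr.
have [D0 [dD0 D0x all]] := normal_derivation k2 np.
have [G [sG dG GE]] := invariant_quadratic k2 d0 np dD0 D0x all trt qt.
exact: (relation_cover_form k2 d0 np trt qt nKx An Bn prim rel dD0 D0x sG dG GE).
Qed.

(** * Triples of Artin-Schreier equations *)

Section Resultants.

Variable k : fieldType.
Hypothesis k2 : 2%:R = 0 :> k.

Definition quadratic (a b c : k) : {poly k} := a%:P + b%:P * 'X + c%:P * 'X^2.

(** The resultant, in characteristic two, of two polynomials of formal degree two, common roots at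
    infinity included. *)
Definition resultant2 (p0 p1 p2 q0 q1 q2 : k) :=
  (p0 * q2 + p2 * q0) ^+ 2 + (p0 * q1 + p1 * q0) * (p1 * q2 + p2 * q1).

Let P2 : 2%:R = 0 :> {poly k}.
Proof. by rewrite -(rmorph_nat polyC) k2 rmorph0. Qed.

Lemma resultant_bezout p0 p1 p2 q0 q1 q2 : exists u v : {poly k},
  u * quadratic p0 p1 p2 + v * quadratic q0 q1 q2 = (resultant2 p0 p1 p2 q0 q1 q2)%:P.
Proof.
pose e0 := p0 * q2 + p2 * q0; pose e1 := p1 * q2 + p2 * q1.
exists ((e1 * q1 + e0 * q2)%:P + (e1 * q2)%:P * 'X).
exists ((e1 * p1 + e0 * p2)%:P + (e1 * p2)%:P * 'X).
rewrite /quadratic /resultant2 /e0 /e1 !(polyCD, polyCM, rmorphXn) /=; ring2 P2.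
Qed.

Lemma quadratic_coef a b c : [/\ (quadratic a b c)`_0 = a, (quadratic a b c)`_1 = b
  & (quadratic a b c)`_2 = c].
Proof.
by rewrite /quadratic !coefD !coefCM !coefX !coefXn !coefC /= !mulr0 !mulr1 !addr0 !add0r.
Qed.

Lemma quadratic_size a c : (1 < size (quadratic a 1 c))%N.
Proof.
rewrite ltnNge; apply/negP => /leq_sizeP/(_ 1%N isT)/eqP.
by have [_ -> _] := quadratic_coef a 1 c; rewrite oner_eq0.
Qed.

Lemma quadratic_deriv a c : (quadratic a 1 c)^`() = 1.
Proof.
rewrite /quadratic !derivD derivC !deriv_mulC derivX derivXn add0r mulr1.
by rewrite -mulr_natl P2 mul0r mulr0 addr0.
Qed.

(** A pole of the first fraction cancels against the others, so [G1] has a common root with [H1],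
    [G2] or [G3]. Multiplying the three Bezout identities, the product of the resultants becomes a
    multiple of the nonconstant [G1], hence zero. *)
Lemma resultant_vanish a0 a1 a2 b0 b1 b2 c0 c1 c2 g0 g2 g0' g2' g0'' g2'' (s : k) :
  let H1 := quadratic a0 a1 a2 in let H2 := quadratic b0 b1 b2 in
  let H3 := quadratic c0 c1 c2 in let G1 := quadratic g0 1 g2 in
  let G2 := quadratic g0' 1 g2' in let G3 := quadratic g0'' 1 g2'' in
  H1 * G2 * G3 + H2 * G1 * G3 + H3 * G1 * G2 = s%:P * G1 * G2 * G3 ->
  resultant2 a0 a1 a2 g0 1 g2 * resultant2 g0' 1 g2' g0 1 g2 *
    resultant2 g0'' 1 g2'' g0 1 g2 = 0.
Proof.
move=> H1 H2 H3 G1 G2 G3 E.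
have [u1 [v1 e1]] := resultant_bezout a0 a1 a2 g0 1 g2.
have [u2 [v2 e2]] := resultant_bezout g0' 1 g2' g0 1 g2.
have [u3 [v3 e3]] := resultant_bezout g0'' 1 g2'' g0 1 g2.
apply: (@polyC_inj k); rewrite !polyCM -e1 -e2 -e3 polyC0 -/H1 -/G1 -/G2 -/G3.
pose W := v1 * (u2 * G2 + v2 * G1) * (u3 * G3 + v3 * G1) + u1 * H1 * v2 * (u3 * G3 + v3 * G1)
  + u1 * H1 * u2 * G2 * v3 + u1 * u2 * u3 * (s%:P * G2 * G3 + H2 * G3 + H3 * G2).
have WE : (u1 * H1 + v1 * G1) * (u2 * G2 + v2 * G1) * (u3 * G3 + v3 * G1) = G1 * W.
  have E' : H1 * G2 * G3 = G1 * (s%:P * G2 * G3 + H2 * G3 + H3 * G2).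
    have -> : H1 * G2 * G3 = H1 * G2 * G3 + H2 * G1 * G3 + H3 * G1 * G2
       + (H2 * G1 * G3 + H3 * G1 * G2) by ring2 P2.
    by rewrite E; ring2 P2.
  transitivity (u1 * u2 * u3 * (H1 * G2 * G3) + G1 * (v1 * (u2 * G2 + v2 * G1) * (u3 * G3 + v3 * G1)
    + u1 * H1 * v2 * (u3 * G3 + v3 * G1) + u1 * H1 * u2 * G2 * v3)); first by ring2 P2.
  by rewrite E' /W; ring2 P2.
have WC : G1 * W = (resultant2 a0 a1 a2 g0 1 g2 * resultant2 g0' 1 g2' g0 1 g2 *
    resultant2 g0'' 1 g2'' g0 1 g2)%:P by rewrite -WE !polyCM -e1 -e2 -e3.
by rewrite WE (mul_const_eq0 (quadratic_size _ _) WC) mulr0.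
Qed.

(** The two factors are the homogeneous values of the quadratic at the roots of the linear forms
    [l0 + l2 t] and [m0 + m2 t]. *)
Lemma resultant_split h0 h1 h2 l0 l2 m0 m2 : l0 * m2 = l2 * m0 + 1 ->
  resultant2 h0 h1 h2 (l0 * m0) 1 (l2 * m2) =
  (h0 * l2 ^+ 2 + h1 * (l0 * l2) + h2 * l0 ^+ 2) *
  (h0 * m2 ^+ 2 + h1 * (m0 * m2) + h2 * m0 ^+ 2).
Proof.
move=> det; have -> : 1 = l0 * m2 + l2 * m0 by rewrite det; ring2 k2.
by rewrite /resultant2; ring2 k2.
Qed.

Hypothesis k_perfect : forall c : k, exists s, c = s ^+ 2.

(** Both linear coefficients are 1, so the sum of the two quadratics is the square of a linear form
    l, and a common root is the root of l. If m denotes the cofactor of l in the first quadratic,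
    the second is l (l + m). *)
Lemma common_root g0 g2 g0' g2' : resultant2 g0' 1 g2' g0 1 g2 = 0 ->
    (g0, g2) != (g0', g2') ->
  exists l0 l2 m0 m2, [/\ l0 * m2 = l2 * m0 + 1, g0 = l0 * m0, g2 = l2 * m2,
    g0' = l0 * (l0 + m0) & g2' = l2 * (l2 + m2)].
Proof.
move=> R ne; have [l0 E0] := k_perfect (g0 + g0'); have [l2 E2] := k_perfect (g2 + g2').
have g0E : g0' = g0 + l0 ^+ 2 by rewrite -E0; ring2 k2.
have g2E : g2' = g2 + l2 ^+ 2 by rewrite -E2; ring2 k2.
have root : g0 * l2 ^+ 2 + g2 * l0 ^+ 2 = l0 * l2.
  apply: (addxx_eq0 k2); apply/eqP; rewrite -sqrf_eq0; apply/eqP.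
  by rewrite -R /resultant2 g0E g2E; ring2 k2.
have [m0 [m2 [e1 e2 e3]]] : exists m0 m2, [/\ l0 * m2 = l2 * m0 + 1, g0 = l0 * m0 & g2 = l2 * m2].
  have [l00|l00] := eqVneq l0 0.
    have l20 : l2 != 0.
      by apply: contraNneq ne => l20; rewrite g0E g2E l00 l20 expr0n !addr0.
    exists l2^-1, (g2 / l2); rewrite l00 !mul0r divff // addxx //; split=> //.
      move/eqP: root; rewrite l00 mul0r expr0n mulr0 addr0 mulf_eq0.
      by rewrite sqrf_eq0 (negPf l20) orbF => /eqP.
    by rewrite mulrC divfK.
  exists (g0 / l0), ((1 + l2 * (g0 / l0)) / l0); split.
  - by rewrite mulrC divfK // addrC.
  - by rewrite mulrC divfK.
  have -> : g2 = (l0 * l2 + g0 * l2 ^+ 2) / l0 ^+ 2.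
    by rewrite -root; field2 k2.
  by field2 k2.
exists l0, l2, m0, m2; split=> //.
  by rewrite g0E e2; ring2 k2.
by rewrite g2E e3; ring2 k2.
Qed.

End Resultants.

Section SimplePoles.

Variables (k F : fieldType) (kap : {rmorphism k -> F}).
Hypothesis k2 : 2%:R = 0 :> k.
Let F2 : 2%:R = 0 :> F. Proof. by rewrite -(rmorph_nat kap) k2 rmorph0. Qed.
Variable t : F.
Hypothesis tr : transcendental kap t.
Local Notation K := (ratl kap t).

Lemma pev_quadratic a b c : pev kap t (quadratic a b c) = kap a + kap b * t + kap c * t ^+ 2.
Proof. by rewrite /quadratic !pevE. Qed.

Lemma quadratic_nz a c : pev kap t (quadratic a 1 c) != 0.
Proof. by apply: tr; rewrite -size_poly_gt0 ltnW ?quadratic_size. Qed.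

(** The pole at infinity is at most simple even if the denominator drops to degree one. *)
Lemma simple_infinite O g0 g2 h0 h1 h2 : valuation_ring kap O -> ~ O t ->
  O (t^-1 * (pev kap t (quadratic h0 h1 h2) / pev kap t (quadratic g0 1 g2))).
Proof.
move=> vO nt; have mi := maxidV nt; have Oi := maxidW vO mi; have t0 := transcendental_nz tr.
have G0 := quadratic_nz g0 g2; rewrite !pev_quadratic rmorph1 mul1r in G0 *.
have unit z : O z -> ~ maxid O z -> O z^-1 by apply: vr_unit.
have OH : O (kap h0 * t^-1 ^+ 2 + kap h1 * t^-1 + kap h2) by vrsolve vO.
have [g20|g20] := eqVneq g2 0.
  rewrite g20 rmorph0 mul0r addr0 in G0 *.
  have u : O (1 + kap g0 * t^-1)^-1.
    apply: unit; first by vrsolve vO.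
    rewrite addrC; apply: (maxid_add_unit vO _ (maxid1 vO)).
    by apply: (maxidMl vO) => //; vrsolve vO.
  have -> : t^-1 * ((kap h0 + kap h1 * t + kap h2 * t ^+ 2) / (kap g0 + t)) =
     (kap h0 * t^-1 ^+ 2 + kap h1 * t^-1 + kap h2) * (1 + kap g0 * t^-1)^-1.
    have -> : 1 + kap g0 * t^-1 = (kap g0 + t) / t by field2 F2.
    by rewrite invf_div; field2 F2.
  exact: (vrM vO).
have u : O (kap g0 * t^-1 ^+ 2 + t^-1 + kap g2)^-1.
  apply: unit; first by vrsolve vO.
  apply: (maxid_add_unit vO _ (unit_const vO g20)).
  by apply: (maxidD vO) => //; rewrite expr2 mulrA; apply: (maxidMl vO) => //; vrsolve vO.
have -> : t^-1 * ((kap h0 + kap h1 * t + kap h2 * t ^+ 2) / (kap g0 + t + kap g2 * t ^+ 2)) =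
   t^-1 * (kap h0 * t^-1 ^+ 2 + kap h1 * t^-1 + kap h2) *
     (kap g0 * t^-1 ^+ 2 + t^-1 + kap g2)^-1.
  have -> : kap g0 * t^-1 ^+ 2 + t^-1 + kap g2 = (kap g0 + t + kap g2 * t ^+ 2) / t ^+ 2.
    by field2 F2.
  by rewrite invf_div; field2 F2.
by apply: (vrM vO) => //; apply: (vrM vO).
Qed.

Variables (I : Type) (r : seq I) (h0 h1 h2 g0 g2 : I -> k).
Let H i := pev kap t (quadratic (h0 i) (h1 i) (h2 i)).
Let G i := pev kap t (quadratic (g0 i) 1 (g2 i)).

(* A pole of [z] would be a double pole of [z ^+ 2 + z]. *)
Lemma simple_poles_const z : K z -> z ^+ 2 + z = \sum_(i <- r) H i / G i ->
  exists c, z = kap c.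
Proof.
move=> Kz zE; have sK := rat_subfield kap t.
have odd O p : valuation_ring kap O -> uniformizer O K p ->
    (forall i, O (p * (H i / G i))) -> O z.
  move=> vO up h; apply: (odd_norm_local F2 vO sK up Kz (vr1 vO)).
  rewrite mulr1 -mulrDr zE mulr_sumr; apply: big_ind => //; first exact: (vr0 vO).
  exact: (vrD vO).
have all O : valuation_ring kap O -> O z.
  move=> vO; have [Ot|nt] := pselect (O t); last first.
    apply: (odd O _ vO (inverse_uniformizer vO tr nt)) => i.
    exact: simple_infinite.
  have OH i : O (H i) by apply: (vr_pev vO).
  have OG i : O (G i) by apply: (vr_pev vO).
  have [[i mi]|none] := pselect (exists i, maxid O (G i)); last first.
    apply: (vr_quadratic vO (vr1 vO) (c := z ^+ 2 + z)); last by rewrite mul1r.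
    rewrite zE; apply: big_ind => [||i _]; [exact: (vr0 vO)|exact: (vrD vO)|].
    apply: (vrM vO) => //; apply: (vr_unit (OG i)) => mi.
    by apply: none; exists i.
  have up j : maxid O (G j) -> uniformizer O K (G j).
    by move=> mj; apply: deriv1_uniformizer => //; apply: quadratic_deriv.
  apply: (odd O (G i) vO (up i mi)) => j; have [mj|nj] := pselect (maxid O (G j)).
    have -> : G i * (H j / G j) = H j * (G i / G j) by rewrite mulrCA.
    apply: (vrM vO) => //; have [_ _ _ h] := up j mj; apply: h => //; exact: rat_pev.
  by apply: (vrM vO) => //; apply: (vrM vO) => //; apply: (vr_unit (OG j)).
by apply: (rat_integral_both tr Kz) => O vO _; apply: all.
Qed.

End SimplePoles.

Section Triple.

Variables (k : fieldType).
Hypothesis k2 : 2%:R = 0 :> k.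
Hypothesis k_perfect : forall c : k, exists s, c = s ^+ 2.
Variables (M : curve k) (t : M).
Let M2 : 2%:R = 0 :> M := char2_curve M k2.
Let P2 : 2%:R = 0 :> {poly k}. Proof. by rewrite -(rmorph_nat polyC) k2 rmorph0. Qed.
Local Notation kap := (const M).
Hypothesis tr : transcendental kap t.
Local Notation ev := (pev kap t).

Lemma mobius_transcendental (l0 l2 m0 m2 : k) : l0 * m2 = l2 * m0 + 1 ->
    kap m0 + kap m2 * t != 0 ->
  transcendental kap ((kap l0 + kap l2 * t) / (kap m0 + kap m2 * t)).
Proof.
move=> det nm p p0; apply/negP => /eqP px.
have [c cE] : exists c, (kap l0 + kap l2 * t) / (kap m0 + kap m2 * t) = kap c.
  by apply: curve_const_closed; exists p => //; apply/rootP.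
have E : ev ((l0 + c * m0)%:P + (l2 + c * m2)%:P * 'X) = 0.
  rewrite !pevE !(rmorphD, rmorphM); apply: (addxx_eq0 M2).
  transitivity ((kap l0 + kap l2 * t) + kap c * (kap m0 + kap m2 * t)); last first.
    by rewrite -cE divfK // addxx.
  by ring2 M2.
have Z : (l0 + c * m0)%:P + (l2 + c * m2)%:P * 'X = 0 :> {poly k}.
  by apply/eqP; apply: contraT => nz; move/eqP: E; rewrite (negPf (tr nz)).
have z0 := congr1 (fun q : {poly k} => q`_0) Z; have z1 := congr1 (fun q : {poly k} => q`_1) Z.
rewrite /= coefD coefCM coefX coefC coef0 mulr0 addr0 in z0.
rewrite /= coefD coefCM coefX coefC coef0 mulr1 add0r in z1.
have := det; rewrite (addxx_eq0 k2 z0) (addxx_eq0 k2 z1) => /eqP; rewrite -subr_eq0.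
have -> : c * m0 * m2 - (c * m2 * m0 + 1) = 1 by ring2 k2.
by rewrite oner_eq0.
Qed.

(** The common numerator for the denominators X, X (X + 1) and a third quadratic. Only the leading
    coefficient is recorded; the value at 1 is read off the unexpanded side. *)
Let quintic (b1 n1 a1 b2 n2 a2 b3 n3 a3 b a s : k) : exists c0 c1 c2 c3 c4 : k,
  quadratic b1 n1 a1 * ('X + 1) * quadratic b 1 a + quadratic b2 n2 a2 * quadratic b 1 a +
    quadratic b3 n3 a3 * ('X * ('X + 1)) + s%:P * ('X * ('X + 1)) * quadratic b 1 a =
  (a1 * a)%:P * 'X^5 + (c0%:P + c1%:P * 'X + c2%:P * 'X^2 + c3%:P * 'X^3 + c4%:P * 'X^4).
Proof.
exists (b1 * b + b2 * b).
exists (b1 * b + b1 + n1 * b + (b2 + n2 * b) + b3 + s * b).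
exists (b1 + n1 * b + b1 * a + n1 + a1 * b + (b2 * a + n2 + a2 * b) + b3 + n3 + s * b + s).
exists (b1 * a + n1 + a1 * b + n1 * a + a1 + n2 * a + a2 + n3 + a3 + s + s * a).
exists (n1 * a + a1 + a1 * a + a2 * a + a3 + s * a).
rewrite /quadratic !(polyCD, polyCM, polyC1); ring2 P2.
Qed.

Section Distinct.

Variables (l0 l2 m0 m2 : k).
Hypothesis det : l0 * m2 = l2 * m0 + 1.
Variables (a0 a1 a2 b0 b1 b2 c0 c1 c2 q0 q2 s : k).
Let L := kap l0 + kap l2 * t.
Let m := kap m0 + kap m2 * t.
Let res1 := resultant2 a0 a1 a2 (l0 * m0) 1 (l2 * m2).
Let res2 := resultant2 b0 b1 b2 (l0 * (l0 + m0)) 1 (l2 * (l2 + m2)).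
Let res3 := resultant2 c0 c1 c2 q0 1 q2.
Hypotheses (res1_neq0 : res1 != 0) (res2_neq0 : res2 != 0) (res3_neq0 : res3 != 0).
Variables (f1 f2 f3 : M).
Hypotheses (f1E : (kap (l0 * m0) + t + kap (l2 * m2) * t ^+ 2) * f1 =
    kap a0 + kap a1 * t + kap a2 * t ^+ 2)
  (f2E : (kap (l0 * (l0 + m0)) + t + kap (l2 * (l2 + m2)) * t ^+ 2) * f2 =
    kap b0 + kap b1 * t + kap b2 * t ^+ 2)
  (f3E : (kap q0 + t + kap q2 * t ^+ 2) * f3 = kap c0 + kap c1 * t + kap c2 * t ^+ 2)
  (fE : f1 + f2 + f3 = kap s).

(* The coefficients of a form in the basis [L ^+ 2, L * m, m ^+ 2]. *)
Let al (h : k * k * k) := h.1.1 * m2 ^+ 2 + h.1.2 * (m0 * m2) + h.2 * m0 ^+ 2.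
Let be (h : k * k * k) := h.1.1 * l2 ^+ 2 + h.1.2 * (l0 * l2) + h.2 * l0 ^+ 2.

Let mod_nz (u v : k) : ~~ ((u == 0) && (v == 0)) -> kap u + kap v * t != 0.
Proof.
move=> uv; have -> : kap u + kap v * t = ev (u%:P + v%:P * 'X) by rewrite !pevE.
apply: tr; apply: contraNneq uv => E; apply/andP; split; apply/eqP.
  by have := congr1 (fun q : {poly k} => q`_0) E; rewrite /= coefD coefCM coefX coefC coef0 mulr0 addr0.
by have := congr1 (fun q : {poly k} => q`_1) E; rewrite /= coefD coefCM coefX coefC coef0 mulr1 add0r.
Qed.

Let L0 : L != 0.
Proof.
apply: mod_nz; apply/negP => /andP[/eqP u /eqP v]; have /eqP := det.
by rewrite u v !mul0r add0r eq_sym oner_eq0.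
Qed.

Let m_nz : m != 0.
Proof.
apply: mod_nz; apply/negP => /andP[/eqP u /eqP v]; have /eqP := det.
by rewrite u v !mulr0 add0r eq_sym oner_eq0.
Qed.

Let Lm0 : L + m != 0.
Proof.
have -> : L + m = kap (l0 + m0) + kap (l2 + m2) * t by rewrite /L /m !rmorphD; ring2 M2.
apply: mod_nz; apply/negP => /andP[/eqP/(addxx_eq0 k2) u /eqP/(addxx_eq0 k2) v].
have := det; rewrite u v => /eqP; rewrite -subr_eq0.
have -> : m0 * m2 - (m2 * m0 + 1) = 1 by ring2 k2.
by rewrite oner_eq0.
Qed.

Let x := L / m.
Let trx : transcendental kap x. Proof. exact: mobius_transcendental. Qed.

(** The middle coefficient stays [h1] because the substitution has determinant 1 and the other
    contributions to it are doubled. *)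
Let formE (h0 h1 h2 : k) : kap h0 + kap h1 * t + kap h2 * t ^+ 2 =
  m ^+ 2 * pev kap x (quadratic (be (h0, h1, h2)) h1 (al (h0, h1, h2))).
Proof.
have kdet : kap l0 * kap m2 = kap l2 * kap m0 + 1 by rewrite -!rmorphM det rmorphD rmorph1.
have e1 : kap l2 * m + kap m2 * L = 1.
  have -> : kap l2 * m + kap m2 * L = kap l0 * kap m2 + kap l2 * kap m0.
    by rewrite /L /m; ring2 M2.
  by rewrite kdet; ring2 M2.
have e2 : kap l0 * m + kap m0 * L = t.
  have -> : kap l0 * m + kap m0 * L = (kap l0 * kap m2 + kap l2 * kap m0) * t.
    by rewrite /L /m; ring2 M2.
  by rewrite kdet; ring2 M2.
have -> : kap h0 + kap h1 * t + kap h2 * t ^+ 2 = kap h0 * (kap l2 * m + kap m2 * L) ^+ 2 +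
    kap h1 * ((kap l2 * m + kap m2 * L) * (kap l0 * m + kap m0 * L)) +
    kap h2 * (kap l0 * m + kap m0 * L) ^+ 2 by rewrite e1 e2; ring2 M2.
have e3 : (kap l2 * m + kap m2 * L) * (kap l0 * m + kap m0 * L) =
    kap l0 * kap l2 * m ^+ 2 + L * m + kap m0 * kap m2 * L ^+ 2.
  transitivity (kap l0 * kap l2 * m ^+ 2 + (kap l0 * kap m2 + kap l2 * kap m0) * (L * m) +
    kap m0 * kap m2 * L ^+ 2); first by ring2 M2.
  by rewrite kdet; ring2 M2.
rewrite e3 pev_quadratic /al /be /= !(rmorphD kap) !(rmorphM kap) /x.
by clearbody L m; field2 M2.
Qed.

Let D1 : l0 * m2 + l2 * m0 = 1. Proof. by rewrite det; ring2 k2. Qed.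

Let res1E : res1 = be (a0, a1, a2) * al (a0, a1, a2).
Proof. exact: resultant_split. Qed.

Let at_sum (h0 h1 h2 : k) : be (h0, h1, h2) + h1 + al (h0, h1, h2) =
  h0 * (l2 + m2) ^+ 2 + h1 * ((l0 + m0) * (l2 + m2)) + h2 * (l0 + m0) ^+ 2.
Proof.
rewrite /be /al /=; transitivity (h0 * l2 ^+ 2 + h1 * (l0 * l2) + h2 * l0 ^+ 2 +
  h1 * (l0 * m2 + l2 * m0) + (h0 * m2 ^+ 2 + h1 * (m0 * m2) + h2 * m0 ^+ 2)).
  by rewrite D1 mulr1.
by ring2 k2.
Qed.

Let res2E : res2 = be (b0, b1, b2) * (be (b0, b1, b2) + b1 + al (b0, b1, b2)).
Proof. by rewrite at_sum; apply: resultant_split => //; rewrite mulrDr det; ring2 k2. Qed.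

Let form_coefs (h : k * k * k) :
  h.1.1 = al h * l0 ^+ 2 + h.1.2 * (l0 * m0) + be h * m0 ^+ 2 /\
  h.2 = al h * l2 ^+ 2 + h.1.2 * (l2 * m2) + be h * m2 ^+ 2.
Proof.
case: h => [[h0 h1] h2]; rewrite /al /be /=; split.
  transitivity (h0 * (l0 * m2 + l2 * m0) ^+ 2 + h1 * (l0 * m0) * (l0 * m2 + l2 * m0 + 1)).
    by rewrite D1; ring2 k2.
  by ring2 k2.
transitivity (h2 * (l0 * m2 + l2 * m0) ^+ 2 + h1 * (l2 * m2) * (l0 * m2 + l2 * m0 + 1)).
  by rewrite D1; ring2 k2.
by ring2 k2.
Qed.

(* In the coordinate [x = L / m] the denominators become [x], [x * (x + 1)] and
   a quadratic form, which has to vanish at infinity and at [1]. *)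
Lemma distinct_denominator : q0 = m0 * (l0 + m0) /\ q2 = m2 * (l2 + m2).
Proof.
pose u1 := (a0, a1, a2); pose u2 := (b0, b1, b2); pose u3 := (c0, c1, c2).
pose v := (q0, 1 : k, q2).
have kdet : kap l0 * kap m2 = kap l2 * kap m0 + 1 by rewrite -!rmorphM det rmorphD rmorph1.
have tE : t = (kap l0 * kap m2 + kap l2 * kap m0) * t by rewrite kdet; ring2 M2.
have e1 : kap (l0 * m0) + t + kap (l2 * m2) * t ^+ 2 = m ^+ 2 * x.
  have -> : m ^+ 2 * x = m * L by rewrite /x; clearbody m L; field2 M2.
  by rewrite {1}tE !rmorphM /m /L; ring2 M2.
have e2 : kap (l0 * (l0 + m0)) + t + kap (l2 * (l2 + m2)) * t ^+ 2 = m ^+ 2 * (x * (x + 1)).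
  have -> : m ^+ 2 * (x * (x + 1)) = L * (L + m) by rewrite /x; clearbody m L; field2 M2.
  by rewrite {1}tE !(rmorphM, rmorphD) /m /L; ring2 M2.
have e3 : kap q0 + t + kap q2 * t ^+ 2 = m ^+ 2 * pev kap x (quadratic (be v) 1 (al v)).
  by rewrite -formE rmorph1 mul1r.
have m20 : m ^+ 2 != 0 by rewrite expf_neq0.
have h1 : x * f1 = pev kap x (quadratic (be u1) a1 (al u1)).
  by apply: (mulfI m20); rewrite mulrA -e1 f1E formE.
have h2 : x * (x + 1) * f2 = pev kap x (quadratic (be u2) b1 (al u2)).
  by apply: (mulfI m20); rewrite mulrA -e2 f2E formE.
have h3 : pev kap x (quadratic (be v) 1 (al v)) * f3 = pev kap x (quadratic (be u3) c1 (al u3)).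
  by apply: (mulfI m20); rewrite mulrA -e3 f3E formE.
have [w0 [w1 [w2 [w3 [w4 wE]]]]] := quintic (be u1) a1 (al u1) (be u2) b1 (al u2)
  (be u3) c1 (al u3) (be v) (al v) s.
have Z : (al u1 * al v)%:P * 'X^5 + (w0%:P + w1%:P * 'X + w2%:P * 'X^2 + w3%:P * 'X^3 +
   w4%:P * 'X^4) = 0 :> {poly k}.
  apply: (pev_inj trx); rewrite -wE; move: h1 h2 h3.
  move: (quadratic (be u1) a1 (al u1)) (quadratic (be u2) b1 (al u2)).
  move: (quadratic (be u3) c1 (al u3)) (quadratic (be v) 1 (al v)) => A3 A4 A1 A2 h1 h2 h3.
  by rewrite !pevE -fE -h1 -h2 -h3; clearbody x; ring2 M2.
have al0 : al u1 * al v = 0.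
  have := congr1 (fun q : {poly k} => q`_5) Z.
  by rewrite /= !coefD !coefCM coefX !coefXn coefC coef0 /= !mulr0 !mulr1 !addr0.
have [r1 r2] : be u1 != 0 /\ al u1 != 0.
  have E : res1 = be u1 * al u1 by exact: res1E.
  by have := res1_neq0; rewrite E mulf_eq0 negb_or => /andP.
have al0' : al v = 0 by move/eqP: al0; rewrite mulf_eq0 (negPf r2) => /eqP.
have at1 : (be u2 + b1 + al u2) * (be v + 1 + al v) = 0.
  have h := congr1 (fun q : {poly k} => q.[1]) wE; rewrite Z /quadratic !hornerE /= in h.
  by rewrite -[RHS]h; ring2 k2.
have n2 : be u2 + b1 + al u2 != 0.
  by apply: contraNneq res2_neq0 => z; rewrite res2E z mulr0.
have be1 : be v = 1.
  move/eqP: at1; rewrite mulf_eq0 (negPf n2) al0' addr0 => /eqP; exact: addxx_eq0.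
have [v1 v2] := form_coefs (q0, 1 : k, q2).
by rewrite /= -/v al0' be1 in v1 v2; split; rewrite ?v1 ?v2; ring2 k2.
Qed.

(** In the coordinate [x] the poles are 0, infinity and 1, each shared by two of the three
    functions; [a], [b] and [c] are the common residues there. The coefficient of [x ^+ 2] in the
    cleared identity determines [s]. *)
Lemma distinct_invariants : exists a b c, [/\ res1 = a * b, res2 = a * c, res3 = b * c
  & a + b + c + (a1 + b1 + c1) = s].
Proof.
have [q0E q2E] := distinct_denominator.
pose u1 := (a0, a1, a2); pose u2 := (b0, b1, b2); pose u3 := (c0, c1, c2).
have kdet : kap l0 * kap m2 = kap l2 * kap m0 + 1 by rewrite -!rmorphM det rmorphD rmorph1.
have tE : t = (kap l0 * kap m2 + kap l2 * kap m0) * t by rewrite kdet; ring2 M2.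
have e1 : kap (l0 * m0) + t + kap (l2 * m2) * t ^+ 2 = m ^+ 2 * x.
  have -> : m ^+ 2 * x = m * L by rewrite /x; clearbody m L; field2 M2.
  by rewrite {1}tE !rmorphM /m /L; ring2 M2.
have e2 : kap (l0 * (l0 + m0)) + t + kap (l2 * (l2 + m2)) * t ^+ 2 = m ^+ 2 * (x * (x + 1)).
  have -> : m ^+ 2 * (x * (x + 1)) = L * (L + m) by rewrite /x; clearbody m L; field2 M2.
  by rewrite {1}tE !(rmorphM, rmorphD) /m /L; ring2 M2.
have e3 : kap q0 + t + kap q2 * t ^+ 2 = m ^+ 2 * (x + 1).
  have -> : m ^+ 2 * (x + 1) = m * (L + m) by rewrite /x; clearbody m L; field2 M2.
  by rewrite q0E q2E {1}tE !(rmorphM, rmorphD) /m /L; ring2 M2.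
have m20 : m ^+ 2 != 0 by rewrite expf_neq0.
have h1 : x * f1 = pev kap x (quadratic (be u1) a1 (al u1)).
  by apply: (mulfI m20); rewrite mulrA -e1 f1E formE.
have h2 : x * (x + 1) * f2 = pev kap x (quadratic (be u2) b1 (al u2)).
  by apply: (mulfI m20); rewrite mulrA -e2 f2E formE.
have h3 : (x + 1) * f3 = pev kap x (quadratic (be u3) c1 (al u3)).
  by apply: (mulfI m20); rewrite mulrA -e3 f3E formE.
have Z : (be u1 + be u2)%:P + (be u1 + a1 + b1 + be u3 + s)%:P * 'X +
    (a1 + al u1 + al u2 + c1 + s)%:P * 'X^2 + (al u1 + al u3)%:P * 'X^3 = 0 :> {poly k}.
  transitivity (quadratic (be u1) a1 (al u1) * ('X + 1) + quadratic (be u2) b1 (al u2) +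
      quadratic (be u3) c1 (al u3) * 'X + s%:P * ('X * ('X + 1))).
    by rewrite /quadratic !polyCD; ring2 P2.
  apply: (pev_inj trx); move: h1 h2 h3.
  move: (quadratic (be u1) a1 (al u1)) (quadratic (be u2) b1 (al u2)).
  move: (quadratic (be u3) c1 (al u3)) => A3 A1 A2 h1 h2 h3.
  by rewrite !pevE -fE -h1 -h2 -h3; clearbody x; ring2 M2.
have z i := congr1 (fun q : {poly k} => q`_i) Z.
have z0 := z 0; have z2 := z 2%N; have z1 := z 1%N; have z3 := z 3%N.
rewrite /= !coefD !coefCM !coefXn !coefX !coefC /= !mulr0 !addr0 in z0.
rewrite /= !coefD !coefCM !coefXn !coefX !coefC /= !mulr0 !mulr1 !addr0 !add0r in z1.
rewrite /= !coefD !coefCM !coefXn !coefX !coefC /= !mulr0 !mulr1 !addr0 !add0r in z2.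
rewrite /= !coefD !coefCM !coefXn !coefX !coefC /= !mulr0 !mulr1 !add0r in z3.
have res3E : res3 = al u3 * (be u3 + c1 + al u3).
  rewrite at_sum /res3 q0E q2E (@resultant_split _ k2 c0 c1 c2 m0 m2 (l0 + m0) (l2 + m2)) //.
  by rewrite mulrDr mulrDr; have -> : m0 * l2 = l0 * m2 + 1; [rewrite det; ring2 k2|ring2 k2].
move/(addxx_eq0 k2): z0 => z0; move/(addxx_eq0 k2): z3 => z3; move/(addxx_eq0 k2): z2 => z2.
exists (be u1), (al u1), (be u2 + b1 + al u2); split.
- by rewrite res1E.
- by rewrite z0 res2E.
- rewrite res3E -z3; congr (_ * _); apply: (addxx_eq0 k2).
  rewrite -[RHS]z1 -z2 -z0; ring2 k2.
by rewrite -z2 -z0; ring2 k2.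
Qed.

End Distinct.

End Triple.

(** All regular forms on a rational curve vanish, so the zero form would have several coordinate
    vectors. *)
Lemma genus_not_rational (k : fieldType) (k2 : 2%:R = 0 :> k) (M : curve k) g r :
  transcendental (const M) r -> (forall z, ratl (const M) r z) -> ~ has_genus M g.+1.
Proof.
move=> tr all [b rb h].
have z D i : is_derivation D -> form_at (b i) D = 0.
  by move=> dD; apply: (genus0_regular k2 tr all (rb i) dD).
have sum (c : 'rV[k]_g.+1) D : is_derivation D ->
    form_at [::] D = \sum_i const M (c 0 i) * form_at (b i) D.
  move=> dD; rewrite [LHS]big_nil big1 // => i _.
  by rewrite z // mulr0.
have [c [_ uniq]] := h [::] (@regular0 k M).
have e0 := uniq 0 (sum 0); have e1 := uniq (const_mx 1) (sum _).
have := congr1 (fun v : 'rV[k]_g.+1 => v 0 0) (etrans (esym e0) e1).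
by rewrite !mxE => /esym/eqP; rewrite oner_eq0.
Qed.

(** * Equal denominators *)

Section Equal.

Variable k : fieldType.
Hypothesis k2 : 2%:R = 0 :> k.
Hypothesis k_perfect : forall c : k, exists s, c = s ^+ 2.
Variable M : curve k.
Let M2 : 2%:R = 0 :> M := char2_curve M k2.
Local Notation kap := (const M).
Variables (t y1 y2 : M) (L1 : M -> Prop).
Hypothesis tr : transcendental kap t.
Local Notation K := (ratl kap t).
Hypothesis q1 : quad K L1 y1.
Hypothesis q2 : quad L1 (@anything M) y2.
Variables g0 g2 n1 u1 v1 n2 u2 v2 : k.
Let G := kap g0 + t + kap g2 * t ^+ 2.
Hypothesis y1E : G * (y1 ^+ 2 + y1) = kap n1 * G + (kap u1 + kap v1 * t ^+ 2).
Hypothesis y2E : G * (y2 ^+ 2 + y2) = kap n2 * G + (kap u2 + kap v2 * t ^+ 2).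
Hypotheses (uv1 : ~~ ((u1 == 0) && (v1 == 0))) (uv2 : ~~ ((u2 == 0) && (v2 == 0))).
Hypothesis uv3 : ~~ ((u1 + u2 == 0) && (v1 + v2 == 0)).
Hypothesis prop : u1 * v2 = u2 * v1.

Let sK : is_subfield K := rat_subfield kap t.
Let Kt : K t := rat_gen kap t.
Let Kc a : K (kap a) := rat_const kap t a.

(* The two Artin-Schreier equations are proportional up to constants, and the
   combination [r] below generates a subfield of index at most two. *)
Lemma proportional_hyperelliptic : has_genus M 3 -> hyperelliptic M.
Proof.
move=> g3.
have [mu [u2E v2E]] : exists mu, u2 = mu * u1 /\ v2 = mu * v1.
  have [u10|u10] := eqVneq u1 0.
    have v10 : v1 != 0 by move: uv1; rewrite u10 eqxx.
    exists (v2 / v1); rewrite divfK // u10 mulr0; split=> //.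
    by move/esym/eqP: prop; rewrite u10 mul0r mulf_eq0 (negPf v10) orbF => /eqP.
  exists (u2 / u1); rewrite divfK //; split=> //.
  by rewrite mulrAC -prop mulrAC divff // mul1r.
have [nu nuE] := k_perfect mu.
have d0 : mu + nu != 0.
  have -> : mu + nu = nu * (nu + 1) by rewrite nuE; ring2 k2.
  rewrite mulf_neq0 //.
    by apply: contraNneq uv2 => nu0; rewrite u2E v2E nuE nu0 expr0n !mul0r eqxx.
  apply: contraNneq uv3 => /(addxx_eq0 k2) nu1.
  by rewrite u2E v2E nuE nu1 expr1n !mul1r !(addxx k2) eqxx.
have kd0 : kap (mu + nu) != 0 by rewrite fmorph_eq0.
have G0 : G != 0.
  have -> : G = pev kap t (quadratic g0 1 g2) by rewrite pev_quadratic rmorph1 mul1r.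
  exact: quadratic_nz.
pose phi := (kap u1 + kap v1 * t ^+ 2) / G.
have y1E' : y1 ^+ 2 + y1 = kap n1 + phi.
  by apply: (mulfI G0); rewrite y1E /phi; field2 M2.
have y2E' : y2 ^+ 2 + y2 = kap n2 + kap mu * phi.
  by apply: (mulfI G0); rewrite y2E /phi u2E v2E !rmorphM; field2 M2.
(* As [nu ^+ 2 = mu], the multiples of [phi] cancel in [r ^+ 2 + r], which becomes an affine
   function of [y1]. *)
pose r := y2 + kap nu * y1.
have rE : r ^+ 2 + r = kap (n2 + mu * n1) + kap (mu + nu) * y1.
  have -> : r ^+ 2 + r = (y2 ^+ 2 + y2) + kap (nu ^+ 2) * (y1 ^+ 2 + y1) + (kap (nu ^+ 2) + kap nu) * y1.
    by rewrite rmorphXn /r; ring2 M2.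
  by rewrite y1E' y2E' -nuE !(rmorphD, rmorphM); ring2 M2.
have y1r : y1 = (r ^+ 2 + r + kap (n2 + mu * n1)) / kap (mu + nu).
  by rewrite rE; field2 M2.
have trr : transcendental kap r.
  move=> p p0; apply/negP => /eqP pr; have [c cE] : exists c, r = kap c.
    by apply: curve_const_closed; exists p => //; apply/rootP.
  have [_ _ ny _] := q1; apply: ny; rewrite y1r cE.
  by have := (Kc c, Kc (n2 + mu * n1), Kc (mu + nu)) => -[[? ?] ?]; sfsolve.
have sR := rat_subfield kap r; have Rr := rat_gen kap r; have Rc a := rat_const kap r a.
have Ry1 : ratl kap r y1.
  have := (Rc (n2 + mu * n1), Rc (mu + nu)) => -[? ?].
  by rewrite y1r; sfsolve.
have Ry2 : ratl kap r y2.
  have -> : y2 = r + kap nu * y1 by rewrite /r; ring2 M2.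
  by have := Rc nu => ?; sfsolve.
have all_of S : is_subfield S -> (forall c, S (kap c)) -> S t -> S y1 -> S y2 -> forall z, S z.
  move=> sS Sc St S1 S2 z; have KS x : K x -> S x by apply: (rat_min sS).
  have [_ _ _ h1] := q1; have [_ _ _ h2] := q2.
  have L1S x : L1 x -> S x.
    by case/h1=> a [b [/KS Sa /KS Sb ->]]; sfsolve.
  have /h2[a [b [/L1S Sa /L1S Sb ->]]] := I : anything z.
  by sfsolve.
have nt : ~ ratl kap r t.
  move=> Rt; apply: (genus_not_rational k2 trr _ g3).
  exact: all_of.
have Rphi : ratl kap r phi.
  have -> : phi = y1 ^+ 2 + y1 + kap n1 by rewrite y1E'; ring2 M2.
  by have := Rc n1 => ?; sfsolve.
have phi0 : phi != 0.
  rewrite mulf_neq0 ?invr_eq0 //.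
  have -> : kap u1 + kap v1 * t ^+ 2 = pev kap t (quadratic u1 0 v1).
    by rewrite pev_quadratic rmorph0 mul0r addr0.
  apply: tr; apply: contraNneq uv1 => E; have [e0 _ e2] := quadratic_coef u1 0 v1.
  by rewrite E !coef0 in e0 e2; rewrite -e0 -e2 eqxx.
have tE : (kap v1 + phi * kap g2) * t ^+ 2 + phi * t + (kap u1 + phi * kap g0) = 0.
  transitivity (phi * G + (kap u1 + kap v1 * t ^+ 2)); first by rewrite /G; ring2 M2.
  by rewrite divfK // addxx.
have := (Rc v1, Rc g2, Rc u1, Rc g0) => -[[[? ?] ?] ?].
pose A := kap v1 + phi * kap g2; pose B := kap u1 + phi * kap g0.
have RA : ratl kap r A by rewrite /A; sfsolve.
have RB : ratl kap r B by rewrite /B; sfsolve.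
rewrite -/A -/B in tE.
have A0 : A != 0.
  apply/eqP => A0; apply: nt; have -> : t = B / phi; last by sfsolve.
  apply: (mulIf phi0); rewrite divfK //; apply: (addxx_eq0 M2).
  by rewrite -[RHS]tE A0 mul0r add0r mulrC.
pose w := t * A / phi.
have tw : t = w * phi / A by rewrite /w; clearbody A phi; field2 M2.
have wE : w ^+ 2 + w = A * B / phi ^+ 2.
  apply: (addxx_eq0 M2); transitivity (A / phi ^+ 2 * (A * t ^+ 2 + phi * t + B)).
    by rewrite /w; clearbody A B phi; field2 M2.
  by rewrite tE mulr0.
have nw : ~ ratl kap r w by move=> Rw; apply: nt; rewrite tw; sfsolve.
have Rw2 : ratl kap r (w ^+ 2 + w) by rewrite wE; sfsolve.
pose L z := exists a b, [/\ ratl kap r a, ratl kap r b & z = a + b * w].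
have qL : quad (ratl kap r) L w by split.
have sL := quad_subfield M2 qL; have RL := quad_sub qL; have Lw := quad_gen qL.
have Lphi := RL _ Rphi; have LA := RL _ RA.
have allL : forall z, L z.
  apply: all_of => //; [by move=> c; apply: RL|by rewrite tw; sfsolve|exact: RL|exact: RL].
have qw : quad (ratl kap r) (@anything M) w.
  by split=> // z; split=> // _; apply: allL.
have [psi [psic psir]] := frac_lift trr.
have qpsi : quad (image_of psi) (@anything M) w.
  by apply: quad_ext qw => z; rewrite (frac_image psic) psir.
split; first by exists 3%N.
by exists (@CurveHom k M (projective_line k) psi psic); apply: (quad_degree M2 qpsi).
Qed.

End Equal.

Section EqualResultants.

Variable k : fieldType.
Hypothesis k2 : 2%:R = 0 :> k.
Variables g0 g2 u1 v1 u2 v2 : k.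
(** The resultant of [u + v t^2] and [g0 + t + g2 t^2]. *)
Let d u v := (u * g2 + v * g0) ^+ 2 + u * v.

Lemma equal_discriminant : d u1 v1 + d u2 v2 + d (u1 + u2) (v1 + v2) = u1 * v2 + u2 * v1.
Proof. by rewrite /d; ring2 k2. Qed.

(** Divided by the square of D = [u1 * v2 + u2 * v1], the identity puts the sum of [g0 * g2] and d1
    d2 / D^2 into AS(k). *)
Lemma equal_product : exists z, d u1 v1 * d u2 v2 + g0 * g2 * (u1 * v2 + u2 * v1) ^+ 2 =
  z ^+ 2 + z * (u1 * v2 + u2 * v1).
Proof.
by exists ((u1 * g2 + v1 * g0) * (u2 * g2 + v2 * g0) + u1 * v2); rewrite /d; ring2 k2.
Qed.

End EqualResultants.

Section Solutions.

Variable k : finFieldType.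
Hypothesis k2 : 2%:R = 0 :> k.
Variables (M : curve k) (t : M).
Let M2 : 2%:R = 0 :> M := char2_curve M k2.
Local Notation kap := (const M).
Hypothesis tr : transcendental kap t.
Let kp := @finite_sqrt k k2.

Definition solution (d e : k) (f : M) (h0 h1 h2 g0 g2 : k) :=
  [/\ (kap g0 + t + kap g2 * t ^+ 2) * f = kap h0 + kap h1 * t + kap h2 * t ^+ 2,
      resultant2 h0 h1 h2 g0 1 g2 = d & AS (h1 + g0 * g2 + e)].

(** A denominator with rational linear factors has its product of outer coefficients in AS(k), so
    with distinct denominators these products do not affect the signatures. *)
Let split_AS (l0 l2 m0 m2 : k) : l0 * m2 = l2 * m0 + 1 -> AS (l0 * m0 * (l2 * m2)).
Proof.
move=> det; exists (l2 * m0); have -> : l0 * m0 * (l2 * m2) = l0 * m2 * (l2 * m0) by ring2 k2.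
by rewrite det; ring2 k2.
Qed.

Lemma distinct_case d1 d2 d3 e1 e2 e3 f1 f2 f3 a0 a1 a2 b0 b1 b2 c0 c1 c2 p0 p2 q0 q2 r0 r2 s :
    d1 != 0 -> d2 != 0 -> d3 != 0 ->
    solution d1 e1 f1 a0 a1 a2 p0 p2 -> solution d2 e2 f2 b0 b1 b2 q0 q2 ->
    solution d3 e3 f3 c0 c1 c2 r0 r2 -> f1 + f2 + f3 = kap s -> AS s ->
    resultant2 q0 1 q2 p0 1 p2 = 0 -> (p0, p2) != (q0, q2) ->
  exists a b c, [/\ d1 = a * b, d2 = a * c, d3 = b * c & AS (a + b + c + (e1 + e2 + e3))].
Proof.
move=> d10 d20 d30 [f1E r1E AS1] [f2E r2E AS2] [f3E r3E AS3] fE ASs R ne.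
have [l0 [l2 [m0 [m2 [det p0E p2E q0E q2E]]]]] := common_root k2 kp R ne.
subst p0 p2 q0 q2.
have res1 : resultant2 a0 a1 a2 (l0 * m0) 1 (l2 * m2) != 0 by rewrite r1E.
have res2 : resultant2 b0 b1 b2 (l0 * (l0 + m0)) 1 (l2 * (l2 + m2)) != 0 by rewrite r2E.
have res3 : resultant2 c0 c1 c2 r0 1 r2 != 0 by rewrite r3E.
have [r0E r2E'] := distinct_denominator k2 tr det res1 res2 f1E f2E f3E fE.
have [a [b [c [E1 E2 E3 E]]]] := distinct_invariants k2 tr det res1 res2 f1E f2E f3E fE.
exists a, b, c; rewrite -r1E -r2E -r3E; split=> //.
have AS4 := split_AS det.
have AS5 : AS (l0 * (l0 + m0) * (l2 * (l2 + m2))).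
  by apply: split_AS; rewrite mulrDr det; ring2 k2.
have AS6 : AS (r0 * r2).
  rewrite r0E r2E'; apply: split_AS; rewrite mulrDr mulrDr.
  by have -> : m0 * l2 = l0 * m2 + 1; [rewrite det; ring2 k2|ring2 k2].
have -> : a + b + c + (e1 + e2 + e3) = s + (a1 + l0 * m0 * (l2 * m2) + e1) +
   (b1 + l0 * (l0 + m0) * (l2 * (l2 + m2)) + e2) + (c1 + r0 * r2 + e3) +
   l0 * m0 * (l2 * m2) + l0 * (l0 + m0) * (l2 * (l2 + m2)) + r0 * r2.
  by rewrite -E; ring2 k2.
by repeat first [assumption | apply: (ASD k2)].
Qed.

Let coefs_eq (x0 x1 x2 z0 z1 z2 : k) :
  kap x0 + kap x1 * t + kap x2 * t ^+ 2 = kap z0 + kap z1 * t + kap z2 * t ^+ 2 ->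
  [/\ x0 = z0, x1 = z1 & x2 = z2].
Proof.
rewrite -!pev_quadratic => /(pev_inj tr) E.
have [e0 e1 e2] := quadratic_coef x0 x1 x2; rewrite E in e0 e1 e2.
have [h0 h1 h2] := quadratic_coef z0 z1 z2.
by rewrite -e0 -e1 -e2 h0 h1 h2.
Qed.

Lemma equal_case d1 d2 d3 e1 e2 e3 y1 y2 f3 a0 a1 a2 b0 b1 b2 c0 c1 c2 p0 p2 s L1 :
    d1 != 0 -> d2 != 0 -> d3 != 0 ->
    solution d1 e1 (y1 ^+ 2 + y1) a0 a1 a2 p0 p2 ->
    solution d2 e2 (y2 ^+ 2 + y2) b0 b1 b2 p0 p2 ->
    solution d3 e3 f3 c0 c1 c2 p0 p2 ->
    y1 ^+ 2 + y1 + (y2 ^+ 2 + y2) + f3 = kap s -> AS s ->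
    quad (ratl kap t) L1 y1 -> quad L1 (@anything M) y2 ->
    has_genus M 3 -> ~ hyperelliptic M ->
  d1 + d2 + d3 != 0 /\ AS (d1 * d2 / (d1 + d2 + d3) ^+ 2 + (e1 + e2 + e3)).
Proof.
move=> d10 d20 d30 [f1E r1E AS1] [f2E r2E AS2] [f3E r3E AS3] fE ASs q1 q2 g3 nh.
set G := kap p0 + t + kap p2 * t ^+ 2 in f1E f2E f3E.
have [x0 x1 x2] : [/\ a0 + b0 + c0 = s * p0, a1 + b1 + c1 = s & a2 + b2 + c2 = s * p2].
  apply: coefs_eq; transitivity (G * (y1 ^+ 2 + y1 + (y2 ^+ 2 + y2) + f3)).
    by rewrite (mulrDr G _ f3) (mulrDr G (y1 ^+ 2 + y1)) f1E f2E f3E !rmorphD; ring2 M2.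
  by rewrite fE /G !rmorphM; ring2 M2.
(* Subtracting the constant [a1] from the first function leaves the numerator [u1 + v1 t^2] without
   changing the resultant; likewise for the other two. *)
pose u1 := a0 + a1 * p0; pose v1 := a2 + a1 * p2.
pose u2 := b0 + b1 * p0; pose v2 := b2 + b1 * p2.
pose u3 := c0 + c1 * p0; pose v3 := c2 + c1 * p2.
have u3E : u3 = u1 + u2.
  by apply: (addxx_eq0 k2); rewrite /u1 /u2 /u3 -(addxx k2 (s * p0)) -{1}x0 -x1; ring2 k2.
have v3E : v3 = v1 + v2.
  by apply: (addxx_eq0 k2); rewrite /v1 /v2 /v3 -(addxx k2 (s * p2)) -{1}x2 -x1; ring2 k2.
pose D u v := (u * p2 + v * p0) ^+ 2 + u * v.
have D1 : d1 = D u1 v1 by rewrite -r1E /resultant2 /D /u1 /v1; ring2 k2.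
have D2 : d2 = D u2 v2 by rewrite -r2E /resultant2 /D /u2 /v2; ring2 k2.
have D3 : d3 = D (u1 + u2) (v1 + v2) by rewrite -u3E -v3E -r3E /resultant2 /D /u3 /v3; ring2 k2.
have nz u v : D u v != 0 -> ~~ ((u == 0) && (v == 0)).
  move=> n0; apply/negP => /andP[/eqP u0 /eqP v0]; move: n0.
  by rewrite /D u0 v0 !mul0r !addr0 expr0n eqxx.
have DD : d1 + d2 + d3 = u1 * v2 + u2 * v1.
  by rewrite D1 D2 D3; apply: equal_discriminant.
(* The sum of the invariants vanishes exactly when the reduced numerators are proportional, the
   hyperelliptic configuration. *)
have n0 : d1 + d2 + d3 != 0.
  rewrite DD; apply/eqP => /(addxx_eq0 k2) prop; apply: nh.
  have e1E : G * (y1 ^+ 2 + y1) = kap a1 * G + (kap u1 + kap v1 * t ^+ 2).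
    by rewrite f1E /G /u1 /v1 !(rmorphD, rmorphM); ring2 M2.
  have e2E : G * (y2 ^+ 2 + y2) = kap b1 * G + (kap u2 + kap v2 * t ^+ 2).
    by rewrite f2E /G /u2 /v2 !(rmorphD, rmorphM); ring2 M2.
  apply: (proportional_hyperelliptic k2 kp tr q1 q2 e1E e2E _ _ _ prop g3); apply: nz.
  - by rewrite -D1.
  - by rewrite -D2.
  - by rewrite -D3.
split=> //.
have [z zE] := equal_product k2 p0 p2 u1 v1 u2 v2.
rewrite -/(D _ _) -/(D _ _) -D1 -D2 -DD in zE.
set Dl := d1 + d2 + d3 in n0 zE *.
have AS4 : AS (d1 * d2 / Dl ^+ 2 + p0 * p2).
  exists (z / Dl); transitivity ((d1 * d2 + p0 * p2 * Dl ^+ 2) / Dl ^+ 2).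
    by clearbody Dl; field2 k2.
  by rewrite zE; clearbody Dl; field2 k2.
have -> : d1 * d2 / Dl ^+ 2 + (e1 + e2 + e3) = (d1 * d2 / Dl ^+ 2 + p0 * p2) + s +
   (a1 + p0 * p2 + e1) + (b1 + p0 * p2 + e2) + (c1 + p0 * p2 + e3).
  by rewrite -x1; move: (d1 * d2 / Dl ^+ 2) => w; ring2 k2.
by repeat first [assumption | apply: (ASD k2)].
Qed.

Lemma solutions_vanish d1 d2 d3 e1 e2 e3 f1 f2 f3 a0 a1 a2 b0 b1 b2 c0 c1 c2 p0 p2 q0 q2 r0 r2 s :
    d1 != 0 ->
    solution d1 e1 f1 a0 a1 a2 p0 p2 -> solution d2 e2 f2 b0 b1 b2 q0 q2 ->
    solution d3 e3 f3 c0 c1 c2 r0 r2 -> f1 + f2 + f3 = kap s ->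
  resultant2 q0 1 q2 p0 1 p2 = 0 \/ resultant2 r0 1 r2 p0 1 p2 = 0.
Proof.
move=> d10 [f1E r1E _] [f2E _ _] [f3E _ _] fE.
have := resultant_vanish k2 (a0 := a0) (a1 := a1) (a2 := a2) (b0 := b0) (b1 := b1) (b2 := b2)
  (c0 := c0) (c1 := c1) (c2 := c2) (g0 := p0) (g2 := p2) (g0' := q0) (g2' := q2)
  (g0'' := r0) (g2'' := r2) (s := s).
rewrite r1E => /= h; have {}h : d1 * resultant2 q0 1 q2 p0 1 p2 * resultant2 r0 1 r2 p0 1 p2 = 0.
  apply: h; apply: (pev_inj tr).
  have ev1 x z : pev kap t (quadratic x 1 z) = kap x + t + kap z * t ^+ 2.
    by rewrite pev_quadratic rmorph1 mul1r.
  have evh := pev_quadratic kap t.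
  move: (ev1 p0 p2) (ev1 q0 q2) (ev1 r0 r2) (evh a0 a1 a2) (evh b0 b1 b2) (evh c0 c1 c2).
  rewrite -f1E -f2E -f3E => <- <- <-.
  move: (quadratic p0 1 p2) (quadratic q0 1 q2) (quadratic r0 1 r2).
  move: (quadratic a0 a1 a2) (quadratic b0 b1 b2) (quadratic c0 c1 c2) => A B C G1 G2 G3 h1 h2 h3.
  by rewrite !pevE h1 h2 h3 -fE; ring2 M2.
move/eqP: h; rewrite mulf_eq0 mulf_eq0 (negPf d10) /= => /orP[] /eqP; first by left.
by right.
Qed.

Lemma resultant2C x0 x1 x2 z0 z1 z2 : resultant2 x0 x1 x2 z0 z1 z2 = resultant2 z0 z1 z2 x0 x1 x2 :> k.
Proof. by rewrite /resultant2; ring2 k2. Qed.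

End Solutions.

Lemma quad_morph (k F M : fieldType) (kap : {rmorphism k -> F}) (mu : {rmorphism k -> M})
    (g : {rmorphism F -> M}) t y :
    (forall c, g (kap c) = mu c) -> quad (ratl kap t) (@anything F) y ->
  quad (ratl mu (g t)) (image_of g) (g y).
Proof.
move=> gk [sK Kf ny h].
have morK z := morph_rat gk t z.
have im u : ratl mu (g t) u -> exists2 a, ratl kap t a & u = g a.
  case=> p [q [q0 uE]]; exists (pev kap t p / pev kap t q).
    by apply: (sf_div sK); apply: rat_pev.
  by rewrite rmorphM fmorphV !(morph_pev gk).
split.
- exact: rat_subfield.
- by rewrite -rmorphXn -rmorphD; apply/morK.
- by move/morK.
move=> z; split=> [[x ->]|[a [b [/im[a' _ ->] /im[b' _ ->] ->]]]].
  have /h[a [b [Ka Kb ->]]] := I : anything x.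
  by exists (g a), (g b); split; [apply/morK|apply/morK|rewrite rmorphD rmorphM].
by exists (a' + b' * y); rewrite rmorphD rmorphM.
Qed.

(** * Necessity *)

Section Forward.

Variables (k : finFieldType) (r0 : k).
Hypothesis k2 : 2%:R = 0 :> k.
Hypothesis r0_AS : ~ AS r0.
Let kp := @finite_sqrt k k2.
Variables (E : 3.-tuple (elliptic_curve k)) (C : artin_schreier_cover E).
Let M : curve k := as_curve C.
Let M2 : 2%:R = 0 :> M := char2_curve M k2.
Local Notation t0 := (@FracField.tofrac {poly k} 'X).
Let t : M := as_top C ord0 (as_bot C ord0 t0).
Let tE i : t = as_top C i (as_bot C i t0). Proof. exact: as_comm. Qed.
Local Notation K := (ratl (const M) t).
Let L i : M -> Prop := image_of (as_top C i).

Let trt : transcendental (const M) t.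
Proof.
apply: (morph_transcendental (pullback_const (as_top C ord0))).
exact: (frac_transcendental (phi := as_bot C ord0) (pullback_const (as_bot C ord0))).
Qed.

Lemma cover_solution i d : ordinary (tnth E i) -> (jinv (tnth E i))^-1 = d ^+ 2 -> d != 0 ->
  exists h0 h1 h2 g0 g2 (y : M), quad K (L i) y /\
    solution t d (sgn r0 (tnth E i)) (y ^+ 2 + y) h0 h1 h2 g0 g2.
Proof.
move=> ordE dE d0; have [x [Y np]] := model_normal_pair k2 r0_AS ordE dE (as_modelP C i).
have X2 := char2_curve (as_model C i) k2.
have hbot := pullback_const (as_bot C i).
have [deg sep] := as_bot2 C i.
have [y0 q0] := degree2_quad X2 deg sep.
have qt := quad_ext (frac_image (phi := as_bot C i) hbot) (q0 (@anything _) (fun=> I)).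
have trX := frac_transcendental (phi := as_bot C i) hbot.
have [h0 [h1 [h2 [g0 [g2 [y [qy yE dE' ASe]]]]]]] := cover_form_exists k2 d0 np trX qt.
exists h0, h1, h2, g0, g2, (as_top C i y); split.
  rewrite /L (tE i); exact: quad_morph (pullback_const (as_top C i)) qy.
split=> //; last by rewrite /resultant2 -dE'; ring2 k2.
have g c := pullback_const (as_top C i) c.
have := congr1 (as_top C i) yE.
by rewrite !(rmorphM, rmorphD) /= !g -(tE i).
Qed.

Let sK : is_subfield K := rat_subfield (const M) t.

(** A generator of one quotient lying in another would generate that one too; the two subfields
    would coincide, against their distinctness. *)
Lemma cover_notin i j y : i != j -> quad K (L i) y -> (exists y', quad K (L j) y') -> ~ L j y.
Proof.
move=> ij qi [y' qj] Ly; apply: (as_distinct ij) => z.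
have [_ Kf ny hi] := qi; have [_ _ _ hj] := qj.
have q := quad_replace M2 qj Ly ny Kf; have [_ _ _ h] := q.
by rewrite -/(image_of _ z) -/(image_of _ z); split=> [/hi/h|/h/hi].
Qed.

Lemma cover_top i y : ~ L i y -> K (y ^+ 2 + y) -> (exists y', quad K (L i) y') ->
  quad (L i) (@anything M) y.
Proof.
move=> ny Ky [y' qi]; have [deg _] := as_top2 C i.
have [_ h] := degree2P M2 deg.
split=> //; first exact: image_subfield.
  exact: (quad_sub qi).
move=> z; split=> // _; have [a [b ->]] := h y ny z.
by exists (as_top C i a), (as_top C i b); split=> //; [exists a|exists b].
Qed.

Variables (d1 d2 d3 : k).
Local Notation i1 := (ord0 : 'I_3).
Local Notation i2 := (inord 1 : 'I_3).
Local Notation i3 := (inord 2 : 'I_3).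
Hypotheses (ord1 : ordinary (tnth E i1)) (ord2 : ordinary (tnth E i2))
  (ord3 : ordinary (tnth E i3)).
Hypotheses (dE1 : (jinv (tnth E i1))^-1 = d1 ^+ 2) (dE2 : (jinv (tnth E i2))^-1 = d2 ^+ 2)
  (dE3 : (jinv (tnth E i3))^-1 = d3 ^+ 2).
Hypotheses (d10 : d1 != 0) (d20 : d2 != 0) (d30 : d3 != 0).
Hypothesis nh : ~ hyperelliptic M.
Let s := sgn r0 (tnth E i1) + sgn r0 (tnth E i2) + sgn r0 (tnth E i3).

Lemma cover_necessary :
  (exists a b c, [/\ d1 = a * b, d2 = b * c, d3 = a * c & AS (a + b + c + s)]) \/
  (d1 + d2 + d3 != 0 /\ AS (d1 * d2 / (d1 + d2 + d3) ^+ 2 + s)).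
Proof.
have [a0 [a1 [a2 [p0 [p2 [y1 [q1 S1]]]]]]] := cover_solution ord1 dE1 d10.
have [b0 [b1 [b2 [q0 [q3 [y2 [q2 S2]]]]]]] := cover_solution ord2 dE2 d20.
have [c0 [c1 [c2 [x0 [x2 [y3 [q4 S3]]]]]]] := cover_solution ord3 dE3 d30.
have ne12 : i2 != i1 by rewrite -val_eqE /= inordK.
have ne13 : i3 != i1 by rewrite -val_eqE /= inordK.
have ne23 : i3 != i2 by rewrite -val_eqE /= !inordK.
have ex1 : exists y', quad K (L i1) y' by exists y1.
have ex2 : exists y', quad K (L i2) y' by exists y2.
have n21 := cover_notin ne12 q2 ex1; have n31 := cover_notin ne13 q4 ex1.
have n32 := cover_notin ne23 q4 ex2.
have [_ Kf1 ny1 hL1] := q1; have [_ Kf2 _ _] := q2; have [_ Kf3 _ _] := q4.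
have qM := cover_top n21 Kf2 ex1.
have L1K := quad_sub q1.
(* [y2] and [y3] both generate the top field over the first quotient, so their sum lies in that
   quotient. Its coefficient [be] at [y1] is 0 or 1, and 0 would put [y3] into the second
   quotient. *)
have [al [be [Kal Kbe zE]]] : exists al be, [/\ K al, K be & y2 + y3 = al + be * y1].
  by apply/hL1; apply: (quad_AS M2 qM I n31); apply: L1K.
have be1 : be = 1.
  have e1 : y1 ^+ 2 = y1 + (y1 ^+ 2 + y1) by ring2 M2.
  have bE : be ^+ 2 + be = 0.
    have [] // := quad_uniq M2 q1 (a := al ^+ 2 + al + be ^+ 2 * (y1 ^+ 2 + y1))
      (b := be ^+ 2 + be) (a' := (y2 ^+ 2 + y2) + (y3 ^+ 2 + y3)) (b' := 0); try by sfsolve.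
    transitivity ((y2 + y3) ^+ 2 + (y2 + y3)); last by ring2 M2.
    by rewrite zE; ring2 M2.
  have : be * (be + 1) = 0 by rewrite -bE; ring2 M2.
  move/eqP; rewrite mulf_eq0 => /orP[]/eqP; last exact: addxx_eq0.
  move=> be0; case: n32; have -> : y3 = al + y2.
    by apply: (addxx_eq0 M2); rewrite -(addxx M2 (al + be * y1)) -{1}zE be0; ring2 M2.
  have sL2 := quad_subfield M2 q2; apply: (sfD sL2); last exact: (quad_gen q2).
  exact: (quad_sub q2).
have alE : al = y1 + y2 + y3.
  by apply: (addxx_eq0 M2); rewrite -(addxx M2 (al + be * y1)) -{2}zE be1; ring2 M2.
have fE : al ^+ 2 + al = (y1 ^+ 2 + y1) + (y2 ^+ 2 + y2) + (y3 ^+ 2 + y3).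
  by rewrite alE; ring2 M2.
have quo d e f h0 h1 h2 g0 g2 : solution t d e f h0 h1 h2 g0 g2 ->
    f = pev (const M) t (quadratic h0 h1 h2) / pev (const M) t (quadratic g0 1 g2).
  case=> E1 _ _; have nG := quadratic_nz trt g0 g2.
  by apply: (mulIf nG); rewrite divfK // mulrC !pev_quadratic rmorph1 mul1r.
(* The sum of the three generators lies in k(t), and its Artin-Schreier image has at most simple
   poles. *)
have [a aE] : exists a, al = const M a.
  apply: (@simple_poles_const k M (const M) k2 t trt 'I_3 (index_enum 'I_3)
    (fun i => [:: a0; b0; c0]`_i) (fun i => [:: a1; b1; c1]`_i) (fun i => [:: a2; b2; c2]`_i)
    (fun i => [:: p0; q0; x0]`_i) (fun i => [:: p2; q3; x2]`_i)) => //.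
  by rewrite !big_ord_recl big_ord0 /= addr0 addrA fE (quo _ _ _ _ _ _ _ _ S1)
     (quo _ _ _ _ _ _ _ _ S2) (quo _ _ _ _ _ _ _ _ S3).
have fs : (y1 ^+ 2 + y1) + (y2 ^+ 2 + y2) + (y3 ^+ 2 + y3) = const M (a ^+ 2 + a).
  by rewrite -fE aE rmorphD rmorphXn.
have fs1 : (y1 ^+ 2 + y1) + (y3 ^+ 2 + y3) + (y2 ^+ 2 + y2) = const M (a ^+ 2 + a).
  by rewrite -fs addrAC.
have fs2 : (y2 ^+ 2 + y2) + (y3 ^+ 2 + y3) + (y1 ^+ 2 + y1) = const M (a ^+ 2 + a).
  by rewrite -fs; ring2 M2.
have fs3 : (y2 ^+ 2 + y2) + (y1 ^+ 2 + y1) + (y3 ^+ 2 + y3) = const M (a ^+ 2 + a).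
  by rewrite -fs; ring2 M2.
have fs4 : (y3 ^+ 2 + y3) + (y1 ^+ 2 + y1) + (y2 ^+ 2 + y2) = const M (a ^+ 2 + a).
  by rewrite -fs; ring2 M2.
have ASa := AS_map (a : k).
pose R (u v w z : k) := resultant2 u 1 v w 1 z.
(* A common root of two denominators makes them equal or gives the first alternative; the three
   statements differ in the order of the quotients. *)
have D12 : R q0 q3 p0 p2 = 0 -> (p0, p2) = (q0, q3) \/ exists a b c,
    [/\ d1 = a * b, d2 = b * c, d3 = a * c & AS (a + b + c + s)].
  move=> R0; have [->|ne] := eqVneq (p0, p2) (q0, q3); [by left|right].
  have [A [B [C' [h1 h2 h3 h4]]]] := distinct_case k2 trt d10 d20 d30 S1 S2 S3 fs ASa R0 ne.
  by exists B, A, C'; rewrite (addrC B) [B * A]mulrC.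
have D13 : R x0 x2 p0 p2 = 0 -> (p0, p2) = (x0, x2) \/ exists a b c,
    [/\ d1 = a * b, d2 = b * c, d3 = a * c & AS (a + b + c + s)].
  move=> R0; have [->|ne] := eqVneq (p0, p2) (x0, x2); [by left|right].
  have [A [B [C' [h1 h2 h3 h4]]]] := distinct_case k2 trt d10 d30 d20 S1 S3 S2 fs1 ASa R0 ne.
  have sE : s = sgn r0 (tnth E i1) + sgn r0 (tnth E i3) + sgn r0 (tnth E i2) by exact: addrAC.
  by exists A, B, C'; rewrite sE; split; [exact: h1|exact: h3|exact: h2|exact: h4].
have D23 : R x0 x2 q0 q3 = 0 -> (q0, q3) = (x0, x2) \/ exists a b c,
    [/\ d1 = a * b, d2 = b * c, d3 = a * c & AS (a + b + c + s)].
  move=> R0; have [->|ne] := eqVneq (q0, q3) (x0, x2); [by left|right].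
  have [A [B [C' [h1 h2 h3 h4]]]] := distinct_case k2 trt d20 d30 d10 S2 S3 S1 fs2 ASa R0 ne.
  have sE : s = sgn r0 (tnth E i2) + sgn r0 (tnth E i3) + sgn r0 (tnth E i1).
    by have rot (u v w : k) : u + v + w = v + w + u; [rewrite -addrA addrC|exact: rot].
  exists C', B, A; rewrite sE (addrC (C' + B)) (addrC C') addrA.
  by split; [rewrite mulrC; exact: h3|rewrite mulrC; exact: h1|rewrite mulrC; exact: h2|exact: h4].
(* Each denominator is prime to its own numerator, the invariant being nonzero, and so has a common
   root with another denominator. If the first alternative fails, all three are equal. *)
have V1 := solutions_vanish k2 trt d10 S1 S2 S3 fs.
have V2 := solutions_vanish k2 trt d20 S2 S1 S3 fs3.
have V3 := solutions_vanish k2 trt d30 S3 S1 S2 fs4.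
rewrite (resultant2C k2 p0) in V2; rewrite (resultant2C k2 p0) (resultant2C k2 q0) in V3.
have [|] := pselect (exists a b c, [/\ d1 = a * b, d2 = b * c, d3 = a * c & AS (a + b + c + s)]).
  by left.
move=> none; right.
have {}D12 : R q0 q3 p0 p2 = 0 -> (p0, p2) = (q0, q3) by move/D12 => [].
have {}D13 : R x0 x2 p0 p2 = 0 -> (p0, p2) = (x0, x2) by move/D13 => [].
have {}D23 : R x0 x2 q0 q3 = 0 -> (q0, q3) = (x0, x2) by move/D23 => [].
have [E12 E13] : (p0, p2) = (q0, q3) /\ (p0, p2) = (x0, x2).
  case: V1 => [/D12 e|/D13 e].
    by split=> //; case: V3 => [/D13 //|/D23 <-].
  by split=> //; case: V2 => [/D12 //|/D23 ->].
case: E12 => e1 e2; case: E13 => e3 e4; subst q0 q3 x0 x2.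
exact: (equal_case k2 trt d10 d20 d30 S1 S2 S3 fs ASa q1 qM (as_genus C) nh).
Qed.

End Forward.

Theorem theorem3p3 (k : finFieldType) (n : nat) (card_k : #|k| = (2 ^ n)%N)
    (q_gt2 : (2 < 2 ^ n)%N)
    (r0 : k) (tr_r0 : abs_trace n r0 = 1) (r0_nonsquare : odd n -> r0 = 1)
    (E1 E2 E3 : elliptic_curve k)
    (ord1 : ordinary E1) (ord2 : ordinary E2) (ord3 : ordinary E3) :
  let j1 := jinv E1 in let j2 := jinv E2 in let j3 := jinv E3 in
  let s := sgn r0 E1 + sgn r0 E2 + sgn r0 E3 in
  let Ta := (j1 + j2 + j3) ^+ 2 / (j1 * j2 * j3) in
  let Tb := (j1 * j2 * j3 ^+ 2) / (j1 * j2 + j1 * j3 + j2 * j3) ^+ 2 in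
  (exists C : artin_schreier_cover [tuple E1; E2; E3], ~ hyperelliptic C) <->
  (exists2 a, AS a & Ta = s + a) \/
  (* Tb is defined only when its denominator does not vanish *)
  (j1 * j2 + j1 * j3 + j2 * j3 != 0 /\ exists2 a, AS a & Tb = s + a).
Proof.
have k2 := char2_card card_k.
(* Elements of AS(k) have trace 0, so [r0] represents the non-trivial class. *)
have r0_AS : ~ AS r0.
  by move=> /(trace_AS card_k); rewrite tr_r0 => /eqP; rewrite oner_eq0.
have [d1 dE1] := finite_sqrt k2 (jinv E1)^-1.
have [d2 dE2] := finite_sqrt k2 (jinv E2)^-1.
have [d3 dE3] := finite_sqrt k2 (jinv E3)^-1.
have d10 := jinv_sqrt_nz k2 ord1 dE1; have d20 := jinv_sqrt_nz k2 ord2 dE2.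
have d30 := jinv_sqrt_nz k2 ord3 dE3.
have den := Tb_denominator k2 ord1 ord2 ord3 dE1 dE2 dE3.
move=> /=; rewrite den; split; last first.
  case=> [Ta|[D0 Tb]].
    exact: (cover_of_Ta k2 r0_AS ord1 ord2 ord3 dE1 dE2 dE3 Ta).
  exact: (cover_of_Tb k2 r0_AS ord1 ord2 ord3 dE1 dE2 dE3 D0 Tb).
case=> C nh.
have i2 : (inord 1 : 'I_3) = @Ordinal 3 1 isT by apply: val_inj; rewrite /= inordK.
have i3 : (inord 2 : 'I_3) = @Ordinal 3 2 isT by apply: val_inj; rewrite /= inordK.
have := @cover_necessary k r0 k2 r0_AS [tuple E1; E2; E3] C d1 d2 d3.
rewrite i2 i3 !(tnth_nth E1) /= => /(_ ord1 ord2 ord3 dE1 dE2 dE3 d10 d20 d30 nh).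
case=> [[a [b [c [h1 h2 h3 h]]]]|[D0 h]]; [left|right].
  apply/(AS_coset_sum k2); rewrite (TaE k2 ord1 ord2 dE1 dE2 dE3 h1 h2 h3).
  have -> : (a + b + c) ^+ 4 + (sgn r0 E1 + sgn r0 E2 + sgn r0 E3) =
    ((((a + b + c) ^+ 2) ^+ 2 + (a + b + c) ^+ 2) + ((a + b + c) ^+ 2 + (a + b + c)))
    + (a + b + c + (sgn r0 E1 + sgn r0 E2 + sgn r0 E3)) by ring2 k2.
  by apply: (ASD k2) => //; apply: (ASD k2); apply: AS_map.
split=> //; apply/(AS_coset_sum k2); rewrite (TbE k2 ord1 ord2 ord3 dE1 dE2 dE3 D0).
move: (d1 * d2 / _) h => w h.
have -> : w ^+ 2 + (sgn r0 E1 + sgn r0 E2 + sgn r0 E3) =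
  (w ^+ 2 + w) + (w + (sgn r0 E1 + sgn r0 E2 + sgn r0 E3)) by ring2 k2.
by apply: (ASD k2) => //; apply: AS_map.
Qed.
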